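(* Fix $\lambda\in(0,e/2)$, $\eta>0$, $m>1$. Let $\Psi:\mathbb{R}^d\to[0,\infty)$ be in $C^1(\mathbb{R}^d)$ with $|\nabla\Psi(y)|\le K(1+|y|)$ for all $y\in\mathbb{R}^d$ for some $K>0$. For any $\rho_0\in\mathcal{D}_2(\mathbb{R}^d)$ with $J_{\lambda,\eta}(\rho_0)<\infty$, let $\rho:[0,\infty)\to\mathcal{D}_2(\mathbb{R}^d)$ be a minimizing-movement solution (as defined in the context) of the Fokker-Planck equation $$\partial_tu-\operatorname{div}\big(u\nabla\Psi+\nabla(\lambda u+\eta u^m)\big)=0,\qquad u(0,\cdot)=\rho_0.$$ Then $J_{\lambda,\eta}(\rho(t))\le J_{\lambda,\eta}(\rho_0)$ for all $t\ge0$. If additionally $\nabla\Psi$ is Lipschitz, then $t\mapsto J_{\lambda,\eta}(\rho(t))$ is non-increasing on $[0,\infty)$.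
   Context: Notation. $\mathcal{L}^d$ is Lebesgue measure on $\mathbb{R}^d$. $\mathcal{D}(\mathbb{R}^d)$ is the set of probability density functions on $\mathbb{R}^d$, and $\mathcal{D}_2(\mathbb{R}^d)$ the subset with $\int|y|^2\rho(y)dy<\infty$. $\mathcal{P}(\mathbb{R}^d)$ is the set of Borel probability measures; $\mathcal{P}_2(\mathbb{R}^d)$ is the subset with finite second moment, equipped with the Wasserstein-2 metric $\mathcal{W}_2$. $\rho\mathcal{L}^d$ is the measure with density $\rho$. $H(s)=\lambda s\ln s$ for $s>0$, $H(0)=0$; $F(s)=H(s)+\frac{\eta}{m-1}s^m$; $L_F(s):=sF'(s)-F(s)=\lambda s+\eta s^m$. For $\rho\in\mathcal{D}_2(\mathbb{R}^d)$, $J_{\lambda,\eta}(\rho)=\int\Psi\rho\,dy+\int H^+(\rho)\,dy-\int H^-(\rho)\,dy+\int\frac{\eta}{m-1}\rho^m\,dy\in(-\infty,\infty]$ ($H^-(\rho)$ is integrable). For $\mu\in\mathcal{P}_2(\mathbb{R}^d)$, $\mathcal{J}_{\lambda,\eta}(\mu)=J_{\lambda,\eta}(\rho)$ if $\mu=\rho\mathcal{L}^d$, and $=\infty$ otherwise. Solution of the Fokker-Planck equation. $\rho:[0,\infty)\to\mathcal{D}(\mathbb{R}^d)$ is a solution if: (i) $t\mapsto\rho(t)$ is continuous on $[0,\infty)$ under the weak-$*$ topology in $L^1(\mathbb{R}^d)$ (i.e. $t\mapsto\rho(t)\mathcal{L}^d$ is weakly continuous in $\mathcal{P}(\mathbb{R}^d)$),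 with $\rho(0)=\rho_0$; (ii) $L_F(\rho(t))\in W^{1,1}_{\mathrm{loc}}(\mathbb{R}^d)$ for all $t>0$; (iii) for all $\varphi\in C_c^\infty((0,\infty)\times\mathbb{R}^d)$, $\int_0^\infty\int\{\rho\,\partial_t\varphi-(\rho\nabla\Psi+\nabla(\lambda\rho+\eta\rho^m))\cdot\nabla\varphi\}\,dy\,dt=0$. Minimizing-movement solution. For $\tau>0$ set $M_\tau^0=\rho_0\mathcal{L}^d$ and choose recursively $M_\tau^n\in\operatorname{argmin}\{\frac1{2\tau}\mathcal{W}_2^2(\nu,M_\tau^{n-1})+\mathcal{J}_{\lambda,\eta}(\nu):\nu\in\mathcal{P}_2(\mathbb{R}^d)\}$, $n\in\mathbb{N}$. Let $\overline M_\tau(0)=\rho_0\mathcal{L}^d$ and $\overline M_\tau(t)=M_\tau^n$ for $t\in((n-1)\tau,n\tau]$. A minimizing-movement solution is a solution $\rho:[0,\infty)\to\mathcal{D}_2(\mathbb{R}^d)$ of the Fokker-Planck equation such that: for some $\tau_k\downarrow0$, $\overline M_{\tau_k}(t)\to\rho(t)\mathcal{L}^d$ weakly in $\mathcal{P}(\mathbb{R}^d)$ for all $t\ge0$; $t\mapsto\rho(t)\mathcal{L}^d$ is locally absolutely continuous of order 2 in $\mathcal{P}_2(\mathbb{R}^d)$ (there is $g\in L^2_{\mathrm{loc}}([0,\infty))$ with $\mathcal{W}_2(\rho(t)\mathcal{L}^d,\rho(s)\mathcal{L}^d)\le\int_s^tg(z)\,dz$ for $0\le s\le t$); and $v_\rho:=-(\nabla\Psi+\lambda\nabla\rho/\rho+\eta\nabla\rho^m/\rho)$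 satisfies $\int_0^T\int|v_\rho|^2\rho\,dy\,dt<\infty$ for all $T>0$. Such a $\rho$ exists for every $\rho_0\in\mathcal{D}_2(\mathbb{R}^d)$ with $J_{\lambda,\eta}(\rho_0)<\infty$. *)

(* Defs.v *)
From HB Require Import structures.
From mathcomp Require Import all_boot all_order all_algebra.
From mathcomp Require Import all_classical all_reals all_analysis.
From mathcomp Require Import measurable_realfun.

Set Implicit Arguments.
Unset Strict Implicit.
Unset Printing Implicit Defensive.

Import Order.TTheory GRing.Theory Num.Theory.
Import numFieldNormedType.Exports.

Local Open Scope classical_set_scope.
Local Open Scope ring_scope.

(* R^d is 'rV[R]_d with its Borel sigma-algebra.  The library's norm on
   'rV[R]_d is the sup norm: it is used only through the topology (open and
   compact sets, continuity, differentiability).  Lengths are Euclidean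
   ([enorm]). *)

HB.instance Definition _ (R : realType) (m n : nat) :=
  @isMeasurable.Build (sigma_display (@open 'M[R]_(m, n))) 'M[R]_(m, n)
    <<s @open 'M[R]_(m, n) >> (@sigma_algebra0 _ setT _)
    (@sigma_algebraC _ _) (@sigma_algebra_bigcup _ setT _).

Lemma measurable_rV_open (R : realType) n (U : set 'rV[R]_n) :
  open U -> measurable U.
Proof. by move=> oU; exact: sub_sigma_algebra. Qed.

Lemma measurable_coord (R : realType) n (i : 'I_n) :
  measurable_fun [set: 'rV[R]_n] (fun v => v ord0 i).
Proof.
apply: (measurability _ (RGenOpens.measurableE R)).
move=> _ [_ [a [b ->] <-]]; rewrite setTI; apply: measurable_rV_open.
apply: open_comp => [v _|]; [exact: coord_continuous|exact: interval_open].
Qed.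

Lemma rV_open_bigcup_rat (R : realType) n (U : set 'rV[R]_n) : open U ->
  U = \bigcup_(p in [set: 'rV[rat]_n * nat])
    [set v | (forall i, `|v ord0 i - ratr (p.1 ord0 i)| < p.2.+1%:R^-1) /\
       (forall w : 'rV[R]_n,
          (forall i, `|w ord0 i - ratr (p.1 ord0 i)| < p.2.+1%:R^-1) -> U w)].
Proof.
move=> oU; apply/seteqP; split => [v Uv|v [p _ [pv]]]; last exact.
have /nbhs_ballP[e /= e0 eU] : nbhs v U by exact: open_nbhs_nbhs.
have [k ke] : exists k : nat, k.+1%:R^-1 < e / 2.
  exists (Num.truncn (e / 2)^-1).
  rewrite invf_plt ?posrE ?divr_gt0//; exact: truncnS_gt.
have k0 : 0 < k.+1%:R^-1 :> R by rewrite invr_gt0.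
have qP i : exists q : rat, `|v ord0 i - ratr q| < k.+1%:R^-1.
  have /rat_in_itvoo[q /itvP qv] : v ord0 i < v ord0 i + k.+1%:R^-1.
    by rewrite ltrDl.
  exists q; rewrite distrC gtr0_norm ?subr_gt0 ?qv//.
  by rewrite ltrBlDl qv.
have [q qv] := choice qP.
exists (\row_i q i, k) => //=; split => [i|w wq]; first by rewrite mxE.
apply: eU; split => // a i; rewrite ord1 /ball/=.
rewrite (le_lt_trans (ler_distD (ratr (q i)) _ _))//.
rewrite (splitr e) ltrD// (lt_trans _ ke)//.
by have := wq i; rewrite mxE distrC.
Qed.

Lemma measurable_fun_rV d (T : measurableType d) (R : realType) n
    (f : T -> 'rV[R]_n) :
  (forall i, measurable_fun setT (fun x => f x ord0 i)) ->
  measurable_fun setT f.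
Proof.
move=> mf; apply: (@measurability _ _ _ _ _ _ (@open 'rV[R]_n)) => //.
move=> _ [U oU <-]; rewrite setTI (rV_open_bigcup_rat oU) preimage_bigcup.
apply: countable_bigcupT_measurable => [|p]; first exact: countableP.
have [pU|npU] := pselect (forall w : 'rV[R]_n,
  (forall i, `|w ord0 i - ratr (p.1 ord0 i)| < p.2.+1%:R^-1) -> U w); last first.
  by rewrite [X in measurable X](_ : _ = set0)//; apply/seteqP; split => // x [].
rewrite [X in measurable X](_ : _ = \bigcap_(i in [set: 'I_n])
    ((fun x => f x ord0 i) @^-1`
      ball (ratr (p.1 ord0 i) : R) p.2.+1%:R^-1)); last first.
  apply/seteqP; split => [x [xp _] i/= _|x xp].
    by rewrite /ball/= distrC; exact: xp.
  by split => // i; have := xp i; rewrite /ball/= distrC; exact.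
apply: fin_bigcap_measurable => // i _; rewrite -[X in measurable X]setTI.
by apply: mf => //; exact: measurable_ball.
Qed.

Definition snocrv (R : realType) n (p : 'rV[R]_n * R) : 'rV[R]_n.+1 :=
  \row_i oapp (fun j => p.1 ord0 j) p.2 (unlift ord_max i).

Lemma measurable_snocrv (R : realType) n :
  measurable_fun setT (@snocrv R n).
Proof.
apply: measurable_fun_rV => i.
under eq_fun do rewrite mxE.
case: (unlift ord_max i) => [j|] /=; last exact: measurable_snd.
by apply: (measurableT_comp (measurable_coord j)); exact: measurable_fst.
Qed.

Definition snoc_measure (R : realType) n
    (m : {measure set 'rV[R]_n -> \bar R}) : set 'rV[R]_n.+1 -> \bar R :=
  pushforward (m \x (@lebesgue_measure R))%E (@snocrv R n).

Section snoc_measure.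
Context (R : realType) (n : nat) (m : {measure set 'rV[R]_n -> \bar R}).

Let measurable_preimage (A : set 'rV[R]_n.+1) :
  measurable A -> measurable (@snocrv R n @^-1` A).
Proof. by move=> mA; rewrite -[X in measurable X]setTI; exact: measurable_snocrv. Qed.

Let snoc_measure0 : snoc_measure m set0 = 0%E.
Proof. by rewrite /snoc_measure /pushforward preimage_set0 measure0. Qed.

Let snoc_measure_ge0 A : (0 <= snoc_measure m A)%E.
Proof. by rewrite /snoc_measure /pushforward; apply: integral_ge0. Qed.

Let snoc_measure_sigma_additive : semi_sigma_additive (snoc_measure m).
Proof.
move=> F mF tF mUF; rewrite /snoc_measure /pushforward preimage_bigcup.
apply: measure_semi_sigma_additive.
- by move=> i; exact: measurable_preimage.
- apply/trivIsetP => /= i j _ _ ij; rewrite -preimage_setI.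
  by move/trivIsetP : tF => /(_ _ _ _ _ ij) ->//; rewrite preimage_set0.
- by rewrite -preimage_bigcup; exact: measurable_preimage.
Qed.

HB.instance Definition _ := isMeasure.Build _ _ _ (snoc_measure m)
  snoc_measure0 snoc_measure_ge0 snoc_measure_sigma_additive.

End snoc_measure.

Fixpoint lebesgue_rV (R : realType) d : {measure set 'rV[R]_d -> \bar R} :=
  match d with
  | 0 => \d_(0 : 'rV[R]_0)
  | d'.+1 => snoc_measure (lebesgue_rV R d')
  end.

Lemma lebesgue_rV_box (R : realType) d (A : 'I_d -> set R) :
  (forall i, measurable (A i)) ->
  lebesgue_rV R d [set v | forall i, A i (v ord0 i)] =
  (\prod_(i < d) @lebesgue_measure R (A i))%E.
Proof.
elim: d A => [|d ih] A mA /=.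
  by rewrite big_ord0 diracE mem_set// => -[].
rewrite big_ord_recr/= -ih//.
have mB : measurable
    [set v : 'rV[R]_d | forall i, A (widen_ord (leqnSn d) i) (v ord0 i)].
  rewrite [X in measurable X](_ : _ = \bigcap_(i in [set: 'I_d])
    ((fun v : 'rV[R]_d => v ord0 i) @^-1` A (widen_ord (leqnSn d) i))); last first.
    by apply/seteqP; split => [x xp i _|x xp i] /=; [exact: xp|exact: (xp i)].
  apply: fin_bigcap_measurable => // i _; rewrite -[X in measurable X]setTI.
  by apply: measurable_coord => //; exact: mA.
rewrite -(product_measure1E (lebesgue_rV R d) (@lebesgue_measure R) mB (mA _))/=.
have lift_widen (j : 'I_d) : lift ord_max j = widen_ord (leqnSn d) j.
  by apply/val_inj => /=; rewrite /bump leqNgt ltn_ord.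
rewrite /snoc_measure /pushforward; congr (product_measure1 _ _ _).
apply/seteqP; split => [[v x] /= vx|[v x] /= [vA xA] i].
  split => [i|].
    by have := vx (lift ord_max i); rewrite mxE liftK lift_widen.
  by have := vx ord_max; rewrite mxE unlift_none.
rewrite mxE; case: unliftP => [j|] -> //=.
by rewrite lift_widen.
Qed.

Definition dotv (R : realType) d (u v : 'rV[R]_d) : R :=
  \sum_(i < d) u ord0 i * v ord0 i.

Definition enorm (R : realType) d (u : 'rV[R]_d) : R := Num.sqrt (dotv u u).

Definition grad (R : realType) d (f : 'rV[R]_d -> R) (y : 'rV[R]_d) : 'rV[R]_d :=
  \row_i 'D_(delta_mx ord0 i) f y.

(* On a finite-dimensional space this is C^k: the k-th differential is
   continuous iff all iterated directional derivatives are. *)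
Fixpoint Ck (R : realType) (V : normedModType R) (k : nat) (f : V -> R) : Prop :=
  continuous f /\
  match k with
  | 0 => True
  | k'.+1 => (forall x, differentiable f x) /\ (forall v, Ck k' ('D_v f))
  end.

Definition Cc_infty (R : realType) (V : normedModType R) (D : set V)
    (phi : V -> R) : Prop :=
  (forall k, Ck k phi) /\
  exists K : set V, [/\ compact K, K `<=` D & forall x, ~ K x -> phi x = 0].

Section measures.
Context (R : realType) (d : nat).

Record density := Density {
  density_fun :> 'rV[R]_d -> R ;
  measurable_density : measurable_fun setT density_fun ;
  density_ge0 : forall y, 0 <= density_fun y ;
  density_int1 : (\int[lebesgue_rV R d]_y (density_fun y)%:E = 1)%E }.

Definition density_measure (rho : density) (A : set 'rV[R]_d) : \bar R :=
  (\int[lebesgue_rV R d]_(y in A) (rho y)%:E)%E.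

Section density_measure.
Context (rho : density).

Let density_measure0 : density_measure rho set0 = 0%E.
Proof. exact: integral_set0. Qed.

Let density_measure_ge0 A : (0 <= density_measure rho A)%E.
Proof. by apply: integral_ge0 => y _; rewrite lee_fin density_ge0. Qed.

Let density_measure_sigma_additive : semi_sigma_additive (density_measure rho).
Proof.
move=> F mF tF mUF; rewrite /density_measure ge0_integral_bigcup//=.
- by apply: is_cvg_ereal_nneg_natsum => n _; exact: density_measure_ge0.
- apply/measurable_EFinP/measurable_funTS; exact: measurable_density.
- by move=> y _; rewrite lee_fin density_ge0.
Qed.

HB.instance Definition _ := isMeasure.Build _ _ _ (density_measure rho)
  density_measure0 density_measure_ge0 density_measure_sigma_additive.

Let density_measure_setT : density_measure rho setT = 1%E.
Proof. exact: density_int1. Qed.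

HB.instance Definition _ := Measure_isProbability.Build _ _ _
  (density_measure rho) density_measure_setT.

End density_measure.

Definition density_prob (rho : density) : probability 'rV[R]_d R :=
  density_measure rho.

Definition D2 (rho : density) : Prop :=
  (\int[lebesgue_rV R d]_y (enorm y ^+ 2 * rho y)%:E < +oo)%E.

Definition P2 (mu : probability 'rV[R]_d R) : Prop :=
  (\int[mu]_y (enorm y ^+ 2)%:E < +oo)%E.

Definition coupling (mu nu : probability 'rV[R]_d R)
    (gamma : probability ('rV[R]_d * 'rV[R]_d)%type R) : Prop :=
  forall A, measurable A ->
    gamma (A `*` setT) = mu A /\ gamma (setT `*` A) = nu A.

Definition W2 (mu nu : probability 'rV[R]_d R) : \bar R :=
  sqrte (ereal_inf
    [set (\int[gamma]_z (enorm (z.1 - z.2) ^+ 2)%:E)%E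
    | gamma in coupling mu nu]).

Definition Cb (f : 'rV[R]_d -> R) : Prop :=
  continuous f /\ exists C, forall y, `|f y| <= C.

Definition weak_cvg (mu_ : nat -> probability 'rV[R]_d R)
    (mu : probability 'rV[R]_d R) : Prop :=
  forall f, Cb f -> (fun k => \int[mu_ k]_y f y) @ \oo --> \int[mu]_y f y.

Definition L1loc (u : 'rV[R]_d -> R) : Prop :=
  measurable_fun setT u /\
  forall K, compact K -> (lebesgue_rV R d).-integrable K (EFin \o u).

Definition is_wgrad (u : 'rV[R]_d -> R) (G : 'rV[R]_d -> 'rV[R]_d) : Prop :=
  (forall i, L1loc (fun y => G y ord0 i)) /\
  forall phi, Cc_infty setT phi -> forall i,
    \int[lebesgue_rV R d]_y (u y * grad phi y ord0 i) =
    - \int[lebesgue_rV R d]_y (G y ord0 i * phi y).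

Definition W11loc (u : 'rV[R]_d -> R) : Prop :=
  L1loc u /\ exists G, is_wgrad u G.

(* A representative of the distributional gradient, which is unique up to a
   null set; 0 if there is none. *)
Definition wgrad (u : 'rV[R]_d -> R) : 'rV[R]_d -> 'rV[R]_d :=
  xget (fun=> 0) [set G | is_wgrad u G].

End measures.

Section fokker_planck.
Context (R : realType) (d : nat) (Psi : 'rV[R]_d -> R) (lambda eta m : R).

(* [ln 0 = 0] in the library, so that [entropyH 0 = 0]. *)
Definition entropyH (s : R) : R := lambda * s * ln s.

(* s F'(s) - F(s) for F s = entropyH s + eta / (m - 1) * s `^ m *)
Definition L_F (s : R) : R := lambda * s + eta * s `^ m.

Definition J (rho : density R d) : \bar R :=
  (\int[lebesgue_rV R d]_y (Psi y * rho y)%:E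
   + \int[lebesgue_rV R d]_y (Num.max (entropyH (rho y)) 0)%:E
   - \int[lebesgue_rV R d]_y (Num.max (- entropyH (rho y)) 0)%:E
   + \int[lebesgue_rV R d]_y (eta / (m - 1) * rho y `^ m)%:E)%E.

Definition has_density (mu : probability 'rV[R]_d R) (rho : density R d) : Prop :=
  forall A, measurable A -> mu A = density_measure rho A.

(* Densities of the same measure are a.e. equal, hence have the same [J]. *)
Definition calJ (mu : probability 'rV[R]_d R) : \bar R :=
  if pselect (exists rho, has_density mu rho) is left ex then J (sval (cid ex))
  else +oo%E.

Definition FP_solution (rho0 : density R d) (rho : R -> density R d) : Prop :=
  [/\ (forall f, Cb f ->
         {within `[0, +oo[, continuous (fun t => \int[density_prob (rho t)]_y f y)})
      /\ {ae lebesgue_rV R d, forall y, rho 0 y = rho0 y},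
      forall t, 0 < t -> W11loc (fun y => L_F (rho t y)) &
      forall phi : (R * 'rV[R]_d)%type -> R,
        Cc_infty [set p : R * 'rV[R]_d | 0 < p.1] phi ->
        (\int[@lebesgue_measure R]_(t in `]0%R, +oo[) \int[lebesgue_rV R d]_y
          (rho t y * 'D_1 (fun s => phi (s, y)) t
           - dotv (rho t y *: grad Psi y + wgrad (fun z => L_F (rho t z)) y)
               (grad (fun z => phi (t, z)) y))%:E = 0)%E].

Definition MM_step (tau : R) (mu nu : probability 'rV[R]_d R) : \bar R :=
  ((2 * tau)^-1%:E * W2 nu mu ^+ 2 + calJ nu)%E.

Definition MM_scheme (rho0 : density R d) (tau : R)
    (M : nat -> probability 'rV[R]_d R) : Prop :=
  M 0%N = density_prob rho0 /\
  forall n, P2 (M n.+1) /\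
    forall nu, P2 nu -> (MM_step tau (M n) (M n.+1) <= MM_step tau (M n) nu)%E.

(* [M n] on ](n - 1) tau, n tau], [M 0] at t = 0 *)
Definition MM_interp (tau : R) (M : nat -> probability 'rV[R]_d R) (t : R) :
    probability 'rV[R]_d R :=
  M `|Num.ceil (t / tau)|%N.

Definition AC2_loc (mu : R -> probability 'rV[R]_d R) : Prop :=
  exists g : R -> R, [/\ measurable_fun (`[0, +oo[ : set R) g,
    forall T, 0 < T ->
      (\int[@lebesgue_measure R]_(z in `[0%R, T]) (g z ^+ 2)%:E < +oo)%E &
    forall s t, 0 <= s -> s <= t ->
      (W2 (mu t) (mu s) <= \int[@lebesgue_measure R]_(z in `[s, t]) (g z)%:E)%E].

Definition velocity (rho : density R d) (y : 'rV[R]_d) : 'rV[R]_d :=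
  - (grad Psi y + (lambda / rho y) *: wgrad rho y
     + (eta / rho y) *: wgrad (fun z => rho z `^ m) y).

Definition MM_solution (rho0 : density R d) (rho : R -> density R d) : Prop :=
  [/\ forall t, 0 <= t -> D2 (rho t),
      FP_solution rho0 rho,
      exists M : R -> nat -> probability 'rV[R]_d R,
        (forall tau, 0 < tau -> MM_scheme rho0 tau (M tau)) /\
        exists tau_ : nat -> R,
          [/\ forall k, 0 < tau_ k, nonincreasing_seq tau_,
              tau_ @ \oo --> (0 : R) &
              forall t, 0 <= t ->
                weak_cvg (fun k => MM_interp (tau_ k) (M (tau_ k)) t)
                  (density_prob (rho t))],
      AC2_loc (fun t => density_prob (rho t)) &
      forall T, 0 < T ->
        (\int[@lebesgue_measure R]_(t in `]0%R, T[) \int[lebesgue_rV R d]_y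
           (enorm (velocity (rho t) y) ^+ 2 * rho t y)%:E < +oo)%E].

End fokker_planck.

(* Main.v *)
Require Import Defs.
From HB Require Import structures.
From mathcomp Require Import all_boot all_order all_algebra.
From mathcomp Require Import all_classical all_reals all_analysis.
From mathcomp Require Import measurable_realfun ring lra.

Set Implicit Arguments.
Unset Strict Implicit.
Unset Printing Implicit Defensive.

Import Order.TTheory GRing.Theory Num.Theory.
Import numFieldNormedType.Exports.

Local Open Scope classical_set_scope.
Local Open Scope ring_scope.

(* Write the equation as [d_t u + div (u v) = 0] with [v = velocity] and [u = rho t].  Inside the
   support of [u], [grad u = u b] with [b = - (v + grad Psi) / p' u] and [p = L_F], so that finite
   dissipation and finite second moments give [u |b|^2] integrable for a.e. time.
   Mollify in space: [u_n = mol u] solves [d_t u_n = - div (u v)_n] pointwise in [x], and is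
   absolutely continuous in time.  For [G] smooth and convex with [G'] and [u G'' u] bounded, and
   for a bounded potential [psi], convexity alone gives
     [E_n t - E_n s <= int_s^t int (G'' (u_n) grad u_n + grad psi) . (u v)_n],
   where [E_n = int (G (u_n) + psi u_n)].  By Cauchy-Schwarz, [|(u f)_n|^2 <= u_n (u f^2)_n], so the
   integrands are dominated by mollifications of fixed L^1 functions, which converge in L^1, and
   [n -> oo] is a generalised dominated convergence.
   Letting finally [G -> F] and [psi -> Psi], the slope tends to [- int u |v|^2 <= 0], the energy at
   time [s] converges by domination, and the energy at time [t] is lower semicontinuous (Fatou).
   This yields [J (rho t) <= J (rho s)] for [s <= t]. *)

(** Formally one tests the equation with [F' u + Psi]. But [ln u] blows up where [u] is small, [Psi]
    and [u^(m-1)] may be unbounded, and neither [u ln u] nor [u^m] is known beforehand to be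
    globally integrable at later times: hence the truncated [G] and [psi]. Bounded [G'] makes
    [G (u_n)] and [G' (u_n) div (u v)_n] integrable; bounded [u G'' u] absorbs the two factors
    [sqrt u_n] that Cauchy-Schwarz produces from [(u b)_n] and [(u v)_n]. These bounds may
    degenerate as the truncation is removed. The last limit survives because [u G'' u] is at most a
    fixed multiple of [p' u], uniformly in the truncation, while [b] carries exactly the factor
    [1 / p' u]. Two obstacles shape the rest. Weak gradients are representatives chosen separately
    at each time, so measurability in time is recovered from the weak continuity of [rho], through
    mollified quantities in which no gradient appears. And [u b] is the gradient of [u] because
    [L_F] has a C^1 inverse with derivative at most [1 / lambda], to which a chain rule for weak
    gradients applies. *)

(** * Lebesgue measure on row vectors *)

(* A constant alias: unlike the fixpoint [lebesgue_rV], it does not unfold when [d] is a successor. *)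
Definition vol (R : realType) (d : nat) : set 'rV[R]_d -> \bar R := lebesgue_rV R d.

HB.instance Definition _ (R : realType) (d : nat) := Measure.copy (@vol R d) (lebesgue_rV R d).

Lemma lebE (R : realType) d : lebesgue_rV R d = (@vol R d : {measure set _ -> \bar R}).
Proof. exact: eq_measure. Qed.

Section vol.
Context (R : realType).

Lemma cont_measurable d (f : 'rV[R]_d -> R) : continuous f -> measurable_fun setT f.
Proof.
move=> cf; apply: (measurability _ (RGenOpens.measurableE R)).
move=> _ [_ [a [b ->] <-]]; rewrite setTI; apply: measurable_rV_open.
apply: open_comp => [v _|]; [exact: cf|exact: interval_open].
Qed.

(** Sup-norm balls: as boxes they have an explicit volume, and as compact sets they exhaust the
    space, so local integrability is tested on them. *)
Definition cube d (c : R) : set 'rV[R]_d := [set v | forall i, v ord0 i \in `[- c, c]].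

Lemma measurable_cube d c : measurable (@cube d c).
Proof.
rewrite (_ : @cube d c = \bigcap_(i in [set: 'I_d])
    ((fun v : 'rV[R]_d => v ord0 i) @^-1` `[- c, c]%classic)); last first.
  by apply/seteqP; split => [x xp i _|x xp i] /=; [exact: xp|exact: (xp i)].
apply: fin_bigcap_measurable => // i _; rewrite -[X in measurable X]setTI.
exact: measurable_coord.
Qed.

Lemma vol_box d (A : 'I_d -> set R) : (forall i, measurable (A i)) ->
  @vol R d [set v | forall i, A i (v ord0 i)] =
  (\prod_(i < d) @lebesgue_measure R (A i))%E.
Proof. exact: lebesgue_rV_box. Qed.

Lemma vol_box_lty d (A : 'I_d -> set R) : (forall i, measurable (A i)) ->
  (forall i, @lebesgue_measure R (A i) < +oo)%E ->
  (@vol R d [set v | forall i, A i (v ord0 i)] < +oo)%E.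
Proof.
move=> mA fA; rewrite vol_box//.
suff : (\prod_(i < d) @lebesgue_measure R (A i))%E \is a fin_num by rewrite fin_numElt => /andP[].
elim/big_rec : _ => // i x _ xf; rewrite fin_numM// ge0_fin_numE//.
Qed.

Lemma vol_cube_lty d c : (@vol R d (cube c) < +oo)%E.
Proof.
apply: (@vol_box_lty d (fun=> `[-c, c]%classic)) => // i.
by rewrite /= lebesgue_measure_itv/=; case: ifPn => // _; rewrite -EFinB ltry.
Qed.

Lemma cubeT d : [set: 'rV[R]_d] = \bigcup_n cube n%:R.
Proof.
apply/seteqP; split => // v _.
exists (Num.truncn (\sum_i `|v ord0 i|)).+1 => // i.
rewrite in_itv/= -ler_norml.
have h : \sum_i `|v ord0 i| <= (Num.truncn (\sum_i `|v ord0 i|)).+1%:R.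
  exact/ltW/truncnS_gt.
apply: le_trans h; rewrite (bigD1 i)//= lerDl sumr_ge0//.
Qed.

Lemma vol_sigma_finite d : sigma_finite setT (@vol R d).
Proof.
exists (fun n => cube n%:R); first exact: cubeT.
by move=> n; split; [exact: measurable_cube|exact: vol_cube_lty].
Qed.

HB.instance Definition _ d := Measure_isSigmaFinite.Build _ _ R (@vol R d) (@vol_sigma_finite d).

(** In dimension [d.+1] the measure is by construction the image of a product, so this is Tonelli's
    theorem; it drives the inductions on the dimension. *)
Lemma snoc_ge0_integral d (f : 'rV[R]_d.+1 -> \bar R) :
  measurable_fun setT f -> (forall x, 0 <= f x)%E ->
  (\int[@vol R d.+1]_x f x = \int[@vol R d]_p \int[@lebesgue_measure R]_t f (snocrv (p, t)))%E.
Proof.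
move=> mf f0.
have ms : measurable_fun setT (@snocrv R d : 'rV[R]_d * measurableTypeR R -> 'rV[R]_d.+1).
  exact: measurable_snocrv.
transitivity (\int[pushforward (@vol R d \x @lebesgue_measure R)%E (@snocrv R d : 'rV[R]_d * measurableTypeR R -> 'rV[R]_d.+1)]_x f x)%E => //.
rewrite (ge0_integral_pushforward ms)//= preimage_setT.
rewrite (@fubini_tonelli1 _ _ _ _ _ (@vol R d) (@lebesgue_measure R) (f \o (@snocrv R d : 'rV[R]_d * measurableTypeR R -> 'rV[R]_d.+1)))//=.
by apply: measurableT_comp => //; exact: measurable_snocrv.
Qed.

Lemma lebesgue_measureD (a : R) (A : set R) : measurable A ->
  pushforward lebesgue_measure ((fun x => x + a) : _ -> measurableTypeR R) A = lebesgue_measure A.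
Proof.
move=> mA; apply/esym/lebesgue_measure_unique => //=; first exact: measurable_funD.
move=> ? _ [[u v]] _ <-.
rewrite /pushforward (_ : _ @^-1` _ = `]u - a, v - a]%classic).
  by rewrite !lebesgue_measure_itv/= !lte_fin ltrD2r -!EFinB; case: ifP => // _; congr EFin; lra.
by apply/seteqP; split => x /=; rewrite !in_itv/= => /andP[]; lra.
Qed.

Lemma ge0_integral_shift1 (a : R) (f : R -> \bar R) : measurable_fun setT f ->
  (forall x, 0 <= f x)%E ->
  (\int[lebesgue_measure]_x f (x + a)%R = \int[lebesgue_measure]_x f x)%E.
Proof.
move=> mf f0.
have m : measurable_fun [set: measurableTypeR R]
    ((fun x => x + a) : measurableTypeR R -> measurableTypeR R).
  exact: measurable_funD.
transitivity (\int[pushforward (@lebesgue_measure R)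
    ((fun x => x + a)%R : measurableTypeR R -> measurableTypeR R)]_x (f : measurableTypeR R -> \bar R) x)%E.
  by rewrite (ge0_integral_pushforward m lebesgue_measure measurableT mf)//= ?preimage_setT.
apply: eq_measure_integral => A mA _; exact: (lebesgue_measureD a).
Qed.

Lemma measurable_shift d (a : 'rV[R]_d) : measurable_fun setT (fun x : 'rV[R]_d => x + a).
Proof.
apply: measurable_fun_rV => i; under eq_fun do rewrite mxE.
by apply: measurable_funD => //; exact: measurable_coord.
Qed.

Lemma ge0_integral_shift d (a : 'rV[R]_d) (f : 'rV[R]_d -> \bar R) :
  measurable_fun setT f -> (forall x, 0 <= f x)%E ->
  (\int[@vol R d]_x f (x + a)%R = \int[@vol R d]_x f x)%E.
Proof.
elim: d a f => [|d ih] a f mf f0.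
  by apply: eq_integral => x _; congr f; apply/rowP => -[].
have mfa : measurable_fun setT (fun x : 'rV[R]_d.+1 => f (x + a)).
  by apply: measurableT_comp => //; exact: measurable_shift.
rewrite (snoc_ge0_integral mfa (fun x => f0 _)) (snoc_ge0_integral mf f0).
(* The translation splits into [a'] on the first [d] coordinates, left to the induction hypothesis,
   and the last coordinate of [a], acting on the line. *)
pose a' : 'rV[R]_d := \row_i a ord0 (widen_ord (leqnSn d) i).
pose F p := (\int[@lebesgue_measure R]_t f (snocrv (p, t)))%E.
rewrite -(ih a' F); first last.
- by move=> x; exact: integral_ge0.
- apply: (@measurable_fun_fubini_tonelli_F _ _ _ _ _ (@lebesgue_measure R) (f \o @snocrv R d)) => //.
    by apply: measurableT_comp => //; exact: measurable_snocrv.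
  by move=> ? /=.
apply: eq_integral => p _.
have h t : snocrv (p, t) + a = snocrv (p + a', t + a ord0 ord_max).
  apply/rowP => i; rewrite !mxE; case: unliftP => [j|] -> //=.
  rewrite !mxE; congr (_ + a _ _); apply/val_inj => /=.
  by rewrite /bump leqNgt ltn_ord.
under eq_integral do rewrite h.
rewrite (ge0_integral_shift1 (a ord0 ord_max) (f := fun t => f (snocrv (p + a', t))))//.
apply: measurableT_comp => //; apply: measurableT_comp; first exact: measurable_snocrv.
exact: measurable_pair1.
Qed.

(** Positive and negative parts are shifted separately, so functions that are not integrable are
    covered as well. *)
Lemma integral_shift d (a : 'rV[R]_d) (f : 'rV[R]_d -> \bar R) :
  measurable_fun setT f ->
  (\int[@vol R d]_x f (x + a)%R = \int[@vol R d]_x f x)%E.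
Proof.
move=> mf; rewrite integralE [RHS]integralE; congr (_ - _)%E.
  rewrite -(ge0_integral_shift a (measurable_funepos mf) (funepos_ge0 f)).
  by apply: eq_integral => x _; rewrite !funeposE.
rewrite -(ge0_integral_shift a (measurable_funeneg mf) (funeneg_ge0 f)).
by apply: eq_integral => x _; rewrite !funenegE.
Qed.

Lemma Rintegral_shift d (a : 'rV[R]_d) (f : 'rV[R]_d -> R) : measurable_fun setT f ->
  \int[@vol R d]_x f (x + a) = \int[@vol R d]_x f x.
Proof.
move=> mf; rewrite /Rintegral; congr fine.
by apply: (integral_shift a (f := EFin \o f)); exact/measurable_EFinP.
Qed.

Lemma integrable_shift d (a : 'rV[R]_d) (f : 'rV[R]_d -> R) :
  (@vol R d).-integrable setT (EFin \o f) ->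
  (@vol R d).-integrable setT (EFin \o (fun x => f (x + a))).
Proof.
move=> /integrableP[mf fy]; apply/integrableP; split.
  apply: (measurableT_comp mf); exact: measurable_shift.
rewrite /= in fy *.
rewrite (integral_shift a (f := fun x => `|(f x)%:E|%E))//.
exact: measurableT_comp.
Qed.

Lemma measurable_sub d : measurable_fun setT (fun p : 'rV[R]_d * 'rV[R]_d => p.2 - p.1).
Proof.
apply: measurable_fun_rV => i; under eq_fun do rewrite !mxE.
apply: measurable_funB; first exact: (measurableT_comp (measurable_coord i) measurable_snd).
exact: (measurableT_comp (measurable_coord i) measurable_fst).
Qed.

Lemma cube_compact d (c : R) : compact (@cube d c).
Proof. by apply: (@rV_compact _ _ (fun=> `[- c, c]%classic)) => i; exact: segment_compact. Qed.

Lemma compact_cube d (K : set 'rV[R]_d) : compact K -> exists N : nat, K `<=` cube N%:R.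
Proof.
move=> /compact_bounded[M [Mr KM]].
exists (Num.truncn (`|M| + 1)).+1 => v Kv i.
rewrite in_itv/= -ler_norml.
have h : `|v| <= `|M| + 1 by apply: KM => //; rewrite ltr_pwDr// ler_norm.
apply: le_trans (ltW (truncnS_gt _)); apply: le_trans h.
rewrite [`|v|]mx_normrE; apply: (le_trans _ (le_bigmax _ _ (ord0, i))) => //=.
Qed.

Lemma subset_cube d (a b : R) : a <= b -> @cube d a `<=` cube b.
Proof. by move=> ab v h i; have := h i; rewrite !in_itv/= => /andP[? ?]; apply/andP; split; lra. Qed.

End vol.

(** * Convergence of integrals and Fubini *)

Notation intg mu D f := (integrable mu D (EFin \o f)).

Section real_integration.
Context {dd} {T : measurableType dd} {R : realType} (mu : {measure set T -> \bar R}).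

(** Measurability plays no part here: the integral of a nonnegative function is the supremum over
    the simple functions below it, and that set grows with the function. *)
Lemma le_lower_integral (D : set T) (f g : T -> \bar R) :
  (forall x, D x -> 0 <= f x)%E -> (forall x, D x -> f x <= g x)%E ->
  (\int[mu]_(x in D) f x <= \int[mu]_(x in D) g x)%E.
Proof.
move=> f0 fg; have g0 x : D x -> (0 <= g x)%E by move=> Dx; exact: le_trans (f0 _ Dx) (fg _ Dx).
have patch0 (h : T -> \bar R) : (forall x, D x -> 0 <= h x)%E -> forall x, (0 <= (h \_ D) x)%E.
  by move=> h0 x; rewrite patchE; case: ifPn => // /set_mem/h0.
rewrite [leLHS]integral_mkcond [leRHS]integral_mkcond.
rewrite (ge0_integralTE _ (patch0 _ f0)) (ge0_integralTE _ (patch0 _ g0)).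
apply: le_ereal_sup => _ [h /= hf <-]; exists h => //= x.
apply: le_trans (hf x) _; rewrite !patchE; case: ifPn => // /set_mem; exact: fg.
Qed.

Lemma intg_measurable (D : set T) (f : T -> R) : measurable D -> intg mu D f -> measurable_fun D f.
Proof. by move=> mD /integrableP[/measurable_EFinP]. Qed.

Lemma le_intg (D : set T) (f g : T -> R) : measurable D -> measurable_fun D f ->
  (forall x, D x -> `|f x| <= g x) -> intg mu D g -> intg mu D f.
Proof.
move=> mD mf fg; apply: le_integrable => //; first exact/measurable_EFinP.
by move=> x Dx /=; rewrite lee_fin (le_trans (fg _ Dx))// ler_norm.
Qed.

Lemma le_intg_ae (D : set T) (f g : T -> R) : measurable D -> measurable_fun D f ->
  {ae mu, forall x, D x -> `|f x| <= g x} -> intg mu D g -> intg mu D f.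
Proof.
move=> mD mf fg ig; have /integrableP[/measurable_EFinP mg gy] := ig.
apply/integrableP; split; first exact/measurable_EFinP.
apply: le_lt_trans gy; apply: ae_ge0_le_integral => //=.
- by do 2!apply: measurableT_comp => //.
- by do 2!apply: measurableT_comp => //.
- by apply: filterS fg => x fgx Dx; rewrite lee_fin (le_trans (fgx Dx))// ler_norm.
Qed.

Lemma intgD (D : set T) (f g : T -> R) : measurable D ->
  intg mu D f -> intg mu D g -> intg mu D (fun x => f x + g x).
Proof. by move=> mD fi gi; apply: eq_integrable (integrableD mD fi gi). Qed.

Lemma intgN (D : set T) (f : T -> R) : measurable D ->
  intg mu D f -> intg mu D (fun x => - f x).
Proof. by move=> mD fi; apply: eq_integrable (integrableN fi). Qed.

Lemma intgB (D : set T) (f g : T -> R) : measurable D ->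
  intg mu D f -> intg mu D g -> intg mu D (fun x => f x - g x).
Proof. by move=> mD fi gi; apply: eq_integrable (integrableB mD fi gi). Qed.

Lemma intgZl (D : set T) (k : R) (f : T -> R) : measurable D ->
  intg mu D f -> intg mu D (fun x => k * f x).
Proof. by move=> mD fi; apply: eq_integrable (integrableZl mD k fi). Qed.

Lemma intg_sum I (s : seq I) (D : set T) (f : I -> T -> R) : measurable D ->
  (forall i, intg mu D (f i)) -> intg mu D (fun x => \sum_(i <- s) f i x).
Proof.
move=> mD fi; apply: eq_integrable (integrable_sum mD s (P := xpredT) (h := fun i => EFin \o f i) _) => //.
by move=> x _ /=; rewrite sumEFin.
Qed.

Lemma Rintegral_sum I (s : seq I) (D : set T) (f : I -> T -> R) : measurable D ->
  (forall i, intg mu D (f i)) ->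
  \int[mu]_(x in D) (\sum_(i <- s) f i x) = \sum_(i <- s) \int[mu]_(x in D) f i x.
Proof.
move=> mD fi; elim: s => [|i s ih].
  by under eq_Rintegral do rewrite big_nil; rewrite big_nil Rintegral_cst// mul0r.
under eq_Rintegral do rewrite big_cons.
by rewrite big_cons RintegralD// ?ih//; exact: intg_sum.
Qed.

Lemma intg_norm (D : set T) (f : T -> R) : measurable D ->
  intg mu D f -> intg mu D (fun x => `|f x|).
Proof. by move=> mD fi; exact: integrable_norm. Qed.

Lemma Rintegral_EFin (D : set T) (f : T -> R) : measurable D -> intg mu D f ->
  (\int[mu]_(x in D) (f x)%:E)%E = (\int[mu]_(x in D) f x)%:E.
Proof. by move=> mD fi; rewrite /Rintegral fineK//; exact: integrable_fin_num. Qed.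

Lemma ae_eq_Rintegral (D : set T) (f g : T -> R) : measurable D ->
  measurable_fun D f -> measurable_fun D g ->
  {ae mu, forall x, D x -> f x = g x} ->
  \int[mu]_(x in D) f x = \int[mu]_(x in D) g x.
Proof.
move=> mD mf mg fg; rewrite /Rintegral; congr fine.
apply: ae_eq_integral => //; try exact/measurable_EFinP.
by apply: filterS fg => x fgx Dx; rewrite fgx.
Qed.

Lemma ae_eq_intg (D : set T) (f g : T -> R) : measurable D ->
  measurable_fun D g -> {ae mu, forall x, D x -> f x = g x} ->
  intg mu D f -> intg mu D g.
Proof.
move=> mD mg fg fi; apply: (le_intg_ae mD mg _ (intg_norm mD fi)).
by apply: filterS fg => x fgx Dx; rewrite fgx.
Qed.

(** Replacing [g] by [max f g], which is almost everywhere equal to it, turns the comparison into a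
    pointwise one. *)
Lemma le_Rintegral_ae (D : set T) (f g : T -> R) : measurable D ->
  intg mu D f -> intg mu D g ->
  {ae mu, forall x, D x -> f x <= g x} ->
  \int[mu]_(x in D) f x <= \int[mu]_(x in D) g x.
Proof.
move=> mD fi gi fg; have [mf mg] := (intg_measurable mD fi, intg_measurable mD gi).
have mm : measurable_fun D (fun x => Num.max (f x) (g x)) by exact: measurable_maxr.
have mi : intg mu D (fun x => Num.max (f x) (g x)).
  apply: (ae_eq_intg mD mm _ gi); apply: filterS fg => x fgx Dx.
  by rewrite max_r// fgx.
rewrite (@ae_eq_Rintegral D g (fun x => Num.max (f x) (g x)))//.
  by apply: le_Rintegral => // x _; rewrite le_max lexx.
by apply: filterS fg => x fgx Dx; rewrite max_r// fgx.
Qed.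

Lemma dominated_Rintegral (D : set T) (f_ : nat -> T -> R) (f g : T -> R) : measurable D ->
  (forall n, measurable_fun D (f_ n)) -> measurable_fun D f ->
  {ae mu, forall x, D x -> f_ ^~ x @ \oo --> f x} ->
  (forall n x, D x -> `|f_ n x| <= g x) -> intg mu D g ->
  intg mu D f /\ (fun n => \int[mu]_(x in D) f_ n x) @ \oo --> \int[mu]_(x in D) f x.
Proof.
move=> mD mf_ mf ff fg gi.
have [||||fi _ cf] := @dominated_convergence _ _ _ mu D mD (fun n => EFin \o f_ n) (EFin \o f) (EFin \o g) _ _ _ gi.
- by move=> n; exact/measurable_EFinP.
- exact/measurable_EFinP.
- by apply: filterS ff => x fx Dx; apply: cvg_EFin; [exact: nearW|exact: fx].
- by apply: aeW => x n Dx; rewrite lee_fin fg.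
split => //; apply: fine_cvg; move: cf; rewrite /= Rintegral_EFin//.
Qed.

Lemma minr_ge0 (x y : R) : 0 <= x -> 0 <= y -> 0 <= Num.min x y.
Proof. by move=> x0 y0; rewrite le_min x0. Qed.

(* [|f_n - f| <= min(|f_n - f|, 2h) + |h_n - h|]: ordinary dominated convergence
   for the first term. *)
Lemma gen_dominated_Rintegral (D : set T) (f_ h_ : nat -> T -> R) (f h : T -> R) :
  measurable D ->
  (forall n, measurable_fun D (f_ n)) -> measurable_fun D f ->
  {ae mu, forall x, D x -> f_ ^~ x @ \oo --> f x} ->
  (forall n x, D x -> `|f_ n x| <= h_ n x) ->
  {ae mu, forall x, D x -> `|f x| <= h x} ->
  (forall n, intg mu D (h_ n)) -> intg mu D h ->
  (fun n => \int[mu]_(x in D) `|h_ n x - h x|) @ \oo --> 0 ->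
  intg mu D f /\ (fun n => \int[mu]_(x in D) f_ n x) @ \oo --> \int[mu]_(x in D) f x.
Proof.
move=> mD mf_ mf ff fh_ fh hi_ hi hh.
have fi : intg mu D f by exact: le_intg_ae fh hi.
have fi_ n : intg mu D (f_ n) by exact: le_intg (fh_ n) (hi_ n).
split => //.
have mh := intg_measurable mD hi.
pose k (n : nat) (x : T) : R := Num.min `|f_ n x - f x| (2 * `|h x|).
have mk n : measurable_fun D (k n).
  apply: measurable_minr; first by apply: measurableT_comp => //; exact: measurable_funB.
  by apply: measurable_funM => //; exact: measurableT_comp.
have [_ k0] : intg mu D (cst 0) /\ (fun n => \int[mu]_(x in D) k n x) @ \oo --> \int[mu]_(x in D) (cst 0 x).
  apply: (@dominated_Rintegral D k (cst 0) (fun x => 2 * `|h x|)) => //.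
  - apply: filterS ff => x fx Dx.
    have {}fx := fx Dx.
    apply: (@squeeze_cvgr _ _ _ _ (cst 0) (fun n => `|f_ n x - f x|)); last 2 first.
    + exact: cvg_cst.
    + by move/cvgrPdist_lt : fx => fx; apply/cvgrPdist_lt => e e0; near=> n;
       rewrite sub0r normrN normr_id distrC; near: n; exact: fx.
    apply: nearW => n; rewrite /k /= ge_min lexx andbT; apply/minr_ge0 => //; exact: mulr_ge0.
  - move=> n x Dx; rewrite /k ger0_norm ?ge_min ?lexx ?orbT//.
  - apply: intgZl => //; exact: intg_norm.
rewrite Rintegral_cst// mul0r in k0.
have hhi n : intg mu D (fun x => `|h_ n x - h x|) by apply: intg_norm => //; exact: intgB.
have ki n : intg mu D (k n).
  apply: (le_intg mD (mk n) _ (intgZl 2 mD (intg_norm mD hi))) => x Dx.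
  rewrite /k ger0_norm ?ge_min ?lexx ?orbT//.
apply/cvgrPdist_lt => e e0.
have e2 : 0 < e / 2 by rewrite divr_gt0.
move/cvgrPdist_lt : hh => /(_ _ e2) hh; move/cvgrPdist_lt : k0 => /(_ _ e2) k0.
near=> n.
have hn : \int[mu]_(x in D) `|h_ n x - h x| < e / 2.
  apply: le_lt_trans (ler_norm _) _; rewrite -[X in `|X|]opprK normrN -[X in `|X|]sub0r; near: n; exact: hh.
have kn : \int[mu]_(x in D) k n x < e / 2.
  apply: le_lt_trans (ler_norm _) _; rewrite -[X in `|X|]opprK normrN -[X in `|X|]sub0r; near: n; exact: k0.
rewrite distrC -RintegralB//.
have fBi : intg mu D (fun x => f_ n x - f x) by exact: intgB.
apply: le_lt_trans (le_normr_Rintegral mD fBi) _.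
apply: (@le_lt_trans _ _ (\int[mu]_(x in D) (k n x + `|h_ n x - h x|))).
  apply: le_Rintegral_ae => //; [exact: intg_norm|exact: intgD|].
  apply: filterS fh => x fhx Dx; have {}fhx := fhx Dx; have := fh_ n x Dx.
  rewrite /k /Num.min; case: ifP => _ h1; first by rewrite lerDl.
  have := ler_normB (f_ n x) (f x).
  have := ler_norm (h x); have := ler_norm (h_ n x - h x); lra.
by rewrite RintegralD// [e]splitr ltrD.
Unshelve. all: end_near. Qed.

(** If convergence fails, the indices at distance at least some [e] from the limit form an infinite
    set [S], inside which no subsequence can converge. This is needed because convergence in L^1
    gives convergence almost everywhere only along subsequences. *)
Lemma cvg_subsubseq (x : nat -> R) (l : R) :
  (forall S : set nat, (forall N, exists2 n, (N <= n)%N & S n) ->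
    exists phi : nat -> nat, (forall N, (N <= phi N)%N /\ S (phi N)) /\ x \o phi @ \oo --> l) ->
  x @ \oo --> l.
Proof.
move=> H; apply/cvgrPdist_lt => e e0; apply: contrapT => nH.
have [|phi [phiS]] := H [set n | ~ `|l - x n| < e].
  move=> N; apply: contrapT => hN; apply: nH; exists N => // n /= Nn.
  by apply: contrapT => hn; apply: hN; exists n.
move=> /cvgrPdist_lt /(_ _ e0)[N _ /(_ N (leqnn N))] /=.
by have [_] := phiS N.
Qed.

(** Indices are taken in [S] so that the integrals over [D_ N] are summable. On each fixed [D_ M]
    the series of the chosen functions is then integrable, hence finite almost everywhere, and its
    terms tend to 0. *)
Lemma ae_cvg_subseq (D_ : nat -> set T) (a : nat -> T -> R) (S : set nat) :
  (forall M, measurable (D_ M)) -> (forall M N, (M <= N)%N -> D_ M `<=` D_ N) ->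
  \bigcup_M D_ M = setT ->
  (forall n x, 0 <= a n x) -> (forall M n, intg mu (D_ M) (a n)) ->
  (forall M, (fun n => \int[mu]_(x in D_ M) a n x) @ \oo --> 0) ->
  (forall N, exists2 n, (N <= n)%N & S n) ->
  exists phi : nat -> nat, (forall N, (N <= phi N)%N /\ S (phi N)) /\
    {ae mu, forall x, (fun N => a (phi N) x) @ \oo --> 0}.
Proof.
move=> mD DD DT a0 ai a_ SS.
have phiP N : exists n, [/\ (N <= n)%N, S n & \int[mu]_(x in D_ N) a n x < 1 / (2 ^ N.+1)%:R].
  have e0 : 0 < 1 / (2 ^ N.+1)%:R :> R by rewrite divr_gt0// ltr0n expn_gt0.
  move/cvgrPdist_lt : (a_ N) => /(_ _ e0)[k _ hk].
  have [n kn Sn] := SS (maxn N k); exists n; split => //.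
    by rewrite (leq_trans _ kn)// leq_maxl.
  have := hk n; rewrite /= sub0r normrN => h; apply: le_lt_trans (ler_norm _) (h _).
  by rewrite (leq_trans _ kn)// leq_maxr.
have [phi phiE] := choice phiP.
exists phi; split; first by move=> N; have [] := phiE N.
have : {ae mu, forall x M, D_ M x -> (fun N => a (phi N) x) @ \oo --> 0}.
  apply: (@ae_foralln _ _ _ mu (fun M x => D_ M x -> (fun N => a (phi N) x) @ \oo --> 0)) => M.
  have ma n : measurable_fun (D_ M) (a n) by exact: intg_measurable.
  have b0 (k : nat) x : (0 <= (a (phi (k + M)%N) x)%:E)%E by rewrite lee_fin.
  (* The index is shifted by [M] so that [D_ M] lies inside every [D_ (k + M)] on which smallness is
     known. *)
  have intS : mu.-integrable (D_ M) (fun x => \sum_(0 <= k <oo) (a (phi (k + M)%N) x)%:E)%E.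
    apply/integrableP; split.
      apply: ge0_emeasurable_sum => // k _; exact/measurable_EFinP.
    rewrite (eq_integral (fun x => \sum_(0 <= k <oo) (a (phi (k + M)%N) x)%:E)%E); last first.
      by move=> x _; rewrite gee0_abs// nneseries_ge0.
    rewrite integral_nneseries//; last by move=> n; exact/measurable_EFinP.
    apply: (@le_lt_trans _ _ 1%:E); last exact: ltry.
    apply: le_trans (epsilon_trick0 xpredT ler01).
    apply: lee_nneseries => [k _ _|k _]; first by apply: integral_ge0 => x _; exact: b0.
    rewrite Rintegral_EFin// lee_fin.
    have [Nphi Sphi h] := phiE (k + M)%N.
    apply: (@le_trans _ _ (1 / (2 ^ (k + M).+1)%:R)); last first.
      rewrite ler_pM2l// lef_pV2 ?posrE ?ltr0n ?expn_gt0// ler_nat leq_exp2l//.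
      by rewrite ltnS leq_addr.
    apply: le_trans (ltW h).
    rewrite -lee_fin -!Rintegral_EFin//.
    apply: ge0_subset_integral => //.
    + by apply/measurable_EFinP; exact: intg_measurable.
    + by apply: DD; rewrite leq_addl.
  apply: filterS (integrable_ae (mD M) intS) => x h Dx.
  have {}h := h Dx.
  pose b k := a (phi (k + M)%N) x.
  have cb : cvgn (series b).
    apply: nondecreasing_is_cvgn.
      apply/nondecreasing_seqP => n; rewrite seriesEnat/= big_nat_recr//= lerDl; exact: a0.
    exists (fine (\sum_(0 <= k <oo) (b k)%:E)) => _ [n _ <-].
    rewrite -lee_fin fineK// seriesEnat/= -sumEFin.
    by apply: nneseries_lim_ge => k _ _; exact: b0.
  have := cvg_series_cvg_0 cb.
  by rewrite /b (@cvg_shiftn M _ (fun N => a (phi N) x)).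
apply: filterS => x h; have [M _ Mx] : (\bigcup_M D_ M) x by rewrite DT.
exact: (h M).
Qed.

End real_integration.

(** Valid for every measurable [f]: the integrals of both parts are measurable by Tonelli, and
    [fine] is a measurable function of their difference. *)
Lemma measurable_Rint2 {d1 d2} {T1 : measurableType d1} {T2 : measurableType d2} {R : realType}
    (m2 : {sigma_finite_measure set T2 -> \bar R}) (f : T1 * T2 -> R) :
  measurable_fun setT f -> measurable_fun setT (fun x => \int[m2]_y f (x, y)).
Proof.
move=> mf; pose g := EFin \o f.
have mg : measurable_fun setT g by exact/measurable_EFinP.
have h : measurable_fun setT (fun x => \int[m2]_y g (x, y))%E; last first.
  exact: (measurableT_comp (@fine_measurable R setT measurableT) h).
under eq_fun do rewrite integralE.
apply: emeasurable_funB.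
  rewrite (_ : (fun x => _) = fubini_F m2 (g^\+)%E).
    exact: (measurable_fun_fubini_tonelli_F _ (measurable_funepos mg) (funepos_ge0 g)).
  by apply/funext => x; apply: eq_integral => y _; rewrite !funeposE.
rewrite (_ : (fun x => _) = fubini_F m2 (g^\-)%E).
  exact: (measurable_fun_fubini_tonelli_F _ (measurable_funeneg mg) (funeneg_ge0 g)).
by apply/funext => x; apply: eq_integral => y _; rewrite !funenegE.
Qed.

Section real_fubini.
Context {d1 d2} {T1 : measurableType d1} {T2 : measurableType d2} {R : realType}.
Context (m1 : {sigma_finite_measure set T1 -> \bar R}) (m2 : {sigma_finite_measure set T2 -> \bar R}).
Variable f : T1 * T2 -> R.
Hypothesis mf : measurable_fun setT f.
Hypothesis fy : (\int[m1]_x \int[m2]_y `|f (x, y)|%:E < +oo)%E.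

Let fi : (m1 \x m2)%E.-integrable setT (EFin \o f).
Proof.
apply/(integrable12ltyP m1 m2 (f := EFin \o f)) => //; exact/measurable_EFinP.
Qed.

Let aeF : {ae m1, forall x, setT x -> (\int[m2]_y (f (x, y))%:E)%E = (\int[m2]_y f (x, y))%:E}.
Proof.
apply: filterS (ae_integrable1 fi) => x h _.
by rewrite Rintegral_EFin.
Qed.

(** The real-valued inner integral agrees with the extended one except where the section is not
    integrable, and Fubini confines this to a null set. *)
Lemma intg_RintegralF : intg m1 setT (fun x => \int[m2]_y f (x, y)).
Proof.
have /integrableP[mF Fy] := integrable_fubini_F fi.
apply/integrableP; split; first exact/measurable_EFinP/measurable_Rint2.
apply: le_lt_trans Fy; rewrite le_eqVlt; apply/orP; left; apply/eqP.
apply: ae_eq_integral => //.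
- by apply: measurableT_comp => //; exact/measurable_EFinP/measurable_Rint2.
- exact: measurableT_comp.
- by apply: filterS aeF => x h _; rewrite /fubini_F /= h.
Qed.

Lemma ae_intg_section1 : {ae m1, forall x, intg m2 setT (fun y => f (x, y))}.
Proof. exact: (ae_integrable1 fi). Qed.

End real_fubini.

Lemma tonelli {d1 d2} {T1 : measurableType d1} {T2 : measurableType d2} {R : realType}
    (m1 : {sigma_finite_measure set T1 -> \bar R}) (m2 : {sigma_finite_measure set T2 -> \bar R})
    (f : T1 * T2 -> R) : measurable_fun setT f -> (forall z, 0 <= f z) ->
  (\int[m1]_x \int[m2]_y (f (x, y))%:E = \int[m2]_y \int[m1]_x (f (x, y))%:E)%E.
Proof.
move=> mf f0; apply: (@fubini_tonelli _ _ _ _ _ m1 m2 (EFin \o f)).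
  exact/measurable_EFinP.
by move=> z; rewrite lee_fin.
Qed.

Section real_fubini_swap.
Context {d1 d2} {T1 : measurableType d1} {T2 : measurableType d2} {R : realType}.
Context (m1 : {sigma_finite_measure set T1 -> \bar R}) (m2 : {sigma_finite_measure set T2 -> \bar R}).
Variable f : T1 * T2 -> R.
Hypothesis mf : measurable_fun setT f.
Hypothesis fy : (\int[m1]_x \int[m2]_y `|f (x, y)|%:E < +oo)%E.

Let fs (z : T2 * T1) := f (z.2, z.1).

Let mfs : measurable_fun setT fs.
Proof. by apply: measurableT_comp => //; exact: measurable_swap. Qed.

Let fsy : (\int[m2]_x \int[m1]_y `|fs (x, y)|%:E < +oo)%E.
Proof.
rewrite -(@tonelli _ _ _ _ _ m1 m2 (fun z => `|f z|))//.
exact: measurableT_comp.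
Qed.

Lemma intg_RintegralG : intg m2 setT (fun y => \int[m1]_x f (x, y)).
Proof. exact: intg_RintegralF mfs fsy. Qed.

Lemma ae_intg_section2 : {ae m2, forall y, intg m1 setT (fun x => f (x, y))}.
Proof. exact: ae_intg_section1 mfs fsy. Qed.

Lemma Rfubini :
  \int[m1]_x (\int[m2]_y f (x, y)) = \int[m2]_y (\int[m1]_x f (x, y)).
Proof.
have fi : (m1 \x m2)%E.-integrable setT (EFin \o f).
  by apply/(integrable12ltyP m1 m2 (f := EFin \o f)) => //; exact/measurable_EFinP.
have E := Fubini fi.
apply: EFin_inj; rewrite -!Rintegral_EFin//; first last.
- exact: intg_RintegralF.
- exact: intg_RintegralG.
transitivity (\int[m1]_x \int[m2]_y (f (x, y))%:E)%E.
  apply: ae_eq_integral => //; first exact/measurable_EFinP/measurable_Rint2.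
    exact: (measurable_int m1 (integrable_fubini_F fi)).
  by apply: filterS (ae_intg_section1 mf fy) => x h _; rewrite Rintegral_EFin.
rewrite E.
apply: ae_eq_integral => //.
- have fsi : (m2 \x m1)%E.-integrable setT (EFin \o fs).
    by apply/(integrable12ltyP m2 m1 (f := EFin \o fs)) => //; exact/measurable_EFinP.
  exact: (measurable_int m2 (integrable_fubini_F fsi)).
- exact/measurable_EFinP/(measurable_Rint2 m1 mfs).
- by apply: filterS ae_intg_section2 => x h _; rewrite Rintegral_EFin.
Qed.

End real_fubini_swap.

(** * Integration against a probability density *)

Section density.
Import HBNNSimple.
Context {R : realType} {d : nat} (rho : density R d).

(** The measure is given only by its values on sets: the formula is read off indicators, extended to
    simple functions by linearity and to nonnegative functions by monotone convergence. *)
Lemma ge0_integral_density (f : 'rV[R]_d -> \bar R) :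
  measurable_fun setT f -> (forall x, 0 <= f x)%E ->
  (\int[density_prob rho]_y f y = \int[@vol R d]_y (f y * (rho y)%:E))%E.
Proof.
move=> mf f0.
have mr := measurable_density rho.
pose g := nnsfun_approx measurableT mf.
have gf x : (EFin \o g ^~ x) @ \oo --> f x by exact: cvg_nnsfun_approx.
have ndg x : {homo (g ^~ x) : n m / (n <= m)%N >-> n <= m}.
  by move=> n m nm; exact/lefP/nd_nnsfun_approx.
have -> : (\int[density_prob rho]_y f y = limn (fun n => \int[density_prob rho]_y (g n y)%:E))%E.
  rewrite -monotone_convergence//.
  - by apply: eq_integral => x _; exact/esym/cvg_lim/gf.
  - by move=> n; exact/measurable_EFinP.
  - by move=> n x _; rewrite lee_fin.
  - by move=> x _ n m nm; rewrite lee_fin; exact: ndg.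
have -> : (\int[@vol R d]_y (f y * (rho y)%:E) = limn (fun n => \int[@vol R d]_y ((g n y)%:E * (rho y)%:E)))%E.
  rewrite -monotone_convergence//.
  - apply: eq_integral => x _; apply/esym/cvg_lim => //.
    by apply: cvgeZr => //; exact: gf.
  - move=> n; apply: emeasurable_funM; exact/measurable_EFinP.
  - by move=> n x _; rewrite mule_ge0// lee_fin// density_ge0.
  - by move=> x _ n m nm; rewrite lee_wpmul2r// lee_fin ?density_ge0//; exact: ndg.
congr (limn _); apply/funext => n.
rewrite (eq_integral (fun y => \sum_(r \in range (g n)) (r * \1_(g n @^-1` [set r]) y)%:E)%E); last first.
  by move=> y _; rewrite fimfunE -fsumEFin.
rewrite [RHS](eq_integral (fun y => \sum_(r \in range (g n)) (r * \1_(g n @^-1` [set r]) y * rho y)%:E)%E); last first.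
  move=> y _; rewrite fimfunE -EFinM fsumEFin//; congr EFin.
  rewrite !fsbig_finite//= big_distrl//=.
rewrite ge0_integral_fsum//; last 2 first.
- by move=> r; apply/measurable_EFinP/measurable_funM.
- by move=> r y _; rewrite nnfun_muleindic_ge0.
rewrite ge0_integral_fsum//; last 2 first.
- by move=> r; apply/measurable_EFinP/measurable_funM => //; exact: measurable_funM.
- by move=> r y _; rewrite EFinM mule_ge0 ?nnfun_muleindic_ge0// lee_fin density_ge0.
apply: eq_fsbigr => r _.
have mA : measurable (g n @^-1` [set r]) by [].
rewrite integralZl_indic_nnsfun// integral_indic// setIT.
under [RHS]eq_integral => y _ do rewrite -mulrA EFinM.
have [r0|r0] := leP 0 r; last first.
  rewrite preimage_nnfun0//.
  rewrite measure0 mule0; apply/esym/integral0_eq => y _.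
  by rewrite indic0/= mul0r mule0.
rewrite ge0_integralZl//; first last.
- by move=> y _; rewrite lee_fin mulr_ge0// ?indicE// density_ge0.
- exact/measurable_EFinP/measurable_funM.
congr (_ * _)%E.
rewrite /density_prob /= /density_measure lebE integral_mkcond.
apply: eq_integral => y _; rewrite patchE indicE; case: ifPn => _; first by rewrite mul1r.
by rewrite mul0r.
Qed.

End density.

(** * Test functions and mollification *)

Section Ck_closure.
Context {R : realType}.

Lemma Ck_continuous (V : normedModType R) k (f : V -> R) : Ck k f -> continuous f.
Proof. by case: k => [|k] []. Qed.

Lemma CkSP (V : normedModType R) k (f : V -> R) : Ck k.+1 f <->
  [/\ continuous f, forall x, differentiable f x & forall v, Ck k ('D_v f)].
Proof. by split => [[? []]|[]]. Qed.

Lemma CkW (V : normedModType R) k (f : V -> R) : Ck k.+1 f -> Ck k f.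
Proof.
elim: k f => [|k ih] f /CkSP[cf df Df]; first by [].
by apply/CkSP; split => // v; exact: ih.
Qed.

Lemma Ck_cst (V : normedModType R) k (c : R) : Ck k (fun _ : V => c).
Proof.
elim: k c => [|k ih] c; first by split => //; exact: cst_continuous.
apply/CkSP; split => [|x|v]; [exact: cst_continuous|exact: differentiable_cst|].
have -> : 'D_v (fun=> c) = (fun _ : V => (0 : R)) by apply/funext => x; exact: derive_cst.
exact: ih.
Qed.

Lemma CkD (V : normedModType R) k (f g : V -> R) :
  Ck k f -> Ck k g -> Ck k (fun x => f x + g x).
Proof.
elim: k f g => [|k ih] f g.
  by move=> [cf _] [cg _]; split=> // x; apply: cvgD; [exact: cf|exact: cg].
move=> /CkSP[cf df Df] /CkSP[cg dg Dg]; apply/CkSP.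
split => [x|x|v]; [by apply: cvgD; [exact: cf|exact: cg]|exact: differentiableD|].
have -> : 'D_v (fun x => f x + g x) = (fun x => 'D_v f x + 'D_v g x).
  by apply/funext => x; apply: deriveD; exact: diff_derivable.
exact: ih.
Qed.

Lemma CkM (V : normedModType R) k (f g : V -> R) :
  Ck k f -> Ck k g -> Ck k (fun x => f x * g x).
Proof.
elim: k f g => [|k ih] f g Cf Cg.
  have [[cf _] [cg _]] := (Cf, Cg).
  by split=> // x; apply: cvgM; [exact: cf|exact: cg].
have [cf df Df] := (CkSP _ _).1 Cf; have [cg dg Dg] := (CkSP _ _).1 Cg; apply/CkSP.
split => [x|x|v]; [by apply: cvgM; [exact: cf|exact: cg]|exact: differentiableM|].
have -> : 'D_v (fun x => f x * g x) = (fun x => f x * 'D_v g x + g x * 'D_v f x).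
  by apply/funext => x; apply: deriveM; exact: diff_derivable.
by apply: CkD; apply: ih => //; exact: CkW.
Qed.

Lemma Ck_prod (V : normedModType R) k I (s : seq I) (f : I -> V -> R) :
  (forall i, Ck k (f i)) -> Ck k (fun x => \prod_(i <- s) f i x).
Proof.
move=> Cf; elim: s => [|i s ih].
  by under eq_fun do rewrite big_nil; exact: Ck_cst.
by under eq_fun do rewrite big_cons; exact: CkM.
Qed.

Lemma Ck_comp_affine (V : normedModType R) (l : {linear V -> R}) (c : R) (f : R -> R) :
  continuous l -> (forall k, Ck k f) -> forall k, Ck k (fun x => f (l x + c)).
Proof.
move=> cl Cf k; elim: k f Cf => [|k ih] f Cf.
  split => // x; apply: continuous_comp; last exact: (Ck_continuous (Cf 0%N)).
  by apply: cvgD; [exact: cl|exact: cvg_cst].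
have dl x : differentiable (fun x : V => l x + c) x.
  by apply: differentiableD; [exact: linear_differentiable|exact: differentiable_cst].
have df x : differentiable f x by have /CkSP[_ ] := Cf 1%N.
have dfl x : differentiable (fun x : V => f (l x + c)) x by exact: differentiable_comp.
apply/CkSP; split => // [x|v]; first exact: differentiable_continuous.
have -> : 'D_v (fun x => f (l x + c)) = (fun x => l v * ('D_1 f) (l x + c)).
  apply/funext => x.
  rewrite deriveE// (@diff_comp _ _ _ _ (fun x : V => l x + c) f)//=.
  have -> : 'd (fun x : V => l x + c) x = l :> (V -> R).
    rewrite diffD//; last exact: linear_differentiable.
    by rewrite diff_lin// diff_cst; apply/funext => y /=; rewrite addr0.
  rewrite -[X in 'd f _ X]mulr1 -[X in 'd f _ X]/(l v *: 1) linearZ/=.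
  by rewrite deriveE.
apply: CkM; first exact: Ck_cst.
by apply: (ih ('D_1 f)) => j; have /CkSP[_ _ /(_ 1)] := Cf j.+1.
Qed.

Lemma Ck_of_derive (f : R -> R) (g : R -> R) :
  (forall x : R, is_derive x 1 f (g x)) -> (forall k, Ck k g) -> forall k, Ck k f.
Proof.
move=> fg Cg k.
have df x : differentiable f x by apply/derivable1_diffP; have [] := fg x.
apply: CkW; apply/CkSP; split => // [x|v]; first exact: differentiable_continuous.
have -> : 'D_v f = (fun x => v * g x).
  apply/funext => x; rewrite deriveE//.
  rewrite -[X in 'd f _ X]mulr1 -[X in 'd f _ X]/(v *: 1) linearZ/= -deriveE//.
  by rewrite derive_val.
by apply: CkM => //; exact: Ck_cst.
Qed.

End Ck_closure.

(** * A smooth bump with compact support *)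

Section bump.
Context {R : realType}.

(** The functions [x^-j exp (-1/x)], extended by 0. One function alone would not allow an induction;
    the family does, since derivatives are combinations of members with larger [j]. *)
Let theta (j : nat) (x : R) : R := if 0 < x then x^-1 ^+ j * expR (- x^-1) else 0.

(** From [exp y >= y^(j+1) / (j+1)!] at [y = 1/x]. A bound linear in [x] is what the derivative at 0
    requires. *)
Let theta_bound j x : `|theta j x| <= j.+1`!%:R * `|x|.
Proof.
rewrite /theta; case: ifPn => x0; last by rewrite normr0 mulr_ge0.
have xi0 : 0 < x^-1 by rewrite invr_gt0.
rewrite ger0_norm ?mulr_ge0 ?exprn_ge0 ?expR_ge0 ?(ltW xi0)// (gtr0_norm x0).
have h := expR_ge1Dxn j (ltW xi0).
have F0 : 0 < j.+1`!%:R :> R by rewrite ltr0n fact_gt0.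
have {h} : x^-1 ^+ j.+1 <= j.+1`!%:R * expR x^-1.
  rewrite -ler_pdivrMl// mulrC; apply: le_trans h; by rewrite lerDr.
rewrite exprSr -ler_pdivlMr// => h; apply: le_trans (ler_wpM2r (expR_ge0 _) h) _.
rewrite invrK expRN -mulrA [x * _]mulrC mulrA -(mulrA _ (expR _)) divff ?expR_eq0//.
by rewrite mulr1.
Qed.

Let theta_derive j (x : R) : is_derive x 1 (theta j) (theta j.+2 x - j%:R * theta j.+1 x).
Proof.
have [x0|x0|<-] := ltgtP 0 x.
- pose f y : R := y^-1 ^+ j * expR (- y^-1).
  have fd : is_derive x 1 f (theta j.+2 x - j%:R * theta j.+1 x).
    have xn0 : x != 0 by rewrite gt_eqF.
    have dv : is_derive x 1 (fun y : R => y^-1) (- x^-2).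
      have := @is_deriveV R id x 1 1 xn0 _.
      by move=> /(_ (is_derive_id _ _)); rewrite scaler1.
    have dp : is_derive x 1 (fun y : R => y^-1 ^+ j) (j%:R * x^-1 ^+ j.-1 * - x^-2).
      have h := @is_deriveX _ _ (fun y : R => y^-1) j x 1 _ dv.
      by rewrite exprfctE in h.
    have de : is_derive x 1 (fun y : R => expR (- y^-1)) (expR (- x^-1) * x^-2).
      apply: (@is_derive1_comp _ expR (fun y : R => - y^-1)).
      by apply: is_derive_eq; rewrite opprK.
    apply: (is_derive_eq (is_deriveM dp de)).
    rewrite /theta x0 /GRing.scale/=.
    rewrite -!exprVn; move: (x^-1) (expR _) => y E.
    by case: j {f dp} => [|j]; rewrite /= !exprS !expr0; ring.
  apply: near_eq_is_derive fd.
  near=> y; rewrite /f /theta ifT//; near: y; exact: lt_nbhsr.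
- rewrite /theta ltNge (ltW x0)/= mulr0 subr0.
  have fd : is_derive x 1 (fun=> 0 : R) (0 : R) by exact: is_derive_cst.
  apply: near_eq_is_derive fd.
  near=> y; rewrite ifN// -leNgt; apply: ltW; near: y; exact: lt_nbhsl.
- rewrite {2 3}/theta ltxx mulr0 subr0.
  have h : (fun h : R => h^-1 *: (theta j (h *: 1 + 0) - theta j 0)) @ 0^' --> (0 : R).
    apply/cvgrPdist_lt => e e0.
    near=> h.
    have hn0 : h != 0 by near: h; exact: nbhs_dnbhs_neq.
    rewrite sub0r normrN addr0 /GRing.scale/= mulr1 {2}/theta ltxx subr0.
    (* At 0 the difference quotient of [theta j] is [theta j.+1] itself, which the linear bound
       sends to 0. *)
    have -> : h^-1 * theta j h = theta j.+1 h.
      by rewrite /theta; case: ifP => _; rewrite ?mulr0// exprS mulrA.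
    apply: le_lt_trans (theta_bound _ _) _.
    rewrite -ltr_pdivlMl ?ltr0n ?fact_gt0//.
    near: h; apply: dnbhs0_lt; rewrite mulr_gt0// invr_gt0 ltr0n fact_gt0//.
  split; first by apply/cvg_ex; exists 0.
  exact/cvg_lim.
Unshelve. all: end_near. Qed.

Let theta_Ck k j : Ck k (theta j).
Proof.
elim: k j => [|k ih] j.
  by split => // x; apply: differentiable_continuous; apply/derivable1_diffP; have [] := theta_derive j x.
apply/CkSP; have d x : differentiable (theta j) x by apply/derivable1_diffP; have [] := theta_derive j x.
split => // [x|v]; first exact: differentiable_continuous.
have -> : 'D_v (theta j) = (fun x => v * (theta j.+2 x + (- j%:R) * theta j.+1 x)).
  apply/funext => x; rewrite deriveE//.
  rewrite -[X in 'd _ _ X]mulr1 -[X in 'd _ _ X]/(v *: 1) linearZ/= -deriveE//.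
  by have := theta_derive j x => /@derive_val ->; rewrite mulNr.
apply: CkM; first exact: Ck_cst.
by apply: CkD => //; apply: CkM => //; exact: Ck_cst.
Qed.

(** This is [exp (-1/(1+x) - 1/(1-x))] inside []-1, 1[] and 0 elsewhere. *)
Definition smooth_bump (x : R) : R := theta 0 (x + 1) * theta 0 (- x + 1).

Lemma smooth_bump_Ck k : Ck k smooth_bump.
Proof.
have cN : continuous (-%R : R -> R) by exact: opp_continuous.
apply: CkM; first by apply: (@Ck_comp_affine _ _ idfun 1 (theta 0)) => // x.
exact: (@Ck_comp_affine _ _ (-%R : {linear R -> R}) 1 (theta 0)).
Qed.

Lemma smooth_bumpN x : smooth_bump (- x) = smooth_bump x.
Proof. by rewrite /smooth_bump opprK mulrC. Qed.

Lemma smooth_bump_gt0 x : `|x| < 1 -> 0 < smooth_bump x.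
Proof.
rewrite ltr_norml => /andP[a b]; rewrite /smooth_bump /theta.
by rewrite !ifT ?mulr_gt0 ?expR_gt0//; lra.
Qed.

Lemma smooth_bump_ge0 x : 0 <= smooth_bump x.
Proof.
by rewrite /smooth_bump /theta; do 2!case: ifP => _; rewrite ?mul0r ?mulr0// !expr0 !mul1r mulr_ge0 ?expR_ge0.
Qed.

Lemma smooth_bump_eq0 x : 1 <= `|x| -> smooth_bump x = 0.
Proof.
rewrite ler_normr /smooth_bump /theta => /orP[h|h].
  by rewrite [X in _ * X]ifF ?mulr0//; apply/negbTE; rewrite -leNgt; lra.
by rewrite ifF ?mul0r//; apply/negbTE; rewrite -leNgt; lra.
Qed.

End bump.

Section kernels.
Context {R : realType} {d : nat}.
Implicit Types (kappa : 'rV[R]_d -> R).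

(** The support is pinned to the unit cube for every kernel, derivatives included, so a
    mollification on [cube N] involves only the values on [cube N.+1]. Nonnegativity is left out, to
    keep the class stable under derivatives. *)
Definition kernel_fun kappa :=
  (forall k, Ck k kappa) /\ forall y, ~ cube 1 y -> kappa y = 0.

Lemma closed_cube c : closed (@cube R d c).
Proof. by apply: compact_closed; [exact: norm_hausdorff|exact: cube_compact]. Qed.

Lemma derive_shift (f : 'rV[R]_d -> R) x v y : 'D_v (fun y => f (y - x)) y = 'D_v f (y - x).
Proof.
rewrite /derive; congr (lim (_ @ 0^')); apply/funext => h /=.
by rewrite addrA.
Qed.

Lemma differentiable_shift (f : 'rV[R]_d -> R) x y : differentiable f (y - x) ->
  differentiable (fun y => f (y - x)) y.
Proof.
move=> df; apply: (@differentiable_comp _ _ _ _ (fun y => y - x) f) => //.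
Qed.

Lemma Ck_shift (f : 'rV[R]_d -> R) x k : Ck k f -> Ck k (fun y => f (y - x)).
Proof.
elim: k f => [|k ih] f.
  move=> [cf _]; split => // y; apply: continuous_comp; last exact: cf.
  exact: differentiable_continuous.
move=> /CkSP[cf df Df]; apply/CkSP; split => [y|y|v].
- by apply: differentiable_continuous; exact: differentiable_shift.
- exact: differentiable_shift.
have -> : 'D_v (fun y => f (y - x)) = (fun y => 'D_v f (y - x)).
  by apply/funext => y; exact: derive_shift.
exact: (ih ('D_v f) (Df v)).
Qed.

Lemma kernel_continuous kappa : kernel_fun kappa -> continuous kappa.
Proof. by move=> [/(_ 0%N) []]. Qed.

Lemma kernel_measurable kappa : kernel_fun kappa -> measurable_fun setT kappa.
Proof. by move=> /kernel_continuous/cont_measurable. Qed.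

Lemma kernel_bounded kappa : kernel_fun kappa ->
  exists2 C, 0 < C & forall y, `|kappa y| <= C * \1_(cube 1) y.
Proof.
move=> kk; have ck := kernel_continuous kk.
have /compact_bounded[M [_ hM]] : compact (kappa @` (cube 1)).
  by apply: continuous_compact; [exact: continuous_subspaceT|exact: cube_compact].
exists (`|M| + 1); first by rewrite ltr_wpDl.
move=> y; rewrite indicE; case: (boolP (y \in cube 1)) => [/set_mem yc|/negP yc].
  by rewrite mulr1; apply: hM; [rewrite ltr_pwDr// ler_norm|exists y].
by rewrite kk.2 ?normr0 ?mulr0// => /mem_set.
Qed.

Lemma kernel_derive kappa v : kernel_fun kappa -> kernel_fun ('D_v kappa).
Proof.
move=> kk; split => [k|y yc]; first by have /CkSP[] := kk.1 k.+1.
have nn : \forall z \near y, kappa z = (fun=> 0) z.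
  have := open_nbhs_nbhs (conj (closed_openC (@closed_cube 1)) yc).
  by apply: filterS => z; exact: kk.2.
by rewrite (near_eq_derive v nn) derive_cst.
Qed.

Lemma kernel_test kappa x : kernel_fun kappa -> Cc_infty setT (fun y => kappa (y - x)).
Proof.
move=> kk; split => [k|]; first exact/Ck_shift/kk.1.
exists [set y | cube 1 (y - x)]; split => //; last by move=> y; exact: kk.2.
have -> : [set y | cube 1 (y - x)] = (fun y => y + x) @` cube 1.
  apply/seteqP; split => [y h|_ [y h <-]] /=; last by rewrite addrK.
  by exists (y - x) => //; rewrite subrK.
apply: continuous_compact; last exact: cube_compact.
apply: continuous_subspaceT => y.
exact: differentiable_continuous.
Qed.

Let kern0 (n : nat) (y : 'rV[R]_d) : R := \prod_(i < d) smooth_bump (n.+1%:R * y ord0 i).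

Let kern0_Ck n k : Ck k (kern0 n).
Proof.
apply: Ck_prod => i.
pose l : 'rV[R]_d -> R := fun y => n.+1%:R * y ord0 i.
have ll : linear l by move=> a u v; rewrite /l !mxE mulrDr /GRing.scale/= !mulrA (mulrC a).
pose L : {linear 'rV[R]_d -> R} := HB.pack l (GRing.isLinear.Build _ _ _ _ _ ll).
have cl : continuous L.
  move=> x; apply: (@cvgM _ _ (nbhs x) _ (cst n.+1%:R) (fun y : 'rV[R]_d => y ord0 i)).
    exact: cvg_cst.
  exact: coord_continuous.
have := @Ck_comp_affine _ _ L 0 smooth_bump cl smooth_bump_Ck k.
by under eq_fun do rewrite addr0.
Qed.

Let kern0_ge0 n y : 0 <= kern0 n y.
Proof. by apply: prodr_ge0 => i _; exact: smooth_bump_ge0. Qed.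

Let kern0_eq0 n y : ~ cube n.+1%:R^-1 y -> kern0 n y = 0.
Proof.
move=> /existsNP[i /negP yi]; rewrite /kern0 (bigD1 i)//= smooth_bump_eq0 ?mul0r//.
move: yi; rewrite in_itv/= -ler_norml -ltNge => yi.
by rewrite normrM ger0_norm// -ler_pdivrMl// mulr1 ltW.
Qed.

Let cube1 n : @cube R d n.+1%:R^-1 `<=` cube 1.
Proof. by apply: subset_cube; rewrite invf_le1// ler1n. Qed.

Let kern0_kernel n : kernel_fun (kern0 n).
Proof. by split=> [k|y yc]; [exact: kern0_Ck|apply: kern0_eq0 => /cube1]. Qed.

Lemma kernel_intg kappa : kernel_fun kappa -> intg (@vol R d) setT kappa.
Proof.
move=> kk; have [C C0 hC] := kernel_bounded kk.
apply: (le_intg (g := fun y => C * \1_(cube 1) y)) => //.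
  exact: kernel_measurable.
apply: intgZl => //; apply/integrableP; split.
  by apply/measurable_EFinP; apply: measurable_indic; exact: measurable_cube.
under eq_integral => x _ do rewrite gee0_abs ?lee_fin ?indicE//=.
rewrite (eq_integral (fun x => (\1_(cube 1) x)%:E))//.
rewrite integral_indic ?setIT//; [exact: vol_cube_lty|exact: measurable_cube].
Qed.

Let kc n := \int[@vol R d]_y kern0 n y.

(** A zero integral would make [kern0 n] vanish almost everywhere, although it is positive on an
    open box of positive volume. *)
Let kc_gt0 n : 0 < kc n.
Proof.
rewrite lt_neqAle Rintegral_ge0// andbT; apply/negP => /eqP kc0.
have ki := kernel_intg (kern0_kernel n).
have i0 : (\int[@vol R d]_x `|(kern0 n x)%:E| = 0)%E.
  rewrite (eq_integral (fun x => (kern0 n x)%:E)); last by move=> x _; rewrite gee0_abs// lee_fin.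
  by rewrite Rintegral_EFin// -/(kc n) -kc0.
have mk : measurable_fun setT (EFin \o kern0 n).
  by apply/measurable_EFinP; exact: kernel_measurable (kern0_kernel n).
have [N [mN N0 sub]] := (ae_eq_integral_abs (@vol R d) measurableT mk).1 i0.
pose A : set 'rV[R]_d := [set v | forall i, v ord0 i \in `]- n.+1%:R^-1, n.+1%:R^-1[].
have mI (i : 'I_d) : measurable (`]- n.+1%:R^-1, n.+1%:R^-1[%classic : set R) by [].
have : (@vol R d A > 0)%E.
  rewrite (@vol_box R d (fun=> `]- n.+1%:R^-1, n.+1%:R^-1[%classic))//.
  elim/big_rec : _ => [|i x _ x0]; first by rewrite lte_fin.
  apply: mule_gt0 => //; rewrite lebesgue_measure_itv/= lte_fin.
  have p : 0 < n.+1%:R^-1 :> R by rewrite invr_gt0.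
  by rewrite ifT ?gtrN// -EFinB lte_fin opprK addr_gt0.
rewrite lt_neqAle => /andP[/eqP + _]; apply; apply/esym.
apply: (@subset_measure0 _ _ _ (@vol R d) A N) => //.
- rewrite (_ : A = \bigcap_(i in [set: 'I_d])
    ((fun v : 'rV[R]_d => v ord0 i) @^-1` `]- n.+1%:R^-1, n.+1%:R^-1[%classic)); last first.
    by apply/seteqP; split => [x xp i _|x xp i] /=; [exact: xp|exact: (xp i)].
  apply: fin_bigcap_measurable => // i _; rewrite -[X in measurable X]setTI.
  exact: measurable_coord.
move=> v Av; apply: sub => /= /(_ I)/eqP; rewrite eqe => /eqP.
apply/eqP; rewrite gt_eqF// prodr_gt0// => i _; apply: smooth_bump_gt0.
have := Av i; rewrite in_itv/= -ltr_norml => h.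
by rewrite normrM ger0_norm// -ltr_pdivlMl// mulr1.
Qed.

Definition moll (n : nat) (y : 'rV[R]_d) : R := (kc n)^-1 * kern0 n y.

Lemma moll_kernel n : kernel_fun (moll n).
Proof.
split => [k|y yc]; first by apply: CkM; [exact: Ck_cst|exact: kern0_Ck].
by rewrite /moll (kern0_kernel n).2 ?mulr0.
Qed.

Lemma moll_ge0 n y : 0 <= moll n y.
Proof. by rewrite mulr_ge0// invr_ge0 ltW. Qed.

Lemma mollN n y : moll n (- y) = moll n y.
Proof.
rewrite /moll; congr (_ * _); apply: eq_bigr => i _.
by rewrite mxE mulrN smooth_bumpN.
Qed.

Lemma moll_eq0 n y : ~ cube n.+1%:R^-1 y -> moll n y = 0.
Proof. by move=> yc; rewrite /moll kern0_eq0// mulr0. Qed.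

Lemma moll_int n : \int[@vol R d]_y moll n y = 1.
Proof.
rewrite RintegralZl//; last exact: kernel_intg (kern0_kernel n).
by rewrite mulVf// gt_eqF.
Qed.

End kernels.

Lemma cvg_bigsum {R : realType} (I : Type) (s : seq I) (a : I -> nat -> R) (l : I -> R) :
  (forall i, a i @ \oo --> l i) -> (fun n => \sum_(i <- s) a i n) @ \oo --> \sum_(i <- s) l i.
Proof.
move=> al; elim: s => [|i s ih].
  by under eq_fun do rewrite big_nil; rewrite big_nil; exact: cvg_cst.
by under eq_fun do rewrite big_cons; rewrite big_cons; exact: cvgD.
Qed.

(** * Mollification: localisation, mass, convergence in L^1 *)

Section mollification.
Import HBSimple.
Context {R : realType} {d : nat}.
Local Notation V := 'rV[R]_d.
Local Notation mu := (@vol R d).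
Implicit Types (f g : V -> R) (kappa : V -> R).

Definition loc f := measurable_fun setT f /\ forall N : nat, intg mu (cube N%:R) f.

(** The kernel sits at [y - x], so that in [y] it is literally a test function; the price is a minus
    sign when differentiating in [x]. *)
Definition mol kappa f (x : V) : R := \int[mu]_y (f y * kappa (y - x)).

Lemma intg_patch f (A : set V) : measurable A ->
  intg mu A f <-> intg mu setT (fun x => f x * \1_A x).
Proof.
move=> mA; rewrite integrable_mkcond// restrict_EFin.
by rewrite (_ : f \_ A = (fun x => f x * \1_A x))//; exact: patch_indic.
Qed.

Lemma intg_indic (A : set V) : measurable A -> (mu A < +oo)%E -> intg mu setT \1_A.
Proof.
move=> mA muA; apply/integrableP; split; first exact/measurable_EFinP/measurable_indic.
rewrite (eq_integral (fun x => (\1_A x)%:E)); last first.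
  by move=> x _; rewrite /comp gee0_abs// lee_fin.
by rewrite integral_indic// setIT.
Qed.

Lemma intg_loc f : intg mu setT f -> loc f.
Proof.
move=> fi; split; first exact: intg_measurable fi.
move=> N; apply: integrableS fi => //; exact: measurable_cube.
Qed.

Lemma loc_patch f N : loc f -> intg mu setT (fun x => f x * \1_(cube N%:R) x).
Proof. by move=> [_ /(_ N)] /(intg_patch _ (@measurable_cube R d _)). Qed.

Lemma subset_cube_shift (x : V) (N : nat) y : cube N%:R x -> cube 1 (y - x) -> cube N.+1%:R y.
Proof.
move=> xN yx i; have := xN i; have := yx i; rewrite !mxE !in_itv/= -natr1 => /andP[? ?] /andP[? ?].
by apply/andP; split; lra.
Qed.

Lemma kernel_patch kappa f (N : nat) x y : kernel_fun kappa -> cube N%:R x ->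
  f y * \1_(cube N.+1%:R) y * kappa (y - x) = f y * kappa (y - x).
Proof.
move=> kk xN; have [h|h] := pselect (cube 1 (y - x)); last by rewrite kk.2// !mulr0.
by rewrite indicE mem_set ?mulr1//; exact: subset_cube_shift h.
Qed.

(** Reduces statements on locally integrable functions to integrable ones: near [x] only the values
    on the next cube matter. *)
Lemma mol_patch kappa f (N : nat) x : kernel_fun kappa -> cube N%:R x ->
  mol kappa (fun y => f y * \1_(cube N.+1%:R) y) x = mol kappa f x.
Proof. by move=> kk xN; apply: eq_Rintegral => y _; exact: kernel_patch. Qed.

Lemma in_some_cube (x : V) : exists N : nat, cube N%:R x.
Proof. by have : [set: V] x by []; rewrite cubeT => -[N _]; exists N. Qed.

Lemma measurable_kernel_sub kappa : measurable_fun setT kappa ->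
  measurable_fun setT (fun p : V * V => kappa (p.2 - p.1)).
Proof. by move=> mk; apply: measurableT_comp => //; exact: measurable_sub. Qed.

Lemma measurable_subr (x : V) : measurable_fun setT (fun y : V => y - x).
Proof. exact: measurable_shift. Qed.

Lemma loc_mol_intg kappa f x : kernel_fun kappa -> loc f ->
  intg mu setT (fun y => f y * kappa (y - x)).
Proof.
move=> kk lf; have [N xN] := in_some_cube x.
have [C C0 hC] := kernel_bounded kk.
apply: (le_intg (g := fun y => C * `|f y * \1_(cube N.+1%:R) y|)) => //.
- apply: measurable_funM; first exact: lf.1.
  apply: measurableT_comp; [exact: kernel_measurable|exact: measurable_subr].
- move=> y _; rewrite -(kernel_patch f y kk xN) normrM mulrC ler_wpM2r//.
  apply: le_trans (hC _) _; rewrite ler_piMr// ?ltW// indicE lern1; by case: (_ \in _).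
- apply: intgZl => //; apply: intg_norm => //; exact: loc_patch.
Qed.

Lemma measurable_mol kappa f : kernel_fun kappa -> measurable_fun setT f ->
  measurable_fun setT (mol kappa f).
Proof.
move=> kk mf; apply: (@measurable_Rint2 _ _ V V R mu (fun p : V * V => f p.2 * kappa (p.2 - p.1))).
apply: measurable_funM; first exact: measurableT_comp.
by apply: measurable_kernel_sub; exact: kernel_measurable.
Qed.

(** Tonelli and translation invariance; evenness of [k] turns the integral in [x] of [k (y - x)]
    into a translate of its integral. With [k = moll n] the mass is preserved. *)
Lemma ge0_integral_even (k f : V -> R) :
  measurable_fun setT k -> measurable_fun setT f -> (forall x, 0 <= k x) -> (forall x, 0 <= f x) ->
  (forall x, k (- x) = k x) ->
  (\int[mu]_x \int[mu]_y (f y * k (y - x))%:E = (\int[mu]_y (f y)%:E) * \int[mu]_y (k y)%:E)%E.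
Proof.
move=> mk mf k0 f0 kN.
have mm : measurable_fun setT (fun p : V * V => f p.2 * k (p.2 - p.1)).
  apply: measurable_funM; first exact: measurableT_comp.
  exact: measurable_kernel_sub.
rewrite (@tonelli _ _ _ _ _ mu mu (fun p : V * V => f p.2 * k (p.2 - p.1)))//; last first.
  by move=> z; rewrite mulr_ge0.
rewrite -ge0_integralZr//; first last.
- by apply: integral_ge0 => y _; rewrite lee_fin.
- by move=> y _; rewrite lee_fin.
- exact/measurable_EFinP.
apply: eq_integral => y _.
under eq_integral => x _ do rewrite /= EFinM.
rewrite ge0_integralZl//; first last.
- by rewrite lee_fin.
- by move=> x _; rewrite lee_fin.
- apply/measurable_EFinP; rewrite (_ : (fun x => _) = (fun x => k (x - y))).
    by apply: measurableT_comp => //; exact: measurable_subr.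
  by apply/funext => x; rewrite -kN opprB.
congr (_ * _)%E; rewrite -(integral_shift (- y) (f := EFin \o k)); last exact/measurable_EFinP.
by apply: eq_integral => x _ /=; rewrite -kN opprB.
Qed.

Lemma mol_ge0 n f x : (forall y, 0 <= f y) -> 0 <= mol (moll n) f x.
Proof. by move=> f0; apply: Rintegral_ge0 => y _; rewrite mulr_ge0// moll_ge0. Qed.

Lemma intg_mol kappa f : kernel_fun kappa -> intg mu setT f -> intg mu setT (mol kappa f).
Proof.
move=> kk fi; have mf := intg_measurable measurableT fi.
have [C C0 hC] := kernel_bounded kk.
have mc : measurable (@cube R d 1) by exact: measurable_cube.
apply/integrableP; split; first by apply/measurable_EFinP; exact: measurable_mol.
have fin : ((\int[mu]_y (`|f y|)%:E) * \int[mu]_y (C * \1_(cube 1) y)%:E < +oo)%E.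
  have i1 := intg_norm measurableT fi.
  have i2 : intg mu setT (fun y => C * \1_(cube 1) y).
    by apply: intgZl => //; apply: intg_indic => //; exact: vol_cube_lty.
  by rewrite !Rintegral_EFin// -EFinM ltry.
have m2 : measurable_fun setT (fun y : V => C * \1_(cube 1) y).
  by apply: measurable_funM => //; exact: measurable_indic.
apply: le_lt_trans fin.
(* The kernel is replaced by an even majorant, a constant on the unit cube, to which the product
   formula applies. *)
rewrite -(ge0_integral_even (k := fun y => C * \1_(cube 1) y) (f := fun y => `|f y|))//; last 3 first.
- exact: measurableT_comp.
- by move=> x; rewrite mulr_ge0// ltW.
- move=> x; congr (_ * _); rewrite !indicE; congr (_%:R); congr (nat_of_bool _).
  apply/idP/idP => /set_mem h; apply/mem_set => i; have := h i; rewrite mxE !in_itv/= => /andP[? ?];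
    by apply/andP; split; lra.
apply: le_lower_integral => [x _|x _]; first by rewrite abse_ge0.
have ii := loc_mol_intg x kk (intg_loc fi).
rewrite [X in (`|X| <= _)%E](_ : _ = \int[mu]_y (f y * kappa (y - x))%:E)%E; last first.
  by rewrite Rintegral_EFin.
apply: le_trans (le_abse_integral _ _ _) _ => //; first exact: measurable_int ii.
apply: le_lower_integral => [y _|y _]; first by rewrite abse_ge0.
by rewrite /= lee_fin normrM ler_wpM2l.
Qed.

Lemma moll_measurable n : measurable_fun setT (moll n : V -> R).
Proof. exact: kernel_measurable (moll_kernel n). Qed.

Lemma moll_shift_int n (x : V) : \int[mu]_y moll n (y - x) = 1.
Proof. by rewrite (Rintegral_shift (- x) (moll_measurable n)) moll_int. Qed.

Lemma intg_moll_shift n (x : V) : intg mu setT (fun y => moll n (y - x)).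
Proof. exact: integrable_shift (kernel_intg (moll_kernel n)). Qed.

Lemma ge0_mol_moll_int n f : intg mu setT f -> (forall x, 0 <= f x) ->
  \int[mu]_x mol (moll n) f x = \int[mu]_x f x.
Proof.
move=> fi f0; apply: EFin_inj; rewrite -!Rintegral_EFin//; last exact: intg_mol (moll_kernel n) fi.
have := ge0_integral_even (moll_measurable n) (intg_measurable measurableT fi) (moll_ge0 n) f0 (mollN n).
rewrite (Rintegral_EFin measurableT (kernel_intg (moll_kernel n))) moll_int mule1 => <-.
apply: eq_integral => x _; rewrite /mol -Rintegral_EFin//.
exact: loc_mol_intg (moll_kernel n) (intg_loc fi).
Qed.

Lemma molB kappa f g x : kernel_fun kappa -> loc f -> loc g ->
  mol kappa (fun y => f y - g y) x = mol kappa f x - mol kappa g x.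
Proof.
move=> kk lf lg; rewrite /mol -RintegralB//; try exact: loc_mol_intg.
by apply: eq_Rintegral => y _; rewrite mulrBl.
Qed.

Lemma molD kappa f g x : kernel_fun kappa -> loc f -> loc g ->
  mol kappa (fun y => f y + g y) x = mol kappa f x + mol kappa g x.
Proof.
move=> kk lf lg; rewrite /mol -RintegralD//; try exact: loc_mol_intg.
by apply: eq_Rintegral => y _; rewrite mulrDl.
Qed.

Lemma molZ kappa c f x : kernel_fun kappa -> loc f ->
  mol kappa (fun y => c * f y) x = c * mol kappa f x.
Proof.
move=> kk lf; rewrite /mol -RintegralZl//; try exact: loc_mol_intg.
by apply: eq_Rintegral => y _; rewrite mulrA.
Qed.

Lemma loc_norm f : loc f -> loc (fun x => `|f x|).
Proof.
move=> [mf lf]; split; first exact: measurableT_comp.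
by move=> N; apply: intg_norm => //; exact: measurable_cube.
Qed.

Lemma le_norm_mol n f x : loc f -> `|mol (moll n) f x| <= mol (moll n) (fun y => `|f y|) x.
Proof.
move=> lf; have ii := loc_mol_intg x (moll_kernel n) lf.
apply: le_trans (le_normr_Rintegral measurableT ii) _.
rewrite /mol le_eqVlt; apply/orP; left; apply/eqP; apply: eq_Rintegral => y _.
by rewrite normrM (ger0_norm (moll_ge0 _ _)).
Qed.

Lemma mol_contract n f : intg mu setT f ->
  \int[mu]_x `|mol (moll n) f x| <= \int[mu]_x `|f x|.
Proof.
move=> fi; have ai := intg_norm measurableT fi.
rewrite -(ge0_mol_moll_int n ai)//; apply: le_Rintegral => //.
- by apply: intg_norm => //; exact: intg_mol (moll_kernel n) fi.
- exact: intg_mol (moll_kernel n) ai.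
- by move=> x _; apply: le_norm_mol; exact: intg_loc.
Qed.

(** Convergence in L^1 is proved for a class closed under linear combinations and under L^1
    approximation. Open sets of finite measure come first, then measurable subsets of a cube, then
    simple functions, which are dense. *)
Let good f := intg mu setT f /\
  (fun n => \int[mu]_x `|mol (moll n) f x - f x|) @ \oo --> 0.

(** A three-term splitting in which the middle function is good and the first error is controlled
    because mollification contracts the L^1 norm. *)
Let goodP f : intg mu setT f -> (forall e, 0 < e -> exists2 g, good g & \int[mu]_x `|f x - g x| <= e) -> good f.
Proof.
move=> fi H; split => //; apply/cvgrPdist_le => e e0.
have e3 : 0 < e / 3 by rewrite divr_gt0.
have [g [gi gg] fg] := H _ e3.
move/cvgrPdist_le : gg => /(_ _ e3); apply: filterS => n.
rewrite !sub0r !normrN !ger0_norm ?Rintegral_ge0// => gn.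
have [lf lg] := (intg_loc fi, intg_loc gi).
have ki : kernel_fun (moll n : V -> R) by exact: moll_kernel.
have fgi : intg mu setT (fun x => f x - g x) by exact: intgB.
have mfi := intg_mol ki fi; have mgi := intg_mol ki gi; have mfgi := intg_mol ki fgi.
have i1 : intg mu setT (fun x => `|mol (moll n) (fun y => f y - g y) x|) by exact: intg_norm.
have i2 : intg mu setT (fun x => `|mol (moll n) g x - g x|) by apply: intg_norm => //; exact: intgB.
have i3 : intg mu setT (fun x => `|f x - g x|) by exact: intg_norm.
apply: (@le_trans _ _ (\int[mu]_x (`|mol (moll n) (fun y => f y - g y) x| + `|mol (moll n) g x - g x| + `|f x - g x|))).
  apply: le_Rintegral => //.
  - by apply: intg_norm => //; exact: intgB.
  - by apply: intgD => //; exact: intgD.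
  move=> x _; rewrite (molB x ki lf lg).
  rewrite (_ : mol (moll n) f x - f x = (mol (moll n) f x - mol (moll n) g x) + (mol (moll n) g x - g x) + (g x - f x)); last by lra.
  apply: le_trans (ler_normD _ _) _; rewrite (distrC (g x)) lerD2r; exact: ler_normD.
rewrite RintegralD//; last exact: intgD.
rewrite RintegralD//.
have := mol_contract n fgi; lra.
Qed.

Let goodD f g : good f -> good g -> good (fun x => f x + g x).
Proof.
move=> [fi hf] [gi hg]; split; first exact: intgD.
apply: (@squeeze_cvgr _ _ _ _ (cst 0) (fun n => \int[mu]_x `|mol (moll n) f x - f x| + \int[mu]_x `|mol (moll n) g x - g x|)); last 2 first.
- exact: cvg_cst.
- by rewrite -[X in _ --> X]addr0; exact: cvgD.
apply: nearW => n; rewrite Rintegral_ge0//=.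
have [lf lg] := (intg_loc fi, intg_loc gi).
have ki : kernel_fun (moll n : V -> R) by exact: moll_kernel.
have mfi := intg_mol ki fi; have mgi := intg_mol ki gi.
have i1 : intg mu setT (fun x => `|mol (moll n) f x - f x|) by apply: intg_norm => //; exact: intgB.
have i2 : intg mu setT (fun x => `|mol (moll n) g x - g x|) by apply: intg_norm => //; exact: intgB.
rewrite -RintegralD//; apply: le_Rintegral => //.
- apply: intg_norm => //; apply: intgB => //; last exact: intgD.
  by apply: intg_mol => //; exact: intgD.
- exact: intgD.
move=> x _; rewrite (molD x ki lf lg) opprD addrACA; exact: ler_normD.
Qed.

Let goodZ c f : good f -> good (fun x => c * f x).
Proof.
move=> [fi hf]; split; first exact: intgZl.
have lf := intg_loc fi.
rewrite (_ : (fun n => _) = (fun n => `|c| * \int[mu]_x `|mol (moll n) f x - f x|)).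
  by rewrite -[X in _ --> X](mulr0 `|c|); apply: cvgM => //; exact: cvg_cst.
apply/funext => n; have ki : kernel_fun (moll n : V -> R) by exact: moll_kernel.
rewrite -RintegralZl//; last first.
  by apply: intg_norm => //; apply: intgB => //; exact: intg_mol.
by apply: eq_Rintegral => x _; rewrite (molZ c x ki lf) -mulrBr normrM.
Qed.

Let good_sum I (s : seq I) (f : I -> V -> R) : (forall i, good (f i)) ->
  good (fun x => \sum_(i <- s) f i x).
Proof.
move=> gf; elim: s => [|i s ih].
  have -> : (fun x => \sum_(i <- [::]) f i x) = (fun=> 0) :> (V -> R) by apply/funext => x; rewrite big_nil.
  split; first exact: integrable0.
  rewrite (_ : (fun n => _) = (fun=> 0)); first exact: cvg_cst.
  apply/funext => n; under eq_Rintegral => x _.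
    rewrite /mol (_ : (fun y => _) = cst 0) ?Rintegral_cst// ?mul0r ?subrr ?normr0.
      over.
    by apply/funext => y; rewrite mul0r.
  by rewrite Rintegral_cst// mul0r.
have -> : (fun x => \sum_(j <- i :: s) f j x) = (fun x => f i x + \sum_(j <- s) f j x).
  by apply/funext => x; rewrite big_cons.
exact: goodD.
Qed.

(* [mol 1_O] has the same mass as [1_O] and tends to 1 on [O]: no mass is left outside. *)
Let good_open (O : set V) : open O -> (mu O < +oo)%E -> good \1_O.
Proof.
move=> oO fO; have mO := measurable_rV_open oO.
have iO := intg_indic mO fO; split => //.
have O1 (x : V) : (\1_O x : R) * \1_O x = \1_O x.
  by rewrite indicE; case: (_ \in _); rewrite ?mulr1 ?mulr0.
have O01 (x : V) : 0 <= (\1_O x : R) <= 1 by rewrite indicE; case: (_ \in _); rewrite lexx ler01.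
have a01 n x : 0 <= mol (moll n) \1_O x <= 1.
  rewrite mol_ge0//=; rewrite -(moll_shift_int n x); apply: le_Rintegral => //.
  - exact: loc_mol_intg (moll_kernel n) (intg_loc iO).
  - exact: intg_moll_shift.
  - by move=> y _; rewrite ler_piMl ?moll_ge0//; have /andP[] := O01 y.
have mi n := intg_mol (moll_kernel n) iO.
have m1 n : measurable_fun setT (fun x => \1_O x * mol (moll n) \1_O x).
  by apply: measurable_funM; [exact: measurable_indic|exact: intg_measurable (mi n)].
have b1 n x : `|\1_O x * mol (moll n) \1_O x| <= \1_O x.
  have /andP[? ?] := a01 n x; have /andP[? ?] := O01 x.
  by rewrite ger0_norm ?mulr_ge0// ler_piMr.
have i1 n : intg mu setT (fun x => \1_O x * mol (moll n) \1_O x).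
  by apply: (le_intg _ _ _ iO).
have [_ cv] : intg mu setT \1_O /\
    (fun n => \int[mu]_x (\1_O x * mol (moll n) \1_O x)) @ \oo --> \int[mu]_x \1_O x.
  apply: (dominated_Rintegral _ _ _ _ _ iO) => //.
  apply: aeW => x _; rewrite indicE; case: (boolP (x \in O)) => [/set_mem Ox|_]; last first.
    by under eq_fun do rewrite mul0r; exact: cvg_cst.
  have /nbhs_ballP[e /= e0 eO] : nbhs x O by exact: open_nbhs_nbhs.
  (* At a point of [O] the support of the kernel eventually lies in [O], so the mollified indicator
     is exactly 1 from then on. *)
  apply: cvg_near_cst; near=> n.
  rewrite mul1r -(moll_shift_int n x); apply: eq_Rintegral => y _.
  rewrite indicE; case: (boolP (y \in O)) => [|/negP yO]; first by rewrite mul1r.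
  rewrite mul0r moll_eq0// => yc; apply: yO; apply/mem_set; apply: eO.
  split=> // a i; rewrite ord1 /ball/= distrC.
  have := yc i; rewrite in_itv/= -ler_norml mxE => h.
  rewrite (_ : (- x) ord0 i = - x ord0 i) in h; last by rewrite mxE.
  apply: le_lt_trans h _; near: n; exact: near_infty_natSinv_lt (PosNum e0).
(* For [q] equal to 0 or 1 and [p] in [[0, 1]], [|p - q| = p + q - 2 q p]; since both masses agree,
   only the integral of the product remains. *)
have -> : (fun n => \int[mu]_x `|mol (moll n) \1_O x - \1_O x|) =
    (fun n => 2 * (\int[mu]_x \1_O x - \int[mu]_x (\1_O x * mol (moll n) \1_O x))).
  apply/funext => n.
  transitivity (\int[mu]_x (mol (moll n) \1_O x + \1_O x - 2 * (\1_O x * mol (moll n) \1_O x))).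
    apply: eq_Rintegral => x _; have /andP[? ?] := a01 n x.
    have [->|->] : (\1_O x : R) = 0 \/ (\1_O x : R) = 1.
    - by rewrite indicE; case: (_ \in _); [right|left].
    - by rewrite ger0_norm; lra.
    - by rewrite ler0_norm; lra.
  rewrite RintegralB//; last 2 first.
  - exact: intgD.
  - exact: intgZl.
  rewrite RintegralD// RintegralZl// (ge0_mol_moll_int n iO)//; lra.
rewrite -[X in _ --> X](mulr0 2); apply: cvgM; first exact: cvg_cst.
by rewrite -(subrr (\int[mu]_x \1_O x)); apply: cvgB => //; exact: cvg_cst.
Unshelve. all: end_near. Qed.

(** Open cubes rather than [cube]: intersected with an open set they stay open, as [good_open]
    demands. *)
Let ocube (N : nat) : set V := [set v | forall i, v ord0 i \in `]- N%:R, N%:R[].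

Let open_ocube N : open (ocube N).
Proof.
rewrite openE => v vB.
apply: (@filter_forall V 'I_d (fun i (w : V) => w ord0 i \in `]- N%:R, N%:R[) (nbhs v)) => i.
have h : nbhs (v ord0 i) `]- N%:R, N%:R[%classic.
  by apply: open_nbhs_nbhs; split; [exact: interval_open|exact: vB].
exact: (@coord_continuous R 1 d ord0 i v _ h).
Qed.

Let ocube_lty N : (mu (ocube N) < +oo)%E.
Proof.
apply: (@vol_box_lty R d (fun=> `]- N%:R, N%:R[%classic)) => // i.
by rewrite /= lebesgue_measure_itv/=; case: ifPn => // _; rewrite -EFinB ltry.
Qed.

Let ocubeT : [set: V] = \bigcup_N ocube N.
Proof.
apply/seteqP; split => // v _; have [N vN] := in_some_cube v.
exists N.+1 => // i; have := vN i; rewrite !in_itv/= -natr1 => /andP[? ?].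
by apply/andP; split; lra.
Qed.

Let measurable_ocube N : measurable (ocube N).
Proof. by apply: measurable_rV_open; exact: open_ocube. Qed.

(** Dynkin's theorem, with the open sets as generating pi-system. A disjoint union is the L^1 limit
    of its partial unions, because everything stays in a cube of finite measure. *)
Let good_meas N (A : set V) : measurable A -> good (fun x => \1_(A `&` ocube N) x).
Proof.
have mB := measurable_ocube N.
have ltB (A' : set V) : measurable A' -> (mu (A' `&` ocube N) < +oo)%E.
  move=> mA'; apply: le_lt_trans (ocube_lty N); apply: le_measure; rewrite ?inE//; exact: measurableI.
have gO (O : set V) : open O -> good \1_(O `&` ocube N).
  move=> oO; apply: good_open; last by apply: ltB; exact: measurable_rV_open.
  by apply: openI => //; exact: open_ocube.
move=> mA; move: (mA).
apply: (@dynkin_induction _ _ (@open V) (fun A => good \1_(A `&` ocube N))) => //.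
- by move=> U U' oU oU'; exact: openI.
- by apply: gO; exact: openT.
- move=> S mS gS.
  have -> : \1_(~` S `&` ocube N) = (fun x => \1_(setT `&` ocube N) x + (-1) * \1_(S `&` ocube N) x) :> (V -> R).
    apply/funext => x; rewrite !indicE !in_setI in_setC in_setT /=.
    by case: (x \in S); case: (x \in ocube N); rewrite /= ?mulr0 ?mulr1 ?addr0 ?subrr.
  by apply: goodD; [apply: gO; exact: openT|exact: goodZ].
- move=> F mF tF gF.
  have mU : measurable (\bigcup_k F k) by exact: bigcupT_measurable.
  have iU : intg mu setT \1_(\bigcup_k F k `&` ocube N).
    by apply: intg_indic; [exact: measurableI|exact: ltB].
  apply: goodP => // e e0.
  pose S_ k (x : V) : R := \sum_(0 <= i < k) \1_(F i `&` ocube N) x.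
  have gS k : good (S_ k) by exact: good_sum.
  (* By disjointness a partial sum of indicators is the indicator of a finite union, hence is
     dominated by the indicator of the full union. *)
  have S_E k x : S_ k x = \1_(\bigcup_(i < k) F i `&` ocube N) x.
    rewrite /S_ !indicE in_setI; case: (boolP (x \in ocube N)) => xN; last first.
      rewrite andbF big1// => i _; by rewrite indicE in_setI (negbTE xN) andbF.
    rewrite andbT.
    have [[j /= jk Fjx]|nF] := pselect ((\bigcup_(i < k) F i) x); last first.
      rewrite memNset// big_nat_cond big1// => i; rewrite andbT => /andP[_ ik].
      rewrite indicE in_setI memNset// => Fi; apply: nF; exists i => //.
    rewrite mem_set; last by exists j.
    rewrite (bigD1_seq j)//= ?iota_uniq// ?mem_index_iota// indicE in_setI xN mem_set//= big1 ?addr0// => i ij.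
    rewrite indicE in_setI memNset// => Fi.
    by move/trivIsetP : tF => /(_ i j Logic.I Logic.I ij)/seteqP[+ _] => /(_ x); exact.
  have [_ cv] : intg mu setT (cst 0) /\ (fun k => \int[mu]_x `|\1_(\bigcup_k F k `&` ocube N) x - S_ k x|) @ \oo --> \int[mu]_x (cst 0 x).
    apply: (dominated_Rintegral measurableT (g := \1_(\bigcup_k F k `&` ocube N)) _ _ _ _ iU) => //.
    + move=> k; apply: measurableT_comp => //; apply: measurable_funB.
        exact: intg_measurable iU.
      exact: intg_measurable (gS k).1.
    + apply: aeW => x _; apply: cvg_near_cst.
      have [[j _ Fjx]|nF] := pselect ((\bigcup_k F k) x); last first.
        apply: nearW => k.
        have h1 : x \in \bigcup_(i < k) F i = false.
          by apply: memNset => -[i _ Fi]; apply: nF; exists i.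
        by rewrite S_E !indicE !in_setI (memNset nF) h1 subrr normr0.
      near=> k.
      have h1 : x \in \bigcup_k F k by apply/mem_set; exists j.
      have h2 : x \in \bigcup_(i < k) F i.
        by apply/mem_set; exists j => //=; near: k; exact: nbhs_infty_gt.
      by rewrite S_E !indicE !in_setI h1 h2 subrr normr0.
    + move=> k x _; rewrite S_E !indicE !in_setI normr_id.
      case: (x \in ocube N); rewrite ?andbF ?subrr ?normr0// !andbT.
      have [h|h] := boolP (x \in \bigcup_(i < k) F i).
        have -> : x \in \bigcup_k F k by apply/mem_set; move/set_mem : h => [i _ Fi]; exists i.
        by rewrite subrr normr0.
      by case: (x \in _); rewrite subr0 ?normr1 ?normr0.
  rewrite Rintegral_cst// mul0r in cv.
  move/cvgrPdist_le : cv => /(_ _ e0)[k _ /(_ k (leqnn k))] h.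
  exists (S_ k) => //; apply: le_trans h; rewrite sub0r normrN; exact: ler_norm.
Unshelve. all: end_near. Qed.

(** Truncation to a large open cube, then approximation there by a simple function, each costing
    half of [e]. *)
Lemma mol_cvg_L1 f : intg mu setT f ->
  (fun n => \int[mu]_x `|mol (moll n) f x - f x|) @ \oo --> 0.
Proof.
move=> fi; suff : good f by case.
have mf := intg_measurable measurableT fi.
apply: goodP => // e e0.
have e2 : 0 < e / 2 by rewrite divr_gt0.
have fNi N : intg mu setT (fun x => f x * \1_(ocube N) x).
  by apply: (intg_patch f (measurable_ocube N)).1; exact: integrableS fi.
have [N fN] : exists N, \int[mu]_x `|f x - f x * \1_(ocube N) x| <= e / 2.
  have [_ cv] : intg mu setT (cst 0) /\ (fun N => \int[mu]_x `|f x - f x * \1_(ocube N) x|) @ \oo --> \int[mu]_x (cst 0 x).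
    apply: (dominated_Rintegral measurableT (g := fun x => `|f x|)) => //; last exact: intg_norm.
    - move=> N; apply: measurableT_comp => //; apply: measurable_funB => //.
      by apply: measurable_funM => //; exact: measurable_indic.
    - apply: aeW => x _; apply: cvg_near_cst.
      have : [set: V] x by []; rewrite ocubeT => -[M _ xM].
      near=> N; rewrite indicE mem_set ?mulr1 ?subrr ?normr0// => i.
      have := xM i; rewrite !in_itv/= => /andP[h1 h2].
      have : M%:R <= N%:R :> R by rewrite ler_nat; near: N; exact: nbhs_infty_ge.
      by move=> ?; apply/andP; split; lra.
    - move=> N x _; rewrite normr_id indicE; case: (_ \in _); rewrite ?mulr1 ?subrr ?normr0// mulr0 subr0//.
  rewrite Rintegral_cst// mul0r in cv.
  move/cvgrPdist_le : cv => /(_ _ e2)[k _ /(_ k (leqnn k))] h.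
  by exists k; apply: le_trans h; rewrite sub0r normrN; exact: ler_norm.
have mB := measurable_ocube N.
have fB : mu.-integrable (ocube N) (EFin \o f) by exact: integrableS fi.
have [g_ [gi gx gcv]] := approximation_sfun_integrable mB fB.
have [k hk] : exists k, (\int[mu]_(z in ocube N) `|(f z)%:E - (g_ k z)%:E| <= (e / 2)%:E)%E.
  have /fine_cvgP[_ /cvgrPdist_le /(_ _ e2)[k _ /(_ k (leqnn k))]] := gcv.
  rewrite sub0r normrN => h; exists k.
  have ii : intg mu (ocube N) (fun z => `|f z - g_ k z|) by apply: intg_norm => //; exact: intgB.
  rewrite (eq_integral (fun z => `|f z - g_ k z|%:E))//.
  rewrite Rintegral_EFin// lee_fin; apply: le_trans h; exact: ler_norm.
pose g (x : V) : R := \sum_(r <- finmap.enum_fset (fset_set (range (g_ k)))) (r * \1_(g_ k @^-1` [set r] `&` ocube N) x).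
have gE x : g x = g_ k x * \1_(ocube N) x.
  rewrite [in RHS]fimfunE fsbig_finite//= /g big_distrl/=; apply: eq_bigr => r _.
  rewrite -mulrA; congr (_ * _); rewrite !indicE in_setI.
  by case: (_ \in _); rewrite ?mul1r ?mul0r.
exists g; first by apply: good_sum => r; apply: goodZ; exact: good_meas.
have ggi : intg mu setT g.
  rewrite (_ : g = fun x => g_ k x * \1_(ocube N) x); last exact/funext.
  exact: (intg_patch (g_ k) mB).1.
apply: (@le_trans _ _ (\int[mu]_x (`|f x - f x * \1_(ocube N) x| + `|f x - g_ k x| * \1_(ocube N) x))).
  apply: le_Rintegral => //.
  - by apply: intg_norm => //; exact: intgB.
  - apply: intgD => //; first by apply: intg_norm => //; exact: intgB.
    apply: (intg_patch (fun x => `|f x - g_ k x|) mB).1; apply: intg_norm => //; exact: intgB.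
  move=> x _; rewrite gE indicE; case: (_ \in _); rewrite ?mulr1 ?mulr0 ?subr0 ?addr0 ?subrr ?normr0 ?add0r//.
have i1 : intg mu setT (fun x => `|f x - g_ k x| * \1_(ocube N) x).
  apply: (intg_patch (fun x => `|f x - g_ k x|) mB).1; apply: intg_norm => //; exact: intgB.
rewrite RintegralD//; last by apply: intg_norm => //; exact: intgB.
rewrite (splitr e) lerD// -lee_fin -Rintegral_EFin//.
apply: le_trans hk; rewrite [leRHS]integral_mkcond le_eqVlt; apply/orP; left; apply/eqP.
apply: eq_integral => x _; rewrite patchE indicE; case: ifPn => xN; rewrite ?mulr1 ?mulr0//.
Unshelve. all: end_near. Qed.

Lemma mol_cvg_loc f (N : nat) : loc f ->
  (fun n => \int[mu]_(x in cube N%:R) `|mol (moll n) f x - f x|) @ \oo --> 0.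
Proof.
move=> lf; have mC : measurable (@cube R d N%:R) by exact: measurable_cube.
pose g x := f x * \1_(cube N.+1%:R) x.
have gi : intg mu setT g by exact: loc_patch.
have h := mol_cvg_L1 gi.
apply: (@squeeze_cvgr _ _ _ _ (cst 0) _ _ _ _ _ h); last exact: cvg_cst.
apply: nearW => n; rewrite Rintegral_ge0//=.
have ki : kernel_fun (moll n : V -> R) by exact: moll_kernel.
have ii : intg mu setT (fun x => `|mol (moll n) g x - g x|).
  by apply: intg_norm => //; apply: intgB => //; exact: intg_mol.
rewrite (@eq_Rintegral _ _ _ _ _ (fun x => `|mol (moll n) g x - g x|)); last first.
  move=> x /set_mem xN; rewrite (mol_patch f ki xN) /g indicE mem_set ?mulr1//.
  by apply: subset_cube xN; rewrite ler_nat.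
rewrite -lee_fin -!Rintegral_EFin//; last exact: integrableS ii.
apply: ge0_subset_integral => //; exact: measurable_int ii.
Qed.

Lemma loc_mol kappa f : kernel_fun kappa -> loc f -> loc (mol kappa f).
Proof.
move=> kk lf; split; first exact: measurable_mol lf.1.
move=> M; have mC : measurable (@cube R d M%:R) by exact: measurable_cube.
pose g x := f x * \1_(cube M.+1%:R) x.
have gi : intg mu setT g by exact: loc_patch.
apply: (@eq_integrable _ _ _ _ _ mC (EFin \o mol kappa g)).
  by move=> x /set_mem xM; rewrite /= (mol_patch f kk xM).
exact: integrableS (intg_mol kk gi).
Qed.

(** A single subsequence serves finitely many functions: the extraction is applied to the sum of
    their errors. *)
Lemma mol_ae_cvg (I : finType) (f : I -> V -> R) (S : set nat) : (forall i, loc (f i)) ->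
  (forall N, exists2 n, (N <= n)%N & S n) ->
  exists phi : nat -> nat, (forall N, (N <= phi N)%N /\ S (phi N)) /\
    {ae mu, forall x i, (fun N => mol (moll (phi N)) (f i) x) @ \oo --> f i x}.
Proof.
move=> lf SS.
have mC M : measurable (@cube R d M) by exact: measurable_cube.
have ki n : kernel_fun (moll n : V -> R) by exact: moll_kernel.
have ii M n i : intg mu (cube M%:R) (fun x => `|mol (moll n) (f i) x - f i x|).
  apply: intg_norm => //; apply: intgB => //; last exact: (lf i).2.
  exact: (loc_mol (ki n) (lf i)).2.
have [||||||phi [phiS ae]] := @ae_cvg_subseq _ _ R mu (fun N => cube N%:R)
    (fun n x => \sum_i `|mol (moll n) (f i) x - f i x|) S _ _ _ _ _ _ SS.
- by [].
- by move=> M N MN; apply: subset_cube; rewrite ler_nat.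
- by rewrite -cubeT.
- by move=> n x; apply: sumr_ge0.
- by move=> M n; exact: intg_sum.
- move=> M; under eq_fun do rewrite Rintegral_sum//.
  have h : (fun n => \sum_i \int[mu]_(x in cube M%:R) `|mol (moll n) (f i) x - f i x|) @ \oo
      --> \sum_(i : I) (0 : R).
    by apply: cvg_bigsum => i; exact: mol_cvg_loc.
  by rewrite big1 in h.
exists phi; split => //; apply: filterS ae => x h i.
apply/cvgrPdist_lt => e e0; move/cvgrPdist_lt : h => /(_ _ e0); apply: filterS => n.
rewrite sub0r normrN ger0_norm ?sumr_ge0// distrC; apply: le_lt_trans.
by rewrite (bigD1 i)//= lerDl sumr_ge0.
Qed.

End mollification.

(** * Integration by parts and weak gradients *)

Section lines.
Context {R : realType}.

Lemma derive_line (V : normedModType R) (f : V -> R) (p w : V) (s : R) :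
  differentiable f (p + s *: w) ->
  is_derive s 1 (fun s : R => f (p + s *: w)) ('D_w f (p + s *: w)).
Proof.
move=> df; have dw : derivable f (p + s *: w) w by exact: diff_derivable.
have E : (fun h : R => h^-1 *: ((fun s : R => f (p + s *: w)) (h *: 1 + s) - f (p + s *: w)))
    = (fun h => h^-1 *: (f (h *: w + (p + s *: w)) - f (p + s *: w))).
  apply/funext => h; congr (_ *: (f _ - _)).
  by rewrite scalerDl /GRing.scale/= mulr1 addrCA.
by split; rewrite /derivable /derive /= E.
Qed.

Context {d : nat}.
Local Notation V := 'rV[R]_d.
Local Notation mu := (@vol R d).

Lemma deriveN_dir (f : V -> R) (v x : V) : differentiable f x -> 'D_(- v) f x = - 'D_v f x.
Proof. by move=> df; rewrite !deriveE// linearN. Qed.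

(** Differentiation under the integral sign. For parameters within distance 1 of [s] the base points
    stay in one cube, so a constant times [|f|] on the next cube is a common majorant. *)
Lemma mol_line (kappa f : V -> R) (x v : V) (s : R) : kernel_fun kappa -> loc f ->
  is_derive s 1 (fun s : R => mol kappa f (x + s *: v)) (- mol ('D_v kappa) f (x + s *: v)).
Proof.
move=> kk lf.
have kv : kernel_fun ('D_v kappa) by exact: kernel_derive.
have dk y : differentiable kappa y by have /CkSP[] := kk.1 1%N.
pose F (t : R) y := f y * kappa (y - (x + t *: v)).
have dF (t : R) (y : V) : is_derive t 1 (F ^~ y) (- (f y * 'D_v kappa (y - (x + t *: v)))).
  have -> : (F ^~ y) = (fun t => f y * kappa ((y - x) + t *: (- v))).
    by apply/funext => u; rewrite /F scalerN opprD addrA.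
  have h := @derive_line V kappa (y - x) (- v) t (dk _).
  apply: (is_derive_eq (is_deriveZ (f y) h)).
  rewrite deriveN_dir//; have -> : y - x + t *: (- v) = y - (x + t *: v) by rewrite scalerN opprD addrA.
  by rewrite scalerN.
have [N0 xN] := in_some_cube x.
pose I : set R := `]s - 1, s + 1[%classic.
have [N hN] : exists N : nat, forall t, I t -> cube N%:R (x + t *: v).
  have cpt : compact ((fun t : R => x + t *: v) @` `[s - 1, s + 1]).
    apply: continuous_compact; last exact: segment_compact.
    apply: continuous_subspaceT => t.
    apply: cvgD; first exact: cvg_cst.
    by apply: cvgZl; exact: cvg_id.
  have [N hN] := compact_cube cpt; exists N => t It; apply: hN; exists t => //.
  by move: It; rewrite /I /= !in_itv/= => /andP[/ltW -> /ltW ->].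
have [C C0 hC] := kernel_bounded kv.
pose G y := C * `|f y * \1_(cube N.+1%:R) y|.
have Gi : intg mu setT G by apply: intgZl => //; apply: intg_norm => //; exact: loc_patch.
have Is : I s by rewrite /I /= in_itv/=; apply/andP; split; lra.
have GP t y : I t -> setT y -> `|partial1of2 F t y| <= G y.
  move=> It _; rewrite partial1of2E derive_val normrN.
  rewrite -(kernel_patch f y kv (hN _ It)) normrM mulrC ler_wpM2r//.
  apply: le_trans (hC _) _; rewrite ler_piMr// ?ltW// indicE lern1; by case: (_ \in _).
have intF t : I t -> intg mu setT (F t) by move=> _; exact: loc_mol_intg.
have dd t y : I t -> setT y -> derivable (F ^~ y) t 1 by move=> _ _; have [] := dF t y.
have G0 y : 0 <= G y by rewrite mulr_ge0// ltW.
have D1 := @derivable_under_integral R _ _ mu F setT measurableT s (s - 1) (s + 1) Is intF dd G G0 Gi GP.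
have D2 := @differentiation_under_integral R _ _ mu F setT measurableT s (s - 1) (s + 1) Is intF dd G G0 Gi GP.
split => //.
rewrite -derive1E D2 /mol.
have ii := loc_mol_intg (x + s *: v) kv lf.
rewrite -[RHS]mulN1r -RintegralZl//.
by apply: eq_Rintegral => y _; rewrite partial1of2E derive_val mulN1r.
Qed.

Lemma mol_line_cont (kappa f : V -> R) (x v : V) : kernel_fun kappa -> loc f ->
  continuous (fun s : R => mol kappa f (x + s *: v)).
Proof.
move=> kk lf s; apply: differentiable_continuous; apply/derivable1_diffP.
by have [] := mol_line x v s kk lf.
Qed.

(* The increments of [f] along [v] have mean zero by translation invariance. *)
Lemma integral_derive_eq0 (f Df : V -> R) (v : V) :
  intg mu setT f -> intg mu setT Df ->
  (forall x (s : R), is_derive s 1 (fun s : R => f (x + s *: v)) (Df (x + s *: v))) ->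
  (forall x, continuous (fun s : R => Df (x + s *: v))) ->
  \int[mu]_x Df x = 0.
Proof.
move=> fi Dfi fD cD.
have mf := intg_measurable measurableT fi; have mDf := intg_measurable measurableT Dfi.
pose lam : {sigma_finite_measure set (measurableTypeR R) -> \bar R} := @lebesgue_measure R.
(* Integrated in [s] over [[0, 1]], [h] gives the increment [f (x + v) - f x]; integrated in [x]
   first, it gives the mean of [Df] for each such [s]. Fubini equates the two. *)
pose h (p : V * measurableTypeR R) : R := Df (p.1 + p.2 *: v) * \1_(`[0, 1]%classic : set R) p.2.
have mh : measurable_fun setT h.
  have m1 : measurable_fun setT (\1_(`[0, 1]%classic : set R) : measurableTypeR R -> R).
    exact: measurable_indic.
  apply: measurable_funM; last exact: (measurableT_comp m1 measurable_snd).
  apply: (measurableT_comp mDf); apply: measurable_fun_rV => i.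
  under eq_fun do rewrite !mxE.
  apply: measurable_funD; first exact: (measurableT_comp (measurable_coord i) measurable_fst).
  by apply: measurable_funM => //; exact: measurable_snd.
have lam01 : (\int[lam]_s (\1_(`[0%R, 1%R]%classic : set R) s)%:E = 1)%E.
  rewrite integral_indic// setIT.
  transitivity (@lebesgue_measure R `[0%R, 1%R]%classic) => //.
  by rewrite lebesgue_measure_itv/= lte_fin ltr01 oppr0 adde0.
have sh (s : R) : \int[mu]_x Df (x + s *: v) = \int[mu]_x Df x by exact: Rintegral_shift.
have hy : (\int[mu]_x \int[lam]_s `|h (x, s)|%:E < +oo)%E.
  rewrite (@tonelli _ _ _ _ _ mu lam (fun z => `|h z|))//; last exact: measurableT_comp.
  rewrite (eq_integral (fun s : measurableTypeR R => (\1_(`[0, 1]%classic : set R) s)%:E * (\int[mu]_x `|Df x|%:E))%E); last first.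
    move=> s _.
    have i0 : 0 <= (\1_(`[0, 1]%classic : set R) s : R) by rewrite indicE.
    rewrite -(integral_shift (s *: v) (f := fun x => `|Df x|%:E)); last first.
      by apply/measurable_EFinP; exact: measurableT_comp.
    rewrite -ge0_integralZl//; last first.
      by apply/measurable_EFinP; do 2!apply: measurableT_comp => //; exact: measurable_shift.
    apply: eq_integral => x _.
    by rewrite /h/= normrM mulrC (ger0_norm i0) EFinM.
  rewrite Rintegral_EFin//; last exact: intg_norm.
  rewrite integralZr//; last exact: integrable_indic_itv.
  by rewrite lam01 mul1e ltry.
have E := Rfubini mh hy.
have ftc x : \int[lam]_s h (x, s) = f (x + v) - f x.
  transitivity (\int[lam]_(s in `[0, 1]) Df (x + s *: v)).
    rewrite [RHS]Rintegral_mkcond; apply: eq_Rintegral => s _.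
    by rewrite patchE /h/= indicE; case: ifPn => _; rewrite ?mulr1 ?mulr0.
  rewrite /Rintegral (@continuous_FTC2 _ (fun s => Df (x + s *: v)) (fun s => f (x + s *: v)) 0 1)//.
  - by rewrite -EFinB/= scale1r scale0r addr0.
  - exact: continuous_subspaceT.
  - have cf : continuous (fun s : R => f (x + s *: v)).
      by move=> s; apply: differentiable_continuous; apply/derivable1_diffP; have [] := fD x s.
    split=> [s _||]; first by have [] := fD x s.
    + by apply: cvg_at_right_filter; exact: cf.
    + by apply: cvg_at_left_filter; exact: cf.
  - by move=> s _; rewrite derive1E derive_val.
have L : \int[mu]_x (\int[lam]_s h (x, s)) = 0.
  under eq_Rintegral => x _ do rewrite ftc.
  rewrite RintegralB//; last exact: integrable_shift.
  by rewrite (Rintegral_shift v mf) subrr.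
rewrite E in L.
rewrite -[RHS]L.
transitivity (\int[lam]_s (\1_(`[0, 1]%classic : set R) s * \int[mu]_x Df x)).
  rewrite RintegralZr//; last exact: integrable_indic_itv.
  by rewrite [X in _ = X * _]/Rintegral lam01 mul1r.
apply: eq_Rintegral => s _.
rewrite /h/= -(sh s) -RintegralZl//; last exact: integrable_shift.
by apply: eq_Rintegral => x _; rewrite mulrC.
Qed.

(** Translated mollifiers are test functions, so every mollification of [h] vanishes, while a
    subsequence of them converges to [h] almost everywhere. *)
Lemma fundamental_lemma (h : V -> R) : loc h ->
  (forall phi, Cc_infty setT phi -> \int[mu]_y (h y * phi y) = 0) ->
  {ae mu, forall x, h x = 0}.
Proof.
move=> lh H.
have [|phi [_]] := @mol_ae_cvg R d unit (fun=> h) setT (fun=> lh); first by move=> N; exists N.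
apply: filterS => x /(_ tt) hx.
have /cvg_unique : (fun N => mol (moll (phi N)) h x) @ \oo --> h x by [].
move/(_ (@norm_hausdorff _ _)); apply.
rewrite (_ : (fun N => _) = (fun=> 0)); first exact: cvg_cst.
by apply/funext => N; rewrite /mol H//; apply: kernel_test; exact: moll_kernel.
Qed.

End lines.

Lemma lipschitz_derive {R : realType} (f f' : R -> R) (C : R) :
  (forall x : R, is_derive x 1 f (f' x)) -> (forall x, `|f' x| <= C) ->
  forall a b, `|f a - f b| <= C * `|a - b|.
Proof.
move=> df hC; have h a b : a <= b -> `|f a - f b| <= C * `|a - b|.
  move=> ab; have cf : {within `[a, b], continuous f}.
    apply: continuous_subspaceT => x; apply: differentiable_continuous; apply/derivable1_diffP.
    by have [] := df x.
  have [c _ E] := MVT_segment ab (fun x _ => df x) cf.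
  by rewrite distrC E normrM (distrC a) ler_wpM2r.
move=> a b; have [ab|/ltW ab] := leP a b; first exact: h.
by rewrite distrC (distrC a); exact: h.
Qed.

(** * Weak gradients and their chain rule *)

Section sobolev.
Context {R : realType} {d : nat}.
Local Notation V := 'rV[R]_d.
Local Notation mu := (@vol R d).
Local Notation e_ i := (delta_mx ord0 i : V).

Lemma L1loc_loc (u : V -> R) : L1loc u -> loc u.
Proof.
move=> [mu_ lu]; split => // N; have := lu _ (@cube_compact R d N%:R).
by rewrite lebE.
Qed.

Lemma loc_L1loc (u : V -> R) : loc u -> L1loc u.
Proof.
move=> [mu_ lu]; split => // K cK; have [N KN] := compact_cube cK.
rewrite lebE; apply: integrableS (lu N) => //; first exact: measurable_cube.
have : closed K by apply: compact_closed => //; exact: norm_hausdorff.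
move=> /closed_openC/measurable_rV_open/measurableC; by rewrite setCK.
Qed.

(** [is_wgrad] by components: a chain rule multiplies each component by a scalar function, and
    identities almost everywhere are handled one index at a time. *)
Definition wg (w : V -> R) (G : 'I_d -> V -> R) :=
  (forall i, loc (G i)) /\ forall phi, Cc_infty setT phi -> forall i,
    \int[mu]_y (w y * 'D_(e_ i) phi y) = - \int[mu]_y (G i y * phi y).

Lemma is_wgrad_wg w G : is_wgrad w G -> wg w (fun i y => G y ord0 i).
Proof.
move=> [lG h]; split => [i|phi cphi i]; first exact: L1loc_loc.
by have := h phi cphi i; rewrite lebE; under eq_Rintegral do rewrite mxE.
Qed.

Lemma wg_is_wgrad w (G : 'I_d -> V -> R) : wg w G -> is_wgrad w (fun y => \row_i G i y).
Proof.
move=> [lG h]; split => [i|phi cphi i].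
  by apply: loc_L1loc; rewrite (_ : (fun y => _) = G i)//; apply/funext => y; rewrite mxE.
rewrite lebE; under eq_Rintegral do rewrite mxE.
by rewrite h//; congr (- _); apply: eq_Rintegral => y _; rewrite mxE.
Qed.

Lemma mol_wg kappa w G i x : kernel_fun kappa -> wg w G ->
  mol ('D_(e_ i) kappa) w x = - mol kappa (G i) x.
Proof.
move=> kk [lG h]; have := h _ (kernel_test x kk) i; rewrite /mol => <-.
by apply: eq_Rintegral => y _; congr (_ * _); exact: esym (derive_shift kappa x (e_ i) y).
Qed.

Lemma mol_wg_line kappa w G i x (s : R) : kernel_fun kappa -> loc w -> wg w G ->
  is_derive s 1 (fun s : R => mol kappa w (x + s *: e_ i)) (mol kappa (G i) (x + s *: e_ i)).
Proof.
move=> kk lw wG; apply: (is_derive_eq (mol_line x (e_ i) s kk lw)).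
by rewrite (mol_wg i _ kk wG) opprK.
Qed.

Lemma test_continuous (phi : V -> R) : Cc_infty setT phi -> continuous phi.
Proof. by move=> [/(_ 0%N) []]. Qed.

Lemma test_bound (phi : V -> R) : Cc_infty setT phi ->
  exists (N : nat) (C : R), 0 < C /\ forall y, `|phi y| <= C * \1_(cube N%:R) y.
Proof.
move=> tphi; have cphi := test_continuous tphi.
have [_ [K [cK _ K0]]] := tphi.
have [N KN] := compact_cube cK; exists N.
have /compact_bounded[M [_ hM]] : compact (phi @` (cube N%:R)).
  by apply: continuous_compact; [exact: continuous_subspaceT|exact: cube_compact].
exists (`|M| + 1); split; first by rewrite ltr_wpDl.
move=> y; rewrite indicE; case: (boolP (y \in cube N%:R)) => [/set_mem yc|/negP yc].
  by rewrite mulr1; apply: hM; [rewrite ltr_pwDr// ler_norm|exists y].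
by rewrite K0 ?normr0 ?mulr0// => /KN/mem_set.
Qed.

Lemma test_derive (phi : V -> R) v : Cc_infty setT phi -> Cc_infty setT ('D_v phi).
Proof.
move=> [Cphi [K [cK _ K0]]]; split => [k|]; first by have /CkSP[] := Cphi k.+1.
exists K; split => // y yK.
have nn : \forall z \near y, phi z = (fun=> 0) z.
  have cl : closed K by apply: compact_closed => //; exact: norm_hausdorff.
  have := open_nbhs_nbhs (conj (closed_openC cl) yK).
  by apply: filterS => z; exact: K0.
by rewrite (near_eq_derive v nn) derive_cst.
Qed.

Lemma test_line (phi : V -> R) x v (s : R) : Cc_infty setT phi ->
  is_derive s 1 (fun s : R => phi (x + s *: v)) ('D_v phi (x + s *: v)).
Proof. by move=> [/(_ 1%N) /CkSP[_ df _] _]; exact: derive_line. Qed.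

Lemma continuous_line (f : V -> R) (x v : V) : continuous f -> continuous (fun s : R => f (x + s *: v)).
Proof.
move=> cf s; apply: continuous_comp; last exact: cf.
apply: cvgD; first exact: cvg_cst.
by apply: cvgZl; exact: cvg_id.
Qed.

Lemma loc_test_intg (h phi : V -> R) N C : loc h -> measurable_fun setT phi ->
  (forall y, `|phi y| <= C * \1_(cube N%:R) y) -> intg mu setT (fun y => h y * phi y).
Proof.
move=> lh mphi hphi; apply: (le_intg (g := fun y => C * `|h y * \1_(cube N%:R) y|)) => //.
- by apply: measurable_funM => //; exact: lh.1.
- move=> y _; rewrite !normrM mulrCA ler_wpM2l//.
  by rewrite (ger0_norm (_ : 0 <= \1_(cube N%:R) y)) ?indicE.
- by apply: intgZl => //; apply: intg_norm => //; exact: loc_patch.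
Qed.

Lemma loc_test (h phi : V -> R) : loc h -> Cc_infty setT phi -> intg mu setT (fun y => h y * phi y).
Proof.
move=> lh tphi; have [N [C [C0 hC]]] := test_bound tphi.
by apply: loc_test_intg lh _ hC; apply: cont_measurable; exact: test_continuous.
Qed.

Lemma loc_lip (Th : R -> R) C (h : V -> R) : (forall a b, `|Th a - Th b| <= C * `|a - b|) ->
  measurable_fun setT Th -> loc h -> loc (fun y => Th (h y)).
Proof.
move=> lT mT [mh lh]; have mTh : measurable_fun setT (fun y => Th (h y)) by exact: measurableT_comp.
split => // N; have mC : measurable (@cube R d N%:R) by exact: measurable_cube.
apply: (le_intg (g := fun y => `|Th 0| + C * `|h y|)) => //.
- exact: measurable_funTS.
- move=> y _; rewrite -[Th (h y)](subrK (Th 0)); apply: le_trans (ler_normD _ _) _.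
  by rewrite addrC lerD2l; apply: le_trans (lT _ _) _; rewrite subr0.
- apply: intgD => //; last by apply: intgZl => //; exact: intg_norm.
  apply: measurable_bounded_integrable => //; first exact: vol_cube_lty.
  by exists `|Th 0|; split => // x ? y _; rewrite /= normr_id ltW.
Qed.

Lemma loc_bounded_mul (b h : V -> R) C : measurable_fun setT b -> (forall y, `|b y| <= C) ->
  loc h -> loc (fun y => b y * h y).
Proof.
move=> mb hb [mh lh]; have mbh : measurable_fun setT (fun y => b y * h y) by exact: measurable_funM.
split => // N; have mC : measurable (@cube R d N%:R) by exact: measurable_cube.
apply: (le_intg (g := fun y => C * `|h y|)) => //.
- exact: measurable_funTS.
- by move=> y _; rewrite normrM ler_wpM2r.
- by apply: intgZl => //; exact: intg_norm.
Qed.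

Section chain_rule.
Variables (w : V -> R) (G : 'I_d -> V -> R) (Th T : R -> R) (C : R).
Hypotheses (lw : loc w) (wG : wg w G).
Hypotheses (dT : forall s : R, is_derive s 1 Th (T s)) (cT : continuous T) (bT : forall s, `|T s| <= C).

Let lipT := lipschitz_derive dT bT.

Let mT : measurable_fun setT T.
Proof. exact: continuous_measurable_fun. Qed.

Let cTh : continuous Th.
Proof.
by move=> s; apply: differentiable_continuous; apply/derivable1_diffP; have [] := dT s.
Qed.

Let mTh : measurable_fun setT Th.
Proof. exact: continuous_measurable_fun. Qed.

(** The mollified [w] is differentiable along lines, so the classical chain and product rules apply,
    and the derivative of the product has mean zero. *)
Let ibp n phi i : Cc_infty setT phi ->
  \int[mu]_y (Th (mol (moll n) w y) * 'D_(e_ i) phi y) =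
  - \int[mu]_y (T (mol (moll n) w y) * mol (moll n) (G i) y * phi y).
Proof.
move=> tphi; have ki : kernel_fun (moll n : V -> R) by exact: moll_kernel.
have lG := wG.1 i.
have lwn := loc_mol ki lw; have lGn := loc_mol ki lG.
have l1 : loc (fun y => Th (mol (moll n) w y)) by exact: loc_lip lipT mTh lwn.
have l2 : loc (fun y => T (mol (moll n) w y) * mol (moll n) (G i) y).
  apply: (loc_bounded_mul _ _ lGn) => //; apply: measurableT_comp => //; exact: lwn.1.
have tD := test_derive (e_ i) tphi.
have i1 := loc_test l1 tphi; have i2 := loc_test l2 tphi; have i3 := loc_test l1 tD.
apply/eqP; rewrite -addr_eq0 -RintegralD//; apply/eqP.
apply: (integral_derive_eq0 (f := fun y => Th (mol (moll n) w y) * phi y) (v := e_ i)) => //.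
- exact: intgD.
- move=> x s.
  have h1 := is_derive1_comp (dT (mol (moll n) w (x + s *: e_ i))) (mol_wg_line i x s ki lw wG).
  have h2 := test_line x (e_ i) s tphi.
  apply: (is_derive_eq (is_deriveM h1 h2)).
  by rewrite /GRing.scale/=; ring.
- move=> x s.
  have c1 : continuous (fun s : R => mol (moll n) w (x + s *: e_ i)) by exact: mol_line_cont.
  have c2 : continuous (fun s : R => mol (moll n) (G i) (x + s *: e_ i)) by exact: mol_line_cont.
  have c3 : continuous (fun s : R => phi (x + s *: e_ i)) by apply: continuous_line; exact: test_continuous.
  have c4 : continuous (fun s : R => 'D_(e_ i) phi (x + s *: e_ i)) by exact: continuous_line (test_continuous tD).
  apply: cvgD; apply: cvgM => //; [|exact: c4|apply: cvgM|exact: c3].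
  + by apply: continuous_comp; [exact: c1|exact: cTh].
  + by apply: continuous_comp; [exact: c1|exact: cT].
  + exact: c2.
Qed.

(** The limit of [ibp]. On the left, [Th] is Lipschitz, so local L^1 convergence of the mollified
    [w] suffices. On the right, [T] is merely continuous and bounded: its argument converges almost
    everywhere along subsequences, and the mollified [|G i|] dominate. *)
Lemma wg_comp : wg (fun y => Th (w y)) (fun i y => T (w y) * G i y).
Proof.
have lTG i : loc (fun y => T (w y) * G i y).
  apply: (loc_bounded_mul _ _ (wG.1 i)) => //; apply: measurableT_comp => //; exact: lw.1.
split => // phi tphi i.
have lG := wG.1 i; have tD := test_derive (e_ i) tphi.
have [N [C1 [C10 hC1]]] := test_bound tphi.
have [N' [C2 [C20 hC2]]] := test_bound tD.
have lTw : loc (fun y => Th (w y)) by exact: loc_lip lipT mTh lw.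
have mphi : measurable_fun setT phi by apply: cont_measurable; exact: test_continuous.
have mDphi : measurable_fun setT ('D_(e_ i) phi) by apply: cont_measurable; exact: test_continuous.
have kn n : kernel_fun (moll n : V -> R) by exact: moll_kernel.
have C0 : 0 <= C by apply: le_trans (bT 0).
have ind0 M (y : V) : 0 <= (\1_(cube M) y : R) by rewrite indicE.
have cv1 : (fun n => \int[mu]_y (Th (mol (moll n) w y) * 'D_(e_ i) phi y)) @ \oo
    --> \int[mu]_y (Th (w y) * 'D_(e_ i) phi y).
  have h := mol_cvg_loc N' lw.
  apply/cvgrPdist_le => e e0.
  (* The added 1 keeps the denominator positive even if [C] is 0. *)
  have C'0 : 0 < C * C2 + 1 by rewrite ltr_wpDl// mulr_ge0// ltW.
  have e' : 0 < e / (C * C2 + 1) by rewrite divr_gt0.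
  move/cvgrPdist_le : h => /(_ _ e'); apply: filterS => n.
  rewrite sub0r normrN ger0_norm ?Rintegral_ge0// => hn.
  have lwn := loc_mol (kn n) lw.
  have l1 : loc (fun y => Th (mol (moll n) w y)) by exact: loc_lip lipT mTh lwn.
  have i1 := loc_test l1 tD; have i2 := loc_test lTw tD.
  rewrite distrC -RintegralB//.
  apply: le_trans (le_normr_Rintegral measurableT (intgB measurableT i1 i2)) _.
  have mC : measurable (@cube R d N'%:R) by exact: measurable_cube.
  have i3 : intg mu (cube N'%:R) (fun y => `|mol (moll n) w y - w y|).
    by apply: intg_norm => //; apply: intgB => //; [exact: lwn.2|exact: lw.2].
  apply: (@le_trans _ _ (\int[mu]_y (C * C2 * (`|mol (moll n) w y - w y| * \1_(cube N'%:R) y)))).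
    apply: le_Rintegral => //.
    - by apply: intg_norm => //; exact: intgB.
    - by apply: intgZl => //; exact: (intg_patch _ mC).1.
    move=> y _; rewrite -mulrBl normrM.
    apply: le_trans (ler_pM _ _ (lipT _ _) (hC2 y)) _ => //.
    by rewrite le_eqVlt; apply/orP; left; apply/eqP; ring.
  rewrite RintegralZl//; last exact: (intg_patch _ mC).1.
  have -> : \int[mu]_y (`|mol (moll n) w y - w y| * \1_(cube N'%:R) y) =
      \int[mu]_(y in cube N'%:R) `|mol (moll n) w y - w y|.
    by rewrite [RHS]Rintegral_mkcond; apply: eq_Rintegral => y _; rewrite patchE indicE;
      case: ifPn; rewrite ?mulr1 ?mulr0.
  apply: le_trans (_ : _ <= (C * C2 + 1) * (e / (C * C2 + 1))) _; last first.
    by rewrite mulrC divfK// gt_eqF.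
  by apply: ler_pM => //; rewrite ?Rintegral_ge0 ?mulr_ge0 ?lerDl// ltW.
have cv2 : (fun n => \int[mu]_y (T (mol (moll n) w y) * mol (moll n) (G i) y * phi y)) @ \oo
    --> \int[mu]_y (T (w y) * G i y * phi y).
  apply: cvg_subsubseq => S SS.
  have lwG (b : bool) : loc (if b then w else G i) by case: b.
  have [phi_ [phiS ae]] := mol_ae_cvg lwG SS.
  exists phi_; split => //.
  have ind_int M : intg mu setT (fun y => `|G i y| * \1_(cube M%:R) y).
    apply: (intg_patch _ _).1; first exact: measurable_cube.
    by apply: (loc_norm lG).2.
  have ind_intn n M : intg mu setT (fun y => `|mol (moll n) (G i) y| * \1_(cube M%:R) y).
    apply: (intg_patch _ _).1; first exact: measurable_cube.
    by apply: (loc_norm (loc_mol (kn n) lG)).2.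
  apply: (gen_dominated_Rintegral measurableT
    (h_ := fun k y => C * C1 * (`|mol (moll (phi_ k)) (G i) y| * \1_(cube N%:R) y))
    (h := fun y => C * C1 * (`|G i y| * \1_(cube N%:R) y)) _ _ _ _ _ _ _ _).2.
  - move=> k; apply: measurable_funM => //; apply: measurable_funM; last exact: (loc_mol (kn _) lG).1.
    by apply: measurableT_comp => //; exact: (loc_mol (kn _) lw).1.
  - by apply: measurable_funM => //; exact: (lTG i).1.
  - apply: filterS ae => y h _; have h1 := h true; have h2 := h false.
    apply: cvgM; last exact: cvg_cst.
    apply: cvgM => //; apply: continuous_cvg => //; exact: cT.
  - move=> k y _; rewrite !normrM.
    apply: (@le_trans _ _ (C * `|mol (moll (phi_ k)) (G i) y| * (C1 * \1_(cube N%:R) y))).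
      by apply: ler_pM => //; apply: ler_wpM2r.
    by rewrite le_eqVlt; apply/orP; left; apply/eqP; ring.
  - apply: aeW => y _; rewrite !normrM.
    apply: (@le_trans _ _ (C * `|G i y| * (C1 * \1_(cube N%:R) y))).
      by apply: ler_pM => //; apply: ler_wpM2r.
    by rewrite le_eqVlt; apply/orP; left; apply/eqP; ring.
  - by move=> k; apply: intgZl.
  - exact: intgZl.
  have h := mol_cvg_loc N lG.
  have mC : measurable (@cube R d N%:R) by exact: measurable_cube.
  have bnd k : \int[mu]_y `|C * C1 * (`|mol (moll (phi_ k)) (G i) y| * \1_(cube N%:R) y) -
      C * C1 * (`|G i y| * \1_(cube N%:R) y)| <=
      C * C1 * \int[mu]_(y in cube N%:R) `|mol (moll (phi_ k)) (G i) y - G i y|.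
    have i3 : intg mu (cube N%:R) (fun y => `|mol (moll (phi_ k)) (G i) y - G i y|).
      by apply: intg_norm => //; apply: intgB => //; [exact: (loc_mol (kn _) lG).2|exact: lG.2].
    have i4 := (intg_patch _ mC).1 i3.
    apply: (@le_trans _ _ (\int[mu]_y (C * C1 * (`|mol (moll (phi_ k)) (G i) y - G i y| * \1_(cube N%:R) y)))).
      apply: le_Rintegral => //.
      - by apply: intg_norm => //; apply: intgB => //; exact: intgZl.
      - exact: intgZl.
      have CC1 : 0 <= C * C1 by rewrite mulr_ge0// ltW.
      move=> y _; rewrite -mulrBr -mulrBl normrM (ger0_norm CC1) ler_wpM2l//.
      rewrite normrM (ger0_norm (ind0 N%:R y)) ler_wpM2r//; exact: ler_dist_dist.
    rewrite RintegralZl// le_eqVlt; apply/orP; left; apply/eqP; congr (_ * _).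
    rewrite [RHS]Rintegral_mkcond; apply: eq_Rintegral => y _; rewrite patchE indicE.
    by case: ifPn; rewrite ?mulr1 ?mulr0.
  apply: (@squeeze_cvgr _ _ _ _ (cst 0) (fun k => C * C1 * \int[mu]_(y in cube N%:R) `|mol (moll (phi_ k)) (G i) y - G i y|)).
  - by apply: nearW => k; rewrite Rintegral_ge0//= bnd.
  - exact: cvg_cst.
  - rewrite -[X in _ --> X](mulr0 (C * C1)); apply: cvgM; first exact: cvg_cst.
    have phioo : phi_ @ \oo --> \oo.
      by apply/cvgnyPge => A; exists A => // k /= Ak; apply: leq_trans Ak (phiS k).1.
    exact: (cvg_comp _ _ phioo h).
have cv2' := cvgN cv2.
have E : (fun n => \int[mu]_y (Th (mol (moll n) w y) * 'D_(e_ i) phi y)) =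
    (fun n => - \int[mu]_y (T (mol (moll n) w y) * mol (moll n) (G i) y * phi y)).
  by apply/funext => n; exact: ibp.
rewrite E in cv1.
by apply: (cvg_unique _ cv1 (cv2' _)).
Qed.

End chain_rule.

Lemma wg_unique w G G' : wg w G -> wg w G' -> forall i, {ae mu, forall y, G i y = G' i y}.
Proof.
move=> [lG h] [lG' h'] i.
have lB : loc (fun y => G i y - G' i y).
  split; first by apply: measurable_funB; [exact: (lG i).1|exact: (lG' i).1].
  by move=> N; apply: intgB; [exact: measurable_cube|exact: (lG i).2|exact: (lG' i).2].
apply: filterS (fundamental_lemma lB _) => [y /eqP|phi tphi]; first by rewrite subr_eq0 => /eqP.
have := h _ tphi i; rewrite (h' _ tphi i) => /oppr_inj E.
under eq_Rintegral do rewrite mulrBl.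
by rewrite RintegralB ?E ?subrr//; exact: loc_test.
Qed.

Lemma wgD w1 w2 G1 G2 : loc w1 -> loc w2 -> wg w1 G1 -> wg w2 G2 ->
  wg (fun y => w1 y + w2 y) (fun i y => G1 i y + G2 i y).
Proof.
move=> l1 l2 [lG1 h1] [lG2 h2]; split=> [i|phi tphi i].
  split; first by apply: measurable_funD; [exact: (lG1 i).1|exact: (lG2 i).1].
  by move=> N; apply: intgD; [exact: measurable_cube|exact: (lG1 i).2|exact: (lG2 i).2].
have tD := test_derive (e_ i) tphi.
under eq_Rintegral do rewrite mulrDl.
rewrite RintegralD//; try exact: loc_test.
under [in RHS]eq_Rintegral do rewrite mulrDl.
rewrite RintegralD//; try exact: loc_test.
by rewrite h1// h2// opprD.
Qed.

Lemma wgZ c w G : loc w -> wg w G -> wg (fun y => c * w y) (fun i y => c * G i y).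
Proof.
move=> lw [lG h]; split=> [i|phi tphi i].
  split; first by apply: measurable_funM => //; exact: (lG i).1.
  by move=> N; apply: intgZl; [exact: measurable_cube|exact: (lG i).2].
have tD := test_derive (e_ i) tphi.
under eq_Rintegral do rewrite -mulrA.
rewrite RintegralZl//; last exact: loc_test.
under [in RHS]eq_Rintegral do rewrite -mulrA.
rewrite RintegralZl//; last exact: loc_test.
by rewrite h// mulrN.
Qed.

End sobolev.

(** * The pressure and the gradient of the density *)

(** Powers extended by 0 to negative arguments. This makes the pressure a C^1 bijection of the whole
    line, so its inverse can be differentiated everywhere. *)
Definition pospow {R : realType} (a s : R) : R := Num.max s 0 `^ a.

Section pospow.
Context {R : realType}.
Implicit Types a s : R.

Lemma pospow_ge0 a s : 0 <= pospow a s. Proof. exact: powR_ge0. Qed.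

Lemma pospowE a s : 0 <= s -> pospow a s = s `^ a.
Proof. by move=> s0; rewrite /pospow max_l. Qed.

Lemma is_derive_pospow_gt0 a s : 0 < s -> is_derive s 1 (pospow a) (a * pospow (a - 1) s).
Proof.
move=> s0; rewrite pospowE ?ltW//.
apply: (near_eq_is_derive (f := fun x => x `^ a)) => //.
- by near=> z; rewrite pospowE// ltW//; near: z; exact: lt_nbhsr.
- exact: is_derive1_powR.
Unshelve. all: by end_near. Qed.

Lemma is_derive_pospow_lt0 a s : a != 0 -> s < 0 -> is_derive s 1 (pospow a) 0.
Proof.
move=> a0 s0; apply: (near_eq_is_derive (f := cst 0)) => //.
near=> z; rewrite /pospow max_r ?powR0// ltW//; near: z; exact: lt_nbhsl.
Unshelve. all: by end_near. Qed.

Lemma continuous_pospow a : 0 < a -> continuous (pospow a : R -> R).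
Proof.
move=> a0 s; have [s0|s0|->] := ltgtP s 0.
- apply: differentiable_continuous; apply/derivable1_diffP.
  by have [] := is_derive_pospow_lt0 (lt0r_neq0 a0) s0.
- apply: differentiable_continuous; apply/derivable1_diffP.
  by have [] := is_derive_pospow_gt0 a s0.
have p0 : pospow a 0 = 0 :> R by rewrite /pospow maxxx powR0 ?gt_eqF.
apply/cvgrPdist_lt => e e0.
have ea : 0 < e `^ a^-1 by exact: powR_gt0.
near=> z; rewrite p0 sub0r normrN ger0_norm ?pospow_ge0//.
have := @gt0_ltr_powR R a a0 (Num.max z 0) (e `^ a^-1).
rewrite -powRrM mulVf ?gt_eqF// powRr1 ?ltW//; apply.
- by rewrite nnegrE le_max lexx orbT.
- by rewrite nnegrE ltW.
- by rewrite gt_max ea andbT; near: z; exact: lt_nbhsl.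
Unshelve. all: by end_near. Qed.

Lemma is_derive_pospow a s : 1 < a -> is_derive s 1 (pospow a) (a * pospow (a - 1) s).
Proof.
move=> a1; have a10 : 0 < a - 1 by rewrite subr_gt0.
have a0 : 0 < a by apply: lt_trans a1.
have [s0|s0|->] := ltgtP s 0; last 1 first.
(* At 0 the difference quotient of [pospow a] is [pospow (a - 1)], continuous and zero there because
   [a > 1]. *)
- apply/is_derive1_caratheodory; exists (pospow (a - 1)); split.
  + move=> z; rewrite subr0 [pospow a 0]/pospow maxxx powR0 ?gt_eqF// subr0.
    rewrite /pospow; have [z0|z0] := leP z 0.
      by rewrite !powR0 ?gt_eqF// mul0r.
    by rewrite mulrC mulr_powRB1// ltW.
  + exact: continuous_pospow.
  + by rewrite /pospow maxxx powR0 ?gt_eqF// mulr0.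
- rewrite [pospow (a - 1) s]/pospow max_r ?ltW// powR0 ?gt_eqF// mulr0.
  by apply: is_derive_pospow_lt0 => //; rewrite gt_eqF.
- exact: is_derive_pospow_gt0.
Qed.

End pospow.

Section pressure.
Context {R : realType} (lambda eta m : R).
Hypotheses (l0 : 0 < lambda) (e0 : 0 < eta) (m1 : 1 < m).

Definition pressure (s : R) : R := lambda * s + eta * pospow m s.
Definition dpressure (s : R) : R := lambda + eta * (m * pospow (m - 1) s).

Lemma pressureE s : 0 <= s -> pressure s = L_F lambda eta m s.
Proof. by move=> s0; rewrite /pressure pospowE. Qed.

Lemma is_derive_pressure (s : R) : is_derive s 1 pressure (dpressure s).
Proof.
have h1 := is_derive_pospow s m1.
have h2 : is_derive s 1 (fun x : R => lambda * x) (lambda *: 1) by exact: is_deriveZ.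
have h3 : is_derive s 1 (fun x : R => eta * pospow m x) (eta *: (m * pospow (m - 1) s)) by exact: is_deriveZ.
by apply: (is_derive_eq (is_deriveD h2 h3)); rewrite /GRing.scale/= mulr1.
Qed.

Lemma pressure_continuous : continuous pressure.
Proof.
by move=> s; apply: differentiable_continuous; apply/derivable1_diffP; have [] := is_derive_pressure s.
Qed.

Lemma dpressure_ge s : lambda <= dpressure s.
Proof. by rewrite lerDl !mulr_ge0 ?pospow_ge0// ltW// (lt_trans _ m1). Qed.

Lemma dpressure_gt0 s : 0 < dpressure s.
Proof. exact: lt_le_trans (dpressure_ge s). Qed.

Lemma dpressure_continuous : continuous dpressure.
Proof.
move=> s; apply: cvgD; first exact: cvg_cst.
apply: cvgM; first exact: cvg_cst.
by apply: cvgM; [exact: cvg_cst|apply: continuous_pospow; rewrite subr_gt0].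
Qed.

Lemma pressure_mono a b : a <= b -> lambda * (b - a) <= pressure b - pressure a.
Proof.
move=> ab; rewrite /pressure opprD addrACA -mulrBr lerDl -mulrBr.
have m0 : 0 <= m by rewrite ltW// (lt_trans _ m1).
apply: mulr_ge0; first exact: ltW.
rewrite subr_ge0; apply: ge0_ler_powR => //; try by rewrite nnegrE le_max lexx orbT.
by apply: le_max2.
Qed.

Lemma pressure_surj w : exists s, pressure s == w.
Proof.
(* By [pressure_mono] from 0, the pressure is at least [|w|] at [M] and at most [- |w|] at [- M], so
   the intermediate value theorem reaches [w]. *)
pose M := `|w| / lambda.
have M0 : 0 <= M by rewrite divr_ge0// ltW.
have p0 : pressure 0 = 0.
  by rewrite /pressure /pospow maxxx powR0 ?mulr0 ?addr0// gt_eqF// (lt_trans _ m1).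
have lM : lambda * M = `|w| by rewrite /M mulrC divfK// gt_eqF.
have h1 := pressure_mono M0; have h2 : - M <= 0 by rewrite oppr_le0.
have {}h2 := pressure_mono h2; rewrite p0 ?subr0 ?sub0r ?opprK lM in h1 h2.
have cL : {within `[- M, M], continuous pressure}.
  by apply: continuous_subspaceT; exact: pressure_continuous.
have MM : - M <= M by rewrite ge0_cp.
have [|s _ <-] := @IVT _ pressure (- M) M w MM cL; last by exists s.
rewrite minEle maxEle; case: ifPn => hh.
  by apply/andP; split; [rewrite lerNr in h2; apply: le_trans h2 _; rewrite lerNl; apply: le_trans (ler_norm _) _; rewrite normrN|apply: le_trans (ler_norm _) _].
by exfalso; move/negP: hh; apply; apply: le_trans (_ : 0 <= _); [rewrite -oppr_ge0 (le_trans _ h2)|rewrite (le_trans _ h1)].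
Qed.

Definition ipressure w : R := xchoose (pressure_surj w).

Lemma ipressureK : cancel ipressure pressure.
Proof. by move=> w; exact/eqP/(xchooseP (pressure_surj w)). Qed.

Lemma pressure_inj : injective pressure.
Proof.
suff h a b : a <= b -> pressure a = pressure b -> a = b.
  by move=> a b; have [ab|/ltW ab] := leP a b => E; [exact: h|apply/esym; exact: h].
move=> ab E; have := pressure_mono ab; rewrite E subrr pmulr_rle0// subr_le0 => ba.
by apply/eqP; rewrite eq_le ab.
Qed.

Lemma pressureK : cancel pressure ipressure.
Proof. by move=> s; apply: pressure_inj; rewrite ipressureK. Qed.

Lemma is_derive_ipressure (w : R) : is_derive w 1 ipressure (dpressure (ipressure w))^-1.
Proof.
rewrite -{1}(ipressureK w); apply: (@is_derive_inverse R pressure).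
- by near=> z; rewrite pressureK.
- by near=> z; exact: pressure_continuous.
- exact: is_derive_pressure.
- by rewrite gt_eqF// dpressure_gt0.
Unshelve. all: by end_near. Qed.

End pressure.

Section weak_gradient_of_density.
Context {R : realType} {d : nat} (lambda eta m : R).
Hypotheses (l0 : 0 < lambda) (e0 : 0 < eta) (m1 : 1 < m).
Local Notation V := 'rV[R]_d.
Local Notation mu := (@vol R d).
Local Notation e_ i := (delta_mx ord0 i : V).
Local Notation L := (L_F lambda eta m).
Variable u : V -> R.
Hypotheses (mu_ : measurable_fun setT u) (u0 : forall y, 0 <= u y).
Variable G : 'I_d -> V -> R.
Let w y := L (u y).
Hypotheses (lw : loc w) (wG : wg w G).

(** The linear term [lambda s] bounds [dpressure] from below, so [u] is a C^1 function of [w] with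
    bounded derivative, and the chain rule applies to the inverse pressure. *)
Lemma wg_density : loc u /\
  wg u (fun i y => (dpressure lambda eta m (u y))^-1 * G i y).
Proof.
have E y : ipressure l0 e0 m1 (w y) = u y.
  by rewrite -[RHS](pressureK l0 e0 m1) pressureE.
have dT := is_derive_ipressure l0 e0 m1.
have bT s : `|(dpressure lambda eta m (ipressure l0 e0 m1 s))^-1| <= lambda^-1.
  rewrite gtr0_norm ?invr_gt0 ?dpressure_gt0// lef_pV2 ?posrE ?dpressure_gt0//.
  exact: dpressure_ge.
have ci : continuous (ipressure l0 e0 m1).
  by move=> s; apply: differentiable_continuous; apply/derivable1_diffP; have [] := dT s.
have cT : continuous (fun s => (dpressure lambda eta m (ipressure l0 e0 m1 s))^-1).
  move=> s; apply: cvgV; first by rewrite gt_eqF// dpressure_gt0.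
  by apply: continuous_comp; [exact: ci|exact: dpressure_continuous].
have lu : loc u.
  have := loc_lip (lipschitz_derive dT bT) (continuous_measurable_fun ci) lw.
  by rewrite (_ : (fun y => _) = u)//; apply/funext.
split => //; have := wg_comp lw wG dT cT bT.
rewrite (_ : (fun y => ipressure l0 e0 m1 (w y)) = u); last exact/funext.
by rewrite (_ : (fun i y => _ * G i y) = (fun i y => (dpressure lambda eta m (u y))^-1 * G i y))//;
  apply/funext => i; apply/funext => y; rewrite E.
Qed.

(* [atan (k s) / k] tends to 0 uniformly while its derivative tends to the indicator of [s = 0]. *)
Lemma wg_eq0 i : {ae mu, forall y, w y = 0 -> G i y = 0}.
Proof.
pose Th (k : nat) (s : R) := k.+1%:R^-1 * atan (k.+1%:R * s).
pose T (k : nat) (s : R) : R := (1 + (k.+1%:R * s) ^+ 2)^-1.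
have k0 k : 0 < k.+1%:R :> R by [].
have dT k (s : R) : is_derive s 1 (Th k) (T k s).
  have h1 : is_derive s 1 (fun x : R => k.+1%:R * x) (k.+1%:R *: 1) by exact: is_deriveZ.
  have h2 := is_derive1_comp (is_derive1_atan (k.+1%:R * s)) h1.
  have h3 : is_derive s 1 (Th k) (k.+1%:R^-1 *: ((1 + (k.+1%:R * s) ^+ 2)^-1 * (k.+1%:R *: 1))) by exact: is_deriveZ.
  apply: (is_derive_eq h3); rewrite /GRing.scale/= mulr1 mulrCA mulVf ?mulr1//.
have T1 k s : 0 < 1 + (k.+1%:R * s) ^+ 2 :> R by rewrite ltr_pwDl// sqr_ge0.
have bT k s : `|T k s| <= 1.
  by rewrite gtr0_norm ?invr_gt0// invf_le1// lerDl sqr_ge0.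
have cT k : continuous (T k).
  move=> s; apply: cvgV; first by rewrite gt_eqF.
  apply: cvgD; first exact: cvg_cst.
  by apply: cvgM; (apply: cvgM; [exact: cvg_cst|exact: cvg_id]).
have wk k := wg_comp lw wG (dT k) (cT k) (bT k).
have mG j : measurable_fun setT (G j) by exact: (wG.1 j).1.
have mw : measurable_fun setT w by exact: lw.1.
have mT k : measurable_fun setT (fun y => T k (w y)).
  by apply: measurableT_comp => //; exact: continuous_measurable_fun.
have mZ : measurable [set y | w y = 0].
  by rewrite -[X in measurable X]setTI; have := mw measurableT [set 0]; apply; exact: measurable_set1.
pose Z := [set y | w y = 0].
have mI : measurable_fun setT (\1_Z : V -> R) by exact: measurable_indic.
have lZ : loc (fun y => \1_Z y * G i y).
  apply: (@loc_bounded_mul _ _ _ _ 1) => //; last exact: wG.1.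
  by move=> y; rewrite indicE; case: (_ \in _); rewrite ?normr1 ?normr0.
have := fundamental_lemma lZ; move=> H.
apply: filterS (H _) => [y Zy wy|phi tphi].
  by move: Zy; rewrite indicE mem_set// mul1r.
have tD := test_derive (e_ i) tphi.
have [N [C [C0 hC]]] := test_bound tphi.
have [N' [C' [C'0 hC']]] := test_bound tD.
have mphi : measurable_fun setT phi by apply: cont_measurable; exact: test_continuous.
have mDphi : measurable_fun setT ('D_(e_ i) phi) by apply: cont_measurable; exact: test_continuous.
have lG := wG.1 i.
have cv1 : (fun k => \int[mu]_y (T k (w y) * G i y * phi y)) @ \oo --> \int[mu]_y (\1_Z y * G i y * phi y).
  apply: (dominated_Rintegral (g := fun y => `|G i y * phi y|) measurableT _ _ _ _ _).2.
  - by move=> k; apply: measurable_funM => //; apply: measurable_funM.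
  - by apply: measurable_funM => //; apply: measurable_funM.
  - apply: aeW => y _; apply: cvgM; last exact: cvg_cst.
    apply: cvgM; last exact: cvg_cst.
    rewrite indicE; case: (boolP (y \in Z)) => [/set_mem zy|/negP zy] /=.
      rewrite (_ : (fun k => T k (w y)) = cst 1); first exact: cvg_cst.
      by apply/funext => k; rewrite /T zy mulr0 expr0n addr0 invr1.
    have wy : w y != 0 by apply/eqP => wy; apply: zy; exact: mem_set.
    apply: (@squeeze_cvgr _ _ _ _ (cst 0) (fun k => (w y ^+ 2)^-1 * k.+1%:R^-1)).
    + apply: nearW => k; rewrite invr_ge0 ltW//= /T -invfM lef_pV2 ?posrE//; last first.
        by rewrite mulr_gt0// exprn_even_gt0.
      rewrite exprMn mulrC (@le_trans _ _ (k.+1%:R ^+ 2 * w y ^+ 2))//; last by rewrite lerDr.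
      by rewrite ler_wpM2r ?sqr_ge0// expr2 ler_peMr// ler1n.
    + exact: cvg_cst.
    + rewrite -[X in _ --> X](mulr0 (w y ^+ 2)^-1); apply: cvgM; first exact: cvg_cst.
      exact: cvg_harmonic.
  - by move=> k y _; rewrite -mulrA normrM ler_piMl.
  - by apply: intg_norm => //; exact: loc_test.
(* After integration by parts only [Th k] is left, and it is bounded by [pi / 2] over [k.+1]. *)
have cv2 : (fun k => \int[mu]_y (T k (w y) * G i y * phi y)) @ \oo --> (0 : R).
  pose A := \int[mu]_y (pi / 2 * `|1 * 'D_(e_ i) phi y|).
  have l1 : loc (fun _ : V => 1 : R).
    split => // n; apply: measurable_bounded_integrable => //.
    - exact: measurable_cube.
    - exact: vol_cube_lty.
    - by exists 1; split => // x x1 y _; rewrite /= normr1 ltW.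
  have i1 := loc_test l1 tD.
  apply/cvgr0Pnorm_le => e ee.
  have : (fun k => A * k.+1%:R^-1) @ \oo --> (0 : R).
    rewrite -[X in _ --> X](mulr0 A); apply: cvgM; first exact: cvg_cst.
    exact: cvg_harmonic.
  move=> /cvgr0Pnorm_le /(_ _ ee); apply: filterS => k; apply: le_trans.
  have -> : \int[mu]_y (T k (w y) * G i y * phi y) = - \int[mu]_y (Th k (w y) * 'D_(e_ i) phi y).
    by rewrite (wk k).2// opprK.
  have lTh : loc (fun y => Th k (w y)).
    apply: (loc_lip (lipschitz_derive (dT k) (bT k))) lw.
    apply: continuous_measurable_fun => s.
    by apply: differentiable_continuous; apply/derivable1_diffP; have [] := dT k s.
  rewrite normrN; apply: le_trans (le_normr_Rintegral measurableT (loc_test lTh tD)) _.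
  apply: le_trans _ (ler_norm _).
  rewrite mulrC -RintegralZl//; last by apply: intgZl => //; exact: intg_norm.
  apply: le_Rintegral => //.
  - by apply: intg_norm => //; exact: loc_test.
  - by apply: intgZl => //; apply: intgZl => //; exact: intg_norm.
  move=> y _; rewrite mul1r normrM mulrA ler_wpM2r// normrM gtr0_norm ?invr_gt0//.
  rewrite ler_wpM2l ?invr_ge0// ltW// ltr_norml atan_gtNpi2 atan_ltpi2//.
exact: (cvg_unique _ cv1 cv2).
Qed.

End weak_gradient_of_density.

(** * The energy slope at a fixed time *)

(** Geometric against arithmetic mean with a crude constant; it turns Cauchy-Schwarz bounds into
    sums, which can be integrated term by term. *)
Lemma sqr_le_mul_norm {R : realType} (x p q : R) : 0 <= p -> 0 <= q ->
  x ^+ 2 <= p * q -> `|x| <= p + q.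
Proof.
move=> p0 q0 h; rewrite -(@ler_pXn2r _ 2%N) ?nnegrE ?addr_ge0//.
rewrite real_normK ?num_real// (le_trans h)//.
by have := mulr_ge0 p0 q0; have := sqr_ge0 p; have := sqr_ge0 q; rewrite sqrrD; lra.
Qed.

Section slice.
Context {R : realType} {d : nat}.
Local Notation V := 'rV[R]_d.
Local Notation mu := (@vol R d).
Local Notation e_ i := (delta_mx ord0 i : V).

Variable u : V -> R.
Hypotheses (u0 : forall y, 0 <= u y) (iu : intg mu setT u).

Let kn n : kernel_fun (moll n : V -> R). Proof. exact: moll_kernel. Qed.
Let mu_ : measurable_fun setT u. Proof. exact: intg_measurable iu. Qed.
Let lu : loc u. Proof. exact: intg_loc. Qed.

Lemma intg_cs (f : V -> R) : measurable_fun setT f ->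
  intg mu setT (fun y => u y * f y ^+ 2) -> intg mu setT (fun y => u y * f y).
Proof.
move=> mf i2; apply: (le_intg (g := fun y => u y + u y * f y ^+ 2)) => //.
- exact: measurable_funM.
- move=> y _; rewrite -{2}(mulr1 (u y)) -mulrDr normrM ger0_norm// ler_wpM2l//.
  by apply: sqr_le_mul_norm; rewrite ?sqr_ge0// mul1r.
- exact: intgD.
Qed.

Lemma loc_cs (f : V -> R) : measurable_fun setT f ->
  loc (fun y => u y * f y ^+ 2) -> loc (fun y => u y * f y).
Proof.
move=> mf i2; split; first exact: measurable_funM.
move=> N; apply: (le_intg (g := fun y => u y + u y * f y ^+ 2)) => //.
- exact: measurable_cube.
- by apply: measurable_funTS; exact: measurable_funM.
- move=> y _; rewrite -{2}(mulr1 (u y)) -mulrDr normrM ger0_norm// ler_wpM2l//.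
  by apply: sqr_le_mul_norm; rewrite ?sqr_ge0// mul1r.
- by apply: intgD; [exact: measurable_cube|exact: lu.2|exact: i2.2].
Qed.

(** Cauchy-Schwarz for the weight [u] times the kernel: the mollification of [u (t f - s)^2] is a
    nonnegative quadratic form in [s] and [t]. *)
Lemma mol_cs n (f : V -> R) x : measurable_fun setT f ->
  loc (fun y => u y * f y ^+ 2) ->
  mol (moll n) (fun y => u y * f y) x ^+ 2 <=
  mol (moll n) u x * mol (moll n) (fun y => u y * f y ^+ 2) x.
Proof.
move=> mf l2; have l1 := loc_cs mf l2.
set P := mol _ (fun y => u y * f y) x; set U := mol _ u x; set Q := mol _ _ x.
have U0 : 0 <= U by exact: mol_ge0.
have Q0 : 0 <= Q by apply: mol_ge0 => y; rewrite mulr_ge0 ?sqr_ge0.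
have key s t : 0 <= t ^+ 2 * Q - 2 * t * s * P + s ^+ 2 * U.
  have : 0 <= mol (moll n) (fun y => u y * (t * f y - s) ^+ 2) x.
    by apply: mol_ge0 => y; rewrite mulr_ge0 ?sqr_ge0.
  have -> : (fun y => u y * (t * f y - s) ^+ 2) =
      (fun y => (t ^+ 2 * (u y * f y ^+ 2) + (- (2 * t * s)) * (u y * f y)) + s ^+ 2 * u y).
    by apply/funext => y; ring.
  have lZ c (h : V -> R) : loc h -> loc (fun y => c * h y).
    move=> [mh lh]; split; first exact: measurable_funM.
    by move=> N; apply: intgZl => //; exact: measurable_cube.
  have lD (h k : V -> R) : loc h -> loc k -> loc (fun y => h y + k y).
    move=> [mh lh] [mk lk]; split; first exact: measurable_funD.
    by move=> N; apply: intgD => //; exact: measurable_cube.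
  rewrite molD//; [|by apply: lD; exact: lZ|exact: lZ].
  rewrite molD//; [|exact: lZ|exact: lZ].
  by rewrite !molZ// mulNr.
(* If [U = 0], the choice [s = Q + 1], [t = P] forces [P = 0]; otherwise [s = P], [t = U] gives the
   discriminant inequality. *)
move: U0; rewrite le_eqVlt => /predU1P[U0|U0].
  have := key (Q + 1) P; rewrite -U0 mulr0 addr0 mul0r.
  have -> : P ^+ 2 * Q - 2 * P * (Q + 1) * P = - (P ^+ 2 * (Q + 2)) by ring.
  by rewrite oppr_ge0 pmulr_lle0// ltr_wpDl.
have := key P U.
have -> : U ^+ 2 * Q - 2 * U * P * P + P ^+ 2 * U = U * (U * Q - P ^+ 2) by ring.
by rewrite pmulr_rge0// subr_ge0.
Qed.

Lemma mol_le n (f g : V -> R) x : loc f -> loc g ->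
  (forall y, cube 1 (y - x) -> f y <= g y) -> mol (moll n) f x <= mol (moll n) g x.
Proof.
move=> lf lg fg; apply: le_Rintegral => //; [exact: loc_mol_intg|exact: loc_mol_intg|].
move=> y _; have [c|c] := pselect (cube 1 (y - x)).
  by rewrite ler_wpM2r ?moll_ge0 ?fg.
by rewrite (kn n).2// !mulr0.
Qed.

Variables (a b : 'I_d -> V -> R).
Hypotheses (ma : forall i, measurable_fun setT (a i)) (mb : forall i, measurable_fun setT (b i)).
Hypotheses (ia : forall i, intg mu setT (fun y => u y * a i y ^+ 2))
  (ib : forall i, intg mu setT (fun y => u y * b i y ^+ 2)).
Variables (psi : V -> R) (phi : 'I_d -> V -> R) (Q : V -> R).
Hypotheses (cphi : forall i, continuous (phi i)) (mQ : measurable_fun setT Q)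
  (iQ : intg mu setT (fun y => Q y * u y))
  (hQ : forall i x y, cube 1 (y - x) -> phi i x ^+ 2 <= Q y).
Variables (g g1 : R -> R) (C : R).
Hypotheses (mg1 : measurable_fun setT g1) (cg1 : forall s, 0 <= s -> {for s, continuous g1})
  (hg1 : forall s, 0 <= s -> `|g1 s| * s <= C).

Local Notation un n := (mol (moll n) u).
Local Notation an n i := (mol (moll n) (fun y => u y * a i y)).
Local Notation bn n i := (mol (moll n) (fun y => u y * b i y)).

(** Below, [a] will be the velocity, [b] the field with [grad u = u b], [phi] the gradient of the
    bounded potential and [g1] the second derivative of the entropy: this is one summand of [(G''
    (u_n) grad u_n + grad psi) . (u v)_n]. *)
Definition slice_term n i x := (g1 (un n x) * bn n i x + phi i x) * an n i x.
Definition slice_lim i x := (g1 (u x) * (u x * b i x) + phi i x) * (u x * a i x).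
(** A fixed L^1 function whose mollification dominates [slice_term n i]. The terms with [C] come
    from the gradient part; one more [u a^2] together with [Q u] pays for the potential. *)
Definition slice_dom i x :=
  C * (u x * b i x ^+ 2) + (C + 1) * (u x * a i x ^+ 2) + Q x * u x.

Let C0 : 0 <= C. Proof. by apply: le_trans (hg1 (lexx 0)); rewrite mulr0. Qed.

Let iua i : intg mu setT (fun y => u y * a i y). Proof. exact: intg_cs. Qed.
Let iub i : intg mu setT (fun y => u y * b i y). Proof. exact: intg_cs. Qed.

Let lia i := intg_loc (ia i).
Let lib i := intg_loc (ib i).
Let liQ := intg_loc iQ.

Let mphi i : measurable_fun setT (phi i). Proof. exact: cont_measurable. Qed.

Let mun n : measurable_fun setT (un n). Proof. exact: measurable_mol. Qed.
Let man n i : measurable_fun setT (an n i).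
Proof. by apply: measurable_mol => //; exact: measurable_funM. Qed.
Let mbn n i : measurable_fun setT (bn n i).
Proof. by apply: measurable_mol => //; exact: measurable_funM. Qed.

Lemma measurable_slice_term n i : measurable_fun setT (slice_term n i).
Proof.
apply: measurable_funM => //; apply: measurable_funD => //; apply: measurable_funM => //.
exact: measurableT_comp.
Qed.

Lemma measurable_slice_lim i : measurable_fun setT (slice_lim i).
Proof.
apply: measurable_funM; last exact: measurable_funM.
apply: measurable_funD => //; apply: measurable_funM; last exact: measurable_funM.
exact: measurableT_comp.
Qed.

Lemma intg_slice_dom i : intg mu setT (slice_dom i).
Proof. by apply: intgD => //; apply: intgD => //; apply: intgZl. Qed.

Let mol_dom n i x : mol (moll n) (slice_dom i) x =
  C * mol (moll n) (fun y => u y * b i y ^+ 2) x +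
  (C + 1) * mol (moll n) (fun y => u y * a i y ^+ 2) x + mol (moll n) (fun y => Q y * u y) x.
Proof.
rewrite molD//; last by apply: intg_loc; apply: intgD => //; apply: intgZl.
by rewrite molD// ?molZ//; apply: intg_loc; apply: intgZl.
Qed.

(** Applying [mol_cs] to both fluxes yields the factor [u_n] twice in the square; the bound on
    [|g1 s| * s] absorbs both. *)
Lemma gterm_le n i x : `|g1 (un n x) * bn n i x * an n i x| <=
  C * mol (moll n) (fun y => u y * b i y ^+ 2) x +
  C * mol (moll n) (fun y => u y * a i y ^+ 2) x.
Proof.
have h1 := mol_cs n x (mb i) (lib i); have h2 := mol_cs n x (ma i) (lia i).
have A0 : 0 <= mol (moll n) (fun y => u y * a i y ^+ 2) x.
  by apply: mol_ge0 => y; rewrite mulr_ge0 ?sqr_ge0.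
have B0 : 0 <= mol (moll n) (fun y => u y * b i y ^+ 2) x.
  by apply: mol_ge0 => y; rewrite mulr_ge0 ?sqr_ge0.
have U0 : 0 <= un n x by exact: mol_ge0.
apply: sqr_le_mul_norm; rewrite ?mulr_ge0//.
rewrite !exprMn -mulrA.
apply: (@le_trans _ _ (g1 (un n x) ^+ 2 * ((un n x * mol (moll n) (fun y => u y * b i y ^+ 2) x) *
  (un n x * mol (moll n) (fun y => u y * a i y ^+ 2) x)))).
  by apply: ler_wpM2l; rewrite ?sqr_ge0//; apply: ler_pM; rewrite ?sqr_ge0.
rewrite [leLHS](_ : _ = (`|g1 (un n x)| * un n x) ^+ 2 *
  (mol (moll n) (fun y => u y * b i y ^+ 2) x * mol (moll n) (fun y => u y * a i y ^+ 2) x)); last first.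
  by rewrite exprMn real_normK ?num_real//; ring.
rewrite [leRHS](_ : _ = C ^+ 2 *
  (mol (moll n) (fun y => u y * b i y ^+ 2) x * mol (moll n) (fun y => u y * a i y ^+ 2) x)); last by ring.
apply: ler_wpM2r; first by rewrite mulr_ge0.
by rewrite ler_pXn2r ?nnegrE ?mulr_ge0// hg1.
Qed.

(** Here [phi] is taken at the centre [x] while [u] is averaged around it. Since [Q] bounds [phi^2]
    over unit neighbourhoods, [phi x ^+ 2] can be moved under the mollification. *)
Lemma pterm_le n i x : `|phi i x * an n i x| <=
  mol (moll n) (fun y => Q y * u y) x + mol (moll n) (fun y => u y * a i y ^+ 2) x.
Proof.
have h2 := mol_cs n x (ma i) (lia i).
have A0 : 0 <= mol (moll n) (fun y => u y * a i y ^+ 2) x.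
  by apply: mol_ge0 => y; rewrite mulr_ge0 ?sqr_ge0.
have Q0 y : cube 1 (y - x) -> 0 <= Q y.
  by move=> c; apply: le_trans (hQ i c); exact: sqr_ge0.
have h3 : phi i x ^+ 2 * un n x <= mol (moll n) (fun y => Q y * u y) x.
  rewrite -molZ//; apply: mol_le => //.
    split; first exact: measurable_funM.
    by move=> N; apply: intgZl; [exact: measurable_cube|exact: lu.2].
  by move=> y c; rewrite ler_wpM2r// hQ.
apply: sqr_le_mul_norm => //.
  by apply: le_trans h3; rewrite mulr_ge0 ?sqr_ge0 ?mol_ge0.
rewrite exprMn; apply: (@le_trans _ _ (phi i x ^+ 2 * (un n x * mol (moll n) (fun y => u y * a i y ^+ 2) x))).
  by rewrite ler_wpM2l ?sqr_ge0.
by rewrite mulrA ler_wpM2r.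
Qed.

Lemma slice_term_le n i x : `|slice_term n i x| <= mol (moll n) (slice_dom i) x.
Proof.
rewrite /slice_term mulrDl; apply: le_trans (ler_normD _ _) _.
apply: le_trans (lerD (gterm_le n i x) (pterm_le n i x)) _.
by rewrite mol_dom le_eqVlt; apply/orP; left; apply/eqP; ring.
Qed.

Lemma intg_slice_term n i : intg mu setT (slice_term n i).
Proof.
apply: le_intg (measurable_slice_term n i) _ (intg_mol (kn n) (intg_slice_dom i)) => // x _.
exact: slice_term_le.
Qed.

Lemma slice_term_int_le n i :
  `|\int[mu]_x slice_term n i x| <= \int[mu]_x slice_dom i x.
Proof.
apply: le_trans (le_normr_Rintegral measurableT (intg_slice_term n i)) _.
have S0 y : 0 <= slice_dom i y.
  have q0 : 0 <= Q y.
    apply: le_trans (hQ i (x := y) _); first exact: sqr_ge0.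
    by rewrite subrr => j; rewrite mxE in_itv/= lerN10 ler01.
  have C10 : 0 <= C + 1 by rewrite addr_ge0.
  have uu (h : V -> R) : 0 <= u y * h y ^+ 2 by rewrite mulr_ge0 ?sqr_ge0.
  have h1 := mulr_ge0 C0 (uu (b i)); have h2 := mulr_ge0 C10 (uu (a i)).
  by have h3 := mulr_ge0 q0 (u0 y); exact: addr_ge0 (addr_ge0 h1 h2) h3.
rewrite -(ge0_mol_moll_int n (intg_slice_dom i) S0).
apply: le_Rintegral => //; first by apply: intg_norm => //; exact: intg_slice_term.
  by apply: intg_mol => //; exact: intg_slice_dom.
by move=> x _; exact: slice_term_le.
Qed.

(** Generalised dominated convergence along subsequences on which all mollifications involved
    converge almost everywhere; the majorants [mol (moll n) (slice_dom i)] converge in L^1. *)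
Lemma slice_cvg i : intg mu setT (slice_lim i) /\
  (fun n => \int[mu]_x slice_term n i x) @ \oo --> \int[mu]_x slice_lim i x.
Proof.
have ldom : loc (slice_dom i) by apply: intg_loc; exact: intg_slice_dom.
have core S : (forall N, exists2 n, (N <= n)%N & S n) ->
  exists f : nat -> nat, (forall N, (N <= f N)%N /\ S (f N)) /\
   (intg mu setT (slice_lim i) /\
   (fun k => \int[mu]_x slice_term (f k) i x) @ \oo --> \int[mu]_x slice_lim i x).
  (* [slice_dom] joins the family because the bound on the limit is obtained by letting the
     majorants converge pointwise too. *)
  move=> SS; pose fam (k : 'I_4) : V -> R := match val k with
    | 0%N => u | 1%N => (fun y => u y * a i y) | 2%N => (fun y => u y * b i y) | _ => slice_dom i end.
  have lfam k : loc (fam k).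
    rewrite /fam; case: (val k) => [//|[|[|n]]] //; exact: intg_loc.
  have [f [fS ae]] := mol_ae_cvg lfam SS; exists f; split => //.
  have foo : f @ \oo --> \oo.
    by apply/cvgnyPge => A; exists A => // k /= Ak; apply: leq_trans Ak (fS k).1.
  apply: (@gen_dominated_Rintegral _ _ _ mu setT (fun k => slice_term (f k) i)
     (fun k => mol (moll (f k)) (slice_dom i)) (slice_lim i) (slice_dom i)) => //.
  - by move=> k; exact: measurable_slice_term.
  - exact: measurable_slice_lim.
  - apply: filterS ae => x h _.
    have h0 := h (inord 0); have h1 := h (inord 1); have h2 := h (inord 2).
    rewrite /fam/= !inordK// in h0 h1 h2.
    apply: cvgM => //; apply: cvgD; last exact: cvg_cst.
    apply: cvgM => //; apply: continuous_cvg => //; exact: cg1.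
  - by move=> k x _; exact: slice_term_le.
  - apply: filterS ae => x h _.
    have h0 := h (inord 0); have h1 := h (inord 1); have h2 := h (inord 2); have h3 := h (inord 3).
    rewrite /fam/= !inordK// in h0 h1 h2 h3.
    have c : (fun k => slice_term (f k) i x) @ \oo --> slice_lim i x.
      apply: cvgM => //; apply: cvgD; last exact: cvg_cst.
      apply: cvgM => //; apply: continuous_cvg => //; exact: cg1.
    apply: ler_cvg_to (cvg_norm c) h3 _; apply: nearW => k; exact: slice_term_le.
  - by move=> k; apply: intg_mol => //; exact: intg_slice_dom.
  - exact: intg_slice_dom.
  - exact: (cvg_comp _ _ foo (mol_cvg_L1 (intg_slice_dom i))).
(* Integrability of the limit is extracted once, along all indices; convergence is then tested on
   arbitrary index sets. *)
have [|f [_ [il _]]] := core setT; first by move=> N; exists N.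
split => //; apply: cvg_subsubseq => S SS.
by have [f' [fS [_ ?]]] := core S SS; exists f'.
Qed.

(** Minus the divergence of the mollified flux, by the sign in [mol_line]. *)
Definition slice_div n (x : V) := \sum_(i < d) mol ('D_(e_ i) (moll n)) (fun y => u y * a i y) x.

Variables (Cg Cpsi : R).
Hypotheses (dg : forall s : R, 0 <= s -> is_derive s 1 g (g1 s)) (mg : measurable_fun setT g)
  (hg : forall s, 0 <= s -> `|g s| <= Cg).
Hypotheses (mpsi : measurable_fun setT psi) (hpsi : forall x, `|psi x| <= Cpsi)
  (cpsi : continuous psi)
  (dpsi : forall i (x : V) (s : R), is_derive s 1 (fun s : R => psi (x + s *: e_ i)) (phi i (x + s *: e_ i))).
Hypothesis wgu : wg u (fun i y => u y * b i y).

(** The product [(g (u_n) + psi) (u a_i)_n] is integrable, so its derivative along the i-th axis has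
    mean zero; the product rule splits this into the two sides. *)
Lemma slice_ibp n : \int[mu]_x ((g (un n x) + psi x) * slice_div n x) =
  \sum_(i < d) \int[mu]_x slice_term n i x.
Proof.
have un0 x : 0 <= un n x by exact: mol_ge0.
have Cg0 : 0 <= Cg by apply: le_trans (hg (lexx 0)).
have mP : measurable_fun setT (fun x => g (un n x) + psi x).
  by apply: measurable_funD => //; exact: measurableT_comp.
have hP x : `|g (un n x) + psi x| <= Cg + Cpsi.
  by apply: le_trans (ler_normD _ _) _; rewrite lerD// hg.
have iP f : intg mu setT f -> intg mu setT (fun x => (g (un n x) + psi x) * f x).
  move=> i_f; have mf := intg_measurable measurableT i_f.
  apply: (le_intg (g := fun x => (Cg + Cpsi) * `|f x|)) => //.
  - exact: measurable_funM.
  - by move=> x _; rewrite normrM ler_wpM2r.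
  - by apply: intgZl => //; exact: intg_norm.
have kd i : kernel_fun ('D_(e_ i) (moll n) : V -> R) by exact: kernel_derive.
have imd i : intg mu setT (mol ('D_(e_ i) (moll n)) (fun y => u y * a i y)) by exact: intg_mol.
rewrite /slice_div; under eq_Rintegral do rewrite mulr_sumr.
rewrite Rintegral_sum; [|exact: measurableT|by move=> i; exact: iP].
apply: eq_bigr => i _.
apply/esym/eqP; rewrite -subr_eq0; apply/eqP.
rewrite -RintegralB//; [|exact: intg_slice_term|exact: iP].
apply: (@integral_derive_eq0 _ _ (fun x => (g (un n x) + psi x) * an n i x) _ (e_ i)).
- by apply: iP; exact: intg_mol.
- by apply: intgB => //; [exact: intg_slice_term|exact: iP].
- move=> x s.
  have h1 := is_derive1_comp (dg (un0 (x + s *: e_ i))) (mol_wg_line i x s (kn n) lu wgu).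
  have h2 := is_deriveD h1 (dpsi i x s).
  have h3 := mol_line x (e_ i) s (kn n) (intg_loc (iua i)).
  apply: (is_derive_eq (is_deriveM h2 h3)).
  by rewrite /slice_term !fctE /GRing.scale/=; ring.
- move=> x s.
  have c1 : continuous (fun s : R => un n (x + s *: e_ i)) by exact: mol_line_cont.
  have c2 : continuous (fun s : R => an n i (x + s *: e_ i)) by apply: mol_line_cont => //; exact: intg_loc.
  have c3 : continuous (fun s : R => bn n i (x + s *: e_ i)) by apply: mol_line_cont => //; exact: intg_loc.
  have c4 : continuous (fun s : R => mol ('D_(e_ i) (moll n)) (fun y => u y * a i y) (x + s *: e_ i)).
    by apply: mol_line_cont => //; exact: intg_loc.
  have c5 : continuous (fun s : R => phi i (x + s *: e_ i)) by exact: (@continuous_line _ _ (phi i) x (e_ i) (@cphi i)).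
  have c6 : continuous (fun s : R => psi (x + s *: e_ i)) by exact: (@continuous_line _ _ psi x (e_ i) cpsi).
  apply: cvgB; apply: cvgM => //.
  + apply: cvgD; last exact: c5.
    apply: cvgM; last exact: c3.
    by apply: continuous_comp; [exact: c1|exact: cg1].
  + exact: c2.
  + apply: cvgD; last exact: c6.
    apply: continuous_comp; first exact: c1.
    by apply: differentiable_continuous; apply/derivable1_diffP; have [] := dg (un0 (x + s *: e_ i)).
  + exact: c4.
Qed.

End slice.

(** * Chain inequality along absolutely continuous curves *)

Section calculus_on_the_line.
Context {R : realType}.
Local Notation lam := (@lebesgue_measure R).

(** Continuous induction: at the supremum [c] of the times with [Phi r <= Phi s], the local
    comparison first puts [c] in this set, then pushes beyond it unless [c = t]. *)
Lemma locally_nonincreasing (Phi : R -> R) (s t : R) : s <= t ->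
  (forall p, s <= p -> p <= t -> exists2 e : R, 0 < e & forall a b, s <= a -> a <= b -> b <= t ->
     `|a - p| < e -> `|b - p| < e -> Phi b <= Phi a) -> Phi t <= Phi s.
Proof.
move=> st H; pose S := [set r | [/\ s <= r, r <= t & Phi r <= Phi s]].
have Ss : S s by [].
have ubS : ubound S t by move=> r [].
have hS : has_sup S by split; [exists s|exists t].
pose c := sup S.
have sc : s <= c by apply: ub_le_sup => //; exists t.
have ct : c <= t by apply: ge_sup => //; exists s.
have [e e0 he] := H c sc ct.
have [r [sr rt Pr] cr] := sup_adherent e0 hS.
have rc : r <= c by apply: ub_le_sup => //; exists t.
have Pc : Phi c <= Phi s.
  apply: le_trans Pr; apply: he => //; last by rewrite subrr normr0.
  by rewrite distrC ger0_norm ?subr_ge0// ltrBlDr addrC -ltrBlDr.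
have [<-//|ct'] := eqVneq c t.
have {}ct' : c < t by rewrite lt_neqAle ct'.
pose b := Num.min t (c + e / 2).
have cb : c < b by rewrite lt_min ct' ltrDl divr_gt0.
have bt : b <= t by rewrite ge_min lexx.
have : S b.
  split => //; first by rewrite (le_trans sc)// ltW.
  apply: le_trans Pc; apply: he => //; first exact: ltW.
    by rewrite subrr normr0.
  rewrite ger0_norm; last by rewrite subr_ge0 ltW.
  rewrite ltrBlDl (@le_lt_trans _ _ (c + e / 2))//; first by rewrite ge_min lexx orbT.
  by rewrite ltrD2l ltr_pdivrMr// ltr_pMr// ltr1n.
by move=> /(ub_le_sup (ex_intro _ _ ubS)) /(lt_le_trans cb); rewrite ltxx.
Qed.

Lemma Rintegral_itv_split (f : R -> R) (s a b : R) : s <= a -> a <= b ->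
  intg lam `]s, b] f ->
  \int[lam]_(r in `]s, b]) f r = \int[lam]_(r in `]s, a]) f r + \int[lam]_(r in `]a, b]) f r.
Proof.
move=> sa ab i_f; have := @Rintegral_itvB R f (BRight s) (BRight b) a i_f.
by rewrite !bnd_simp => /(_ sa ab) <-; rewrite addrC subrK.
Qed.

(* The subgradient inequality is summed over a fine partition of [[s, t]], so that [f] need not be
   differentiable. *)
Lemma convex_chain (s t : R) (f A G g : R -> R) : s <= t ->
  (forall x y, 0 <= x -> 0 <= y -> G y - G x <= g y * (y - x)) ->
  (forall r, s <= r -> r <= t -> 0 <= f r) ->
  intg lam `]s, t] A -> intg lam `]s, t] (fun r => g (f r) * A r) ->
  (forall p, s <= p -> p <= t ->
    (fun r => g (f r)) @ within `[s, t] (nbhs p) --> g (f p)) ->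
  (forall a b, s <= a -> a <= b -> b <= t -> f b - f a = \int[lam]_(r in `]a, b]) A r) ->
  G (f t) - G (f s) <= \int[lam]_(r in `]s, t]) (g (f r) * A r).
Proof.
move=> st cG f0 iA igA cg hf.
have sub a b : s <= a -> b <= t -> `]a, b]%classic `<=` `]s, t]%classic.
  move=> sa bt x /=; rewrite !in_itv/= => /andP[ax xb].
  by rewrite (le_lt_trans sa ax) (le_trans xb).
have intS h a b : s <= a -> b <= t -> intg lam `]s, t] h -> intg lam `]a, b] h.
  by move=> sa bt; apply: integrableS => //; exact: sub.
have iN : intg lam `]s, t] (fun r => `|A r|) by exact: intg_norm.
pose M := \int[lam]_(r in `]s, t]) `|A r|.
have M0 : 0 <= M by exact: Rintegral_ge0.
(* If [g (f r)] oscillates by less than [e] on the pieces, replacing its endpoint value by the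
   running one costs at most [e * M] in total. *)
suff main e : 0 < e -> G (f t) - G (f s) <= \int[lam]_(r in `]s, t]) (g (f r) * A r) + e * M.
  apply/ler_addgt0Pr => e e0.
  have M1 : 0 < M + 1 by rewrite ltr_wpDl.
  apply: le_trans (main (e / (M + 1)) (divr_gt0 e0 M1)) _.
  rewrite lerD2l mulrAC ler_pdivrMr// ler_wpM2l ?ltW//.
  by rewrite ltrDl.
move=> e0.
pose h r := g (f r) * A r + e * `|A r|.
have ih : intg lam `]s, t] h by apply: intgD => //; exact: intgZl.
pose Phi r := G (f r) - \int[lam]_(x in `]s, r]) h x.
have : Phi t <= Phi s.
  apply: locally_nonincreasing => // p sp pt.
  have := cg p sp pt; move=> /cvgrPdist_lt /(_ _ (divr_gt0 e0 (ltr0n _ 2))).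
  rewrite /= near_withinE => /nbhs_ballP[del /= del0 hd].
  exists del => // a b sa ab bt ap bp.
  have hw r : s <= r -> r <= t -> `|r - p| < del -> `|g (f p) - g (f r)| < e / 2.
    move=> sr rt rp; apply: hd; first by rewrite /ball/= distrC.
    by rewrite /= in_itv/= sr.
  rewrite /Phi; have at_ : a <= t by apply: le_trans bt.
  have sb : s <= b by apply: le_trans ab.
  rewrite (@Rintegral_itv_split h s a b)//; last exact: intS.
  rewrite opprD addrCA [X in _ <= X]addrC lerD2l lerBlDr -lerBlDl.
  apply: le_trans (cG _ _ (f0 _ sa at_) (f0 _ sb bt)) _.
  rewrite hf// -RintegralZl//; last exact: intS.
  apply: le_Rintegral => //.
  - by apply: intgZl => //; exact: intS.
  - exact: intS.
  move=> r; rewrite /= in_itv/= => /andP[ar rb].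
  have sr : s <= r by rewrite (le_trans sa)// ltW.
  have rt : r <= t by apply: le_trans bt.
  have rp : `|r - p| < del.
    move: ap bp; rewrite !ltr_norml => /andP[a1 _] /andP[_ b2].
    by apply/andP; split; [apply: lt_trans a1 _; rewrite ltrD2r|apply: le_lt_trans b2; rewrite lerD2r].
  rewrite /h -lerBlDl -mulrBl; apply: le_trans (ler_norm _) _; rewrite normrM ler_wpM2r//.
  have h1 := hw b sb bt bp; have h2 := hw r sr rt rp.
  rewrite (le_trans (ler_distD (g (f p)) _ _))// [leRHS](splitr e) lerD// ltW//.
  by rewrite distrC.
rewrite /Phi set_itvoc0 ?lexx// Rintegral_set0 subr0 lerBlDr addrC -lerBlDr => /le_trans; apply.
rewrite le_eqVlt; apply/orP; left; apply/eqP.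
by rewrite /h RintegralD//; [rewrite RintegralZl|exact: intgZl].
Qed.

Lemma smooth_bump_continuous : continuous (@smooth_bump R).
Proof. exact: (Ck_continuous (smooth_bump_Ck 0)). Qed.

Let step0 (x : R) : R := \int[lam]_(t in `]-oo, x]) smooth_bump t.

Lemma smooth_bump_intg : intg lam setT (@smooth_bump R).
Proof.
have ic : intg lam `[-1, 1] (@smooth_bump R).
  apply: continuous_compact_integrable; first exact: segment_compact.
  by apply: continuous_subspaceT; exact: smooth_bump_continuous.
have := (@integrable_mkcond _ _ _ lam _ _ (measurable_itv `[-1, 1])).1 ic.
congr (integrable _ _ _); apply/funext => x; rewrite /patch/=.
case: ifPn => // /negP xn; rewrite smooth_bump_eq0// leNgt; apply/negP => x1; apply: xn.
by rewrite inE/= in_itv/= -ler_norml ltW.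
Qed.

Let step0_derive (x : R) : is_derive x 1 step0 (smooth_bump x).
Proof.
have xx : x < x + 1 by rewrite ltrDl.
have ix : intg lam [set` Interval -oo%O (BRight (x + 1))] (@smooth_bump R).
  by apply: integrableS smooth_bump_intg.
have [d1 d2] := @continuous_FTC1 R (@smooth_bump R) -oo%O x (x + 1) xx ix (ltNyr _)
  (@smooth_bump_continuous x).
by split; [exact: d1|rewrite -derive1E d2].
Qed.

Let step0_le x y : x <= y -> exists2 c, x <= c <= y & step0 y - step0 x = smooth_bump c * (y - x).
Proof.
move=> xy; have cs : {within `[x, y], continuous step0}.
  apply: continuous_subspaceT => z; apply: differentiable_continuous; apply/derivable1_diffP.
  by have [] := step0_derive z.
by have [c ci E] := MVT_segment xy (fun z _ => step0_derive z) cs; exists c.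
Qed.

Let step0N x : x <= -1 -> step0 x = 0.
Proof.
move=> x1; rewrite /step0 /Rintegral integral0_eq// => y; rewrite /= in_itv/= => yx; congr EFin.
have y1 : y <= -1 by apply: le_trans x1.
by rewrite smooth_bump_eq0// ler0_norm; [rewrite lerNr|rewrite (le_trans y1)// lerN10].
Qed.

Let step0_gt0 : 0 < step0 1.
Proof.
have h a b : a <= b -> step0 a <= step0 b.
  move=> ab; have [c _ E] := step0_le ab.
  by rewrite -subr_ge0 E mulr_ge0 ?smooth_bump_ge0// subr_ge0.
have h0 : 0 <= step0 (- 2^-1).
  rewrite -(step0N (lexx (-1))); apply: h; rewrite lerN2 invf_le1// ler1n//.
apply: (@lt_le_trans _ _ (step0 2^-1)); last by apply: h; rewrite invf_le1// ler1n.
apply: (le_lt_trans h0); rewrite -subr_gt0.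
have hh : - 2^-1 <= 2^-1 :> R by rewrite ge0_cp// invr_ge0.
have [c /andP[c1 c2] ->] := step0_le hh; apply: mulr_gt0.
  apply: smooth_bump_gt0; apply: (@le_lt_trans _ _ 2^-1); first by rewrite ler_norml c1.
  by rewrite invf_lt1// ltr1n.
by rewrite opprK addr_gt0// invr_gt0.
Qed.

Definition smooth_step (x : R) : R := (step0 1)^-1 * step0 x.

Lemma is_derive_smooth_step (x : R) :
  is_derive x 1 smooth_step ((step0 1)^-1 * smooth_bump x).
Proof. by have := step0_derive x; exact: is_deriveZ. Qed.

Lemma smooth_step_Ck k : Ck k smooth_step.
Proof.
apply: Ck_of_derive => [x|k']; first exact: is_derive_smooth_step.
by apply: CkM; [exact: Ck_cst|exact: smooth_bump_Ck].
Qed.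

Lemma smooth_step_le x y : x <= y -> smooth_step x <= smooth_step y.
Proof.
move=> xy; have [c _ E] := step0_le xy.
rewrite ler_pM2l ?invr_gt0// -subr_ge0 E mulr_ge0 ?smooth_bump_ge0// subr_ge0//.
Qed.

Lemma smooth_step0 x : x <= -1 -> smooth_step x = 0.
Proof. by move=> x1; rewrite /smooth_step (step0N x1) mulr0. Qed.

Lemma smooth_step1 x : 1 <= x -> smooth_step x = 1.
Proof.
move=> x1; have [c /andP[c1 c2] E] := step0_le x1.
rewrite /smooth_step (_ : step0 x = step0 1) ?mulVf ?gt_eqF//.
apply/eqP; rewrite -subr_eq0 E smooth_bump_eq0 ?mul0r//.
by rewrite (le_trans c1)// ler_norm.
Qed.

Lemma smooth_step_ge0 x : 0 <= smooth_step x.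
Proof.
have [x1|/ltW x1] := leP x (-1); first by rewrite smooth_step0.
by rewrite -(smooth_step0 (lexx (-1))) smooth_step_le.
Qed.

Lemma smooth_step_le1 x : smooth_step x <= 1.
Proof.
have [x1|/ltW x1] := leP 1 x; first by rewrite smooth_step1.
by rewrite -(smooth_step1 (lexx 1)) smooth_step_le.
Qed.

Definition dsmooth_step (x : R) : R := (step0 1)^-1 * smooth_bump x.

Lemma dsmooth_step_ge0 x : 0 <= dsmooth_step x.
Proof. by rewrite mulr_ge0 ?smooth_bump_ge0 ?invr_ge0 ?ltW. Qed.

Lemma dsmooth_step_eq0 x : 1 <= `|x| -> dsmooth_step x = 0.
Proof. by move=> x1; rewrite /dsmooth_step smooth_bump_eq0// mulr0. Qed.

Lemma dsmooth_step_continuous : continuous dsmooth_step.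
Proof. by move=> x; apply: cvgM; [exact: cvg_cst|exact: smooth_bump_continuous]. Qed.

(** A smooth Heaviside step at [a], of width [2 / k]; its derivative is an approximate identity at
    [a]. *)
Definition scaled_step k a (r : R) := smooth_step (k * (r - a)).
Definition dscaled_step k a (r : R) := k * dsmooth_step (k * (r - a)).

Lemma is_derive_scaled_step k a (r : R) :
  is_derive r 1 (scaled_step k a) (dscaled_step k a r).
Proof.
have h1 : is_derive r 1 (fun x : R => k * (x - a)) (k *: (1 - 0)).
  by apply: is_deriveZ; apply: is_deriveB.
have h2 := @is_derive1_comp _ _ _ r _ _ (is_derive_smooth_step (k * (r - a))) h1.
apply: (is_derive_eq h2).
by rewrite /dscaled_step subr0 /GRing.scale/= mulr1 mulrC.
Qed.

Lemma dscaled_step_continuous k a : continuous (dscaled_step k a).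
Proof.
move=> x; apply: cvgM; first exact: cvg_cst.
apply: (@continuous_comp _ _ _ (fun x => k * (x - a)) dsmooth_step); last exact: dsmooth_step_continuous.
by apply: cvgM; [exact: cvg_cst|apply: cvgB; [exact: cvg_id|exact: cvg_cst]].
Qed.

Lemma dscaled_step_eq0 k a r : 0 < k -> k^-1 <= `|r - a| -> dscaled_step k a r = 0.
Proof.
move=> k0 h; rewrite /dscaled_step dsmooth_step_eq0 ?mulr0//.
by rewrite normrM gtr0_norm// -ler_pdivrMl// mulr1.
Qed.

Lemma dscaled_step_int k a : 0 < k ->
  \int[lam]_(r in `[a - k^-1, a + k^-1]) dscaled_step k a r = 1.
Proof.
move=> k0; have kk : a - k^-1 < a + k^-1.
  by rewrite ltrD2l gt0_cp// invr_gt0.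
rewrite /Rintegral (@continuous_FTC2 R _ (scaled_step k a))//.
- rewrite /scaled_step (addrC a (k^-1)) addrK (addrC a (- k^-1)) addrK mulrN divff ?gt_eqF// -EFinB /=.
  by rewrite (smooth_step0 (lexx _)) smooth_step1// subr0.
- by apply: continuous_subspaceT; exact: dscaled_step_continuous.
- split => [x _||].
  + by have [] := is_derive_scaled_step k a x.
  + apply: cvg_at_right_filter; apply: differentiable_continuous; apply/derivable1_diffP.
    by have [] := is_derive_scaled_step k a (a - k^-1).
  + apply: cvg_at_left_filter; apply: differentiable_continuous; apply/derivable1_diffP.
    by have [] := is_derive_scaled_step k a (a + k^-1).
- by move=> x _; rewrite derive1E; have [] := is_derive_scaled_step k a x.
Qed.

Lemma intg_supp (D I : set R) (f : R -> R) : measurable (D : set (measurableTypeR R)) ->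
  measurable (I : set (measurableTypeR R)) -> I `<=` D ->
  (forall r, D r -> ~ I r -> f r = 0) -> intg lam I f -> intg lam D f.
Proof.
move=> mD mI ID f0 i_f.
have h1 := (@integrable_mkcond _ _ _ lam I (EFin \o f) mI).1 i_f.
apply/(@integrable_mkcond _ _ _ lam D (EFin \o f) mD).
move: h1; congr (integrable _ _ _); apply/funext => x; rewrite !patchE.
case: ifPn => [/set_mem/ID/mem_set -> //|/negP xI].
by case: ifPn => // /set_mem xD /=; rewrite f0// => /mem_set.
Qed.

Lemma dscaled_step_supp k a r : 0 < k -> dscaled_step k a r != 0 -> a - k^-1 <= r <= a + k^-1.
Proof.
move=> k0; apply: contraR => hr; apply/eqP/dscaled_step_eq0 => //.
rewrite leNgt; apply: contra hr; rewrite ltr_norml => /andP[h1 h2].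
by apply/andP; split; lra.
Qed.

Lemma intg_dscaled_step (f : R -> R) (c k : R) : (forall r : R, 0 < r -> {for r, continuous f}) ->
  0 < c -> c^-1 < k -> intg lam `]0, +oo[ (fun r => dscaled_step k c r * f r).
Proof.
move=> cf c0 ck; have k0 : 0 < k by apply: lt_trans ck; rewrite invr_gt0.
have kc : k^-1 < c by rewrite invf_plt ?posrE.
have pos r : c - k^-1 <= r -> 0 < r by apply: lt_le_trans; rewrite subr_gt0.
apply: (@intg_supp _ `[c - k^-1, c + k^-1]%classic).
- exact: measurable_itv.
- exact: measurable_itv.
- by move=> r /=; rewrite !in_itv/= andbT => /andP[/pos].
- move=> r _ nr; have [->|/(dscaled_step_supp k0) h] := eqVneq (dscaled_step k c r) 0; first by rewrite mul0r.
  by exfalso; apply: nr; rewrite /= in_itv.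
apply: continuous_compact_integrable; first exact: segment_compact.
apply: continuous_in_subspaceT => r /set_mem/=; rewrite in_itv/= => /andP[/pos r0 _].
by apply: cvgM; [exact: dscaled_step_continuous|exact: cf].
Qed.

Lemma dscaled_step_approx (f : R -> R) (a : R) : 0 < a -> {for a, continuous f} ->
  (forall k, a^-1 < k -> intg lam `]0, +oo[ (fun r => dscaled_step k a r * f r)) ->
  (fun n : nat => \int[lam]_(r in `]0, +oo[) (dscaled_step n%:R a r * f r)) @ \oo --> f a.
Proof.
move=> a0 cf i_f; apply/cvgrPdist_le => e e0.
move/cvgrPdist_lt : cf => /(_ _ e0) /nbhs_ballP[del /= del0 hd].
near=> n.
have n1 : a^-1 < n%:R by near: n; exact: nbhs_infty_gtr.
have n2 : del^-1 < n%:R by near: n; exact: nbhs_infty_gtr.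
have n0 : 0 < n%:R :> R by apply: lt_trans n1; rewrite invr_gt0.
have an : n%:R^-1 < a by rewrite invf_plt ?posrE.
have dn : n%:R^-1 < del by rewrite invf_plt ?posrE.
pose I := `[a - n%:R^-1, a + n%:R^-1]%classic.
have mI := @measurable_itv R `[a - n%:R^-1, a + n%:R^-1].
have subI : I `<=` `]0, +oo[%classic.
  move=> x; rewrite /I/= !in_itv/= andbT => /andP[h _]; apply: lt_le_trans h.
  by rewrite subr_gt0.
have out r : ~ I r -> dscaled_step n%:R a r = 0.
  move=> nr; apply: dscaled_step_eq0 => //; rewrite leNgt; apply/negP => rl; apply: nr.
  rewrite /I/= in_itv/=; move: rl; rewrite ltr_norml => /andP[h1 h2].
  by rewrite lerBlDr -lerBlDl -lerN2 opprB -lerBlDl; lra.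
have -> : \int[lam]_(r in `]0, +oo[) (dscaled_step n%:R a r * f r) =
    \int[lam]_(r in I) (dscaled_step n%:R a r * f r).
  rewrite Rintegral_mkcond [RHS]Rintegral_mkcond; apply: eq_Rintegral => r _.
  rewrite !patchE; case: ifPn => [_|rn].
    by case: ifPn => // /negP; rewrite inE => /out ->; rewrite mul0r.
  by case: ifPn => // /set_mem /subI /mem_set; rewrite (negbTE rn).
have i1 : intg lam I (fun r => dscaled_step n%:R a r * f r).
  by apply: integrableS (i_f _ n1).
have i2 : intg lam I (dscaled_step n%:R a).
  apply: continuous_compact_integrable; first exact: segment_compact.
  by apply: continuous_subspaceT; exact: dscaled_step_continuous.
have -> : f a = \int[lam]_(r in I) (f a * dscaled_step n%:R a r).
  by rewrite RintegralZl// dscaled_step_int// mulr1.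
have i3 : intg lam I (fun r => f a * dscaled_step n%:R a r) by exact: intgZl.
rewrite -RintegralB//.
have i4 : intg lam I (fun r => f a * dscaled_step n%:R a r - dscaled_step n%:R a r * f r) by exact: intgB.
apply: (le_trans (le_normr_Rintegral _ i4)); first exact: measurable_itv.
rewrite -[leRHS]mulr1 -[X in _ <= _ * X](dscaled_step_int a n0) -RintegralZl//.
apply: le_Rintegral => //.
- by apply: intg_norm => //; exact: intgB.
- exact: intgZl.
move=> r; rewrite /I /= in_itv/= => /andP[h1 h2].
have d0 : 0 <= dscaled_step n%:R a r by rewrite mulr_ge0// dsmooth_step_ge0.
rewrite mulrC -mulrBr normrM mulrC (ger0_norm d0).
apply: ler_wpM2r => //.
apply/ltW/hd; rewrite /ball/=; apply: le_lt_trans dn.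
by rewrite ler_norml; apply/andP; split; lra.
Unshelve. all: by end_near. Qed.

(** The weak equation is tested with a difference of smooth steps at [a] and [b]. It tends to the
    indicator of []a, b]], while its derivative concentrates as a unit mass at [a] minus one at
    [b]. *)
Lemma time_ftc (f A : R -> R) : (forall r : R, 0 < r -> {for r, continuous f}) ->
  (forall T, 0 < T -> intg lam `]0, T] A) ->
  (forall chi : R -> R, (forall k, Ck k chi) ->
    (exists p q : R, 0 < p /\ forall r, chi r != 0 -> p <= r <= q) ->
    \int[lam]_(r in `]0, +oo[) ('D_1 chi r * f r + chi r * A r) = 0) ->
  forall a b, 0 < a -> a <= b -> f b - f a = \int[lam]_(r in `]a, b]) A r.
Proof.
move=> cf iA H a b a0 ab; have b0 : 0 < b by apply: lt_le_trans ab.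
pose chi (n : nat) r := scaled_step n%:R a r - scaled_step n%:R b r.
have Cchi n k : Ck k (chi n).
  have h c : Ck k (scaled_step n%:R c).
    have := @Ck_comp_affine R R (@GRing.scale R R n%:R) (- (n%:R * c)) smooth_step _ _ k.
    rewrite (_ : (fun x => _) = scaled_step n%:R c); last first.
      by apply/funext => x; rewrite /scaled_step mulrBr.
    apply; last exact: smooth_step_Ck.
    by move=> x; apply: cvgM; [exact: cvg_cst|exact: cvg_id].
  have -> : chi n = (fun x => scaled_step n%:R a x + (-1) * scaled_step n%:R b x).
    by apply/funext => x; rewrite mulN1r.
  by apply: CkD => //; apply: CkM => //; exact: Ck_cst.
have dchi n r : 'D_1 (chi n) r = dscaled_step n%:R a r - dscaled_step n%:R b r.
  have [_ <-] : is_derive r 1 (chi n) (dscaled_step n%:R a r - dscaled_step n%:R b r).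
    by apply: is_deriveB; exact: is_derive_scaled_step.
  by [].
have chi1 n r : `|chi n r| <= 1.
  have h1 := smooth_step_ge0 (n%:R * (r - a)); have h2 := smooth_step_le1 (n%:R * (r - a)).
  have h3 := smooth_step_ge0 (n%:R * (r - b)); have h4 := smooth_step_le1 (n%:R * (r - b)).
  by rewrite ler_norml /chi /scaled_step; apply/andP; split; lra.
have chilo n r : 0 < n%:R :> R -> r <= a - n%:R^-1 -> chi n r = 0.
  move=> n0 ra; rewrite /chi /scaled_step !smooth_step0 ?subrr//.
    rewrite -ler_pdivlMl// mulrN1; lra.
  rewrite -ler_pdivlMl// mulrN1; lra.
have chihi n r : 0 < n%:R :> R -> b + n%:R^-1 <= r -> chi n r = 0.
  move=> n0 ra; rewrite /chi /scaled_step !smooth_step1 ?subrr//.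
    rewrite -ler_pdivrMl// mulr1; lra.
  rewrite -ler_pdivrMl// mulr1; lra.
have chimid n r : 0 < n%:R :> R -> a + n%:R^-1 <= r -> r <= b - n%:R^-1 -> chi n r = 1.
  move=> n0 ra rb; rewrite /chi /scaled_step smooth_step1; last first.
    rewrite -ler_pdivrMl// mulr1; lra.
  by rewrite smooth_step0 ?subr0// -ler_pdivlMl// mulrN1; lra.
have mchi n : measurable_fun (setT : set (measurableTypeR R)) (chi n).
  apply: continuous_measurable_fun; exact: (Ck_continuous (Cchi n 0)).
have mab : measurable (`]0, +oo[%classic : set (measurableTypeR R)) by exact: measurable_itv.
(* [A] is integrable only up to finite times. Once [n] is at least 1 and above [a^-1], the test
   function lives in []0, b + 1]], so cutting [A] there changes nothing. *)
pose B r := A r * \1_(`]0, b + 1]%classic : set R) r.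
have b10 : 0 < b + 1 by rewrite addr_gt0.
have iB : intg lam `]0, +oo[ B.
  apply: (@intg_supp _ `]0, b + 1]%classic) => //.
  - by move=> r /=; rewrite !in_itv/= andbT => /andP[].
  - by move=> r _ nr; rewrite /B indicE memNset// mulr0.
  apply: (@le_intg _ _ _ lam `]0, b + 1]%classic B (fun r => `|A r|)) => //.
  - apply: measurable_funM; first by apply: intg_measurable (iA _ b10).
    by apply: measurable_funTS; exact: measurable_indic.
  - by move=> r _; rewrite normrM ler_piMr// indicE; case: (_ \in _); rewrite ?normr1 ?normr0.
  - by apply: intg_norm => //; exact: iA.
have key n r : a^-1 < n%:R -> 1 <= n%:R :> R -> chi n r * A r = chi n r * B r.
  move=> an n1; have n0 : 0 < n%:R :> R by apply: lt_le_trans n1.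
  have ninv : n%:R^-1 <= 1 :> R by rewrite invf_le1.
  rewrite /B; have [r0|r0] := leP r 0.
    by rewrite chilo ?mul0r// (le_trans r0)// subr_ge0 invf_ple ?posrE// ltW.
  have [rb|/ltW rb] := leP r (b + 1); last by rewrite chihi ?mul0r// (le_trans _ rb)// lerD2l.
  by rewrite indicE mem_set ?mulr1//= in_itv/= r0.
have i_chi n : intg lam `]0, +oo[ (fun r => chi n r * B r).
  apply: (@le_intg _ _ _ lam `]0, +oo[%classic _ (fun r => `|B r|)) => //.
  - by apply: measurable_funM; [exact: measurable_funTS|exact: intg_measurable iB].
  - by move=> r _; rewrite normrM ler_piMl.
  - exact: intg_norm.
have c1 := dscaled_step_approx a0 (cf a a0) (fun k => @intg_dscaled_step f a k cf a0).
have c2 := dscaled_step_approx b0 (cf b b0) (fun k => @intg_dscaled_step f b k cf b0).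
have c3 : (fun n => \int[lam]_(r in `]0, +oo[) (chi n r * B r)) @ \oo --> \int[lam]_(r in `]a, b]) A r.
  have -> : \int[lam]_(r in `]a, b]) A r = \int[lam]_(r in `]0, +oo[) (\1_(`]a, b]%classic : set R) r * B r).
    rewrite Rintegral_mkcond [RHS]Rintegral_mkcond; apply: eq_Rintegral => r _.
    rewrite !patchE /B !indicE; case: ifPn => [/set_mem|]; rewrite /= ?mul0r.
      rewrite in_itv/= => /andP[h1 h2].
      rewrite ifT; last by rewrite inE/= in_itv/= andbT (lt_trans a0).
      rewrite (mem_set (_ : `]0, b + 1]%classic r)) ?mulr1 ?mul1r//= in_itv/=.
      by rewrite (lt_trans a0)//= (le_trans h2)// lerDl.
    by move=> _; case: ifP.
  apply: (@dominated_Rintegral _ _ _ lam `]0, +oo[%classic (fun n r => chi n r * B r)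
    (fun r => \1_(`]a, b]%classic : set R) r * B r) (fun r => `|B r|) _ _ _ _ _ _).2 => //.
  - by move=> n; apply: measurable_funM; [exact: measurable_funTS|exact: intg_measurable iB].
  - apply: measurable_funM; last exact: intg_measurable iB.
    by apply: measurable_funTS; exact: measurable_indic.
  (* Convergence to the indicator may fail at the two endpoints, which form a null set. *)
  - have aea c : {ae lam, forall r : R, r != c}.
      exists [set c]; split; [exact: measurable_set1|exact: lebesgue_measure_set1|].
      by move=> r /= /negP; rewrite negbK => /eqP.
    have FF : Filter (almost_everywhere lam) by exact: ae_filter_ringOfSetsType.
    apply: (@filterS2 _ _ FF _ _ _ _ (aea a) (aea b)) => r ra rb r0; apply: cvgM; last exact: cvg_cst.
    have big c : 0 < c -> \forall n \near \oo, 0 < n%:R :> R /\ n%:R^-1 <= c :> R.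
      move=> c0; near=> k; have k0 : 0 < k%:R :> R by near: k; exact: nbhs_infty_gtr.
      by split=> //; rewrite invf_ple ?posrE//; near: k; exact: nbhs_infty_ger.
    apply: cvg_near_cst; rewrite indicE; move: ra; rewrite neq_lt => /orP[ra|ra].
      rewrite memNset; last by rewrite /= in_itv/= ltNge (ltW ra).
      have ra0 : 0 < a - r by rewrite subr_gt0.
      by apply: filterS (big _ ra0) => n [n0 h]; rewrite chilo//; lra.
    move: rb; rewrite neq_lt => /orP[rb|rb].
      rewrite mem_set; last by rewrite /= in_itv/= ra ltW.
      have ra0 : 0 < r - a by rewrite subr_gt0.
      have rb0 : 0 < b - r by rewrite subr_gt0.
      by apply: filterS2 (big _ ra0) (big _ rb0) => n [n0 h] [_ h']; rewrite chimid//; lra.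
    rewrite memNset; last by rewrite /= in_itv/= (leNgt r) rb andbF.
    have rb0 : 0 < r - b by rewrite subr_gt0.
    by apply: filterS (big _ rb0) => n [n0 h]; rewrite chihi//; lra.
  - by move=> n r _; rewrite normrM ler_piMl.
  - exact: intg_norm.
have c4 := cvgD (cvgB c1 c2) c3.
suff : f a - f b + \int[lam]_(r in `]a, b]) A r = 0 by move=> /eqP; rewrite addr_eq0 => /eqP E; rewrite -opprB E opprK.
apply: (cvg_unique _ (c4 _ _)) => //.
- apply: cvg_near_cst; near=> n.
  have n1 : a^-1 < n%:R by near: n; exact: nbhs_infty_gtr.
  have n2 : b^-1 < n%:R by near: n; exact: nbhs_infty_gtr.
  have n3 : 1 <= n%:R :> R by near: n; exact: nbhs_infty_ger.
  have n0 : 0 < n%:R :> R by apply: lt_le_trans n3.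
  have nb : n%:R^-1 <= a / 2.
    have a2 : 0 < a / 2 by rewrite divr_gt0.
    by rewrite invf_ple ?posrE//; near: n; exact: nbhs_infty_ger.
  apply: etrans (_ : _ = \int[lam]_(r in `]0, +oo[) ('D_1 (chi n) r * f r + chi n r * A r)) _; last apply: (H _ (Cchi n)).
    rewrite !fctE; have i1 := intg_dscaled_step cf a0 n1; have i2 := intg_dscaled_step cf b0 n2.
    have i3 := i_chi n.
    rewrite -RintegralB// -RintegralD//; last exact: intgB.
    apply: eq_Rintegral => r _; rewrite (key n r n1 n3); congr (_ + _).
    by rewrite -mulrBl dchi.
  exists (a / 2), (b + 1); split; first by rewrite divr_gt0.
  move=> r; apply: contraR; rewrite negb_and -!ltNge => /orP[ra|rb]; apply/eqP.
    by rewrite chilo//; lra.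
  rewrite chihi// (le_trans _ (ltW rb))// lerD2l invf_le1//.
Unshelve. all: by end_near. Qed.

End calculus_on_the_line.

(** * Measurability in time *)

Section time_extension.
Context {R : realType}.
Local Notation lam := (@lebesgue_measure R).

(** Initial time 0 is reached from the times [1 / (n + 1)], by integrability of [A] up to 0. *)
Lemma time_ftc_ge0 (f A : R -> R) :
  (forall a b, 0 < a -> a <= b -> f b - f a = \int[lam]_(r in `]a, b]) A r) ->
  (forall T, 0 < T -> intg lam `]0, T] A) ->
  (fun n : nat => f n.+1%:R^-1) @ \oo --> f 0 ->
  forall a b, 0 <= a -> a <= b -> f b - f a = \int[lam]_(r in `]a, b]) A r.
Proof.
move=> H iA cf a b; rewrite le_eqVlt => /predU1P[<-|]; last exact: H.
rewrite le_eqVlt => /predU1P[<-|b0].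
  by rewrite subrr set_itvoc0 ?lexx// Rintegral_set0.
have c1 : (fun n : nat => f b - f n.+1%:R^-1) @ \oo --> f b - f 0 by apply: cvgB => //; exact: cvg_cst.
have c2 : (fun n => \int[lam]_(r in `]0, b]) (\1_(`]n.+1%:R^-1, b]%classic : set R) r * A r)) @ \oo
    --> \int[lam]_(r in `]0, b]) A r.
  have mA := intg_measurable _ (iA b b0).
  apply: (@dominated_Rintegral _ _ _ lam `]0, b]%classic _ _ (fun r => `|A r|) _ _ _ _ _ _).2 => //; last 1 first.
  - by apply: intg_norm => //; exact: iA.
  - move=> n; apply: measurable_funM; last exact: mA.
    by apply: measurable_funTS; exact: measurable_indic.
  - exact: mA.
  - apply: aeW => r; rewrite /= in_itv/= => /andP[r0 rb].
    rewrite -[X in _ --> X]mul1r; apply: cvgM; last exact: cvg_cst.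
    apply: cvg_near_cst; near=> n; rewrite indicE mem_set//= in_itv/= rb andbT.
    by near: n; exact: near_infty_natSinv_lt (PosNum r0).
  - by move=> n r _; rewrite normrM ler_piMl// indicE; case: (_ \in _); rewrite ?normr1 ?normr0.
suff c3 : (fun n : nat => f b - f n.+1%:R^-1) @ \oo --> \int[lam]_(r in `]0, b]) A r.
  by apply: (cvg_unique _ c1 c3).
apply: cvg_trans c2; apply: near_eq_cvg; near=> n.
have nb : n.+1%:R^-1 <= b by apply/ltW; near: n; exact: near_infty_natSinv_lt (PosNum b0).
rewrite H ?invr_gt0// Rintegral_mkcond [RHS]Rintegral_mkcond; apply: eq_Rintegral => r _.
rewrite !patchE indicE; case: ifPn => [/set_mem|]; rewrite ?mul0r ?mul1r; last first.
  move=> /negP h; case: ifP => // /set_mem/=; rewrite in_itv/= => /andP[h1 h2].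
  exfalso; apply: h; rewrite inE/= in_itv/= h2 andbT; by apply: lt_trans h1; rewrite invr_gt0.
by move=> _; case: ifPn => _; rewrite ?mul1r ?mul0r.
Unshelve. all: by end_near. Qed.

End time_extension.

(** Time is rounded down to the grid of step [1 / (n + 1)]: the rounded functions are measurable on
    countably many strips and converge by continuity in time. *)
Lemma measurable_caratheodory {R : realType} {dd} {T : measurableType dd} (X : R -> T -> R) :
  (forall y, continuous (fun r : R => X r y)) -> (forall r, measurable_fun setT (X r)) ->
  measurable_fun setT (fun p : measurableTypeR R * T => X p.1 p.2).
Proof.
move=> cX mX.
pose q (n : nat) (r : R) : int := Num.floor (r * n.+1%:R).
pose Xn n (p : measurableTypeR R * T) := X ((q n p.1)%:~R / n.+1%:R) p.2.
apply: (@measurable_fun_cvg _ _ _ setT Xn) => [n|p _].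
- move=> _ B mB; rewrite setTI.
  rewrite [X in measurable X](_ : _ = \bigcup_(z in [set: int])
    ([set r : R | (q n r) = z] `*` (X (z%:~R / n.+1%:R) @^-1` B))); last first.
    apply/seteqP; split => [p pB|p [z _ [/= <-]]//]; by exists (q n p.1).
  apply: countable_bigcupT_measurable => [|z]; first exact: countableP.
  apply: measurableX; last by rewrite -[X in measurable X]setTI; exact: mX.
  rewrite [X in measurable X](_ : _ = `[z%:~R / n.+1%:R, (z + 1)%:~R / n.+1%:R[%classic)//.
  apply/seteqP; split => [r /= <-|r /=]; rewrite in_itv/= ?ler_pdivrMr// ?ltr_pdivlMr//.
    by rewrite /q ge_floor floorD1_gt.
  by move=> h; apply/floor_def.
- have cc : (fun n => (q n p.1)%:~R / n.+1%:R : R) @ \oo --> (p.1 : R).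
    apply/cvgrPdist_le => e e0; near=> n.
    have ne : n.+1%:R^-1 <= e :> R.
      by apply/ltW; near: n; exact: near_infty_natSinv_lt (PosNum e0).
    apply: le_trans ne; rewrite -[X in `|X - _|](@mulfK _ n.+1%:R)// -mulrBl normrM.
    rewrite [X in _ * X]ger0_norm ?invr_ge0// ler_piMl ?invr_ge0//.
    have h1 := ge_floor (p.1 * n.+1%:R : R); have h2 := floorD1_gt (p.1 * n.+1%:R : R).
    rewrite ger0_norm ?subr_ge0// lerBlDr addrC ltW//.
    by move: h2; rewrite intrD.
  exact: (cvg_comp _ (fun r : R => X r p.2) cc (cX p.2 p.1)).
Unshelve. all: by end_near. Qed.

Lemma lipschitz_continuous_real {R : realType} (f : R -> R) (C : R) :
  (forall a b, `|f a - f b| <= C * `|a - b|) -> continuous f.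
Proof.
move=> lf s; apply/cvgrPdist_le => e e0.
have C1 : 0 < `|C| + 1 by rewrite ltr_wpDl.
have e1 : 0 < e / (`|C| + 1) by rewrite divr_gt0.
have /cvgrPdist_le/(_ _ e1) : (fun z : R => z) @ s --> s by exact: cvg_id.
apply: filterS => z h; apply: le_trans (lf _ _) _.
apply: (@le_trans _ _ ((`|C| + 1) * `|s - z|)).
  by rewrite ler_wpM2r//; apply: le_trans (ler_norm _) _; rewrite lerDl.
by rewrite -ler_pdivlMl// mulrC.
Qed.

(** * Joint measurability along weakly continuous densities *)

Section weakly_continuous_densities.
Context {R : realType} {d : nat} (rho : R -> density R d).
Local Notation V := 'rV[R]_d.
Local Notation mu := (@vol R d).
Local Notation T := (measurableTypeR R).

Hypothesis wc : forall f, Cb f ->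
  {within `[0, +oo[, continuous (fun t => \int[density_prob (rho t)]_y f y)}.

Lemma density_intg (r : density R d) : intg mu setT r.
Proof.
apply/integrableP; split; first by apply/measurable_EFinP; exact: measurable_density.
rewrite (eq_integral (fun y => (r y)%:E)); last first.
  by move=> y _ /=; rewrite ger0_norm// density_ge0.
by have := density_int1 r; rewrite lebE => ->; exact: ltry.
Qed.

Lemma density_Rint1 (r : density R d) : \int[mu]_y r y = 1.
Proof. by rewrite /Rintegral; have := density_int1 r; rewrite lebE => ->. Qed.

Lemma Rintegral_density (r : density R d) (f : V -> R) (C : R) : measurable_fun setT f ->
  (forall y, `|f y| <= C) -> \int[density_prob r]_y f y = \int[mu]_y (f y * r y).
Proof.
move=> mf fC; have i1 := density_intg r; have mr := measurable_density r.
have C0 : 0 <= C by apply: le_trans (fC 0).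
have fr : intg mu setT (fun y => f y * r y).
  apply: (le_intg (g := fun y => C * r y)) => //.
  - exact: measurable_funM.
  - by move=> y _; rewrite normrM (ger0_norm (density_ge0 _ _)) ler_wpM2r// density_ge0.
  - exact: intgZl.
have fp : intg (density_prob r) setT f.
  apply: measurable_bounded_integrable => //.
    by rewrite (le_lt_trans (probability_le1 _ _))// ltry.
  exists C; split; first exact: num_real.
  by move=> x Cx y _; rewrite /= (le_trans (fC y))// ltW.
have cp : intg (density_prob r) setT (fun _ => C).
  apply: measurable_bounded_integrable => //.
    by rewrite (le_lt_trans (probability_le1 _ _))// ltry.
  exists C; split; first exact: num_real.
  by move=> x Cx y _; rewrite /= ger0_norm// ltW.
(* Adding [C] makes the integrand nonnegative, the case already known; the constant cancels
   afterwards since both total masses are 1. *)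
have h : \int[density_prob r]_y (f y + C) = \int[mu]_y ((f y + C) * r y).
  rewrite /Rintegral (ge0_integral_density r (f := fun y => (f y + C)%:E))//.
  - by apply/measurable_EFinP; apply: measurable_funD.
  - by move=> y; rewrite lee_fin -lerBlDr sub0r; have := fC y; rewrite ler_norml => /andP[].
have hc : \int[density_prob r]_y C = C.
  rewrite Rintegral_cst// -[RHS]mulr1; congr (_ * _); exact: (congr1 fine (probability_setT _)).
move: h; rewrite RintegralD// hc.
under [in X in _ = X -> _]eq_Rintegral do rewrite mulrDl.
by rewrite RintegralD//; [rewrite RintegralZl// density_Rint1 mulr1 => /addIr|exact: intgZl].
Qed.

Definition density_path (r : R) : V -> R := rho (Num.max r 0).

Lemma path_ge0 r y : 0 <= density_path r y. Proof. exact: density_ge0. Qed.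
Lemma path_measurable r : measurable_fun setT (density_path r). Proof. exact: measurable_density. Qed.
Lemma path_intg r : intg mu setT (density_path r). Proof. exact: density_intg. Qed.
Lemma path_weak_continuous f : Cb f -> continuous (fun r : R => \int[mu]_y (f y * density_path r y)).
Proof.
move=> cbf; have [cf [C fC]] := cbf.
have mf : measurable_fun setT f by exact: cont_measurable.
rewrite (_ : (fun r => _) = (fun r => \int[density_prob (rho (Num.max r 0))]_y f y)); last first.
  by apply/funext => r; rewrite (Rintegral_density _ mf fC).
move=> r; have := wc cbf => /subspace_continuousP /(_ (Num.max r 0)) H.
have m0 : `[0, +oo[%classic (Num.max r 0) by rewrite /= in_itv/= andbT le_max lexx orbT.
have cm : (fun z : R => Num.max z 0) @ r --> within `[0, +oo[ (nbhs (Num.max r 0)).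
  have cmax : {for r, continuous (fun z : R => Num.max z 0)}.
    by apply: (@continuous_max R R idfun (cst 0)); [exact: cvg_id|exact: cvg_cst].
  move=> P /= hP; change (nbhs r (fun z => P (Num.max z 0))).
  have h : nbhs r (fun z => `[0, +oo[%classic (Num.max z 0) -> P (Num.max z 0)) by exact: cmax hP.
  apply: filterS h => z; apply.
  by rewrite /= in_itv/= andbT le_max lexx orbT.
exact: (cvg_comp _ _ cm (H m0)).
Qed.

Lemma moll_Cb l (y : V) : Cb (fun z => moll l (z - y)).
Proof.
have kk : kernel_fun (moll l : V -> R) by exact: moll_kernel.
have [C C0 hC] := kernel_bounded kk.
split; first exact: test_continuous (kernel_test y kk).
exists C => z; apply: le_trans (hC _) _; apply: ler_piMr; first exact: ltW.
by rewrite indicE; case: (_ \in _).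
Qed.

Lemma measurable_mol_path l :
  measurable_fun setT (fun p : T * V => mol (moll l) (density_path p.1) p.2).
Proof.
have kk : kernel_fun (moll l : V -> R) by exact: moll_kernel.
apply: (measurable_caratheodory (X := fun r => mol (moll l) (density_path r))) => [y|r].
  rewrite (_ : (fun r => _) = (fun r => \int[mu]_z (moll l (z - y) * density_path r z))).
    exact: path_weak_continuous (moll_Cb l y).
  by apply/funext => r; apply: eq_Rintegral => z _; rewrite mulrC.
by apply: measurable_mol => //; exact: path_measurable.
Qed.

Section measurable_mol_comp.
Variables (kappa c : V -> R).
Hypotheses (kk : kernel_fun kappa) (cc : continuous c).
Local Notation pos := (fun r : T => \1_(`]0, +oo[%classic : set R) r : R).

Let mc : measurable_fun setT c. Proof. exact: cont_measurable. Qed.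
Let mk : measurable_fun setT kappa. Proof. exact: kernel_measurable. Qed.

Lemma test_kernel_bound x : exists2 C, 0 < C & forall y, `|c y * kappa (y - x)| <= C.
Proof.
have [N [C [C0 hC]]] := test_bound (kernel_test x kk).
have /compact_bounded[M [_ hM]] : compact (c @` (cube N%:R)).
  by apply: continuous_compact; [exact: continuous_subspaceT|exact: cube_compact].
have M1 : 0 < `|M| + 1 by rewrite ltr_wpDl.
exists ((`|M| + 1) * C) => [|y]; first by rewrite mulr_gt0.
rewrite normrM; have [yc|yc] := pselect (cube N%:R y).
  apply: ler_pM => //; first by apply: hM; [rewrite ltr_pwDr// ler_norm|exists y].
  by apply: le_trans (hC y) _; rewrite indicE mem_set// mulr1.
have := hC y; rewrite indicE memNset// mulr0 normr_le0 => /eqP ->.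
by rewrite normr0 mulr0 mulr_ge0// ltW.
Qed.

(** A nonlinear function of the density is not weakly continuous in time. Mollifying the density
    inside [Th] first restores joint measurability, and the Lipschitz bound removes this inner
    mollification in the limit. *)
Lemma measurable_mol_lip (Th : R -> R) (C : R) : (forall a b, `|Th a - Th b| <= C * `|a - b|) ->
  measurable_fun setT (fun p : T * V => mol kappa (fun y => c y * Th (density_path p.1 y)) p.2).
Proof.
move=> lT.
have C0 : 0 <= C by have := lT 1 0; rewrite subr0 normr1 mulr1; apply: le_trans.
have mTh : measurable_fun setT Th.
  by apply: continuous_measurable_fun; exact: lipschitz_continuous_real lT.
pose X l (p : T * V) := mol kappa (fun y => c y * Th (mol (moll l) (density_path p.1) y)) p.2.
have ml l : measurable_fun setT (X l).
  pose F (q : (T * V) * V) := c q.2 * Th (mol (moll l) (density_path q.1.1) q.2) * kappa (q.2 - q.1.2).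
  have mF : measurable_fun setT F.
    apply: measurable_funM; first apply: measurable_funM.
    - by apply: measurableT_comp => //; exact: measurable_snd.
    - apply: measurableT_comp => //.
      apply: (@measurable_comp _ _ _ _ _ _ setT (fun p : T * V => mol (moll l) (density_path p.1) p.2) setT
        (fun q : (T * V) * V => (q.1.1, q.2))) => //; first exact: measurable_mol_path.
      apply: measurable_fun_pair; last exact: measurable_snd.
      by apply: measurableT_comp; [exact: measurable_fst|exact: measurable_fst].
    - apply: (@measurable_comp _ _ _ _ _ _ setT (fun p : V * V => kappa (p.2 - p.1)) setT
        (fun q : (T * V) * V => (q.1.2, q.2))) => //; first exact: measurable_kernel_sub.
      apply: measurable_fun_pair; last exact: measurable_snd.
      by apply: measurableT_comp; [exact: measurable_snd|exact: measurable_fst].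
  exact: (measurable_Rint2 (vol (d:=d)) mF).
apply: (@measurable_fun_cvg _ _ _ setT X) => [//|[r x] _].
have [M M0 hM] := test_kernel_bound x.
have kl l : kernel_fun (moll l : V -> R) by exact: moll_kernel.
have mun l : intg mu setT (mol (moll l) (density_path r)) by apply: intg_mol => //; exact: path_intg.
have lu := intg_loc (path_intg r).
have int (h : V -> R) : intg mu setT h -> intg mu setT (fun y => c y * Th (h y) * kappa (y - x)).
  move=> ih; have lTh := loc_lip lT mTh (intg_loc ih).
  apply: loc_mol_intg => //; split; first by apply: measurable_funM => //; exact: lTh.1.
  move=> N; have /compact_bounded[M' [_ hM']] : compact (c @` (cube N%:R)).
    by apply: continuous_compact; [exact: continuous_subspaceT|exact: cube_compact].
  apply: (le_intg (g := fun y => (`|M'| + 1) * `|Th (h y)|)).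
  - exact: measurable_cube.
  - by apply: measurable_funTS; apply: measurable_funM => //; exact: lTh.1.
  - move=> y yc; rewrite normrM ler_wpM2r//; apply: hM'; last by exists y.
    by rewrite ltr_pwDr// ler_norm.
  - apply: intgZl; first exact: measurable_cube.
    by apply: intg_norm; [exact: measurable_cube|exact: lTh.2].
have i0 := int _ (path_intg r).
have cv := mol_cvg_L1 (path_intg r).
apply/cvgrPdist_le => e e0.
have MC : 0 < M * C + 1 by rewrite ltr_wpDl// mulr_ge0// ltW.
move/cvgrPdist_le : cv => /(_ _ (divr_gt0 e0 MC)); apply: filterS => l.
rewrite sub0r normrN ger0_norm ?Rintegral_ge0// => hl.
have il := int _ (mun l); have i1 := intgB measurableT il i0.
rewrite distrC (_ : X l (r, x) - _ = \int[mu]_y (c y * Th (mol (moll l) (density_path r) y) * kappa (y - x) -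
  c y * Th (density_path r y) * kappa (y - x))); last by rewrite RintegralB.
apply: (le_trans (le_normr_Rintegral measurableT i1)).
have i2 : intg mu setT (fun y => `|mol (moll l) (density_path r) y - density_path r y|).
  by apply: intg_norm => //; apply: intgB => //; exact: path_intg.
apply: (@le_trans _ _ (\int[mu]_y (M * C * `|mol (moll l) (density_path r) y - density_path r y|))).
  apply: le_Rintegral => //.
  - exact: intg_norm.
  - exact: intgZl.
  move=> y _; rewrite -mulrBl -mulrBr mulrAC normrM -mulrA.
  by apply: ler_pM => //; exact: lT.
rewrite RintegralZl//.
apply: (@le_trans _ _ ((M * C + 1) * (e / (M * C + 1)))); last by rewrite mulrC divfK// gt_eqF.
by apply: ler_pM => //; rewrite ?mulr_ge0 ?Rintegral_ge0 ?lerDl// ltW.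
Unshelve. all: by end_near. Qed.

Lemma measurable_mol_comp (Phi : R -> R) (Phi_ : nat -> R -> R) (C_ : nat -> R) :
  (forall k a b, `|Phi_ k a - Phi_ k b| <= C_ k * `|a - b|) ->
  (forall k s, 0 <= s -> `|Phi_ k s| <= `|Phi s|) ->
  (forall s, 0 <= s -> (fun k => Phi_ k s) @ \oo --> Phi s) ->
  (forall r, 0 < r -> loc (fun y => Phi (density_path r y))) ->
  measurable_fun setT (fun p : T * V => pos p.1 * mol kappa (fun y => c y * Phi (density_path p.1 y)) p.2).
Proof.
move=> lP bP cP locP.
pose X k (p : T * V) := pos p.1 * mol kappa (fun y => c y * Phi_ k (density_path p.1 y)) p.2.
have mpos : measurable_fun setT (fun p : T * V => pos p.1).
  have mpos0 : measurable_fun setT (pos : T -> R) by apply: measurable_indic; exact: measurable_itv.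
  exact: (measurableT_comp mpos0 measurable_fst).
apply: (@measurable_fun_cvg _ _ _ setT X) => [k|[r x] _].
  by apply: measurable_funM => //; exact: measurable_mol_lip (lP k).
rewrite /X/= indicE; case: (boolP (r \in _)) => [/set_mem/=|_]; last first.
  by rewrite mul0r; under eq_fun do rewrite mul0r; exact: cvg_cst.
rewrite in_itv/= andbT => r0; apply: cvgM; first exact: cvg_cst.
have lP0 := locP r r0.
have lcP : loc (fun y => c y * Phi (density_path r y)).
  split; first by apply: measurable_funM => //; exact: lP0.1.
  move=> N; have /compact_bounded[M' [_ hM']] : compact (c @` (cube N%:R)).
    by apply: continuous_compact; [exact: continuous_subspaceT|exact: cube_compact].
  apply: (le_intg (g := fun y => (`|M'| + 1) * `|Phi (density_path r y)|)).
  - exact: measurable_cube.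
  - by apply: measurable_funTS; apply: measurable_funM => //; exact: lP0.1.
  - move=> y yc; rewrite normrM ler_wpM2r//; apply: hM'; last by exists y.
    by rewrite ltr_pwDr// ler_norm.
  - apply: intgZl; first exact: measurable_cube.
    by apply: intg_norm; [exact: measurable_cube|exact: lP0.2].
have mks : measurable_fun setT (fun y : V => kappa (y - (x : V))).
  by apply: cont_measurable; exact: test_continuous (kernel_test x kk).
have lPk k : loc (fun y => Phi_ k (density_path r y)).
  apply: (loc_lip (lP k)) (intg_loc (path_intg r)).
  by apply: continuous_measurable_fun; exact: lipschitz_continuous_real (lP k).
rewrite /mol; apply: (@dominated_Rintegral _ _ _ mu setT _ _
  (fun y => `|c y * Phi (density_path r y) * kappa (y - x)|) _ _ _ _ _ _).2 => //.
- by move=> k; do 2![apply: measurable_funM => //]; exact: (lPk k).1.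
- by do 2![apply: measurable_funM => //]; exact: lP0.1.
- apply: aeW => y _; apply: cvgM; last exact: cvg_cst.
  by apply: cvgM; [exact: cvg_cst|apply: cP; exact: path_ge0].
- move=> k y _; rewrite !normrM ler_wpM2r// ler_wpM2l//; apply: bP; exact: path_ge0.
- by apply: intg_norm => //; exact: loc_mol_intg.
Unshelve. all: by end_near. Qed.

End measurable_mol_comp.

End weakly_continuous_densities.

(** * Velocity and kinetic energy *)

Lemma ae_finite_forall {R : realType} {dd} {T : measurableType dd} (mu : {measure set T -> \bar R})
    (n : nat) (P : 'I_n -> T -> Prop) :
  (forall i, {ae mu, forall x, P i x}) -> {ae mu, forall x, forall i, P i x}.
Proof.
move=> H; have := @ae_foralln _ _ _ mu (fun k x => forall i : 'I_n, val i = k -> P i x).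
move=> h; apply: filterS (h _) => [x hx i|k]; first exact: (hx _ i).
have [kn|kn] := ltnP k n.
  by apply: filterS (H (Ordinal kn)) => x Px i ik; rewrite (_ : i = Ordinal kn)//; exact: val_inj.
by apply: aeW => x i ik; exfalso; move: (ltn_ord i); rewrite ik ltnNge kn.
Qed.

(** The quotients [f / (f^2 + 1 / (k + 1))] converge to the inverse everywhere, including the zeros
    of [f], where both sides are 0 by convention. *)
Lemma measurable_inverse {R : realType} {dd} {T : measurableType dd} (f : T -> R) :
  measurable_fun setT f -> measurable_fun setT (fun x => (f x)^-1).
Proof.
move=> mf; pose F k x := f x / (f x ^+ 2 + k.+1%:R^-1).
have h0 k x : 0 < f x ^+ 2 + k.+1%:R^-1 :> R by rewrite ltr_wpDl ?sqr_ge0// invr_gt0.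
have mV (g : T -> R) (e : R) : 0 < e -> measurable_fun setT g -> (forall x, e <= g x) ->
    measurable_fun setT (fun x => (g x)^-1).
  move=> e0 mg ge; have c : continuous (fun s : R => (Num.max s e)^-1).
    move=> s; apply: cvgV; first by rewrite gt_eqF// lt_max e0 orbT.
    by apply: (@continuous_max R R idfun (cst e)); [exact: cvg_id|exact: cvg_cst].
  rewrite (_ : (fun x => _) = (fun s : R => (Num.max s e)^-1) \o g).
    by apply: measurableT_comp => //; exact: continuous_measurable_fun.
  by apply/funext => x /=; rewrite max_l.
apply: (@measurable_fun_cvg _ _ _ setT F) => [k|x _].
  apply: measurable_funM => //; apply: (mV _ k.+1%:R^-1); first by rewrite invr_gt0.
    by apply: measurable_funD => //; exact: measurable_funX.
  by move=> x; rewrite lerDr sqr_ge0.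
have [fx|fx] := eqVneq (f x) 0.
  by rewrite fx invr0; under eq_fun do rewrite /F fx mul0r; exact: cvg_cst.
rewrite [X in _ --> X](_ : _ = f x / (f x ^+ 2 + 0)); last first.
  by rewrite addr0 expr2 invfM mulrA divff// mul1r.
apply: cvgM; first exact: cvg_cst.
apply: cvgV; first by rewrite addr0 expf_eq0.
by apply: cvgD; [exact: cvg_cst|exact: cvg_harmonic].
Qed.

Section truncated_pressure.
Context {R : realType} (lambda eta m : R).
Hypotheses (l0 : 0 < lambda) (e0 : 0 < eta) (m1 : 1 < m).

Lemma dpressure_le s t : s <= t -> dpressure lambda eta m s <= dpressure lambda eta m t.
Proof.
move=> st; rewrite /dpressure lerD2l; apply: ler_wpM2l; first exact: ltW.
apply: ler_wpM2l; first by rewrite ltW// (lt_trans _ m1).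
apply: ge0_ler_powR; rewrite ?subr_ge0 ?(ltW m1)//; try by rewrite nnegrE le_max lexx orbT.
exact: le_max2.
Qed.

(** Freezing the argument above [k] makes the pressure Lipschitz, with constant its derivative at
    [k]; this supplies the approximations for measurability in time. *)
Definition pressure_trunc (k : nat) (s : R) : R := pressure lambda eta m (Num.min s k%:R).

Lemma pressure_trunc_lip k a b :
  `|pressure_trunc k a - pressure_trunc k b| <= dpressure lambda eta m k%:R * `|a - b|.
Proof.
have h a' b' : a' <= b' ->
    `|pressure_trunc k a' - pressure_trunc k b'| <= dpressure lambda eta m k%:R * `|a' - b'|.
  move=> ab; have ab' : Num.min a' k%:R <= Num.min b' k%:R by exact: le_min2.
  have cp : {within `[Num.min a' k%:R, Num.min b' k%:R], continuous (pressure lambda eta m)}.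
    by apply: continuous_subspaceT; exact: pressure_continuous.
  have [c /andP[c1 c2] E] := MVT_segment ab' (fun x _ => is_derive_pressure lambda eta m1 x) cp.
  rewrite distrC /pressure_trunc E normrM gtr0_norm ?dpressure_gt0//.
  apply: ler_pM; rewrite ?(ltW (dpressure_gt0 _ _ _ _))//.
    rewrite !bnd_simp in c1 c2.
    by apply: dpressure_le; apply: le_trans c2 _; rewrite ge_min lexx orbT.
  rewrite (distrC a') !ger0_norm ?subr_ge0//.
  by case: (leP b' k%:R) => hb; case: (leP a' k%:R) => ha; lra.
by have [ab|/ltW ab] := leP a b; [exact: h|rewrite distrC (distrC a); exact: h].
Qed.

Lemma pressure_nonneg s : 0 <= s -> 0 <= pressure lambda eta m s.
Proof. by move=> s0; rewrite addr_ge0 ?mulr_ge0 ?pospow_ge0// ltW. Qed.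

Lemma pressure_trunc_le k s : 0 <= s -> `|pressure_trunc k s| <= `|L_F lambda eta m s|.
Proof.
move=> s0; rewrite -pressureE// !ger0_norm ?pressure_nonneg//; last by rewrite le_min s0 ler0n.
have ms : Num.min s k%:R <= s by rewrite ge_min lexx.
have h := @pressure_mono _ lambda _ _ e0 m1 _ _ ms.
by rewrite -subr_ge0; apply: le_trans h; rewrite mulr_ge0 ?subr_ge0// ltW.
Qed.

Lemma pressure_trunc_cvg s : 0 <= s -> (fun k => pressure_trunc k s) @ \oo --> L_F lambda eta m s.
Proof.
move=> s0; apply: cvg_near_cst; near=> k; rewrite /pressure_trunc min_l ?pressureE//.
by near: k; exact: nbhs_infty_ger.
Unshelve. all: by end_near. Qed.

End truncated_pressure.

Section weak_gradient_representative.
Context {R : realType} {d : nat}.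
Local Notation V := 'rV[R]_d.
Local Notation mu := (@vol R d).
Local Notation e_ i := (delta_mx ord0 i : V).

Lemma wgrad_wg (w : V -> R) (G : 'I_d -> V -> R) : wg w G -> wg w (fun i y => wgrad w y ord0 i).
Proof.
move=> /wg_is_wgrad wG; apply: is_wgrad_wg; rewrite /wgrad.
by have := @xgetPex _ (fun=> 0) [set G | is_wgrad w G] (ex_intro _ _ wG).
Qed.

Lemma wgrad_ae (w : V -> R) (G : 'I_d -> V -> R) : wg w G ->
  {ae mu, forall y, forall i, wgrad w y ord0 i = G i y}.
Proof.
by move=> wG; apply: ae_finite_forall => i; exact: (wg_unique (wgrad_wg wG) wG i).
Qed.

Lemma W11loc_wg (w : V -> R) : W11loc w -> loc w /\ wg w (fun i y => wgrad w y ord0 i).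
Proof.
by move=> [lw [G wG]]; split; [exact: L1loc_loc|exact: (wgrad_wg (is_wgrad_wg wG))].
Qed.

Lemma loc_ae (f g : V -> R) : loc f -> measurable_fun setT g -> {ae mu, forall y, f y = g y} -> loc g.
Proof.
move=> [mf lf] mg fg; split => // N; apply: (ae_eq_intg _ _ _ (lf N)).
- exact: measurable_cube.
- exact: measurable_funTS.
- by apply: filterS fg => y ->.
Qed.

Lemma wg_ae w (G G' : 'I_d -> V -> R) : wg w G -> (forall i, measurable_fun setT (G' i)) ->
  {ae mu, forall y, forall i, G i y = G' i y} -> wg w G'.
Proof.
move=> [lG h] mG' GG'.
have ai i : {ae mu, forall y, G i y = G' i y} by apply: filterS GG' => y.
split => [i|phi tphi i]; first exact: loc_ae (lG i) (mG' i) (ai i).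
rewrite h//; congr (- _).
have mphi : measurable_fun setT phi by apply: cont_measurable; exact: test_continuous.
apply: ae_eq_Rintegral => //.
- by apply: measurable_funM => //; exact: (lG i).1.
- exact: measurable_funM.
- by apply: filterS (ai i) => y -> _.
Qed.

Lemma mol_ae kappa (f g : V -> R) x : kernel_fun kappa -> measurable_fun setT f ->
  measurable_fun setT g -> {ae mu, forall y, f y = g y} -> mol kappa f x = mol kappa g x.
Proof.
move=> kk mf mg fg.
have mk : measurable_fun setT (fun y : V => kappa (y - x)).
  by apply: cont_measurable; exact: test_continuous (kernel_test x kk).
apply: ae_eq_Rintegral => //; try exact: measurable_funM.
by apply: filterS fg => y -> _.
Qed.

End weak_gradient_representative.

Section velocity_identity.
Context {R : realType} {d : nat} (Psi : 'rV[R]_d -> R) (lambda eta m : R).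
Hypotheses (l0 : 0 < lambda) (e0 : 0 < eta) (m1 : 1 < m).
Local Notation V := 'rV[R]_d.
Local Notation mu := (@vol R d).
Local Notation e_ i := (delta_mx ord0 i : V).
Hypothesis CPsi : Ck 1 Psi.
Variable u : density R d.
Local Notation w := (fun y => L_F lambda eta m (u y)).
Hypothesis Ww : W11loc w.

Local Notation vel i y := (velocity Psi lambda eta m u y ord0 i).
Local Notation dPsi i := ('D_(e_ i) Psi).
Local Notation G i y := (wgrad w y ord0 i).

Lemma dPsi_continuous i : continuous (dPsi i).
Proof. by have /CkSP[_ _ /(_ (e_ i))] := CPsi; exact: Ck_continuous. Qed.

Let mdPsi i : measurable_fun setT (dPsi i).
Proof. by apply: cont_measurable; exact: dPsi_continuous. Qed.

Let mu_ : measurable_fun setT u. Proof. exact: measurable_density. Qed.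
Let u0 y : 0 <= u y. Proof. exact: density_ge0. Qed.
Let lw : loc w := (W11loc_wg Ww).1.
Let wG : wg w (fun i y => G i y) := (W11loc_wg Ww).2.
Let mG i : measurable_fun setT (fun y => G i y). Proof. exact: (wG.1 i).1. Qed.

Let dp y := dpressure lambda eta m (u y).
Let dp0 y : 0 < dp y. Proof. exact: dpressure_gt0. Qed.
Let mdp : measurable_fun setT dp.
Proof.
apply: measurableT_comp => //; apply: continuous_measurable_fun; exact: dpressure_continuous.
Qed.

Let lu : loc u := (wg_density l0 e0 m1 u0 lw wG).1.
Let wu := (wg_density l0 e0 m1 u0 lw wG).2.

(** [u^m] is read off as [(L_F u - lambda u) / eta], both terms of which already have weak
    gradients. *)
Let wum : wg (fun y => u y `^ m) (fun i y => eta^-1 * (G i y + (- lambda) * ((dp y)^-1 * G i y))).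
Proof.
have llu : loc (fun y => - lambda * u y).
  split; first exact: measurable_funM.
  by move=> N; apply: intgZl; [exact: measurable_cube|exact: lu.2].
have lD : loc (fun y => w y + - lambda * u y).
  split; first by apply: measurable_funD; [exact: lw.1|exact: llu.1].
  by move=> N; apply: intgD; [exact: measurable_cube|exact: lw.2|exact: llu.2].
have := wgZ eta^-1 lD (wgD lw llu wG (wgZ (- lambda) lu wu)).
rewrite (_ : (fun y => eta^-1 * _) = (fun y => u y `^ m))//.
apply/funext => y; rewrite /L_F mulNr (addrC (lambda * u y)) addrK mulKf//.
by rewrite gt_eqF.
Qed.

Lemma measurable_velocity i : measurable_fun setT (fun y => vel i y).
Proof.
rewrite (_ : (fun y => _) = (fun y => - (dPsi i y + lambda / u y * wgrad u y ord0 i +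
   eta / u y * wgrad (fun z => u z `^ m) y ord0 i))); last first.
  by apply/funext => y; rewrite /velocity !mxE.
have mV : measurable_fun setT (fun y => (u y)^-1).
  exact: measurable_inverse.
apply: measurableT_comp => //; apply: measurable_funD; first apply: measurable_funD => //.
- by apply: measurable_funM; [exact: measurable_funM|exact: ((wgrad_wg wu).1 i).1].
- by apply: measurable_funM; [exact: measurable_funM|exact: ((wgrad_wg wum).1 i).1].
Qed.

(** [velocity] divides by [u] and treats the two diffusion terms separately; multiplied by [u] they
    recombine into the gradient of [L_F u]. *)
Lemma velocity_ae : {ae mu, forall y, forall i,
  u y * vel i y = - (u y * dPsi i y + G i y)}.
Proof.
have h0 := @ae_finite_forall _ _ _ mu d _ (fun i => @wg_eq0 R d lambda eta m u _ lw wG i).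
apply: filterS3 (wgrad_ae wu) (wgrad_ae wum) h0 => y h1 h2 h3 i.
rewrite /velocity !mxE h1 h2; have [uy|uy] := eqVneq (u y) 0.
  (* Where [u] vanishes the left side is 0, and by [wg_eq0] so is the gradient of [L_F u]. *)
  rewrite uy !mul0r add0r h3 ?oppr0// uy /L_F mulr0 add0r powR0 ?mulr0//.
  by rewrite gt_eqF// (lt_trans _ m1).
have en : eta != 0 by rewrite gt_eqF.
have dn : dp y != 0 by rewrite gt_eqF.
rewrite -/(dp y); field; rewrite ?uy ?en ?dn//.
Qed.

(* The gradient of [u] is [u] times this field: [grad (L_F u) = dpressure u * grad u]. *)
Definition log_velocity i y := - (vel i y + dPsi i y) / dp y.

Lemma measurable_log_velocity i : measurable_fun setT (log_velocity i).
Proof.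
apply: measurable_funM; last exact: measurable_inverse.
by apply: measurableT_comp => //; apply: measurable_funD => //; exact: measurable_velocity.
Qed.

Lemma wg_log_velocity : wg u (fun i y => u y * log_velocity i y).
Proof.
apply: (wg_ae wu) => [i|]; first by apply: measurable_funM => //; exact: measurable_log_velocity.
apply: filterS velocity_ae => y h i.
rewrite /log_velocity mulrA mulrN mulrDr h opprD opprK addrAC subrr add0r mulrC.
done.
Qed.

Lemma loc_cont (c f : V -> R) : continuous c -> loc f -> loc (fun y => c y * f y).
Proof.
move=> cc lf; split; first by apply: measurable_funM; [exact: cont_measurable|exact: lf.1].
move=> N; have /compact_bounded[M' [_ hM']] : compact (c @` (cube N%:R)).
  by apply: continuous_compact; [exact: continuous_subspaceT|exact: cube_compact].
apply: (le_intg (g := fun y => (`|M'| + 1) * `|f y|)).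
- exact: measurable_cube.
- by apply: measurable_funTS; apply: measurable_funM; [exact: cont_measurable|exact: lf.1].
- move=> y yc; rewrite normrM ler_wpM2r//; apply: hM'; last by exists y.
  by rewrite ltr_pwDr// ler_norm.
- apply: intgZl; first exact: measurable_cube.
  by apply: intg_norm; [exact: measurable_cube|exact: lf.2].
Qed.

Let lflux i : loc (fun y => - (u y * dPsi i y + G i y)).
Proof.
have l1 : loc (fun y => dPsi i y * u y) by apply: loc_cont => //; exact: dPsi_continuous.
have l1' : loc (fun y => u y * dPsi i y).
  by rewrite (_ : (fun y => _) = (fun y => dPsi i y * u y))//; apply/funext => y; rewrite mulrC.
split; first by apply: measurableT_comp => //; apply: measurable_funD => //; exact: measurable_funM.
move=> N; apply: intgN; first exact: measurable_cube.
by apply: intgD; [exact: measurable_cube|exact: l1'.2|exact: (wG.1 i).2].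
Qed.

Lemma loc_flux i : loc (fun y => u y * vel i y).
Proof.
apply: (loc_ae (lflux i)); first by apply: measurable_funM => //; exact: measurable_velocity.
by apply: filterS velocity_ae => y ->.
Qed.

(** Moving the gradient onto the kernel expresses the mollified flux through [u] and [L_F u] alone.
    No choice of weak gradient is left, which makes it measurable in time. *)
Lemma mol_flux kappa i x : kernel_fun kappa ->
  mol kappa (fun y => u y * vel i y) x =
  - mol kappa (fun y => dPsi i y * u y) x + mol ('D_(e_ i) kappa) w x.
Proof.
move=> kk.
have l1 : loc (fun y => dPsi i y * u y) by apply: loc_cont => //; exact: dPsi_continuous.
rewrite (@mol_ae _ _ _ _ (fun y => - (u y * dPsi i y + G i y)))//; last first.
- by apply: filterS velocity_ae => y ->.
- exact: (lflux i).1.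
- by apply: measurable_funM => //; exact: measurable_velocity.
rewrite (mol_wg _ _ kk wG) -opprD -molD//; last exact: (wG.1 i).
rewrite -mulN1r -molZ//; last first.
  split; first by apply: measurable_funD; [exact: l1.1|exact: (wG.1 i).1].
  by move=> N; apply: intgD; [exact: measurable_cube|exact: l1.2|exact: (wG.1 i).2].
by apply: eq_Rintegral => y _; rewrite mulN1r (mulrC (u y)).
Qed.

End velocity_identity.

(** Fatou applied to [min (f_n, f)]: the hypothesis says that [f_n] is asymptotically at least [f],
    so these minima converge to [f]. *)
Lemma fatou_bound {R : realType} {dd} {T : measurableType dd} (mu : {measure set T -> \bar R})
    (f_ : nat -> T -> R) (f : T -> R) (M : \bar R) :
  (forall n, measurable_fun setT (f_ n)) -> measurable_fun setT f ->
  (forall n x, 0 <= f_ n x) -> (forall x, 0 <= f x) ->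
  {ae mu, forall x, forall e, 0 < e -> \forall n \near \oo, f x <= f_ n x + e} ->
  (forall n, \int[mu]_x (f_ n x)%:E <= M)%E -> (\int[mu]_x (f x)%:E <= M)%E.
Proof.
move=> mf_ mf f_0 f0 ae bM.
pose h n x := Num.min (f_ n x) (f x).
have mh n : measurable_fun setT (fun x => (h n x)%:E).
  by apply/measurable_EFinP; exact: measurable_minr.
have h0 n x : setT x -> (0 <= (h n x)%:E)%E by move=> _; rewrite lee_fin minr_ge0.
have -> : (\int[mu]_x (f x)%:E = \int[mu]_x limn_einf (fun n => (h n x)%:E))%E.
  apply: ae_eq_integral => //.
  - exact/measurable_EFinP.
  - rewrite (_ : (fun x => _) = (fun x => - limn_esup (fun n => (- h n x)%:E))%E).
      apply: measurableT_comp => //; apply: measurable_fun_limn_esup => n.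
      by apply/measurable_EFinP; apply: measurableT_comp => //; exact: measurable_minr.
    apply/funext => x; rewrite -limn_einfN; congr limn_einf; apply/funext => n /=.
    by rewrite opprK.
  apply: filterS ae => x hx _; apply/esym.
  suff : (fun n => (h n x)%:E) @ \oo --> (f x)%:E by move=> /cvg_limn_einf_sup [].
  apply: cvg_EFin; first exact: nearW.
  apply/cvgrPdist_le => e e0; apply: filterS (hx e e0) => n hn.
  rewrite ger0_norm ?subr_ge0 ?ge_min ?lexx ?orbT// lerBlDr -lerBlDl le_min lerBlDl addrC hn/=.
  by rewrite lerBlDr lerDl ltW.
apply: le_trans (fatou mu measurableT mh h0) _.
rewrite limn_einf_lim; apply: lime_le; first exact: is_cvg_einfs.
apply: nearW => n; apply: le_trans (bM n).
apply: (@le_trans _ _ (\int[mu]_x (h n x)%:E)%E).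
  by apply: ereal_inf_lbound; exists n => //=.
apply: ge0_le_integral => //; first exact: h0.
  exact/measurable_EFinP.
by move=> x _; rewrite lee_fin ge_min lexx.
Qed.

Section kinetic_energy.
Context {R : realType} {d : nat} (Psi : 'rV[R]_d -> R) (lambda eta m : R) (rho : R -> density R d).
Hypotheses (l0 : 0 < lambda) (e0 : 0 < eta) (m1 : 1 < m).
Local Notation V := 'rV[R]_d.
Local Notation mu := (@vol R d).
Local Notation e_ i := (delta_mx ord0 i : V).
Local Notation T := (measurableTypeR R).
Local Notation lam := (@lebesgue_measure R).
Local Notation pos := (\1_(`]0, +oo[%classic : set R) : R -> R).

Hypothesis CPsi : Ck 1 Psi.
Hypothesis wc : forall f, Cb f ->
  {within `[0, +oo[, continuous (fun t => \int[density_prob (rho t)]_y f y)}.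
Hypothesis Wrho : forall t, 0 < t -> W11loc (fun y => L_F lambda eta m (rho t y)).

(* Extending the curve by its value at 0 makes it weakly continuous on the whole line. *)
Definition rpos (r : R) : density R d := rho (Num.max r 0).
Definition vel (r : R) (i : 'I_d) (y : V) : R := velocity Psi lambda eta m (rpos r) y ord0 i.

Lemma rposE r : 0 <= r -> rpos r = rho r.
Proof. by move=> r0; rewrite /rpos max_l. Qed.

Lemma rpos_W11 r : 0 < r -> W11loc (fun y => L_F lambda eta m (rpos r y)).
Proof. by move=> r0; rewrite rposE ?ltW//; exact: Wrho. Qed.

Lemma pos_gtE r : pos r = (0 < r)%R%:R.
Proof. by rewrite indicE; congr (_%:R); congr nat_of_bool; apply/idP/idP; rewrite inE/= in_itv/= andbT. Qed.

Lemma measurable_flux kappa i : kernel_fun kappa ->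
  measurable_fun setT (fun p : T * V => pos p.1 * mol kappa (fun y => rpos p.1 y * vel p.1 i y) p.2).
Proof.
move=> kk.
have m2 := @measurable_mol_comp _ _ rho wc kappa _ kk (@dPsi_continuous R d Psi CPsi i) id (fun=> id) (fun=> 1) _ _ _ _.
have m3 := @measurable_mol_comp _ _ rho wc _ _ (kernel_derive (e_ i) kk) (@cst_continuous V R 1) (L_F lambda eta m) (pressure_trunc lambda eta m)
  (fun k => dpressure lambda eta m k%:R) (pressure_trunc_lip l0 e0 m1) (pressure_trunc_le l0 e0 m1)
  (@pressure_trunc_cvg R lambda eta m) (fun r r0 => (W11loc_wg (rpos_W11 r0)).1).
rewrite (_ : (fun p => _) = (fun p : T * V =>
  - (pos p.1 * mol kappa (fun y => 'D_(e_ i) Psi y * density_path rho p.1 y) p.2) +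
  pos p.1 * mol ('D_(e_ i) kappa) (fun y => 1 * L_F lambda eta m (density_path rho p.1 y)) p.2)).
  apply: measurable_funD => //; apply: measurableT_comp => //; apply: m2 => //.
  - by move=> k a b; rewrite mul1r.
  - by move=> s _; exact: cvg_cst.
  - by move=> r _; apply: intg_loc; exact: path_intg.
apply/funext => -[r x] /=; rewrite pos_gtE.
have [r0|r0] := ltP 0 r; last by rewrite !mul0r oppr0 addr0.
rewrite !mul1r (mol_flux l0 e0 m1 CPsi (rpos_W11 r0) i x kk); congr (_ + _).
by apply: eq_Rintegral => y _; rewrite mul1r.
Qed.

Definition kinetic (r : R) : \bar R := (\int[mu]_y (\sum_(i < d) rpos r y * vel r i y ^+ 2)%:E)%E.

Local Notation un n r := (mol (moll n) (rpos r)).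
Local Notation jn n r i := (mol (moll n) (fun y => rpos r y * vel r i y)).

(** The action [|j|^2 / u] of the mollified density and flux. Unlike [kinetic], it is visibly
    measurable in time, and [kinetic] is its supremum over [n]. *)
Definition kinetic_mol n (r : R) : \bar R :=
  (\int[mu]_x (\sum_(i < d) (pos r * jn n r i x) ^+ 2 / un n r x)%:E)%E.

Let kn n : kernel_fun (moll n : V -> R). Proof. exact: moll_kernel. Qed.

Let un0 n r x : 0 <= un n r x.
Proof. by apply: mol_ge0 => y; exact: density_ge0. Qed.

Lemma measurable_kinetic_mol n : measurable_fun setT (kinetic_mol n : T -> \bar R).
Proof.
pose F (p : T * V) := (\sum_(i < d) (pos p.1 * jn n p.1 i p.2) ^+ 2 / un n p.1 p.2)%:E.
have mF : measurable_fun setT F.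
  apply/measurable_EFinP; apply: measurable_sum => i.
  apply: measurable_funM; first by apply: measurable_funX; exact: measurable_flux.
  by apply: measurable_inverse; exact: (measurable_mol_path wc).
apply: (@measurable_fun_fubini_tonelli_F _ _ _ _ _ mu F) => //.
by move=> p; rewrite lee_fin sumr_ge0// => i _; rewrite divr_ge0 ?sqr_ge0.
Qed.

Let mrpos r : measurable_fun setT (rpos r). Proof. exact: measurable_density. Qed.
Let mvel r i : 0 < r -> measurable_fun setT (vel r i).
Proof. by move=> r0; exact: (measurable_velocity l0 e0 m1 CPsi (rpos_W11 r0)). Qed.

Let ivel0 r i y : 0 <= rpos r y * vel r i y ^+ 2.
Proof. by rewrite mulr_ge0 ?sqr_ge0 ?density_ge0. Qed.

Lemma kinetic_intg r i : 0 < r -> (kinetic r < +oo)%E ->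
  intg mu setT (fun y => rpos r y * vel r i y ^+ 2).
Proof.
move=> r0 kr; have mm j : measurable_fun setT (fun y => rpos r y * vel r j y ^+ 2).
  by apply: measurable_funM => //; apply: measurable_funX; exact: mvel.
have : intg mu setT (fun y => \sum_(i < d) rpos r y * vel r i y ^+ 2).
  apply/integrableP; split; first by apply/measurable_EFinP; exact: measurable_sum.
  rewrite (eq_integral (fun y => (\sum_(i < d) rpos r y * vel r i y ^+ 2)%:E))//.
  by move=> y _ /=; rewrite ger0_norm// sumr_ge0.
apply: le_intg => // y _; rewrite ger0_norm// (bigD1 i)//= lerDl.
by apply: sumr_ge0 => j _.
Qed.

Lemma kinetic_fine r : 0 < r -> (kinetic r < +oo)%E ->
  kinetic r = (\sum_(i < d) \int[mu]_y (rpos r y * vel r i y ^+ 2))%:E.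
Proof.
move=> r0 kr; have h i := kinetic_intg i r0 kr.
by rewrite -Rintegral_sum// -Rintegral_EFin//; exact: intg_sum.
Qed.

(** Joint convexity of [|j|^2 / u] in the form of [mol_cs], followed by conservation of mass. *)
Lemma kinetic_mol_le n r : 0 < r -> (kinetic_mol n r <= kinetic r)%E.
Proof.
move=> r0; have [->|kr] := eqVneq (kinetic r) +oo%E; first exact: leey.
have {}kr : (kinetic r < +oo)%E by rewrite lt_neqAle kr leey.
have ii i := kinetic_intg i r0 kr.
have im i : intg mu setT (mol (moll n) (fun y => rpos r y * vel r i y ^+ 2)) by exact: intg_mol.
have -> : kinetic r = (\int[mu]_x (\sum_(i < d) mol (moll n) (fun y => rpos r y * vel r i y ^+ 2) x)%:E)%E.
  rewrite kinetic_fine// Rintegral_EFin//; last exact: intg_sum.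
  rewrite Rintegral_sum//; congr (_%:E); apply: eq_bigr => i _.
  by rewrite ge0_mol_moll_int.
apply: ge0_le_integral => //.
- by move=> x _; rewrite lee_fin sumr_ge0// => i _; rewrite divr_ge0 ?sqr_ge0.
- apply/measurable_EFinP; apply: measurable_sum => i; apply: measurable_funM.
    apply: measurable_funX; apply: measurable_funM => //; apply: measurable_mol => //.
    by apply: measurable_funM => //; exact: mvel.
  by apply: measurable_inverse; apply: measurable_mol.
- by apply/measurable_EFinP; apply: measurable_sum => i; exact: intg_measurable (im i).
move=> x _; rewrite lee_fin; apply: ler_sum => i _; rewrite pos_gtE r0 mul1r.
have h := mol_cs (fun y => density_ge0 (rpos r) y) (density_intg (rpos r)) n x (mvel i r0) (intg_loc (ii i)).
(* Division by 0 gives 0, so the left side vanishes there. *)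
have [u0|u0] := eqVneq (un n r x) 0.
  by rewrite u0 invr0 mulr0; apply: mol_ge0 => y.
have up : 0 < un n r x by rewrite lt_neqAle eq_sym u0 un0.
by rewrite ler_pdivrMr// mulrC.
Qed.

(** Lower semicontinuity: Fatou along a subsequence on which density and flux converge almost
    everywhere. Where the density is 0 the limit integrand is 0. *)
Lemma kinetic_le_mol r M : 0 < r -> (forall n, kinetic_mol n r <= M)%E -> (kinetic r <= M)%E.
Proof.
move=> r0 hM.
pose fam (o : option 'I_d) : V -> R := if o is Some i then (fun y => rpos r y * vel r i y) else rpos r.
have lf o : loc (fam o).
  case: o => [i|] /=; last by apply: intg_loc; exact: density_intg.
  exact: (loc_flux l0 e0 m1 CPsi (rpos_W11 r0)).
have [|f [fS ae]] := mol_ae_cvg (S := setT) lf; first by move=> N; exists N.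
rewrite /kinetic; apply: (@fatou_bound _ _ _ mu (fun k x => \sum_(i < d) (pos r * jn (f k) r i x) ^+ 2 / un (f k) r x)
  (fun y => \sum_(i < d) rpos r y * vel r i y ^+ 2)); last 1 first.
- by move=> k; have := hM (f k); rewrite /kinetic_mol; apply.
- move=> n; apply: measurable_sum => i; apply: measurable_funM.
    apply: measurable_funX; apply: measurable_funM => //; apply: measurable_mol => //.
    by apply: measurable_funM => //; exact: mvel.
  by apply: measurable_inverse; apply: measurable_mol.
- by apply: measurable_sum => i; apply: measurable_funM => //; apply: measurable_funX; exact: mvel.
- by move=> n x; rewrite sumr_ge0// => i _; rewrite divr_ge0 ?sqr_ge0.
- by move=> x; apply: sumr_ge0.
- apply: filterS ae => x hx e ee; rewrite pos_gtE r0.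
  have hu := hx None; have hj i := hx (Some i); rewrite /= in hu hj.
  have [u0|u0] := eqVneq (rpos r x) 0.
    apply: nearW => n; rewrite big1 ?addr_ge0 ?(ltW ee) ?sumr_ge0// => [i _|i _]; last by rewrite u0 mul0r.
    by rewrite divr_ge0 ?sqr_ge0.
  have c : (fun n => \sum_(i < d) (1 * jn (f n) r i x) ^+ 2 / un (f n) r x) @ \oo -->
      \sum_(i < d) (1 * (rpos r x * vel r i x)) ^+ 2 / rpos r x.
    apply: cvg_bigsum => i; apply: cvgM; last exact: cvgV.
    by apply: cvgM; (apply: cvgM; [exact: cvg_cst|exact: hj]).
  move/cvgrPdist_le : c => /(_ _ ee); apply: filterS => n.
  rewrite (_ : \sum_(i < d) _ / rpos r x = \sum_(i < d) rpos r x * vel r i x ^+ 2); last first.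
    by apply: eq_bigr => i _; rewrite mul1r; field.
  by rewrite ler_norml => /andP[_]; rewrite lerBlDl.
Qed.

Lemma measurable_kinetic : measurable_fun (`]0, +oo[%classic : set T) kinetic.
Proof.
apply: (@eq_measurable_fun _ _ _ _ _ (fun r => esups (fun n => kinetic_mol n r) 0%N)); last first.
  by apply: measurable_funTS; apply: measurable_fun_esups => n; exact: measurable_kinetic_mol.
move=> r /set_mem/=; rewrite in_itv/= andbT => r0; apply/eqP; rewrite eq_le; apply/andP; split.
  by apply: ge_ereal_sup => _ [n /= _ <-]; exact: kinetic_mol_le.
by apply: kinetic_le_mol => // n; apply: ereal_sup_ubound; exists n.
Qed.

End kinetic_energy.

(** * Time evolution of the mollified density *)

Section smooth_affine.
Context {R : realType}.

Lemma Ck_comp_linear (V W : normedModType R) (l : {linear V -> W}) (c : W) (f : W -> R) :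
  continuous l -> (forall k, Ck k f) -> forall k, Ck k (fun x => f (l x + c)).
Proof.
move=> cl Cf k; elim: k f Cf => [|k ih] f Cf.
  split => // x; apply: continuous_comp; last exact: (Ck_continuous (Cf 0%N)).
  by apply: cvgD; [exact: cl|exact: cvg_cst].
have dl x : differentiable (fun x : V => l x + c) x.
  by apply: differentiableD; [exact: linear_differentiable|exact: differentiable_cst].
have df x : differentiable f x by have /CkSP[_ ] := Cf 1%N.
have dfl x : differentiable (fun x : V => f (l x + c)) x by exact: differentiable_comp.
apply/CkSP; split => // [x|v]; first exact: differentiable_continuous.
have -> : 'D_v (fun x => f (l x + c)) = (fun x => 'D_(l v) f (l x + c)).
  apply/funext => x.
  rewrite deriveE// (@diff_comp _ _ _ _ (fun x : V => l x + c) f)//=.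
  have -> : 'd (fun x : V => l x + c) x = l :> (V -> W).
    rewrite diffD//; last exact: linear_differentiable.
    by rewrite diff_lin// diff_cst; apply/funext => y /=; rewrite addr0.
  by rewrite deriveE.
by apply: (ih ('D_(l v) f)) => j; have /CkSP[_ _ /(_ (l v))] := Cf j.+1.
Qed.

End smooth_affine.

(** Products of a time cutoff and a translated kernel are the only test functions fed into the
    equation. *)
Lemma product_test {R : realType} {d : nat} (chi : R -> R) (kappa : 'rV[R]_d -> R) (x : 'rV[R]_d) :
  (forall k, Ck k chi) -> (exists p q : R, 0 < p /\ forall r, chi r != 0 -> p <= r <= q) ->
  kernel_fun kappa ->
  Cc_infty [set p : R * 'rV[R]_d | 0 < p.1] (fun p => chi p.1 * kappa (p.2 - x)).
Proof.
move=> Cchi [p [q [p0 hchi]]] kk; split => [k|].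
  apply: CkM.
    have := @Ck_comp_linear R (R * 'rV[R]_d)%type R (fst : {linear (R * 'rV[R]_d)%type -> R}) 0 chi _ Cchi k.
    by under eq_fun do rewrite addr0; apply => y; exact: cvg_fst.
  have := @Ck_comp_linear R (R * 'rV[R]_d)%type 'rV[R]_d (snd : {linear (R * 'rV[R]_d)%type -> 'rV[R]_d}) (- x) kappa _ kk.1 k.
  by apply => y; exact: cvg_snd.
have [_ [K [cK _ K0]]] := kernel_test x kk.
exists (`[p, q]%classic `*` K); split.
- by apply: compact_setX => //; exact: segment_compact.
- by move=> [r y] [/= + _]; rewrite in_itv/= => /andP[pr _]; apply: lt_le_trans pr.
- move=> [r y] /= nK; have [->|c0] := eqVneq (chi r) 0; first by rewrite mul0r.
  rewrite K0 ?mulr0// => Ky; apply: nK; split => //=; rewrite in_itv/=; exact: hchi.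
Qed.

Section time_evolution.
Context {R : realType} {d : nat} (Psi : 'rV[R]_d -> R) (lambda eta m : R) (rho : R -> density R d).
Hypotheses (l0 : 0 < lambda) (e0 : 0 < eta) (m1 : 1 < m).
Local Notation V := 'rV[R]_d.
Local Notation mu := (@vol R d).
Local Notation e_ i := (delta_mx ord0 i : V).
Local Notation T := (measurableTypeR R).
Local Notation lam := (@lebesgue_measure R).
Local Notation pos := (\1_(`]0, +oo[%classic : set R) : R -> R).
Local Notation vel := (vel Psi lambda eta m rho).
Local Notation rpos := (rpos rho).
Local Notation kinetic := (kinetic Psi lambda eta m rho).

Hypothesis CPsi : Ck 1 Psi.
Hypothesis wc : forall f, Cb f ->
  {within `[0, +oo[, continuous (fun t => \int[density_prob (rho t)]_y f y)}.
Hypothesis Wrho : forall t, 0 < t -> W11loc (fun y => L_F lambda eta m (rho t y)).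
Hypothesis FP : forall phi : (R * V)%type -> R,
  Cc_infty [set p : R * V | 0 < p.1] phi ->
  (\int[lam]_(t in `]0%R, +oo[) \int[mu]_y
    (rho t y * 'D_1 (fun s => phi (s, y)) t
     - dotv (rho t y *: grad Psi y + wgrad (fun z => L_F lambda eta m (rho t z)) y)
         (grad (fun z => phi (t, z)) y))%:E = 0)%E.
Hypothesis diss : forall t, 0 < t -> (\int[lam]_(r in `]0%R, t[) kinetic r < +oo)%E.

Lemma kinetic_ge0 r : (0 <= kinetic r)%E.
Proof.
apply: integral_ge0 => y _; rewrite lee_fin sumr_ge0// => i _.
by rewrite mulr_ge0 ?sqr_ge0 ?density_ge0.
Qed.

Let sub_pos t : (`]0, t]%classic : set T) `<=` (`]0, +oo[%classic : set T).
Proof. by move=> r /=; rewrite !in_itv/= andbT => /andP[]. Qed.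

Lemma kinetic_integrable t : 0 < t -> lam.-integrable `]0, t] kinetic.
Proof.
move=> t0.
have mk (D : set T) : measurable D -> D `<=` (`]0, +oo[%classic : set T) -> measurable_fun D kinetic.
  move=> mD sD; apply: (measurable_funS _ sD (measurable_kinetic l0 e0 m1 CPsi wc Wrho)) => //.
apply/integrableP; split; first by apply: mk => //; exact: sub_pos.
(* [diss] concerns right-open intervals, so the endpoint [t] is reached by passing to [t + 1]. *)
have t1 : 0 < t + 1 by rewrite addr_gt0.
apply: le_lt_trans (diss t1).
have -> : (\int[lam]_(r in `]0%R, t]) `|kinetic r| = \int[lam]_(r in `]0%R, t]) kinetic r)%E.
  by apply: eq_integral => r _; rewrite gee0_abs ?kinetic_ge0.
apply: ge0_subset_integral => //.
- by apply: mk => // r /=; rewrite !in_itv/= andbT => /andP[].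
- by move=> r _; exact: kinetic_ge0.
- move=> r /=; rewrite !in_itv/= => /andP[-> rt]/=; apply: le_lt_trans rt _.
  by rewrite ltrDl.
Qed.

Lemma kinetic_ae t : 0 < t -> {ae lam, forall r : T, `]0, t]%classic r -> (kinetic r < +oo)%E}.
Proof.
move=> t0; have := integrable_ae _ (kinetic_integrable t0); move=> /(_ (measurable_itv _)).
by apply: filterS => r h rt; have := h rt; rewrite fin_numE => /andP[_]; rewrite lt_neqAle leey andbT.
Qed.

Lemma kinetic_fine_intg t : 0 < t -> intg lam `]0, t] (fun r => fine (kinetic r)).
Proof.
move=> t0; have ik := kinetic_integrable t0.
have mk : measurable_fun (`]0, t]%classic : set T) kinetic.
  by apply: measurable_int ik.
have mf : measurable_fun (`]0, t]%classic : set T) (fun r => fine (kinetic r)).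
  by apply: measurableT_comp mk.
apply/integrableP; split; first exact/measurable_EFinP.
have /integrableP[_] := ik; apply: le_lt_trans.
apply: ge0_le_integral => //.
- by apply: measurableT_comp => //; exact/measurable_EFinP.
- exact: measurableT_comp.
move=> r _ /=; have := kinetic_ge0 r; case: (kinetic r) => [k| |] //= k0.
by rewrite normr0 leey.
Qed.

(** Minus the divergence of the mollified flux, hence the time derivative of the mollified
    density. *)
Definition flux_div (kappa : V -> R) (r : R) (x : V) : R :=
  \sum_(i < d) mol ('D_(e_ i) kappa) (fun y => rpos r y * vel r i y) x.

Lemma measurable_flux_div kappa : kernel_fun kappa ->
  measurable_fun setT (fun p : T * V => pos p.1 * flux_div kappa p.1 p.2).
Proof.
move=> kk; rewrite /flux_div; under eq_fun do rewrite mulr_sumr.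
apply: measurable_sum => i.
exact: (measurable_flux l0 e0 m1 CPsi wc Wrho i (kernel_derive (e_ i) kk)).
Qed.

Lemma flux_intg r i : 0 < r -> (kinetic r < +oo)%E ->
  intg mu setT (fun y => rpos r y * vel r i y) /\
  \int[mu]_y `|rpos r y * vel r i y| <= 1 + \int[mu]_y (rpos r y * vel r i y ^+ 2).
Proof.
move=> r0 kr; have ii := kinetic_intg l0 e0 m1 CPsi Wrho i r0 kr.
have mv := measurable_velocity l0 e0 m1 CPsi (rpos_W11 Wrho r0) i.
have iu := density_intg (rpos r).
have iv := intg_cs (fun y => density_ge0 (rpos r) y) iu mv ii; split => //.
rewrite -(density_Rint1 (rpos r)) -RintegralD//; apply: le_Rintegral => //.
- exact: intg_norm.
- exact: intgD.
move=> y _; rewrite -{2}(mulr1 (rpos r y)) -mulrDr normrM (ger0_norm (density_ge0 _ _)).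
apply: ler_wpM2l; first exact: density_ge0.
by apply: sqr_le_mul_norm; rewrite ?sqr_ge0// mul1r.
Qed.

(** Uniform in [x]: the derivative kernels are bounded, and the L^1 norm of each flux component is
    at most the mass 1 plus its kinetic energy. *)
Lemma flux_div_bound kappa : kernel_fun kappa -> exists2 C, 0 <= C &
  forall r x, 0 < r -> (kinetic r < +oo)%E -> `|flux_div kappa r x| <= C * (d%:R + fine (kinetic r)).
Proof.
move=> kk.
have hC i : exists C, 0 <= C /\ forall y, `|'D_(e_ i) kappa y| <= C.
  have [C C0 hC] := kernel_bounded (kernel_derive (e_ i) kk).
  exists C; split; first exact: ltW.
  move=> y; apply: le_trans (hC y) _; apply: ler_piMr; first exact: ltW.
  by rewrite indicE; case: (_ \in _).
have [C_ hC_] := choice hC.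
pose C := \sum_(i < d) C_ i.
have CC i : C_ i <= C.
  by rewrite /C (bigD1 i)//= lerDl sumr_ge0// => j _; exact: (hC_ j).1.
exists C; first by rewrite sumr_ge0// => i _; exact: (hC_ i).1.
move=> r x r0 kr; have C0 : 0 <= C by rewrite sumr_ge0// => i _; exact: (hC_ i).1.
apply: (@le_trans _ _ (\sum_(i < d) C * (1 + \int[mu]_y (rpos r y * vel r i y ^+ 2)))); last first.
  rewrite -mulr_sumr big_split/= (kinetic_fine l0 e0 m1 CPsi Wrho r0 kr)/=.
  by rewrite sumr_const card_ord.
apply: le_trans (ler_norm_sum _ _ _) _; apply: ler_sum => i _.
have [iv hv] := flux_intg i r0 kr.
apply: (@le_trans _ _ (C * \int[mu]_y `|rpos r y * vel r i y|)); last exact: ler_wpM2l.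
have ik := loc_mol_intg x (kernel_derive (e_ i) kk) (intg_loc iv).
apply: le_trans (le_normr_Rintegral measurableT ik) _.
rewrite -RintegralZl//; last exact: intg_norm.
apply: le_Rintegral => //; first exact: intg_norm.
  by apply: intgZl => //; exact: intg_norm.
move=> y _; rewrite normrM mulrC ler_wpM2r//.
by apply: le_trans (CC i); exact: (hC_ i).2.
Qed.

Lemma flux_div_intg kappa x t : kernel_fun kappa -> 0 < t ->
  intg lam `]0, t] (fun r => flux_div kappa r x).
Proof.
move=> kk t0; have [C C0 hC] := flux_div_bound kk.
apply: (@le_intg_ae _ _ _ lam `]0, t]%classic _ (fun r => C * (d%:R + fine (kinetic r)))) => //.
- apply: (@eq_measurable_fun _ _ _ _ _ (fun r => pos r * flux_div kappa r x)).
    by move=> r /set_mem/=; rewrite in_itv/= pos_gtE => /andP[-> _]; rewrite mul1r.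
  apply: measurable_funTS.
  apply: (@measurable_comp _ _ _ _ _ _ setT (fun p : T * V => pos p.1 * flux_div kappa p.1 p.2) setT
    (fun r : T => (r, x))) => //; first exact: measurable_flux_div.
- apply: filterS (kinetic_ae t0) => r h rt; apply: hC; last exact: h.
  by move: rt; rewrite /= in_itv/= => /andP[].
- apply: intgZl => //; apply: intgD => //; last exact: kinetic_fine_intg.
  apply: measurable_bounded_integrable => //.
  + by rewrite /= lebesgue_measure_itv/=; case: ifP => _; rewrite ?ltry// -EFinD ltry.
  + by exists d%:R; split => [|z dz y _]; [exact: num_real|rewrite /= ger0_norm// ltW].
Qed.

(** With a product test function the space integral separates, and [velocity_ae] converts the
    gradient in the equation into the flux [u v]. *)
Lemma weak_identity (chi : R -> R) kappa x t : kernel_fun kappa -> (forall k, Ck k chi) -> 0 < t ->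
  (\int[mu]_y (rho t y * 'D_1 (fun s => chi s * kappa (y - x)) t
     - dotv (rho t y *: grad Psi y + wgrad (fun z => L_F lambda eta m (rho t z)) y)
         (grad (fun z => chi t * kappa (z - x)) y))%:E =
  ('D_1 chi t * mol kappa (rpos t) x + chi t * flux_div kappa t x)%:E)%E.
Proof.
move=> kk Cchi t0; have rt : rpos t = rho t by rewrite rposE// ltW.
have Ww := rpos_W11 Wrho t0; have [lw wG] := W11loc_wg Ww.
have lu := intg_loc (density_intg (rpos t)).
have lf i := loc_flux l0 e0 m1 CPsi Ww i.
have i1 := loc_mol_intg x kk lu.
have i2 i := loc_mol_intg x (kernel_derive (e_ i) kk) (lf i).
have dchi y : 'D_1 (fun s => chi s * kappa (y - x)) t = 'D_1 chi t * kappa (y - x).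
  have dc : derivable chi t 1.
    by apply/derivable1_diffP; have /CkSP[_ + _] := Cchi 1%N; apply.
  have h : is_derive t 1 (fun s => kappa (y - x) * chi s) (kappa (y - x) *: 'D_1 chi t).
    by apply: is_deriveZ; exact: derivableP.
  rewrite (_ : (fun s => _) = (fun s => kappa (y - x) * chi s)); last by apply/funext => s; rewrite mulrC.
  by have [_ ->] := h; rewrite /GRing.scale/= mulrC.
have dk i y : 'D_(e_ i) (fun z => chi t * kappa (z - x)) y = chi t * 'D_(e_ i) kappa (y - x).
  have dkap : derivable (fun z => kappa (z - x)) y (e_ i).
    by apply: diff_derivable; apply: differentiable_shift; have /CkSP[_ + _] := kk.1 1%N; apply.
  have h : is_derive y (e_ i) (fun z => chi t * kappa (z - x)) (chi t *: 'D_(e_ i) (fun z => kappa (z - x)) y).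
    by apply: is_deriveZ; exact: derivableP.
  by have [_ ->] := h; rewrite derive_shift.
pose F y := 'D_1 chi t * (rpos t y * kappa (y - x)) +
  chi t * \sum_(i < d) (rpos t y * velocity Psi lambda eta m (rpos t) y ord0 i * 'D_(e_ i) kappa (y - x)).
have mks g : kernel_fun g -> measurable_fun setT (fun y : V => g (y - x)).
  by move=> kg; apply: cont_measurable; exact: test_continuous (kernel_test x kg).
have iF : intg mu setT F.
  apply: intgD => //; apply: intgZl => //; exact: intg_sum.
transitivity (\int[mu]_y (F y)%:E)%E; last first.
  rewrite Rintegral_EFin// RintegralD//; [|exact: intgZl|by apply: intgZl => //; exact: intg_sum].
  by rewrite !RintegralZl//; [rewrite Rintegral_sum|exact: intg_sum].
pose F1 y := rpos t y * ('D_1 chi t * kappa (y - x)) - \sum_(i < d)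
  (rpos t y * 'D_(e_ i) Psi y + wgrad (fun z => L_F lambda eta m (rpos t z)) y ord0 i) *
  (chi t * 'D_(e_ i) kappa (y - x)).
have mr : measurable_fun setT (rpos t) by exact: measurable_density.
have mF1 : measurable_fun setT F1.
  apply: measurable_funB; first by apply: measurable_funM => //; apply: measurable_funM => //; exact: mks.
  apply: measurable_sum => i; apply: measurable_funM; last first.
    by apply: measurable_funM => //; exact: (mks _ (kernel_derive (e_ i) kk)).
  apply: measurable_funD; last exact: (wG.1 i).1.
  by apply: measurable_funM => //; apply: cont_measurable; exact: dPsi_continuous.
rewrite (eq_integral (fun y => (F1 y)%:E)); last first.
  move=> y _; congr (_%:E); rewrite /F1 dchi -rt; congr (_ - _).
  by apply: eq_bigr => i _; rewrite !mxE dk.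
apply: ae_eq_integral => //.
- exact/measurable_EFinP.
- by apply/measurable_EFinP; exact: intg_measurable iF.
suff H : {ae mu, forall y, F1 y = F y} by apply: filterS H => y -> _.
have hv := @velocity_ae R d Psi lambda eta m l0 e0 m1 (rpos t) Ww; apply: filterS hv => y h; rewrite /F1 /F.
congr (_ + _); first by ring.
rewrite -sumrN mulr_sumr; apply: eq_bigr => i _.
by rewrite h; ring.
Qed.

(** For fixed [x] the mollified density is continuous in time by weak continuity, and
    [weak_identity] identifies its distributional derivative with an integrable function. *)
Lemma mollified_ftc kappa x : kernel_fun kappa -> forall a b, 0 <= a -> a <= b ->
  mol kappa (rpos b) x - mol kappa (rpos a) x = \int[lam]_(r in `]a, b]) flux_div kappa r x.
Proof.
move=> kk; have cf : continuous (fun r : R => mol kappa (rpos r) x).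
  rewrite (_ : (fun r => _) = (fun r => \int[mu]_z (kappa (z - x) * density_path rho r z))).
    apply: path_weak_continuous => //; have [C C0 hC] := kernel_bounded kk.
    split; first exact: test_continuous (kernel_test x kk).
    exists C => z; apply: le_trans (hC _) _; apply: ler_piMr; first exact: ltW.
    by rewrite indicE; case: (_ \in _).
  by apply/funext => r; apply: eq_Rintegral => z _; rewrite mulrC.
apply: time_ftc_ge0.
- apply: time_ftc => [r _|t t0|chi Cchi sc]; [exact: cf|exact: flux_div_intg|].
  have := FP (product_test x Cchi sc kk).
  suff -> : (\int[lam]_(t in `]0%R, +oo[) \int[mu]_y
    (rho t y * 'D_1 (fun s => chi s * kappa (y - x)) t
     - dotv (rho t y *: grad Psi y + wgrad (fun z => L_F lambda eta m (rho t z)) y)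
         (grad (fun z => chi t * kappa (z - x)) y))%:E =
    \int[lam]_(r in `]0%R, +oo[) ('D_1 chi r * mol kappa (rpos r) x + chi r * flux_div kappa r x)%:E)%E.
    by rewrite /Rintegral => ->.
  apply: eq_integral => r /set_mem/=; rewrite in_itv/= andbT => r0; exact: weak_identity.
- by move=> t t0; exact: flux_div_intg.
- apply: (cvg_comp _ _ (@cvg_harmonic R) (cf 0)).
Qed.

End time_evolution.

(** * Energy inequality for regularised entropies *)

(** Young's inequality, through a constant even majorant on the unit cube. *)
Lemma mol_L1_bound {R : realType} {d : nat} (kappa : 'rV[R]_d -> R) : kernel_fun kappa ->
  exists2 C, 0 <= C & forall f, intg (@vol R d) setT f ->
    \int[@vol R d]_x `|mol kappa f x| <= C * \int[@vol R d]_x `|f x|.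
Proof.
move=> kk; have [C C0 hC] := kernel_bounded kk.
pose k (y : 'rV[R]_d) := C * \1_(cube 1) y.
have mc : measurable (@cube R d 1) by exact: measurable_cube.
have mk : measurable_fun setT k by apply: measurable_funM => //; exact: measurable_indic.
have k0 y : 0 <= k y by rewrite mulr_ge0 ?(ltW C0)// indicE.
have ik : intg (@vol R d) setT k by apply: intgZl => //; apply: intg_indic => //; exact: vol_cube_lty.
have kN y : k (- y) = k y.
  rewrite /k !indicE; congr (_ * _%:R); congr nat_of_bool.
  apply/idP/idP => /set_mem h; apply/mem_set => i; have := h i; rewrite !mxE !in_itv/= => /andP[h1 h2].
    by apply/andP; split; lra.
  by apply/andP; split; lra.
exists (\int[@vol R d]_y k y) => [|f i_f]; first exact: Rintegral_ge0.
have mf := intg_measurable measurableT i_f.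
have inf : intg (@vol R d) setT (fun x => `|f x|) by exact: intg_norm.
have mnf : measurable_fun setT (fun x => `|f x|) by exact: measurableT_comp.
rewrite -lee_fin -Rintegral_EFin//; last by apply: intg_norm => //; exact: intg_mol.
rewrite EFinM muleC -!Rintegral_EFin// -(ge0_integral_even mk mnf k0 _ kN)//.
have mF : measurable_fun setT (fun x : 'rV[R]_d => \int[@vol R d]_y (`|f y| * k (y - x))%:E)%E.
  pose F (p : 'rV[R]_d * 'rV[R]_d) := (`|f p.2| * k (p.2 - p.1))%:E.
  apply: (@measurable_fun_fubini_tonelli_F _ _ _ _ _ (@vol R d) F).
    apply/measurable_EFinP; apply: measurable_funM; last exact: measurable_kernel_sub.
    by apply: (measurableT_comp mnf measurable_snd).
  by move=> p; rewrite lee_fin mulr_ge0.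
apply: ge0_le_integral => //.
- by apply/measurable_EFinP; apply: measurableT_comp => //; exact: measurable_mol.
- move=> x _; have il := loc_mol_intg x kk (intg_loc i_f).
  have mks : measurable_fun setT (fun y : 'rV[R]_d => k (y - (x : 'rV[R]_d))).
    by apply: (measurableT_comp mk); exact: measurable_subr.
  apply: (@le_trans _ _ (\int[@vol R d]_y `|f y * kappa (y - x)|)%:E).
    by rewrite lee_fin; exact: le_normr_Rintegral.
  rewrite -Rintegral_EFin//; last exact: intg_norm.
  apply: ge0_le_integral => //.
  + by apply/measurable_EFinP; apply: measurableT_comp => //; exact: intg_measurable il.
  + by apply/measurable_EFinP; exact: measurable_funM.
  + by move=> y _; rewrite lee_fin normrM ler_wpM2l.
Qed.

(** Clamping each [f_n] between [- |g|] and [|g|] makes the domination pointwise and changes [f_n]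
    only on a null set. *)
Lemma dominated_Rintegral_ae {R : realType} {dd} {T : measurableType dd}
    (mu : {measure set T -> \bar R}) (D : set T) (f_ : nat -> T -> R) (f g : T -> R) :
  measurable D -> (forall n, measurable_fun D (f_ n)) -> measurable_fun D f ->
  {ae mu, forall x, D x -> f_ ^~ x @ \oo --> f x} ->
  (forall n, {ae mu, forall x, D x -> `|f_ n x| <= g x}) -> intg mu D g ->
  (fun n => \int[mu]_(x in D) f_ n x) @ \oo --> \int[mu]_(x in D) f x.
Proof.
move=> mD mf_ mf cf bf ig; have mg := intg_measurable mD ig.
pose c n x := Num.max (- `|g x|) (Num.min (f_ n x) `|g x|).
have mc n : measurable_fun D (c n).
  apply: measurable_maxr; first by do 2!apply: measurableT_comp => //.
  by apply: measurable_minr => //; exact: measurableT_comp.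
have cE n x : `|f_ n x| <= g x -> c n x = f_ n x.
  move=> h; have h' : `|f_ n x| <= `|g x| by apply: le_trans h (ler_norm _).
  by move: h'; rewrite ler_norml => /andP[h1 h2]; rewrite /c (min_l h2) (max_r h1).
have bfn : {ae mu, forall x, forall n, D x -> `|f_ n x| <= g x} by exact: ae_foralln.
have -> : (fun n => \int[mu]_(x in D) f_ n x) = (fun n => \int[mu]_(x in D) c n x).
  apply/funext => n; apply: ae_eq_Rintegral => //.
  by apply: filterS bfn => x h Dx; rewrite cE//; exact: h.
apply: (dominated_Rintegral mD mc mf _ (g := fun x => `|g x|) _ _).2.
- apply: filterS2 bfn cf => x h h' Dx; rewrite (_ : (fun n => c n x) = f_ ^~ x); first exact: h'.
  by apply/funext => n; rewrite cE//; exact: h.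
- move=> n x _; rewrite /c ler_norml; apply/andP; split; first by rewrite le_max lexx.
  by rewrite ge_max ge_min lexx orbT andbT ge0_cp.
- exact: intg_norm.
Qed.

Section energy_inequality.
Context {R : realType} {d : nat} (Psi : 'rV[R]_d -> R) (lambda eta m : R) (rho : R -> density R d).
Hypotheses (l0 : 0 < lambda) (e0 : 0 < eta) (m1 : 1 < m).
Local Notation V := 'rV[R]_d.
Local Notation mu := (@vol R d).
Local Notation e_ i := (delta_mx ord0 i : V).
Local Notation T := (measurableTypeR R).
Local Notation lam := (@lebesgue_measure R).
Local Notation pos := (\1_(`]0, +oo[%classic : set R) : R -> R).
Local Notation vel := (vel Psi lambda eta m rho).
Local Notation rpos := (rpos rho).
Local Notation kinetic := (kinetic Psi lambda eta m rho).
Local Notation flux_div := (flux_div Psi lambda eta m rho).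

Hypothesis CPsi : Ck 1 Psi.
Hypothesis wc : forall f, Cb f ->
  {within `[0, +oo[, continuous (fun t => \int[density_prob (rho t)]_y f y)}.
Hypothesis Wrho : forall t, 0 < t -> W11loc (fun y => L_F lambda eta m (rho t y)).
Hypothesis FP : forall phi : (R * V)%type -> R,
  Cc_infty [set p : R * V | 0 < p.1] phi ->
  (\int[lam]_(t in `]0%R, +oo[) \int[mu]_y
    (rho t y * 'D_1 (fun s => phi (s, y)) t
     - dotv (rho t y *: grad Psi y + wgrad (fun z => L_F lambda eta m (rho t z)) y)
         (grad (fun z => phi (t, z)) y))%:E = 0)%E.
Hypothesis diss : forall t, 0 < t -> (\int[lam]_(r in `]0%R, t[) kinetic r < +oo)%E.

(** [Q] bounds the squared gradient of [Psi] over unit neighbourhoods; it will be quadratic, so [bQ]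
    is a bound on second moments. *)
Variable Q : V -> R.
Hypotheses (mQ : measurable_fun setT Q)
  (hQ : forall i (x y : V), cube 1 (y - x) -> 'D_(e_ i) Psi x ^+ 2 <= Q y)
  (iQ : forall r, 0 <= r -> intg mu setT (fun y => Q y * rpos r y))
  (bQ : forall t, exists M, forall r, 0 <= r -> r <= t -> \int[mu]_y (Q y * rpos r y) <= M).

Variables (G g g1 : R -> R) (C Cg : R).
Hypotheses (mg1 : measurable_fun setT g1) (cg1 : forall s, 0 <= s -> {for s, continuous g1})
  (hg1 : forall s, 0 <= s -> `|g1 s| * s <= C)
  (dg : forall s : R, 0 <= s -> is_derive s 1 g (g1 s)) (mg : measurable_fun setT g)
  (hg : forall s, 0 <= s -> `|g s| <= Cg)
  (G0 : G 0 = 0) (mG : measurable_fun setT G)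
  (convG : forall x y, 0 <= x -> 0 <= y -> G y - G x <= g y * (y - x)).
Variables (psi : V -> R) (phi : 'I_d -> V -> R) (Cpsi : R).
Hypotheses (cphi : forall i, continuous (phi i))
  (hphi : forall i x, phi i x ^+ 2 <= 'D_(e_ i) Psi x ^+ 2)
  (mpsi : measurable_fun setT psi) (hpsi : forall x, `|psi x| <= Cpsi) (cpsi : continuous psi)
  (dpsi : forall i (x : V) (s : R),
    is_derive s 1 (fun s : R => psi (x + s *: e_ i)) (phi i (x + s *: e_ i))).

(* Times at which the dissipation is finite: almost all of them. *)
Definition good (r : R) := 0 < r /\ (kinetic r < +oo)%E.

Definition logvel (r : R) (i : 'I_d) (y : V) : R :=
  log_velocity Psi lambda eta m (rpos r) i y.

Let kn n : kernel_fun (moll n : V -> R). Proof. exact: moll_kernel. Qed.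

Let hphiQ i x y : cube 1 (y - x) -> phi i x ^+ 2 <= Q y.
Proof. by move=> c; apply: le_trans (hphi i x) _; exact: hQ. Qed.

Lemma dPsi_le_Q i y : 'D_(e_ i) Psi y ^+ 2 <= Q y.
Proof. by apply: hQ; rewrite subrr => j; rewrite mxE in_itv/= lerN10 ler01. Qed.

(** Since [dpressure] is at least [lambda], the squared field is at most [2 / lambda^2] times the
    sum of the squares of velocity and potential gradient. *)
Lemma logvel_bound i r : good r ->
  intg mu setT (fun y => rpos r y * logvel r i y ^+ 2) /\
  \int[mu]_y (rpos r y * logvel r i y ^+ 2) <=
    2 / lambda ^+ 2 * (\int[mu]_y (rpos r y * vel r i y ^+ 2) + \int[mu]_y (Q y * rpos r y)).
Proof.
move=> [r0 kr]; have ii := kinetic_intg l0 e0 m1 CPsi Wrho i r0 kr.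
have iq := iQ (ltW r0).
have mb : measurable_fun setT (fun y => logvel r i y).
  exact: (measurable_log_velocity l0 e0 m1 CPsi (rpos_W11 Wrho r0)).
have mr : measurable_fun setT (rpos r) by exact: measurable_density.
have iS : intg mu setT (fun y => 2 / lambda ^+ 2 * (rpos r y * vel r i y ^+ 2 + Q y * rpos r y)).
  by apply: intgZl => //; exact: intgD.
have le y : rpos r y * logvel r i y ^+ 2 <= 2 / lambda ^+ 2 * (rpos r y * vel r i y ^+ 2 + Q y * rpos r y).
  have u0 : 0 <= rpos r y by exact: density_ge0.
  rewrite [leRHS](_ : _ = rpos r y * (2 / lambda ^+ 2 * (vel r i y ^+ 2 + Q y))); last by ring.
  apply: ler_wpM2l => //.
  rewrite /logvel /log_velocity exprMn sqrrN.
  set v := velocity _ _ _ _ _ _ _ _; set p := 'D_ _ Psi y.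
  have h1 : (v + p) ^+ 2 <= 2 * (v ^+ 2 + Q y).
    apply: (@le_trans _ _ (2 * (v ^+ 2 + p ^+ 2))).
      by have := sqr_ge0 (v - p); rewrite sqrrB sqrrD; lra.
    by rewrite ler_wpM2l// lerD2l; exact: dPsi_le_Q.
  have dp0 : lambda <= dpressure lambda eta m (rpos r y) by exact: dpressure_ge.
  have h2 : (dpressure lambda eta m (rpos r y))^-1 ^+ 2 <= (lambda ^+ 2)^-1.
    rewrite exprVn lef_pV2 ?posrE ?exprn_gt0 ?dpressure_gt0//.
    by apply: lerXn2r => //; rewrite nnegrE ltW// dpressure_gt0.
  rewrite [leRHS](_ : _ = 2 * (v ^+ 2 + Q y) * (lambda ^+ 2)^-1); last by rewrite mulrAC.
  by apply: ler_pM => //; rewrite sqr_ge0.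
have le0 y : 0 <= rpos r y * logvel r i y ^+ 2 by rewrite mulr_ge0 ?sqr_ge0 ?density_ge0.
have ib : intg mu setT (fun y => rpos r y * logvel r i y ^+ 2).
  apply: le_intg iS => //; last by move=> y _; rewrite ger0_norm.
  by apply: measurable_funM => //; exact: measurable_funX.
split => //; apply: le_trans (le_Rintegral _ ib iS _) _ => //.
by rewrite RintegralZl//; [rewrite RintegralD|exact: intgD].
Qed.

Definition slope n (r : R) : R :=
  \int[mu]_x ((g (mol (moll n) (rpos r) x) + psi x) * (pos r * flux_div (moll n) r x)).

Definition limit_slope (r : R) : R :=
  \sum_(i < d) \int[mu]_x slice_lim (rpos r) (vel r) (logvel r) phi g1 i x.

Definition slope_bound (r : R) : R := \sum_(i < d)
  (C * (2 / lambda ^+ 2 * (\int[mu]_y (rpos r y * vel r i y ^+ 2) + \int[mu]_y (Q y * rpos r y))) +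
   (C + 1) * \int[mu]_y (rpos r y * vel r i y ^+ 2) + \int[mu]_y (Q y * rpos r y)).

Let C0 : 0 <= C. Proof. by apply: le_trans (hg1 (lexx 0)); rewrite mulr0. Qed.
Let Cg0 : 0 <= Cg. Proof. by apply: le_trans (hg (lexx 0)). Qed.
Let Cpsi0 : 0 <= Cpsi. Proof. by apply: le_trans (hpsi 0). Qed.

Section good_time.
Variable r : R.
Hypothesis gr : good r.
Let r0 : 0 < r := gr.1.
Let kr := gr.2.
Let u0 := density_ge0 (rpos r).
Let iu := density_intg (rpos r).
Let ma i : measurable_fun setT (vel r i) := measurable_velocity l0 e0 m1 CPsi (rpos_W11 Wrho r0) i.
Let mb i : measurable_fun setT (logvel r i) :=
  measurable_log_velocity l0 e0 m1 CPsi (rpos_W11 Wrho r0) i.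
Let ia i := kinetic_intg l0 e0 m1 CPsi Wrho i r0 kr.
Let ib i := (logvel_bound i gr).1.
Let iq := iQ (ltW r0).

Lemma slope_good n : slope n r =
  \sum_(i < d) \int[mu]_x slice_term (rpos r) (vel r) (logvel r) phi g1 n i x.
Proof.
rewrite -(@slice_ibp _ _ (rpos r) u0 iu (vel r) (logvel r) ma mb ia ib psi phi Q cphi iq hphiQ
  g g1 C mg1 cg1 hg1 Cg Cpsi dg mg hg mpsi hpsi cpsi dpsi
  (wg_log_velocity l0 e0 m1 CPsi (rpos_W11 Wrho r0)) n).
by apply: eq_Rintegral => x _; rewrite pos_gtE r0 mul1r.
Qed.

Lemma slope_le n : `|slope n r| <= slope_bound r.
Proof.
rewrite slope_good; apply: le_trans (ler_norm_sum _ _ _) _; apply: ler_sum => i _.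
apply: le_trans (slice_term_int_le u0 iu ma mb ia ib cphi iq hphiQ mg1 hg1 n i) _.
rewrite /slice_dom RintegralD//; last by apply: intgD => //; exact: intgZl.
rewrite RintegralD//; [|exact: intgZl|exact: intgZl].
rewrite !RintegralZl// lerD2r lerD2r ler_wpM2l//; exact: (logvel_bound i gr).2.
Qed.

Lemma slope_cvg : (fun n => slope n r) @ \oo --> limit_slope r.
Proof.
under eq_fun do rewrite slope_good.
apply: cvg_bigsum => i.
exact: (slice_cvg u0 iu ma mb ia ib cphi iq hphiQ mg1 cg1 hg1 i).2.
Qed.

Lemma slice_lim_intg i : intg mu setT (slice_lim (rpos r) (vel r) (logvel r) phi g1 i).
Proof. exact: (slice_cvg u0 iu ma mb ia ib cphi iq hphiQ mg1 cg1 hg1 i).1. Qed.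

End good_time.

Let sub_pos s t : 0 <= s -> (`]s, t]%classic : set T) `<=` (`]0, t]%classic : set T).
Proof. by move=> s0 r /=; rewrite !in_itv/= => /andP[sr ->]; rewrite (le_lt_trans s0 sr). Qed.

Lemma good_ae s t : 0 <= s -> s < t -> {ae lam, forall r : T, `]s, t]%classic r -> good r}.
Proof.
move=> s0 st; have t0 : 0 < t by apply: le_lt_trans st.
have := kinetic_ae l0 e0 m1 CPsi wc Wrho diss t0.
apply: filterS => r h rst; have rt := sub_pos s0 rst; split; last exact: h.
by move: rt; rewrite /= in_itv/= => /andP[].
Qed.

Lemma slope_bound_le t : exists2 B, 0 <= B & forall r, good r -> r <= t ->
  slope_bound r <= B * (1 + fine (kinetic r)).
Proof.
(* [b k + X] is enlarged to a multiple of [1 + k], so that a single integrable function of time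
   dominates every slope. *)
have aux (k X b : R) : 0 <= k -> 0 <= X * k -> 0 <= b -> b * k + X <= (b + X) * (1 + k).
  move=> k0 Xk b0; rewrite mulrDr mulr1 mulrDl (addrC (b + X)) addrACA.
  by apply: lerD; rewrite ?lerDl ?lerDr.
have [M hM] := bQ t.
pose c := 2 / lambda ^+ 2.
have c0 : 0 <= c by rewrite divr_ge0 ?sqr_ge0.
pose B1 := C * c + (C + 1); pose B2 := (C * c + 1) * `|M|.
have B10 : 0 <= B1 by apply: addr_ge0; [exact: mulr_ge0|exact: addr_ge0].
have B20 : 0 <= B2 by apply: mulr_ge0 => //; apply: addr_ge0 => //; exact: mulr_ge0.
exists (B1 + d%:R * B2) => [|r gr rt]; first by apply: addr_ge0 => //; exact: mulr_ge0.
have [r0 kr] := gr.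
have kE := kinetic_fine l0 e0 m1 CPsi Wrho r0 kr.
have qM : \int[mu]_y (Q y * rpos r y) <= `|M|.
  by apply: le_trans (ler_norm M); apply: hM => //; exact: ltW.
have vi0 i : 0 <= \int[mu]_y (rpos r y * vel r i y ^+ 2).
  by apply: Rintegral_ge0 => y _; rewrite mulr_ge0 ?sqr_ge0 ?density_ge0.
have k0 : 0 <= fine (kinetic r) by rewrite kE/= sumr_ge0.
apply: (@le_trans _ _ (\sum_(i < d) (B1 * \int[mu]_y (rpos r y * vel r i y ^+ 2) + B2))).
  apply: ler_sum => i _; rewrite -/c.
  set v := \int[mu]_y (rpos r y * _); set q := \int[mu]_y (Q y * _).
  rewrite [leLHS](_ : _ = B1 * v + (C * c + 1) * q); last by rewrite /B1; ring.
  by rewrite lerD2l ler_wpM2l// addr_ge0// mulr_ge0.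
rewrite big_split/= -mulr_sumr sumr_const card_ord -(mulr_natl B2).
rewrite [\sum_(i < d) _](_ : _ = fine (kinetic r)); last by rewrite kE.
exact: aux k0 (mulr_ge0 (mulr_ge0 (ler0n R d) B20) k0) B10.
Qed.

Lemma bounded_intg_itv s t (c : R) : intg lam `]s, t] (fun=> c).
Proof.
apply: measurable_bounded_integrable => //.
  by rewrite /= lebesgue_measure_itv/=; case: ifP => _; rewrite ?ltry// -EFinD ltry.
by exists `|c|; split => [|z dz y _]; [exact: num_real|rewrite /= ltW].
Qed.

Lemma slope_bound_intg s t B : 0 <= s -> s < t ->
  intg lam `]s, t] (fun r => B * (1 + fine (kinetic r))).
Proof.
move=> s0 st; have t0 : 0 < t by apply: le_lt_trans st.
apply: intgZl => //; apply: intgD => //; first exact: bounded_intg_itv.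
apply: integrableS (kinetic_fine_intg l0 e0 m1 CPsi wc Wrho diss t0) => //; exact: sub_pos.
Qed.

Lemma measurable_gpsi n : measurable_fun setT
  (fun p : T * V => (g (mol (moll n) (rpos p.1) p.2) + psi p.2) * (pos p.1 * flux_div (moll n) p.1 p.2)).
Proof.
apply: measurable_funM; last exact: (measurable_flux_div l0 e0 m1 CPsi wc Wrho).
apply: measurable_funD; last by apply: (measurableT_comp mpsi measurable_snd).
by apply: (measurableT_comp mg); exact: (measurable_mol_path wc).
Qed.

Lemma measurable_slope n : measurable_fun setT (slope n : T -> R).
Proof. exact: (measurable_Rint2 mu (measurable_gpsi n)). Qed.

Definition energy (r : R) : R := \int[mu]_y (G (rpos r y) + psi y * rpos r y).
Definition energy_mol n (r : R) : R :=
  \int[mu]_y (G (mol (moll n) (rpos r) y) + psi y * mol (moll n) (rpos r) y).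

(** Both one-sided estimates are subgradient inequalities, with the two points exchanged. *)
Lemma G_lip a b : 0 <= a -> 0 <= b -> `|G a - G b| <= Cg * `|a - b|.
Proof.
move=> a0 b0; have h1 := convG b0 a0; have h2 := convG a0 b0.
have k x y : g x * y <= Cg * `|y| -> True by [].
have le x y : 0 <= x -> g x * y <= Cg * `|y|.
  by move=> x0; apply: le_trans (ler_norm _) _; rewrite normrM ler_wpM2r// hg.
rewrite ler_norml; apply/andP; split; last by apply: le_trans h1 _; exact: le.
rewrite lerNl opprB; apply: le_trans h2 _; rewrite distrC; exact: le.
Qed.

Lemma energy_intg (f : V -> R) : intg mu setT f -> (forall y, 0 <= f y) ->
  intg mu setT (fun y => G (f y) + psi y * f y).
Proof.
move=> i_f f0; have mf := intg_measurable measurableT i_f.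
apply: (le_intg (g := fun y => (Cg + Cpsi) * `|f y|)) => //.
- apply: measurable_funD; first exact: measurableT_comp.
  exact: measurable_funM.
- move=> y _; rewrite mulrDl; apply: le_trans (ler_normD _ _) _; apply: lerD.
    by have := G_lip (f0 y) (lexx 0); rewrite G0 !subr0.
  by rewrite normrM ler_wpM2r.
- by apply: intgZl => //; exact: intg_norm.
Qed.

Let umol_intg n r : intg mu setT (mol (moll n) (rpos r)).
Proof. by apply: intg_mol => //; exact: density_intg. Qed.

Let umol0 n r y : 0 <= mol (moll n) (rpos r) y.
Proof. by apply: mol_ge0 => z; exact: density_ge0. Qed.

Lemma energy_mol_cvg r : (fun n => energy_mol n r) @ \oo --> energy r.
Proof.
have cv := mol_cvg_L1 (density_intg (rpos r)).
apply/cvgrPdist_le => e ee.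
have M0 : 0 < Cg + Cpsi + 1 by rewrite ltr_wpDl// addr_ge0.
move/cvgrPdist_le : cv => /(_ _ (divr_gt0 ee M0)); apply: filterS => n.
rewrite sub0r normrN ger0_norm ?Rintegral_ge0// => hn.
have i1 := energy_intg (umol_intg n r) (umol0 n r).
have i2 := energy_intg (density_intg (rpos r)) (density_ge0 (rpos r)).
rewrite distrC /energy_mol /energy -RintegralB//.
apply: le_trans (le_normr_Rintegral measurableT (intgB measurableT i1 i2)) _.
have i3 : intg mu setT (fun y => `|mol (moll n) (rpos r) y - rpos r y|).
  by apply: intg_norm => //; apply: intgB => //; exact: density_intg.
apply: (@le_trans _ _ (\int[mu]_y ((Cg + Cpsi) * `|mol (moll n) (rpos r) y - rpos r y|))).
  apply: le_Rintegral => //; [by apply: intg_norm => //; exact: intgB|exact: intgZl|].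
  move=> y _; rewrite opprD addrACA -mulrBr mulrDl; apply: le_trans (ler_normD _ _) _.
  by apply: lerD; [apply: G_lip => //; exact: density_ge0|rewrite normrM ler_wpM2r].
rewrite RintegralZl//.
apply: (@le_trans _ _ ((Cg + Cpsi + 1) * (e / (Cg + Cpsi + 1)))); last by rewrite mulrC divfK// gt_eqF.
by apply: ler_pM => //; rewrite ?addr_ge0 ?Rintegral_ge0 ?lerDl.
Qed.

(** [convex_chain] at a fixed point [x] handles the entropy; the potential term is linear in the
    density, hence exact. *)
Lemma pointwise_chain n x s t : 0 <= s -> s < t ->
  (G (mol (moll n) (rpos t) x) + psi x * mol (moll n) (rpos t) x) -
  (G (mol (moll n) (rpos s) x) + psi x * mol (moll n) (rpos s) x) <=
  \int[lam]_(r in `]s, t]) ((g (mol (moll n) (rpos r) x) + psi x) * flux_div (moll n) r x).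
Proof.
move=> s0 st; have t0 : 0 < t by apply: le_lt_trans st.
have ftc := mollified_ftc l0 e0 m1 CPsi wc Wrho FP diss x (kn n).
have iA0 := flux_div_intg l0 e0 m1 CPsi wc Wrho diss x (kn n) t0.
have iA : intg lam `]s, t] (fun r => flux_div (moll n) r x).
  by apply: integrableS iA0 => //; exact: sub_pos.
have mU : measurable_fun setT (fun r : T => mol (moll n) (rpos r) x).
  apply: (@measurable_comp _ _ _ _ _ _ setT (fun p : T * V => mol (moll n) (rpos p.1) p.2) setT
    (fun r : T => (r, x))) => //; exact: (measurable_mol_path wc).
have igA : intg lam `]s, t] (fun r => g (mol (moll n) (rpos r) x) * flux_div (moll n) r x).
  apply: (@le_intg _ _ _ lam `]s, t]%classic _ (fun r => Cg * `|flux_div (moll n) r x|)) => //.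
  - apply: measurable_funM; last by apply: intg_measurable iA.
    by apply: measurable_funTS; exact: measurableT_comp.
  - by move=> r _; rewrite normrM ler_wpM2r// hg.
  - by apply: intgZl => //; exact: intg_norm.
have cU : continuous (fun r : R => mol (moll n) (rpos r) x).
  rewrite (_ : (fun r => _) = (fun r => \int[mu]_z (moll n (z - x) * density_path rho r z))).
    exact: path_weak_continuous (moll_Cb n x).
  by apply/funext => r; apply: eq_Rintegral => z _; rewrite mulrC.
have h1 := @convex_chain R s t (fun r => mol (moll n) (rpos r) x) (fun r => flux_div (moll n) r x) G g
  (ltW st) convG (fun r _ _ => umol0 n r x) iA igA.
rewrite opprD addrACA -mulrBr (ftc _ _ s0 (ltW st)) -RintegralZl//.
rewrite [leRHS](_ : _ = \int[lam]_(r in `]s, t]) (g (mol (moll n) (rpos r) x) * flux_div (moll n) r x) +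
  \int[lam]_(r in `]s, t]) (psi x * flux_div (moll n) r x)); last first.
  by rewrite -RintegralD//; [apply: eq_Rintegral => r _; rewrite mulrDl|exact: intgZl].
rewrite lerD2r; apply: h1.
- move=> p _ _; apply: cvg_within_filter.
  apply: (@continuous_comp _ _ _ (fun r => mol (moll n) (rpos r) x) g); first exact: cU.
  by apply: differentiable_continuous; apply/derivable1_diffP; have [] := dg (umol0 n p x).
- move=> a b sa ab _; apply: ftc => //; exact: le_trans sa.
Qed.

(** The pointwise inequality is integrated in [x] and the integrals are exchanged. [g] and [psi]
    being bounded, Fubini needs only that the spatial L^1 norm of [flux_div] is integrable in
    time. *)
Lemma energy_mol_le n s t : 0 <= s -> s < t ->
  energy_mol n t - energy_mol n s <= \int[lam]_(r in `]s, t]) slope n r.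
Proof.
move=> s0 st; have t0 : 0 < t by apply: le_lt_trans st.
pose lamT : {sigma_finite_measure set T -> \bar R} := @lebesgue_measure R.
pose ind (r : T) : R := \1_(`]s, t]%classic : set R) r.
have mind : measurable_fun setT ind by apply: measurable_indic; exact: measurable_itv.
have ind1 r : (`]s, t]%classic : set T) r -> ind r = 1 by move=> h; rewrite /ind indicE mem_set.
have ind0 r : r \notin (`]s, t]%classic : set T) -> ind r = 0 by move=> h; rewrite /ind indicE (negbTE h).
pose F (p : V * T) := (g (mol (moll n) (rpos p.2) p.1) + psi p.1) *
  (pos p.2 * flux_div (moll n) p.2 p.1) * ind p.2.
have mF : measurable_fun setT F.
  apply: measurable_funM; last by apply: (measurableT_comp mind measurable_snd).
  apply: (@measurable_comp _ _ _ _ _ _ setT (fun p : T * V => (g (mol (moll n) (rpos p.1) p.2) + psi p.2) * (pos p.1 * flux_div (moll n) p.1 p.2)) setT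
    (fun p : V * T => (p.2, p.1))) => //; first exact: measurable_gpsi.
  by apply: measurable_fun_pair; [exact: measurable_snd|exact: measurable_fst].
(* This L^1 norm is controlled by the kinetic energy, with a constant depending on the derivatives
   of [moll n]; [n] stays fixed here. *)
have [B0 B00 hB0] : exists2 B, 0 <= B & forall r, good r ->
    intg mu setT (fun x => flux_div (moll n) r x) /\
    \int[mu]_x `|flux_div (moll n) r x| <= B * (d%:R + fine (kinetic r)).
  have hC i := mol_L1_bound (kernel_derive (e_ i) (kn n)).
  have hC' i : exists C, 0 <= C /\ forall f, intg mu setT f ->
      \int[mu]_x `|mol ('D_(e_ i) (moll n)) f x| <= C * \int[mu]_x `|f x|.
    by have [c c0 hc] := hC i; exists c.
  have [c_ hc] := choice hC'; pose c := \sum_(i < d) c_ i.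
  have c0 : 0 <= c by apply: sumr_ge0 => i _; exact: (hc i).1.
  have cc i : c_ i <= c by rewrite /c (bigD1 i)//= lerDl sumr_ge0// => j _; exact: (hc j).1.
  exists c => // r [r0 kr].
  have fi i := flux_intg l0 e0 m1 CPsi Wrho i r0 kr.
  have im i : intg mu setT (mol ('D_(e_ i) (moll n)) (fun y => rpos r y * vel r i y)).
    by apply: intg_mol; [exact: kernel_derive|exact: (fi i).1].
  have iD : intg mu setT (fun x => flux_div (moll n) r x) by exact: intg_sum.
  split => //.
  apply: (@le_trans _ _ (\int[mu]_x \sum_(i < d) `|mol ('D_(e_ i) (moll n)) (fun y => rpos r y * vel r i y) x|)).
    apply: le_Rintegral => //; first exact: intg_norm.
      by apply: intg_sum => // i; exact: intg_norm.
    by move=> x _; exact: ler_norm_sum.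
  rewrite Rintegral_sum//; last by move=> i; exact: intg_norm.
  apply: (@le_trans _ _ (\sum_(i < d) c * (1 + \int[mu]_y (rpos r y * vel r i y ^+ 2)))); last first.
    rewrite -mulr_sumr big_split/= (kinetic_fine l0 e0 m1 CPsi Wrho r0 kr)/=.
    by rewrite sumr_const card_ord.
  apply: ler_sum => i _; apply: le_trans ((hc i).2 _ (fi i).1) _.
  by apply: ler_pM => //; [exact: (hc i).1|exact: Rintegral_ge0|exact: (fi i).2].
pose K := (Cg + Cpsi) * B0.
have fin : (\int[mu]_x \int[lamT]_r `|F (x, r)|%:E < +oo)%E.
  have mnF : measurable_fun setT (fun p => `|F p|) by exact: measurableT_comp.
  rewrite (tonelli mu lamT mnF); last by move=> z; exact: normr_ge0.
  have ib : intg lamT `]s, t] (fun r => K * (d%:R + fine (kinetic r))).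
    apply: intgZl => //; apply: intgD => //; first exact: bounded_intg_itv.
    apply: integrableS (kinetic_fine_intg l0 e0 m1 CPsi wc Wrho diss t0) => //; exact: sub_pos.
  have : (\int[lamT]_(r in `]s, t]) (K * (d%:R + fine (kinetic r)))%:E < +oo)%E.
    by rewrite (Rintegral_EFin _ ib)// ltry.
  apply: le_lt_trans.
  rewrite [leRHS]integral_mkcond.
  have mrhs : measurable_fun setT ((fun r : T => (K * (d%:R + fine (kinetic r)))%:E) \_ `]s, t]%classic).
    by apply/(measurable_restrictT _ _).1 => //; apply/measurable_EFinP; exact: intg_measurable ib.
  apply: ae_ge0_le_integral => //.
  - by move=> r _; apply: integral_ge0 => x _; rewrite lee_fin.
  - apply: (@measurable_fun_fubini_tonelli_F _ _ _ _ _ mu (fun p : T * V => `|F (p.2, p.1)|%:E)) => //.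
    apply/measurable_EFinP; apply: (@measurable_comp _ _ _ _ _ _ setT (fun p => `|F p|) setT (fun p : T * V => (p.2, p.1))) => //.
    by apply: measurable_fun_pair; [exact: measurable_snd|exact: measurable_fst].
  - move=> r _; rewrite patchE; case: ifPn => // _; rewrite lee_fin mulr_ge0//.
      by rewrite /K mulr_ge0 ?addr_ge0.
    by rewrite addr_ge0 ?fine_ge0 ?kinetic_ge0.
  apply: filterS (good_ae s0 st) => r gr _; rewrite patchE.
  case: ifPn => [/set_mem rst|rst]; last first.
    rewrite (eq_integral (fun=> 0%E)) ?integral0// => x _.
    by rewrite /F /= ind0// mulr0 normr0.
  have [iD hD] := hB0 r (gr rst).
  have iK : intg mu setT (fun x => (Cg + Cpsi) * `|flux_div (moll n) r x|).
    by apply: intgZl => //; exact: intg_norm.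
  apply: (@le_trans _ _ (\int[mu]_x ((Cg + Cpsi) * `|flux_div (moll n) r x|)%:E)%E); last first.
    rewrite Rintegral_EFin// lee_fin RintegralZl//; last exact: intg_norm.
    by rewrite /K -mulrA ler_wpM2l// addr_ge0.
  apply: ge0_le_integral => //.
  - apply/measurable_EFinP; apply: measurableT_comp => //.
    by apply: (@measurable_comp _ _ _ _ _ _ setT F setT (fun x : V => (x, r : T))).
  - by apply/measurable_EFinP; exact: intg_measurable iK.
  - move=> x _; rewrite lee_fin /F /= pos_gtE (gr rst).1 mul1r ind1// mulr1 normrM.
    by rewrite ler_wpM2r//; apply: le_trans (ler_normD _ _) _; rewrite lerD// hg.
have fub := @Rfubini _ _ _ _ _ mu lamT F mF fin.
have E1 : \int[lamT]_r \int[mu]_x F (x, r) = \int[lam]_(r in `]s, t]) slope n r.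
  rewrite [RHS]Rintegral_mkcond; apply: eq_Rintegral => r _; rewrite patchE.
  case: ifPn => [/set_mem rst|rst].
    by apply: eq_Rintegral => x _; rewrite /F /= ind1// mulr1.
  by rewrite /Rintegral integral0_eq// => x _; rewrite /F /= ind0// mulr0.
have iE r := energy_intg (umol_intg n r) (umol0 n r).
rewrite -E1 -fub /energy_mol -(RintegralB measurableT (iE t) (iE s)).
apply: le_Rintegral; [exact: measurableT|..].
- exact: (intgB measurableT (iE t) (iE s)).
- exact: (intg_RintegralF mF fin).
move=> x _; apply: le_trans (pointwise_chain n x s0 st) _.
rewrite Rintegral_mkcond le_eqVlt; apply/orP; left; apply/eqP.
apply: eq_Rintegral => r _; rewrite patchE /F /=.
case: ifPn => [/set_mem rst|rst]; last by rewrite ind0// mulr0.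
rewrite ind1// mulr1 pos_gtE; have := sub_pos s0 rst; rewrite /= in_itv/= => /andP[-> _].
by rewrite mul1r.
Qed.

(** [limit_slope] is meaningful only at good times, and its measurability is not evident. The upper
    limit of the slopes is measurable and coincides with it at those times, so it serves as a
    representative [h]. *)
Lemma energy_le s t : 0 <= s -> s < t -> exists h : T -> R,
  [/\ measurable_fun setT h, forall r, good r -> h r = limit_slope r,
      intg lam `]s, t] h & energy t - energy s <= \int[lam]_(r in `]s, t]) h r].
Proof.
move=> s0 st; pose h (r : T) := fine (limn_esup (fun n => (slope n r)%:E)).
have mh : measurable_fun setT h.
  have m1' : measurable_fun setT (fun r : T => limn_esup (fun n => (slope n r)%:E)).
    by apply: measurable_fun_limn_esup => n; apply/measurable_EFinP; exact: measurable_slope.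
  by apply: measurableT_comp m1'.
have hE r : good r -> h r = limit_slope r.
  move=> gr; have := slope_cvg gr => c; have /cvg_limn_einf_sup[_] : (fun n => (slope n r)%:E) @ \oo --> (limit_slope r)%:E.
    by apply: cvg_EFin; [exact: nearW|exact: c].
  by rewrite /h => ->.
have [B B0 hB] := slope_bound_le t.
have iB := slope_bound_intg B s0 st.
have gae := good_ae s0 st.
have bnd n : {ae lam, forall r : T, `]s, t]%classic r -> `|slope n r| <= B * (1 + fine (kinetic r))}.
  apply: filterS gae => r gr rst; apply: le_trans (slope_le (gr rst) n) _; apply: hB; first exact: gr.
  by move: rst; rewrite /= in_itv/= => /andP[].
exists h; split => //.
- apply: (le_intg_ae _ _ _ iB) => //; first exact: measurable_funTS.
  apply: filterS gae => r gr rst; rewrite (hE _ (gr rst)).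
  apply: ler_cvg_to (cvg_norm (slope_cvg (gr rst))) (cvg_cst (B * (1 + fine (kinetic r)))) _.
  apply: nearW => n; apply: le_trans (slope_le (gr rst) n) _; apply: hB; first exact: gr.
  by move: rst; rewrite /= in_itv/= => /andP[].
have ce : (fun n => energy_mol n t - energy_mol n s) @ \oo --> energy t - energy s.
  by apply: cvgB; exact: energy_mol_cvg.
have cs : (fun n => \int[lam]_(r in `]s, t]) slope n r) @ \oo --> \int[lam]_(r in `]s, t]) h r.
  apply: (dominated_Rintegral_ae _ _ _ _ bnd iB) => //.
  - by move=> n; apply: measurable_funTS; exact: measurable_slope.
  - exact: measurable_funTS.
  - by apply: filterS gae => r gr rst; rewrite (hE _ (gr rst)); exact: (slope_cvg (gr rst)).
by apply: ler_cvg_to ce cs _; apply: nearW => n; exact: energy_mol_le.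
Qed.

End energy_inequality.

(** * Approximation of the entropy and of the potential *)

Section tangent.
Context {R : realType}.

Lemma mvt_halfline (f f' : R -> R) : (forall s : R, 0 <= s -> is_derive s 1 f (f' s)) ->
  forall a b, 0 <= a -> a <= b -> exists c, [/\ a <= c, c <= b & f b - f a = f' c * (b - a)].
Proof.
move=> df a b a0 ab.
have cf : {within `[a, b], continuous f}.
  apply: continuous_in_subspaceT => x /set_mem/=; rewrite in_itv/= => /andP[ax _].
  apply: differentiable_continuous; apply/derivable1_diffP.
  by have [] := df x (le_trans a0 ax).
have hd x : x \in `]a, b[ -> is_derive x 1 f (f' x).
  by rewrite in_itv/= => /andP[ax _]; apply: df; rewrite (le_trans a0)// ltW.
by have [c /andP[c1 c2] E] := MVT_segment ab hd cf; exists c; rewrite !bnd_simp in c1 c2.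
Qed.

Lemma tangent_le (G g g1 : R -> R) :
  (forall s : R, 0 <= s -> is_derive s 1 G (g s)) ->
  (forall s : R, 0 <= s -> is_derive s 1 g (g1 s)) -> (forall s, 0 <= s -> 0 <= g1 s) ->
  forall x y, 0 <= x -> 0 <= y -> G y - G x <= g y * (y - x).
Proof.
move=> dG dg g10.
have mg a b : 0 <= a -> a <= b -> g a <= g b.
  move=> a0 ab; have [c [c1 _ E]] := mvt_halfline dg a0 ab.
  by rewrite -subr_ge0 E mulr_ge0 ?subr_ge0 ?g10// (le_trans a0).
move=> x y x0 y0; have [xy|/ltW yx] := leP x y.
  have [c [c1 c2 ->]] := mvt_halfline dG x0 xy.
  by rewrite ler_wpM2r ?subr_ge0// mg// (le_trans x0).
have [c [c1 c2 E]] := mvt_halfline dG y0 yx.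
by rewrite -[leLHS]opprB E -mulrN opprB -subr_ge0 -mulrBl -mulrNN mulr_ge0// opprB subr_ge0// mg.
Qed.

End tangent.

(* [entropy_approx] is the perspective [(1 + del u) F (sg u) - F del] of
   [F s = lambda s ln s + kap s^m], with [sg u = (u + del) / (1 + del u)] in [[del, 1/del]]:
   it is convex, smooth, and has a bounded derivative. *)
Section entropy_approximation.
Context {R : realType} (lambda eta m del : R).
Hypotheses (l0 : 0 < lambda) (e0 : 0 < eta) (m1 : 1 < m) (d0 : 0 < del) (d1 : del < 1).

Let kap := eta / (m - 1).
Let kap0 : 0 < kap. Proof. by rewrite divr_gt0// subr_gt0. Qed.
Let m0 : 0 < m. Proof. exact: lt_trans m1. Qed.
Let mm0 : 0 < m - 1. Proof. by rewrite subr_gt0. Qed.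

Definition sg (u : R) := (u + del) / (1 + del * u).
Definition Fent (s : R) := lambda * (s * ln s) + kap * s `^ m.
Definition dFent (s : R) := lambda * (ln s + 1) + kap * (m * s `^ (m - 1)).
Definition entropy_approx (u : R) := (1 + del * u) * Fent (sg u) - Fent del.
Definition dentropy_approx (u : R) :=
  del * Fent (sg u) + dFent (sg u) * ((1 - del ^+ 2) / (1 + del * u)).
Definition ddentropy_approx (u : R) :=
  dpressure lambda eta m (sg u) / sg u * ((1 - del ^+ 2) ^+ 2 / (1 + del * u) ^+ 3).

Let q0 u : 0 <= u -> 0 < 1 + del * u.
Proof. by move=> u0; rewrite ltr_wpDr// mulr_ge0// ltW. Qed.

Lemma sg_gt0 u : 0 <= u -> 0 < sg u.
Proof. by move=> u0; rewrite divr_gt0 ?q0// ltr_wpDl. Qed.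

Lemma sg0 : sg 0 = del. Proof. by rewrite /sg mulr0 addr0 add0r divr1. Qed.

Lemma sg_ge u : 0 <= u -> del <= sg u.
Proof.
move=> u0; rewrite ler_pdivlMr ?q0// mulrDr mulr1 addrC lerD2r mulrA ler_piMl//.
by rewrite -expr2 expr_le1// ltW.
Qed.

Lemma sg_le u : 0 <= u -> sg u <= del^-1.
Proof.
move=> u0; rewrite ler_pdivrMr ?q0// mulrDr mulr1 mulrA mulVf ?gt_eqF// mul1r addrC lerD2r.
by rewrite (le_trans (ltW d1))// invf_ge1// ltW.
Qed.

Lemma sg_lo u : 0 <= u -> u <= 1 -> u <= sg u /\ sg u <= 1.
Proof.
move=> u0 u1; split.
  by rewrite ler_pdivlMr ?q0//; have h : 0 <= (1 - u) * (1 + u) * del; [rewrite !mulr_ge0 ?subr_ge0 ?addr_ge0// ltW|lra].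
by rewrite ler_pdivrMr ?q0// mul1r; have h : 0 <= (1 - u) * (1 - del); [rewrite mulr_ge0 ?subr_ge0// ltW|lra].
Qed.

Lemma sg_hi u : 1 <= u -> 1 <= sg u /\ sg u <= u.
Proof.
move=> u1; have u0 : 0 <= u by apply: le_trans u1.
split.
  by rewrite ler_pdivlMr ?q0// mul1r; have h : 0 <= (u - 1) * (1 - del); [rewrite mulr_ge0 ?subr_ge0// ltW|lra].
by rewrite ler_pdivrMr ?q0//; have h : 0 <= (u - 1) * (1 + u) * del; [rewrite !mulr_ge0 ?subr_ge0 ?addr_ge0// ltW|lra].
Qed.

Lemma is_derive_sg (u : R) : 0 <= u -> is_derive u 1 sg ((1 - del ^+ 2) / (1 + del * u) ^+ 2).
Proof.
move=> u0; have qn : 1 + del * u != 0 by rewrite gt_eqF// q0.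
have h1 : is_derive u 1 (fun x : R => x + del) (1 + 0) by exact: is_deriveD.
have h2 : is_derive u 1 (fun x : R => 1 + del * x) (0 + del *: 1).
  by apply: is_deriveD; exact: is_deriveZ.
have h3 := @is_deriveV R (fun x : R => 1 + del * x) u _ 1 qn h2.
apply: (is_derive_eq (is_deriveM h1 h3)); rewrite /GRing.scale/=.
by field.
Qed.

Lemma is_derive_Fent (s : R) : 0 < s -> is_derive s 1 Fent (dFent s).
Proof.
move=> s0.
have h1 : is_derive s 1 (fun x : R => x * ln x) (s *: s^-1 + ln s *: 1).
  by apply: is_deriveM; exact: is_derive1_ln.
have h2 := is_derive1_powR m s0.
have h3 : is_derive s 1 (fun x : R => lambda * (x * ln x)) (lambda *: (s *: s^-1 + ln s *: 1)) by exact: is_deriveZ.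
have h4 : is_derive s 1 (fun x : R => kap * x `^ m) (kap *: (m * s `^ (m - 1))) by exact: is_deriveZ.
apply: (is_derive_eq (is_deriveD h3 h4)); rewrite /dFent /GRing.scale/= mulr1 divff ?gt_eqF//.
by rewrite (addrC 1).
Qed.

(** As the pressure is [s F' - F], its derivative is [s F'']: this is how [dpressure] enters the
    second derivative of the entropy. *)
Lemma is_derive_dFent (s : R) : 0 < s -> is_derive s 1 dFent (dpressure lambda eta m s / s).
Proof.
move=> s0.
have h1 : is_derive s 1 (fun x : R => ln x + 1) (s^-1 + 0) by apply: is_deriveD; exact: is_derive1_ln.
have h2 := is_derive1_powR (m - 1) s0.
have h3 : is_derive s 1 (fun x : R => lambda * (ln x + 1)) (lambda *: (s^-1 + 0)) by exact: is_deriveZ.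
have h4 : is_derive s 1 (fun x : R => kap * (m * x `^ (m - 1))) (kap *: (m *: ((m - 1) * s `^ (m - 1 - 1)))).
  by apply: is_deriveZ; exact: is_deriveZ.
apply: (is_derive_eq (is_deriveD h3 h4)); rewrite /dpressure pospowE ?ltW// /GRing.scale/= addr0.
rewrite -(mulr_powRB1 (ltW s0) mm0) /kap.
by field; rewrite gt_eqF// gt_eqF.
Qed.

Lemma is_derive_entropy_approx (u : R) : 0 <= u ->
  is_derive u 1 entropy_approx (dentropy_approx u).
Proof.
move=> u0; have h1 := is_derive1_comp (is_derive_Fent (sg_gt0 u0)) (is_derive_sg u0).
have h2 : is_derive u 1 (fun x : R => 1 + del * x) (0 + del *: 1).
  by apply: is_deriveD; exact: is_deriveZ.
have h3 := is_deriveM h2 h1.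
have h4 : is_derive u 1 (fun x => ((fun x : R => 1 + del * x) * (Fent \o sg)) x - Fent del)
    (((1 + del * u) *: (dFent (sg u) * ((1 - del ^+ 2) / (1 + del * u) ^+ 2)) + (Fent \o sg) u *: (0 + del *: 1)) - 0).
  exact: is_deriveB.
have qn : 1 + del * u != 0 by rewrite gt_eqF// q0.
apply: (is_derive_eq h4); rewrite /dentropy_approx /GRing.scale/=.
by field.
Qed.

Lemma is_derive_dentropy_approx (u : R) : 0 <= u ->
  is_derive u 1 dentropy_approx (ddentropy_approx u).
Proof.
move=> u0; have qn : 1 + del * u != 0 by rewrite gt_eqF// q0.
have h1 := is_derive1_comp (is_derive_Fent (sg_gt0 u0)) (is_derive_sg u0).
have h2 := is_derive1_comp (is_derive_dFent (sg_gt0 u0)) (is_derive_sg u0).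
have h3 : is_derive u 1 (fun x : R => 1 + del * x) (0 + del *: 1).
  by apply: is_deriveD; exact: is_deriveZ.
have h4 := @is_deriveV R (fun x : R => 1 + del * x) u _ 1 qn h3.
have h5 : is_derive u 1 (fun x => (1 - del ^+ 2) * (1 + del * x)^-1) ((1 - del ^+ 2) *: (- (1 + del * u) ^- 2 *: (0 + del *: 1))).
  exact: is_deriveZ.
have h6 := is_deriveM h2 h5.
have h7 : is_derive u 1 (fun x => del * (Fent \o sg) x) (del *: (dFent (sg u) * ((1 - del ^+ 2) / (1 + del * u) ^+ 2))).
  exact: is_deriveZ.
apply: (is_derive_eq (is_deriveD h7 h6)); rewrite /ddentropy_approx /GRing.scale/=.
have sn : sg u != 0 by rewrite gt_eqF// sg_gt0.
by field; rewrite qn sn.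
Qed.

Lemma ddentropy_approx_ge0 u : 0 <= u -> 0 <= ddentropy_approx u.
Proof.
move=> u0; apply: mulr_ge0.
  by rewrite divr_ge0 ?(ltW (sg_gt0 u0))// ltW// dpressure_gt0.
by rewrite divr_ge0 ?sqr_ge0// exprn_ge0// ltW// q0.
Qed.

Lemma entropy_approx_convex x y : 0 <= x -> 0 <= y ->
  entropy_approx y - entropy_approx x <= dentropy_approx y * (y - x).
Proof.
exact: (tangent_le is_derive_entropy_approx is_derive_dentropy_approx ddentropy_approx_ge0).
Qed.

Lemma entropy_approx0 : entropy_approx 0 = 0.
Proof. by rewrite /entropy_approx sg0 mulr0 addr0 mul1r subrr. Qed.

Let dp0 s : 0 < dpressure lambda eta m s. Proof. exact: dpressure_gt0. Qed.

(** Exhibits [u G''] as [dpressure] at [sg u] times a factor in [[0, 1]]; both bounds on [u G'']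
    below follow from this. *)
Lemma ddentropy_approx_mulE u : 0 <= u -> ddentropy_approx u * u =
  dpressure lambda eta m (sg u) * (u / (u + del) * ((1 - del ^+ 2) / (1 + del * u)) ^+ 2).
Proof.
move=> u0; have qn : 1 + del * u != 0 by rewrite gt_eqF// q0.
have un : u + del != 0 by rewrite gt_eqF// ltr_wpDl.
by rewrite /ddentropy_approx /sg; field; rewrite qn un.
Qed.

Let factor_le u : 0 <= u -> 0 <= u / (u + del) * ((1 - del ^+ 2) / (1 + del * u)) ^+ 2 <= 1.
Proof.
move=> u0; have un : 0 < u + del by rewrite ltr_wpDl.
have h1 : 0 <= u / (u + del) <= 1.
  by rewrite divr_ge0//= ?ler_pdivrMr ?mul1r ?lerDl// ltW.
have dd : 0 <= 1 - del ^+ 2 by rewrite subr_ge0 expr_le1// ltW.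
have h2 : 0 <= (1 - del ^+ 2) / (1 + del * u) <= 1.
  rewrite divr_ge0//= ?(ltW (q0 u0))// ler_pdivrMr ?q0// mul1r.
  by have := sqr_ge0 del; have := mulr_ge0 (ltW d0) u0; lra.
move: h1 h2 => /andP[a0 a1] /andP[b0 b1]; apply/andP; split; first by rewrite mulr_ge0 ?sqr_ge0.
by rewrite mulr_ile1 ?sqr_ge0// expr_le1.
Qed.

(** A bound independent of [del], needed when the truncation is removed. For [u >= 1], [sg u <= u]
    and [dpressure] is monotone. For [u <= 1], [dpressure] at [sg u] is at most its value at 1, and
    the constant is that value divided by [lambda]. *)
Lemma ddentropy_approx_le u : 0 <= u ->
  0 <= ddentropy_approx u * u <= (1 + eta * m / lambda) * dpressure lambda eta m u.
Proof.
move=> u0; rewrite ddentropy_approx_mulE//; have /andP[f0 f1] := factor_le u0.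
rewrite mulr_ge0 ?(ltW (dp0 _))//=.
apply: (@le_trans _ _ (dpressure lambda eta m (sg u))); first by rewrite ler_piMr ?(ltW (dp0 _)).
have c0 : 0 <= eta * m / lambda by rewrite divr_ge0 ?mulr_ge0 ?ltW.
have [u1|/ltW u1] := leP u 1.
  have [_ s1] := sg_lo u0 u1.
  apply: (@le_trans _ _ (dpressure lambda eta m 1)); first exact: dpressure_le.
  have -> : dpressure lambda eta m 1 = (1 + eta * m / lambda) * lambda.
    rewrite /dpressure pospowE// powR1; field; by rewrite gt_eqF.
  by rewrite ler_wpM2l ?addr_ge0//; exact: dpressure_ge.
have [_ s1] := sg_hi u1.
apply: (@le_trans _ _ (dpressure lambda eta m u)); first exact: dpressure_le.
by rewrite ler_peMl ?(ltW (dp0 _))// lerDl.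
Qed.

Lemma ddentropy_approx_bound u : 0 <= u ->
  `|ddentropy_approx u| * u <= dpressure lambda eta m del^-1.
Proof.
move=> u0; rewrite ger0_norm ?ddentropy_approx_ge0// ddentropy_approx_mulE//.
have /andP[f0 f1] := factor_le u0.
apply: (@le_trans _ _ (dpressure lambda eta m (sg u))); first by rewrite ler_piMr ?(ltW (dp0 _)).
by apply: dpressure_le => //; exact: sg_le.
Qed.

(** [sg u] stays in [[del, del^-1]], where logarithm and powers are bounded. *)
Lemma dentropy_approx_bound : exists C, forall u, 0 <= u -> `|dentropy_approx u| <= C.
Proof.
pose b := del^-1.
have b0 : 0 < b by rewrite invr_gt0.
pose ell := `|ln del| + `|ln b|.
pose CF := lambda * (b * ell) + kap * b `^ m.
pose CdF := lambda * (ell + 1) + kap * (m * b `^ (m - 1)).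
have dd : 0 <= 1 - del ^+ 2 by rewrite subr_ge0 expr_le1// ltW.
exists (del * CF + CdF) => u u0.
have sp := sg_gt0 u0; have s1 := sg_ge u0; have s2 := sg_le u0.
have hl : `|ln (sg u)| <= ell.
  rewrite ler_norml /ell; apply/andP; split.
    have : ln del <= ln (sg u) by rewrite ler_ln ?posrE.
    by have := ler_norm (- ln del); rewrite normrN; have := normr_ge0 (ln b); lra.
  have : ln (sg u) <= ln b by rewrite ler_ln ?posrE.
  by have := ler_norm (ln b); have := normr_ge0 (ln del); lra.
have hp p : 0 <= p -> 0 <= sg u `^ p <= b `^ p.
  by move=> p0; rewrite powR_ge0/=; apply: ge0_ler_powR; rewrite ?nnegrE// ltW.
have hF : `|Fent (sg u)| <= CF.
  have /andP[h1 h2] := hp m (ltW m0).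
  apply: le_trans (ler_normD _ _) _; apply: lerD.
    by rewrite normrM (gtr0_norm l0) ler_wpM2l ?(ltW l0)// normrM (gtr0_norm sp) ler_pM// ltW.
  by rewrite normrM (gtr0_norm kap0) ler_wpM2l ?(ltW kap0)// ger0_norm.
have hdF : `|dFent (sg u)| <= CdF.
  have /andP[h1 h2] := hp (m - 1) (ltW mm0).
  apply: le_trans (ler_normD _ _) _; apply: lerD.
    rewrite normrM (gtr0_norm l0) ler_wpM2l ?(ltW l0)//.
    by apply: le_trans (ler_normD _ _) _; rewrite normr1 lerD2r.
  rewrite normrM (gtr0_norm kap0) ler_wpM2l ?(ltW kap0)// normrM (gtr0_norm m0) ler_wpM2l ?(ltW m0)//.
  by rewrite ger0_norm.
apply: le_trans (ler_normD _ _) _; apply: lerD.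
  by rewrite normrM (gtr0_norm d0) ler_wpM2l// ltW.
rewrite normrM -[leRHS]mulr1; apply: ler_pM => //.
rewrite ger0_norm; last by rewrite divr_ge0// ltW// q0.
rewrite ler_pdivrMr ?q0// mul1r.
by have := sqr_ge0 del; have := mulr_ge0 (ltW d0) u0; lra.
Qed.

Lemma measurable_sg : measurable_fun setT sg.
Proof.
apply: measurable_funM; first exact: measurable_funD.
by apply: measurable_inverse; apply: measurable_funD => //; exact: measurable_funM.
Qed.

Lemma measurable_Fent : measurable_fun setT Fent.
Proof. by apply: measurable_funD; apply: measurable_funM => //; exact: measurable_funM. Qed.

Lemma measurable_dFent : measurable_fun setT dFent.
Proof.
apply: measurable_funD; apply: measurable_funM => //; first exact: measurable_funD.
exact: measurable_funM.
Qed.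

Let mq : measurable_fun setT (fun u : R => 1 + del * u).
Proof. by apply: measurable_funD => //; exact: measurable_funM. Qed.

Lemma measurable_entropy_approx : measurable_fun setT entropy_approx.
Proof.
apply: measurable_funB => //; apply: measurable_funM => //.
by apply: (measurableT_comp measurable_Fent); exact: measurable_sg.
Qed.

Lemma measurable_dentropy_approx : measurable_fun setT dentropy_approx.
Proof.
apply: measurable_funD; apply: measurable_funM => //.
- by apply: (measurableT_comp measurable_Fent); exact: measurable_sg.
- by apply: (measurableT_comp measurable_dFent); exact: measurable_sg.
- by apply: measurable_funM => //; exact: measurable_inverse.
Qed.

Lemma measurable_ddentropy_approx : measurable_fun setT ddentropy_approx.
Proof.
apply: measurable_funM; apply: measurable_funM => //.
- apply: measurableT_comp; last exact: measurable_sg.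
  by apply: continuous_measurable_fun; exact: dpressure_continuous.
- by apply: measurable_inverse; exact: measurable_sg.
- by apply: measurable_inverse; exact: measurable_funX.
Qed.

Lemma ddentropy_approx_continuous (u : R) : 0 <= u -> {for u, continuous ddentropy_approx}.
Proof.
move=> u0; have qn : 1 + del * u != 0 by rewrite gt_eqF// q0.
have cq : {for u, continuous (fun u : R => 1 + del * u)}.
  by apply: cvgD; [exact: cvg_cst|apply: cvgM; [exact: cvg_cst|exact: cvg_id]].
have csg : {for u, continuous sg}.
  by apply: differentiable_continuous; apply/derivable1_diffP; have [] := is_derive_sg u0.
apply: cvgM; apply: cvgM; rewrite ?expf_eq0//.
- by apply: continuous_comp; [exact: csg|exact: dpressure_continuous].
- by apply: cvgV; [rewrite gt_eqF// sg_gt0|exact: csg].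
- exact: cvg_cst.
- apply: cvgV; first by rewrite expf_neq0.
  by rewrite [X in X @ _](_ : _ = (fun x => (1 + del * x) * ((1 + del * x) * (1 + del * x)))); [apply: cvgM => //; exact: cvgM|by apply/funext => x; rewrite !exprS expr0 mulr1].
Qed.

Lemma entropy_approxE u : 0 <= u -> entropy_approx u =
  lambda * ((u + del) * ln (sg u) - del * ln del) +
  kap * ((u + del) * sg u `^ (m - 1) - del `^ m).
Proof.
move=> u0; rewrite /entropy_approx /Fent -(mulr_powRB1 (ltW (sg_gt0 u0)) m0).
have -> : u + del = (1 + del * u) * sg u by rewrite mulrC divfK// gt_eqF// q0.
by ring.
Qed.

Lemma xlnx_ge (x : R) : 0 < x -> - (x * ln x) <= 1.
Proof.
move=> x0; have h := @le_ln1Dx R (x^-1 - 1) _.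
have xv : 0 < x^-1 by rewrite invr_gt0.
have : ln x^-1 <= x^-1 - 1 by rewrite (_ : 1 + (x^-1 - 1) = x^-1) in h; [apply: h; lra|ring].
rewrite lnV ?posrE// => h1; rewrite -mulrN; apply: (@le_trans _ _ (x * (x^-1 - 1))).
  by rewrite ler_wpM2l// ltW.
by rewrite mulrBr divff ?gt_eqF// mulr1 lerBlDr lerDl ltW.
Qed.

(** For [u <= 1], [sg u] is at least both [u] and [del], which leaves at least [u ln u]; for
    [u >= 1] the logarithmic terms are nonnegative. The power part always is. *)
Lemma entropy_approx_lower u : 0 <= u -> - Num.max (- entropyH lambda u) 0 <= entropy_approx u.
Proof.
move=> u0; rewrite entropy_approxE//.
have sp := sg_gt0 u0; have s1 := sg_ge u0.
have hk : 0 <= (u + del) * sg u `^ (m - 1) - del `^ m.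
  rewrite subr_ge0 -(mulr_powRB1 (ltW d0) m0); apply: ler_pM; rewrite ?powR_ge0 ?(ltW d0)//.
    by rewrite lerDr.
  by apply: ge0_ler_powR; rewrite ?nnegrE ?(ltW mm0)// ltW.
have hl : ln del <= ln (sg u) by rewrite ler_ln ?posrE.
have key : entropyH lambda u <= lambda * ((u + del) * ln (sg u) - del * ln del) \/
    0 <= lambda * ((u + del) * ln (sg u) - del * ln del).
  have [u1|/ltW u1] := leP u 1; [left|right].
    have [us s1'] := sg_lo u0 u1.
    rewrite /entropyH -mulrA ler_wpM2l ?(ltW l0)//.
    have h1 : u * ln u <= u * ln (sg u).
      move: u0; rewrite le_eqVlt => /predU1P[<-|up]; first by rewrite !mul0r.
      by rewrite ler_wpM2l ?(ltW up)// ler_ln ?posrE.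
    have h2 : 0 <= del * (ln (sg u) - ln del) by rewrite mulr_ge0 ?subr_ge0// ltW.
    by move: h1 h2; rewrite mulrBr mulrDl; lra.
  have [s1' _] := sg_hi u1.
  apply: mulr_ge0; first exact: ltW.
  have h1 : 0 <= (u + del) * ln (sg u) by rewrite mulr_ge0 ?ln_ge0// addr_ge0// ltW.
  have h2 : 0 <= - (del * ln del) by rewrite -mulrN mulr_ge0 ?(ltW d0)// oppr_ge0 ln_le0// ltW.
  by lra.
have hkk := mulr_ge0 (ltW kap0) hk.
have h3 : - entropyH lambda u <= Num.max (- entropyH lambda u) 0 by rewrite le_max lexx.
have h4 : 0 <= Num.max (- entropyH lambda u) 0 by rewrite le_max lexx orbT.
by case: key => h; lra.
Qed.

(** A majorant independent of [del]. For [u <= 1], convexity gives the chord bound [u * G 1]; for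
    [u >= 1], [u + del <= 2 u] and [sg u <= u] produce the factors 2, and [lambda u] pays for
    [- del ln del <= 1]. *)
Lemma entropy_approx_upper u : 0 <= u -> entropy_approx u <=
  (2 * kap + lambda) * u + 2 * Num.max (entropyH lambda u) 0 + 2 * (kap * u `^ m).
Proof.
move=> u0; have h4 : 0 <= Num.max (entropyH lambda u) 0 by rewrite le_max lexx orbT.
have h5 : 0 <= kap * u `^ m by rewrite mulr_ge0 ?powR_ge0// ltW.
have hd : - (del * ln del) <= 1 by exact: xlnx_ge.
have hl : lambda * (- (del * ln del)) <= lambda by rewrite ler_piMr// ltW.
have hdm : 0 <= kap * del `^ m by rewrite mulr_ge0 ?powR_ge0// ltW.
have [u1|/ltW u1] := leP u 1.
  have G1 : entropy_approx 1 <= 2 * kap + lambda.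
    rewrite entropy_approxE//.
    have -> : sg 1 = 1 by rewrite /sg mulr1 divff// gt_eqF// addr_gt0.
    rewrite ln1 powR1 mulr0 sub0r mulr1.
    have : kap * del <= kap by rewrite ler_piMr// ltW.
    by move: hl hdm; rewrite mulrBr mulrDr mulr1; lra.
  have c1 := entropy_approx_convex (lexx 0) u0.
  have c2 := entropy_approx_convex ler01 u0.
  have : entropy_approx u <= u * entropy_approx 1.
    rewrite entropy_approx0 !subr0 in c1.
    (* The tangent inequalities at [u] towards 0 and 1, with weights [1 - u] and [u]: the slope
       cancels and the chord bound remains. *)
    have a1 : 0 <= (1 - u) * (dentropy_approx u * u - entropy_approx u) by rewrite mulr_ge0 ?subr_ge0.
    have a2 : 0 <= u * (dentropy_approx u * (u - 1) - (entropy_approx u - entropy_approx 1)) by rewrite mulr_ge0 ?subr_ge0.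
    by lra.
  have : u * entropy_approx 1 <= u * (2 * kap + lambda) by rewrite ler_wpM2l.
  by rewrite (mulrC u (2 * kap + lambda)); lra.
have [s1 s2] := sg_hi u1; have up : 0 < u by apply: lt_le_trans u1.
rewrite entropy_approxE//.
have ud : u + del <= 2 * u by have := le_trans (ltW d1) u1; lra.
have ud0 : 0 <= u + del by rewrite addr_ge0// ltW.
have h1 : lambda * ((u + del) * ln (sg u)) <= 2 * Num.max (entropyH lambda u) 0.
  apply: (@le_trans _ _ (2 * entropyH lambda u)); last by rewrite ler_wpM2l// le_max lexx.
  rewrite /entropyH -mulrA (mulrCA 2) ler_wpM2l ?(ltW l0)// mulrA.
  by apply: ler_pM => //; rewrite ?ln_ge0// ler_ln ?posrE// (lt_le_trans _ s1).
have h2 : kap * ((u + del) * sg u `^ (m - 1)) <= 2 * (kap * u `^ m).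
  rewrite (mulrCA 2) ler_wpM2l ?(ltW kap0)// -(mulr_powRB1 u0 m0) mulrA.
  apply: ler_pM; rewrite ?powR_ge0//; apply: ge0_ler_powR; rewrite ?nnegrE ?(ltW mm0)//.
  by apply: le_trans s1.
have h3 : lambda <= (2 * kap + lambda) * u.
  have : lambda <= lambda * u by rewrite ler_peMr// ltW.
  by have := mulr_ge0 (ltW kap0) u0; rewrite mulrDl -mulrA; lra.
by move: h1 h2; rewrite !mulrBr; move: hl; rewrite mulrN; lra.
Qed.

End entropy_approximation.

Section cutoff_sequence.
Context {R : realType}.

(** Exponential decay makes [ln (dl k)] explicit, so [dl k * ln (dl k)] tends to 0 by comparing the
    exponential with a square. *)
Definition dl (k : nat) : R := expR (- k.+1%:R).

Lemma dl_gt0 k : 0 < dl k. Proof. exact: expR_gt0. Qed.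

Lemma dl_lt1 k : dl k < 1. Proof. by rewrite expR_lt1 oppr_lt0 ltr0n. Qed.

Lemma dl_le k : dl k <= k.+1%:R^-1.
Proof.
rewrite /dl expRN lef_pV2 ?posrE ?expR_gt0 ?ltr0n//.
by have := expR_ge1Dx (k.+1%:R : R); lra.
Qed.

Lemma dl_ln k : dl k * ln (dl k) = - (k.+1%:R * expR (- k.+1%:R)).
Proof. by rewrite /dl expRK mulrN mulrC. Qed.

Lemma dl_ln_le k : `|dl k * ln (dl k)| <= 2 * k.+1%:R^-1.
Proof.
have k0 : 0 < k.+1%:R :> R by rewrite ltr0n.
rewrite dl_ln normrN ger0_norm ?mulr_ge0 ?expR_ge0 ?(ltW k0)// expRN.
have h : k.+1%:R ^+ 2 / 2 <= expR (k.+1%:R : R).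
  by have := @expR_ge1Dxn R k.+1%:R 1 (ltW k0); rewrite (_ : 2`! = 2%N)//; lra.
rewrite ler_pdivrMr ?expR_gt0// mulrAC ler_pdivlMr// -expr2.
by move: h; lra.
Qed.

Lemma cvg_dl : dl @ \oo --> (0 : R).
Proof.
apply: (squeeze_cvgr (f := fun=> 0) (h := harmonic)); [|exact: cvg_cst|exact: cvg_harmonic].
by apply: nearW => k; rewrite (ltW (dl_gt0 k)) dl_le.
Qed.

Lemma cvg_dl_ln : (fun k => dl k * ln (dl k)) @ \oo --> (0 : R).
Proof.
apply: norm_cvg0.
apply: (squeeze_cvgr (f := fun=> 0) (h := fun k => 2 * harmonic k)); [|exact: cvg_cst|].
  by apply: nearW => k; rewrite normr_ge0 dl_ln_le.
by rewrite -[X in _ --> X](mulr0 2); apply: cvgM; [exact: cvg_cst|exact: cvg_harmonic].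
Qed.

Lemma cvg_sg (u : R) : 0 <= u -> (fun k => sg (dl k) u) @ \oo --> u.
Proof.
move=> u0; rewrite -[X in _ --> X](_ : (u + 0) / (1 + 0 * u) = u); last by rewrite addr0 mul0r addr0 divr1.
apply: cvgM; first by apply: cvgD; [exact: cvg_cst|exact: cvg_dl].
apply: cvgV; first by rewrite mul0r addr0 oner_neq0.
by apply: cvgD; [exact: cvg_cst|apply: cvgM; [exact: cvg_dl|exact: cvg_cst]].
Qed.

Lemma powR_continuous_gt0 (a u : R) : 0 < u -> {for u, continuous (fun x => x `^ a)}.
Proof.
move=> u0; apply: differentiable_continuous; apply/derivable1_diffP.
by have [] := is_derive1_powR a u0.
Qed.

Context (lambda eta m : R).
Hypotheses (l0 : 0 < lambda) (e0 : 0 < eta) (m1 : 1 < m).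
Local Notation dp := (dpressure lambda eta m).

Lemma cvg_entropy_approx (u : R) : 0 <= u ->
  (fun k => entropy_approx lambda eta m (dl k) u) @ \oo -->
    entropyH lambda u + eta / (m - 1) * u `^ m.
Proof.
have m0 : 0 < m by exact: lt_trans m1.
rewrite le_eqVlt => /predU1P[<-|u0].
  rewrite /entropyH mulr0 mul0r add0r powR0 ?gt_eqF// mulr0.
  rewrite (_ : (fun k => _) = fun=> 0); first exact: cvg_cst.
  by apply/funext => k; rewrite entropy_approx0 ?dl_gt0.
have -> : (fun k => entropy_approx lambda eta m (dl k) u) = (fun k =>
    lambda * ((u + dl k) * ln (sg (dl k) u) - dl k * ln (dl k)) +
    eta / (m - 1) * ((u + dl k) * sg (dl k) u `^ (m - 1) - dl k `^ m)).
  by apply/funext => k; rewrite entropy_approxE ?dl_gt0 ?dl_lt1// ltW.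
have cu := cvg_sg (ltW u0).
have cud : (fun k => u + dl k) @ \oo --> u.
  by rewrite -[X in _ --> X](addr0 u); apply: cvgD; [exact: cvg_cst|exact: cvg_dl].
have cp : (fun k => dl k `^ m) @ \oo --> (0 : R).
  apply: (squeeze_cvgr (f := fun=> 0) (h := dl)); [|exact: cvg_cst|exact: cvg_dl].
  apply: nearW => k; rewrite powR_ge0 -[leRHS]powRr1 ?(ltW (dl_gt0 _))//.
  by rewrite ger_powR ?dl_gt0 ?(ltW m1)//= (ltW (dl_lt1 k)).
have -> : entropyH lambda u + eta / (m - 1) * u `^ m =
    lambda * (u * ln u - 0) + eta / (m - 1) * (u * u `^ (m - 1) - 0).
  by rewrite /entropyH !subr0 mulrA mulr_powRB1// ltW.
apply: cvgD; apply: cvgM; (try exact: cvg_cst); apply: cvgB => //.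
- apply: cvgM => //; apply: (@cvg_comp _ _ _ _ (@ln R) _ _ _ cu); exact: continuous_ln.
- exact: cvg_dl_ln.
- apply: cvgM => //; apply: (@cvg_comp _ _ _ _ (fun x => x `^ (m - 1)) _ _ _ cu).
  exact: powR_continuous_gt0.
Qed.

Lemma cvg_ddentropy_approx (u : R) : 0 < u ->
  (fun k => ddentropy_approx lambda eta m (dl k) u * u) @ \oo --> dp u.
Proof.
move=> u0.
have -> : (fun k => ddentropy_approx lambda eta m (dl k) u * u) = (fun k =>
    dp (sg (dl k) u) * (u / (u + dl k) * ((1 - dl k ^+ 2) / (1 + dl k * u)) ^+ 2)).
  by apply/funext => k; rewrite ddentropy_approx_mulE ?dl_gt0 ?dl_lt1// ltW.
have -> : dp u = dp u * (u / (u + 0) * ((1 - 0 * 0) / (1 + 0 * u) * ((1 - 0 * 0) / (1 + 0 * u)))).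
  by rewrite addr0 divff ?gt_eqF// !mul0r subr0 addr0 divr1 !mulr1.
have cq : (fun k => (1 - dl k ^+ 2) / (1 + dl k * u)) @ \oo --> (1 - 0 * 0) / (1 + 0 * u).
  apply: cvgM.
    by apply: cvgB; [exact: cvg_cst|apply: cvgM; exact: cvg_dl].
  apply: cvgV; first by rewrite mul0r addr0 oner_neq0.
  by apply: cvgD; [exact: cvg_cst|apply: cvgM; [exact: cvg_dl|exact: cvg_cst]].
apply: cvgM.
  by apply: (cvg_comp _ _ (cvg_sg (ltW u0))); exact: dpressure_continuous.
apply: cvgM; last exact: cvgM.
apply: cvgM; first exact: cvg_cst.
apply: cvgV; first by rewrite addr0 gt_eqF.
by apply: cvgD; [exact: cvg_cst|exact: cvg_dl].
Qed.

End cutoff_sequence.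

Lemma continuous_mul {R : realType} (V : normedModType R) (f g : V -> R) :
  continuous f -> continuous g -> continuous (fun x => f x * g x).
Proof. by move=> cf cg x; apply: cvgM; [exact: cf|exact: cg]. Qed.

Lemma continuous_inv {R : realType} (V : normedModType R) (f : V -> R) :
  continuous f -> (forall x, f x != 0) -> continuous (fun x => (f x)^-1).
Proof. by move=> cf f0 x; apply: cvgV; [exact: f0|exact: cf]. Qed.

Section potential_approximation.
Context {R : realType} {d : nat} (Psi : 'rV[R]_d -> R).
Local Notation V := 'rV[R]_d.
Local Notation e_ i := (delta_mx ord0 i : V).
Hypotheses (Psi0 : forall y, 0 <= Psi y) (CPsi : Ck 1 Psi).

(** A bounded, increasing function of [Psi] with slope in [[0, 1]]: the gradient never exceeds that
    of [Psi], so the same [Q] serves for all [k]. *)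
Definition potential_approx (k : nat) (y : V) : R := Psi y / (1 + k.+1%:R^-1 * Psi y).

Definition dpotential_factor (k : nat) (y : V) : R := (1 + k.+1%:R^-1 * Psi y) ^- 2.

Definition dpotential_approx (k : nat) (i : 'I_d) (y : V) : R :=
  dpotential_factor k y * 'D_(e_ i) Psi y.

Let k0 k : 0 < k.+1%:R^-1 :> R. Proof. by rewrite invr_gt0 ltr0n. Qed.

Let q1 k y : 1 <= 1 + k.+1%:R^-1 * Psi y.
Proof. by rewrite lerDl mulr_ge0// ltW. Qed.

Let q0 k y : 0 < 1 + k.+1%:R^-1 * Psi y. Proof. exact: lt_le_trans (q1 k y). Qed.

Lemma potential_approx_ge0 k y : 0 <= potential_approx k y.
Proof. by rewrite divr_ge0// ltW. Qed.

Lemma potential_approx_le k y : potential_approx k y <= Psi y.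
Proof. by rewrite ler_pdivrMr// ler_peMr. Qed.

Lemma potential_approx_bound k y : `|potential_approx k y| <= k.+1%:R.
Proof.
rewrite ger0_norm ?potential_approx_ge0// ler_pdivrMr// mulrDr mulr1 mulrA.
by rewrite divff ?pnatr_eq0// mul1r lerDr.
Qed.

Lemma dpotential_factor_itv k y : 0 <= dpotential_factor k y <= 1.
Proof.
rewrite invr_ge0 exprn_ge0 ?(ltW (q0 _ _))//= invf_le1 ?exprn_gt0//.
by rewrite expr_ge1// ltW.
Qed.

Lemma dpotential_approx_le k i y : dpotential_approx k i y ^+ 2 <= 'D_(e_ i) Psi y ^+ 2.
Proof.
have /andP[c0 c1] := dpotential_factor_itv k y.
by rewrite exprMn ler_piMl ?sqr_ge0// expr_le1.
Qed.

Let cPsi : continuous Psi. Proof. exact: Ck_continuous CPsi. Qed.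

Let cq k : continuous (fun y => 1 + k.+1%:R^-1 * Psi y).
Proof. apply: (Ck_continuous (k := 0)); apply: CkD; first exact: Ck_cst.
by apply: CkM; [exact: Ck_cst|split]. Qed.

Lemma potential_approx_continuous k : continuous (potential_approx k).
Proof.
apply: continuous_mul; first exact: cPsi.
by apply: continuous_inv => [|x]; [exact: cq|rewrite gt_eqF].
Qed.

Lemma dpotential_approx_continuous k i : continuous (dpotential_approx k i).
Proof.
apply: continuous_mul; last exact: dPsi_continuous.
apply: continuous_inv => [|x]; last by rewrite expf_neq0// gt_eqF.
by apply: continuous_mul; exact: cq.
Qed.

Let cvgq y : (fun k => 1 + k.+1%:R^-1 * Psi y) @ \oo --> (1 : R).
Proof.
rewrite -[X in _ --> X](_ : 1 + 0 * Psi y = 1); last by rewrite mul0r addr0.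
by apply: cvgD; [exact: cvg_cst|apply: cvgM; [exact: cvg_harmonic|exact: cvg_cst]].
Qed.

Lemma cvg_potential_approx y : potential_approx ^~ y @ \oo --> Psi y.
Proof.
rewrite -[X in _ --> X](_ : Psi y / 1 = Psi y); last by rewrite divr1.
by apply: cvgM; [exact: cvg_cst|apply: cvgV; [exact: oner_neq0|exact: cvgq]].
Qed.

Lemma cvg_dpotential_factor y : dpotential_factor ^~ y @ \oo --> (1 : R).
Proof.
rewrite -[X in _ --> X](_ : (1 * 1)^-1 = 1); last by rewrite mulr1 invr1.
by apply: cvgV; [rewrite mulr1 oner_neq0|apply: cvgM; exact: cvgq].
Qed.

Lemma is_derive_potential_approx k i (x : V) (s : R) :
  is_derive s 1 (fun s : R => potential_approx k (x + s *: e_ i))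
    (dpotential_approx k i (x + s *: e_ i)).
Proof.
have h1 : is_derive s 1 (fun s : R => Psi (x + s *: e_ i)) ('D_(e_ i) Psi (x + s *: e_ i)).
  by apply: derive_line; have /CkSP[_ + _] := CPsi; apply.
pose q (s : R) := 1 + k.+1%:R^-1 * Psi (x + s *: e_ i).
have qn : q s != 0 by rewrite gt_eqF// q0.
have h2 : is_derive s 1 q (0 + k.+1%:R^-1 *: 'D_(e_ i) Psi (x + s *: e_ i)).
  by apply: is_deriveD; exact: is_deriveZ.
apply: (is_derive_eq (is_deriveM h1 (is_deriveV qn h2))).
rewrite /GRing.scale/= /dpotential_approx /dpotential_factor -/(q s) -exprVn /q add0r.
have aux (P D c : R) : 1 + c * P != 0 ->
    P * (- (1 + c * P)^-1 ^+ 2 * (c * D)) + (1 + c * P)^-1 * D = (1 + c * P)^-1 ^+ 2 * D.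
  by move=> h; field.
exact: aux.
Qed.

End potential_approximation.

(** * Second moments and the negative part of the entropy *)

Section euclid.
Context {R : realType} {d : nat}.
Local Notation V := 'rV[R]_d.
Local Notation mu := (@vol R d).
Local Notation e_ i := (delta_mx ord0 i : V).
Implicit Types (x y : V) (r : density R d).

Lemma enorm_sqr y : enorm y ^+ 2 = \sum_(i < d) y ord0 i ^+ 2.
Proof.
rewrite /enorm sqr_sqrtr /dotv; first by apply: eq_bigr => i _; rewrite expr2.
by apply: sumr_ge0 => i _; rewrite -expr2 sqr_ge0.
Qed.

Lemma enorm_ge0 y : 0 <= enorm y. Proof. exact: sqrtr_ge0. Qed.

Lemma coord_le_enorm i y : y ord0 i ^+ 2 <= enorm y ^+ 2.
Proof.
rewrite enorm_sqr (bigD1 i)//= lerDl; apply: sumr_ge0 => j _; exact: sqr_ge0.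
Qed.

Lemma enorm_sqr_le x y : enorm x ^+ 2 <= 2 * enorm (x - y) ^+ 2 + 2 * enorm y ^+ 2.
Proof.
rewrite !enorm_sqr !mulr_sumr -big_split/=; apply: ler_sum => i _; rewrite !mxE.
have := sqr_ge0 (x ord0 i - 2 * y ord0 i); lra.
Qed.

Lemma measurable_enorm_sqr : measurable_fun setT (fun y : V => enorm y ^+ 2).
Proof.
under eq_fun do rewrite enorm_sqr.
by apply: measurable_sum => i; apply: measurable_funX; exact: measurable_coord.
Qed.

Lemma D2_intg r : D2 r -> intg mu setT (fun y => enorm y ^+ 2 * r y).
Proof.
have mr := measurable_density r; have me := measurable_enorm_sqr.
have p y : 0 <= enorm y ^+ 2 * r y by rewrite mulr_ge0 ?sqr_ge0// density_ge0.
rewrite /D2 lebE => h; apply/integrableP; split; first exact/measurable_EFinP/measurable_funM.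
by rewrite (eq_integral (fun y => (enorm y ^+ 2 * r y)%:E))// => y _ /=; rewrite ger0_norm.
Qed.

End euclid.

Section gaussian.
Context {R : realType}.

Lemma snoc_enorm d (p : 'rV[R]_d) (t : R) : enorm (snocrv (p, t)) ^+ 2 = enorm p ^+ 2 + t ^+ 2.
Proof.
rewrite !enorm_sqr big_ord_recr/= mxE unlift_none/=; congr (_ + _).
apply: eq_bigr => i _; rewrite mxE.
have -> : widen_ord (leqnSn d) i = lift ord_max i.
  by apply/val_inj => /=; rewrite /fintype.bump leqNgt ltn_ord.
by rewrite liftK.
Qed.

(** The Gaussian factorises when a coordinate is split off, so this is an induction on the dimension
    from the integral on the line. *)
Lemma gaussian_lty d : (\int[@vol R d]_y (expR (- enorm y ^+ 2))%:E < +oo)%E.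
Proof.
have me n : measurable_fun setT (fun y : 'rV[R]_n => (expR (- enorm y ^+ 2))%:E).
  by apply/measurable_EFinP; do 2!apply: measurableT_comp => //; exact: measurable_enorm_sqr.
elim: d => [|d ih].
  rewrite (@le_lt_trans _ _ (\int[@vol R 0]_y 1%E)%E)//.
    apply: ge0_le_integral => // y _.
    by rewrite lee_fin -[leRHS]expR0 ler_expR oppr_le0 sqr_ge0.
  rewrite integral_cst// mul1e (_ : setT = cube 0); first exact: vol_cube_lty.
  by apply/seteqP; split => // x _ [].
rewrite snoc_ge0_integral//.
pose c := (\int[@lebesgue_measure R]_t (gauss_fun t)%:E)%E.
have cy : (c < +oo)%E.
  have /integrableP[_] := @integrableT_gauss R; apply: le_lt_trans.
  rewrite le_eqVlt; apply/orP; left; apply/eqP; apply: eq_integral => t _ /=.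
  by rewrite ger0_norm ?gauss_fun_ge0.
have c0 : (0 <= c)%E by apply: integral_ge0 => t _; rewrite lee_fin gauss_fun_ge0.
rewrite (eq_integral (fun p : 'rV[R]_d => (expR (- enorm p ^+ 2))%:E * c)%E); last first.
  move=> p _; rewrite /c -ge0_integralZl//.
  - by apply: eq_integral => t _; rewrite snoc_enorm opprD expRD EFinM.
  - by apply/measurable_EFinP; exact: measurable_gauss_fun.
  - by move=> t _; rewrite lee_fin gauss_fun_ge0.
rewrite ge0_integralZr//.
by apply: lte_mul_pinfty; rewrite ?ge0_fin_numE//; apply: integral_ge0 => p _; rewrite lee_fin expR_ge0.
Qed.

End gaussian.

Section negative_entropy.
Context {R : realType} {d : nat} (lambda : R).
Hypothesis l0 : 0 < lambda.
Local Notation mu := (@vol R d).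

Lemma measurable_entropyH : measurable_fun setT (entropyH lambda).
Proof. by apply: measurable_funM => //; exact: measurable_funM. Qed.

(** From [exp x >= 1 + x] at [x = - a - ln u]. With [a = |y|^2] the negative entropy is dominated by
    the second moment, the mass and a Gaussian. *)
Lemma neg_entropy_le (u a : R) : 0 <= u -> 0 <= a ->
  Num.max (- entropyH lambda u) 0 <= lambda * ((a + 1) * u + expR (- a)).
Proof.
move=> u0 a0; have r0 : 0 <= lambda * ((a + 1) * u + expR (- a)).
  by rewrite mulr_ge0 ?(ltW l0)// addr_ge0 ?expR_ge0// mulr_ge0// addr_ge0.
rewrite ge_max r0 andbT /entropyH -mulrA -mulrN ler_wpM2l ?(ltW l0)//.
move: u0; rewrite le_eqVlt => /predU1P[<-|u0].
  by rewrite mul0r mulr0 oppr0 add0r expR_ge0.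
have h : 1 + (- a - ln u) <= expR (- a) / u.
  by rewrite -[u in _ / u]lnK ?posrE// -expRN -expRD expR_ge1Dx.
have := ler_wpM2l (ltW u0) h; rewrite mulrCA divff ?gt_eqF// mulr1.
by lra.
Qed.

Lemma neg_entropy_intg (r : density R d) : D2 r ->
  intg mu setT (fun y => Num.max (- entropyH lambda (r y)) 0).
Proof.
move=> hr; apply: (le_intg (g := fun y => lambda * ((enorm y ^+ 2 * r y + r y) + expR (- enorm y ^+ 2)))) => //.
- apply: measurable_maxr => //; apply: measurableT_comp => //.
  by apply: measurableT_comp (measurable_density r); exact: measurable_entropyH.
- move=> y _; rewrite ger0_norm; last by rewrite le_max lexx orbT.
  have -> : enorm y ^+ 2 * r y + r y = (enorm y ^+ 2 + 1) * r y by rewrite mulrDl mul1r.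
  by apply: neg_entropy_le; [exact: density_ge0|exact: sqr_ge0].
- apply: intgZl => //; apply: intgD => //.
    by apply: intgD => //; [exact: D2_intg|exact: density_intg].
  apply/integrableP; split.
    by apply/measurable_EFinP; do 2!apply: measurableT_comp => //; exact: measurable_enorm_sqr.
  rewrite (eq_integral (fun y => (expR (- enorm y ^+ 2))%:E)); last first.
    by move=> y _ /=; rewrite ger0_norm ?expR_ge0.
  exact: gaussian_lty.
Qed.

End negative_entropy.

Section second_moment.
Context {R : realType} {d : nat}.
Local Notation V := 'rV[R]_d.
Local Notation mu := (@vol R d).

Definition moment2 (r : density R d) : R := \int[mu]_y (enorm y ^+ 2 * r y).

Lemma coupling_fst (mu1 mu2 : probability V R) gam (f : V -> \bar R) : coupling mu1 mu2 gam ->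
  measurable_fun setT f -> (forall x, 0 <= f x)%E ->
  (\int[gam]_z f z.1 = \int[mu1]_x f x)%E.
Proof.
move=> hc mf f0; have := ge0_integral_pushforward (@measurable_fst _ _ V V) gam measurableT mf (fun x _ => f0 x).
rewrite preimage_setT => <-; apply: eq_measure_integral => A mA _.
have [E _] := hc A mA; transitivity (gam (A `*` setT)); last exact: E.
by rewrite /= /pushforward; congr (gam _); apply/seteqP; split => // -[x y] [].
Qed.

Lemma coupling_snd (mu1 mu2 : probability V R) gam (f : V -> \bar R) : coupling mu1 mu2 gam ->
  measurable_fun setT f -> (forall x, 0 <= f x)%E ->
  (\int[gam]_z f z.2 = \int[mu2]_x f x)%E.
Proof.
move=> hc mf f0; have := ge0_integral_pushforward (@measurable_snd _ _ V V) gam measurableT mf (fun x _ => f0 x).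
rewrite preimage_setT => <-; apply: eq_measure_integral => A mA _.
have [_ E] := hc A mA; transitivity (gam (setT `*` A)); last exact: E.
by rewrite /= /pushforward; congr (gam _); apply/seteqP; split => // -[x y] [].
Qed.

Lemma density_second_moment (r : density R d) :
  (\int[density_prob r]_y (enorm y ^+ 2)%:E = \int[mu]_y (enorm y ^+ 2 * r y)%:E)%E.
Proof.
rewrite ge0_integral_density//.
- by apply/measurable_EFinP; exact: measurable_enorm_sqr.
- by move=> y; rewrite lee_fin sqr_ge0.
Qed.

Lemma moment2_W2 (r s : density R d) (B : R) : D2 r -> D2 s -> 0 <= B ->
  (W2 (density_prob r) (density_prob s) <= B%:E)%E ->
  moment2 r <= 2 * (B ^+ 2 + 1) + 2 * moment2 s.
Proof.
move=> hr hs B0 hW.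
(* The extra 1 makes the inequality strict, so some coupling satisfies it whether or not the infimum
   is attained. *)
have : (ereal_inf [set (\int[gamma]_z (enorm (z.1 - z.2) ^+ 2)%:E)%E
    | gamma in coupling (density_prob r) (density_prob s)] < (B ^+ 2 + 1)%:E)%E.
  move: hW; rewrite /W2; case: ereal_inf => [x| |]//=.
    by rewrite lee_fin lte_fin => h; apply: (@le_lt_trans _ _ (B ^+ 2)); [|rewrite ltrDl];
      rewrite // -ler_sqrt ?sqr_ge0// sqrtr_sqr ger0_norm.
  by move=> _; rewrite ltNyr.
move=> /ereal_inf_lt[_ [gam hc <-] hlt].
have me := @measurable_enorm_sqr R d.
have E (q : density R d) : D2 q -> ((moment2 q)%:E = \int[density_prob q]_y (enorm y ^+ 2)%:E)%E.
  by move=> hq; rewrite density_second_moment /moment2 Rintegral_EFin//; exact: D2_intg.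
rewrite -lee_fin EFinD !EFinM !E//.
rewrite -(coupling_fst hc (f := fun y => (enorm y ^+ 2)%:E)); [|exact/measurable_EFinP|by move=> y; rewrite lee_fin sqr_ge0].
rewrite -(coupling_snd hc (f := fun y => (enorm y ^+ 2)%:E)); [|exact/measurable_EFinP|by move=> y; rewrite lee_fin sqr_ge0].
have md : measurable_fun setT (fun z : V * V => enorm (z.1 - z.2) ^+ 2).
  under eq_fun do rewrite enorm_sqr.
  apply: measurable_sum => i; apply: measurable_funX; under eq_fun do rewrite !mxE.
  by apply: measurable_funB; apply: (measurableT_comp (measurable_coord i)).
have m2 : measurable_fun setT (fun z : V * V => enorm z.2 ^+ 2) by exact: (measurableT_comp me).
have m1 : measurable_fun setT (fun z : V * V => enorm z.1 ^+ 2) by exact: (measurableT_comp me).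
apply: (@le_trans _ _ (\int[gam]_z ((2 * enorm (z.1 - z.2) ^+ 2)%:E + (2 * enorm z.2 ^+ 2)%:E))%E).
  apply: ge0_le_integral => //.
  - by move=> z _; rewrite lee_fin sqr_ge0.
  - exact/measurable_EFinP.
  - by apply: emeasurable_funD; apply/measurable_EFinP; exact: measurable_funM.
  - by move=> z _; rewrite lee_fin enorm_sqr_le.
rewrite ge0_integralD//; first last.
- by apply/measurable_EFinP; exact: measurable_funM.
- by move=> z _; rewrite lee_fin mulr_ge0// sqr_ge0.
- by apply/measurable_EFinP; exact: measurable_funM.
- by move=> z _; rewrite lee_fin mulr_ge0// sqr_ge0.
apply: leeD.
  under eq_integral do rewrite EFinM.
  rewrite ge0_integralZl//; [|exact/measurable_EFinP|by move=> z _; rewrite lee_fin sqr_ge0].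
  by rewrite lee_wpmul2l// ltW.
under eq_integral do rewrite EFinM.
by rewrite ge0_integralZl//; [exact/measurable_EFinP|move=> z _; rewrite lee_fin sqr_ge0].
Qed.

(** Since [|g| <= 1 + g^2], the distance to the initial measure is bounded on [[0, t]], and second
    moments follow from those at time 0. *)
Lemma AC2_moment2_bounded (rho : R -> density R d) (t : R) : 0 < t ->
  (forall t, 0 <= t -> D2 (rho t)) -> AC2_loc (fun t => density_prob (rho t)) ->
  exists M, forall r, 0 <= r -> r <= t -> moment2 (rho r) <= M.
Proof.
move=> t0 hD [g [mg ig hg]].
pose B := (\int[@lebesgue_measure R]_(z in `[0%R, t]) (1 + (g z ^+ 2)%:E))%E.
have mg2 : measurable_fun (`[0%R, t] : set R) (fun z => (g z ^+ 2)%:E).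
  apply/measurable_EFinP; apply: measurable_funX; apply: measurable_funS mg => //.
  by apply: subset_itvl; rewrite bnd_simp.
have By : (B < +oo)%E.
  rewrite /B ge0_integralD//; last by move=> z _; rewrite lee_fin sqr_ge0.
  rewrite integral_cst//= lebesgue_measure_itv/= lte_fin t0 mul1e.
  by rewrite lte_add_pinfty//; [rewrite -EFinB ltry|exact: ig].
have B0 : (0 <= B)%E by apply: integral_ge0 => z _; rewrite adde_ge0// lee_fin sqr_ge0.
have Bf : B \is a fin_num by rewrite ge0_fin_numE.
exists (2 * (fine B ^+ 2 + 1) + 2 * moment2 (rho 0)) => r r0 rt.
apply: moment2_W2; [exact: hD|exact: hD|exact: fine_ge0|].
rewrite fineK//; apply: le_trans (hg _ _ (lexx 0) r0) _.
have sr : (`[0%R, r] : set R) `<=` (`[0%R, t] : set R) by apply: subset_itvl; rewrite bnd_simp.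
apply: (@le_trans _ _ (\int[@lebesgue_measure R]_(z in `[0%R, r]) `|(g z)%:E|)%E).
  apply: le_trans (lee_abs _) _; apply: le_abse_integral => //.
  apply/measurable_EFinP; apply: measurable_funS mg => //.
  by apply: subset_itvl; rewrite bnd_simp.
have mabs : measurable_fun (`[0%R, t] : set R) (fun z => `|(g z)%:E|%E).
  apply: measurableT_comp => //; apply/measurable_EFinP; apply: measurable_funS mg => //.
  by apply: subset_itvl; rewrite bnd_simp.
apply: (@le_trans _ _ (\int[@lebesgue_measure R]_(z in `[0%R, t]) `|(g z)%:E|)%E).
  exact: ge0_subset_integral.
apply: ge0_le_integral => //.
- exact: emeasurable_funD.
- move=> z _; rewrite /= -EFinD lee_fin; have := sqr_ge0 (`|g z| - 1).
  by have := sqr_ge0 (g z); rewrite -[in X in X -> _](real_normK (num_real (g z))) -(real_normK (num_real (g z))); have := normr_ge0 (g z); lra.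
Qed.

End second_moment.

Section gradient_bound.
Context {R : realType} {d : nat} (Psi : 'rV[R]_d -> R) (K : R).
Local Notation V := 'rV[R]_d.
Local Notation mu := (@vol R d).
Local Notation e_ i := (delta_mx ord0 i : V).
Hypotheses (K0 : 0 < K) (hK : forall y, enorm (grad Psi y) <= K * (1 + enorm y)).

(** If [y - x] lies in the unit cube then [|x|^2 <= 2 d + 2 |y|^2]; inserted into
    [K^2 (1 + |x|)^2 <= K^2 (2 + 2 |x|^2)], this gives the constants. *)
Definition grad_bound (y : V) : R := K ^+ 2 * (2 + 4 * d%:R + 4 * enorm y ^+ 2).

Lemma cube_enorm (z : V) : cube 1 z -> enorm z ^+ 2 <= d%:R.
Proof.
move=> hz; rewrite enorm_sqr -[d in d%:R]card_ord -sum1_card natr_sum.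
apply: ler_sum => i _; have := hz i; rewrite in_itv/= -ler_norml => h.
by rewrite -(real_normK (num_real _)) expr_le1.
Qed.

Lemma grad_boundP i (x y : V) : cube 1 (y - x) -> 'D_(e_ i) Psi x ^+ 2 <= grad_bound y.
Proof.
move=> hc; have h1 : 'D_(e_ i) Psi x ^+ 2 <= enorm (grad Psi x) ^+ 2.
  by have := coord_le_enorm i (grad Psi x); rewrite mxE.
apply: le_trans h1 _; apply: (@le_trans _ _ ((K * (1 + enorm x)) ^+ 2)).
  rewrite ler_sqr ?nnegrE ?enorm_ge0 ?hK//.
  by rewrite mulr_ge0 ?(ltW K0)// addr_ge0 ?enorm_ge0.
rewrite exprMn ler_wpM2l ?sqr_ge0//.
have h2 := enorm_sqr_le x y; have h3 := cube_enorm hc.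
have h4 : enorm (x - y) ^+ 2 = enorm (y - x) ^+ 2.
  by rewrite !enorm_sqr; apply: eq_bigr => j _; rewrite !mxE -sqrrN opprB.
by have := sqr_ge0 (1 - enorm x); lra.
Qed.

Lemma grad_bound_intg (r : density R d) : D2 r -> intg mu setT (fun y => grad_bound y * r y).
Proof.
move=> hr; rewrite (_ : (fun y => _) = (fun y => K ^+ 2 * (2 + 4 * d%:R) * r y + K ^+ 2 * 4 * (enorm y ^+ 2 * r y))); last first.
  by apply/funext => y; rewrite /grad_bound; ring.
by apply: intgD => //; apply: intgZl => //; [exact: density_intg|exact: D2_intg].
Qed.

Lemma grad_bound_Rintegral (r : density R d) : D2 r ->
  \int[mu]_y (grad_bound y * r y) = K ^+ 2 * (2 + 4 * d%:R) + K ^+ 2 * 4 * moment2 r.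
Proof.
move=> hr; rewrite (_ : (fun y => _) = (fun y => K ^+ 2 * (2 + 4 * d%:R) * r y + K ^+ 2 * 4 * (enorm y ^+ 2 * r y))); last first.
  by apply/funext => y; rewrite /grad_bound; ring.
have i1 := density_intg r; have i2 := D2_intg hr.
by rewrite RintegralD// ?RintegralZl// ?density_Rint1 ?mulr1//; exact: intgZl.
Qed.

End gradient_bound.

(** * Passage to the limit *)

Lemma RintegralN {dd} {T : measurableType dd} {R : realType} (mu : {measure set T -> \bar R})
    (D : set T) (f : T -> R) : measurable D -> intg mu D f ->
  \int[mu]_(x in D) (- f x) = - \int[mu]_(x in D) f x.
Proof.
move=> mD i_f; rewrite (@eq_Rintegral _ _ _ _ _ (fun x => -1 * f x)).
  by rewrite RintegralZl// mulN1r.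
by move=> x _; rewrite mulN1r.
Qed.

Section slope_limits.
Context {R : realType} {d : nat} (Psi : 'rV[R]_d -> R) (lambda eta m : R) (rho : R -> density R d).
Hypotheses (l0 : 0 < lambda) (e0 : 0 < eta) (m1 : 1 < m).
Local Notation V := 'rV[R]_d.
Local Notation mu := (@vol R d).
Local Notation e_ i := (delta_mx ord0 i : V).
Local Notation T := (measurableTypeR R).
Local Notation lam := (@lebesgue_measure R).
Local Notation vel := (vel Psi lambda eta m rho).
Local Notation rpos := (rpos rho).
Local Notation kinetic := (kinetic Psi lambda eta m rho).
Local Notation logvel := (logvel Psi lambda eta m rho).
Local Notation good := (good Psi lambda eta m rho).
Local Notation dp := (dpressure lambda eta m).
Local Notation dPsi i := ('D_(e_ i) Psi).
Local Notation g1_ k := (ddentropy_approx lambda eta m (dl k)).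
Local Notation phi_ k := (dpotential_approx Psi k).

Hypotheses (Psi0 : forall y, 0 <= Psi y) (CPsi : Ck 1 Psi).
Hypothesis wc : forall f, Cb f ->
  {within `[0, +oo[, continuous (fun t => \int[density_prob (rho t)]_y f y)}.
Hypothesis Wrho : forall t, 0 < t -> W11loc (fun y => L_F lambda eta m (rho t y)).
Hypothesis diss : forall t, 0 < t -> (\int[lam]_(r in `]0%R, t[) kinetic r < +oo)%E.
Variable Q : V -> R.
Hypotheses (hQ : forall i (x y : V), cube 1 (y - x) -> dPsi i x ^+ 2 <= Q y)
  (iQ : forall r, 0 <= r -> intg mu setT (fun y => Q y * rpos r y))
  (bQ : forall t, exists M, forall r, 0 <= r -> r <= t -> \int[mu]_y (Q y * rpos r y) <= M).

Definition slope_approx (k : nat) (r : R) : R :=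
  limit_slope Psi lambda eta m rho (g1_ k) (phi_ k) r.

Let Sl k r i y := slice_lim (rpos r) (vel r) (logvel r) (phi_ k) (g1_ k) i y.

(** The only combination in which the truncated entropy enters the slope: bounded uniformly in [k],
    and tending to 1 where [u > 0]. *)
Let theta k u := g1_ k u * u / dp u.

Let dp0 u : 0 < dp u. Proof. exact: dpressure_gt0. Qed.

Let Cth := 1 + eta * m / lambda.

Let Cth0 : 0 <= Cth.
Proof. by rewrite addr_ge0// divr_ge0 ?(ltW l0)// mulr_ge0 ?(ltW e0)// ltW// (lt_trans _ m1). Qed.

Let Cth1 : 0 <= Cth + 1. Proof. by rewrite ler_wpDr. Qed.

Let theta_itv k u : 0 <= u -> 0 <= theta k u <= Cth.
Proof.
move=> u0; have /andP[h1 h2] := ddentropy_approx_le l0 e0 m1 (dl_gt0 k) (dl_lt1 k) u0.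
by rewrite /theta divr_ge0 ?(ltW (dp0 u))//= ler_pdivrMr.
Qed.

(** The factor [1 / dpressure] carried by [logvel] meets [u G''], leaving [theta]. *)
Let SlE k r i y : Sl k r i y =
  (dpotential_factor Psi k y * dPsi i y - theta k (rpos r y) * (vel r i y + dPsi i y)) *
    (rpos r y * vel r i y).
Proof.
rewrite /Sl /slice_lim /dpotential_approx /theta /logvel /log_velocity -/(vel r i y).
by ring.
Qed.

Let Sl_bound k r i y :
  `|Sl k r i y| <= (Cth + 1) * (2 * (rpos r y * vel r i y ^+ 2) + Q y * rpos r y).
Proof.
have u0 := density_ge0 (rpos r) y; have /andP[t0 t1] := theta_itv k u0.
have /andP[c0 c1] := dpotential_factor_itv Psi0 k y.
have hq : dPsi i y ^+ 2 <= Q y by exact: (dPsi_le_Q hQ).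
rewrite SlE normrM (normrM (rpos r y)) (ger0_norm u0).
have h1 : `|dpotential_factor Psi k y * dPsi i y - theta k (rpos r y) * (vel r i y + dPsi i y)| <=
    (Cth + 1) * (`|vel r i y| + `|dPsi i y|).
  move: (theta k _) t0 t1 => th t0 t1.
  apply: le_trans (ler_normB _ _) _; rewrite !normrM (ger0_norm c0) (ger0_norm t0).
  apply: (@le_trans _ _ (`|dPsi i y| + Cth * (`|vel r i y| + `|dPsi i y|))).
    by apply: lerD; [rewrite ler_piMl|apply: ler_pM => //; exact: ler_normD].
  by have := normr_ge0 (vel r i y); lra.
apply: (@le_trans _ _ ((Cth + 1) * (`|vel r i y| + `|dPsi i y|) * (rpos r y * `|vel r i y|))).
  by rewrite ler_wpM2r// mulr_ge0.
rewrite -mulrA ler_wpM2l ?Cth1//.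
have -> : (`|vel r i y| + `|dPsi i y|) * (rpos r y * `|vel r i y|) =
    rpos r y * (`|vel r i y| ^+ 2 + `|dPsi i y| * `|vel r i y|) by ring.
have -> : 2 * (rpos r y * vel r i y ^+ 2) + Q y * rpos r y = rpos r y * (2 * `|vel r i y| ^+ 2 + Q y).
  by rewrite real_normK ?num_real//; ring.
rewrite ler_wpM2l//; have := sqr_ge0 (`|vel r i y| - `|dPsi i y|).
have : `|dPsi i y| ^+ 2 <= Q y by rewrite real_normK ?num_real.
by have := sqr_ge0 `|vel r i y|; have := sqr_ge0 `|dPsi i y|; lra.
Qed.

(** With [theta] and the potential factor both at 1, the potential gradients cancel and minus the
    kinetic density is left; where [u = 0] everything vanishes. *)
Let Sl_cvg r i y : (fun k => Sl k r i y) @ \oo --> - (rpos r y * vel r i y ^+ 2).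
Proof.
have := density_ge0 (rpos r) y; rewrite le_eqVlt => /predU1P[u0|u0].
  rewrite -u0 mul0r oppr0 (_ : (fun k => _) = fun=> 0); first exact: cvg_cst.
  by apply/funext => k; rewrite SlE -u0 mul0r mulr0.
rewrite (_ : (fun k => _) = (fun k => (dpotential_factor Psi k y * dPsi i y -
    theta k (rpos r y) * (vel r i y + dPsi i y)) * (rpos r y * vel r i y))); last first.
  by apply/funext => k; rewrite SlE.
have -> : - (rpos r y * vel r i y ^+ 2) =
    (1 * dPsi i y - dp (rpos r y) / dp (rpos r y) * (vel r i y + dPsi i y)) * (rpos r y * vel r i y).
  by rewrite divff ?gt_eqF//; ring.
apply: cvgM; last exact: cvg_cst.
apply: cvgB; apply: cvgM; try exact: cvg_cst.
  exact: cvg_dpotential_factor.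
by apply: cvgM; [exact: cvg_ddentropy_approx|exact: cvg_cst].
Qed.

Let Sl_intg k r i : good r -> intg mu setT (Sl k r i).
Proof.
move=> gr; have d0 := dl_gt0 k; have d1 := dl_lt1 k.
apply: (slice_lim_intg l0 e0 m1 CPsi Wrho hQ iQ (C := dp (dl k)^-1)) gr i.
- exact: measurable_ddentropy_approx.
- by move=> s s0; exact: ddentropy_approx_continuous.
- by move=> s s0; exact: ddentropy_approx_bound.
- by move=> j; exact: dpotential_approx_continuous.
- by move=> j x; exact: dpotential_approx_le.
Qed.

Let dom_intg r i : good r ->
  intg mu setT (fun y => (Cth + 1) * (2 * (rpos r y * vel r i y ^+ 2) + Q y * rpos r y)).
Proof.
move=> [r0 kr]; have ii := kinetic_intg l0 e0 m1 CPsi Wrho i r0 kr.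
by apply: intgZl => //; apply: intgD => //; [exact: intgZl|exact: iQ (ltW r0)].
Qed.

Lemma cvg_slope_approx r : good r -> slope_approx ^~ r @ \oo --> - fine (kinetic r).
Proof.
move=> gr; have [r0 kr] := gr; have ii i := kinetic_intg l0 e0 m1 CPsi Wrho i r0 kr.
rewrite kinetic_fine//= -sumrN.
apply: cvg_bigsum => i.
rewrite -RintegralN//.
apply: (@dominated_Rintegral_ae _ _ _ mu setT _ _
    (fun y => (Cth + 1) * (2 * (rpos r y * vel r i y ^+ 2) + Q y * rpos r y))) => //.
- by move=> k; apply: intg_measurable (Sl_intg k i gr).
- by apply: intg_measurable (intgN _ (ii i)).
- by apply: aeW => y _; exact: Sl_cvg.
- by move=> k; apply: aeW => y _; exact: Sl_bound.
- exact: dom_intg.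
Qed.

Lemma slope_approx_bound t : exists B, forall k r, good r -> r <= t ->
  `|slope_approx k r| <= B * (1 + fine (kinetic r)).
Proof.
have [M hM] := bQ t; exists ((Cth + 1) * (2 + d%:R * `|M|)) => k r gr rt.
have [r0 kr] := gr; have ii i := kinetic_intg l0 e0 m1 CPsi Wrho i r0 kr.
have kf := kinetic_fine l0 e0 m1 CPsi Wrho r0 kr.
have k0 : 0 <= fine (kinetic r) by apply: fine_ge0; exact: kinetic_ge0.
apply: le_trans (ler_norm_sum _ _ _) _.
apply: (@le_trans _ _ (\sum_(i < d) (Cth + 1) * (2 * \int[mu]_y (rpos r y * vel r i y ^+ 2) + `|M|))).
  apply: ler_sum => i _; apply: le_trans (le_normr_Rintegral measurableT (Sl_intg k i gr)) _.
  apply: (@le_trans _ _ (\int[mu]_y ((Cth + 1) * (2 * (rpos r y * vel r i y ^+ 2) + Q y * rpos r y)))).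
    have iS := intg_norm measurableT (Sl_intg k i gr); have iD := dom_intg i gr.
    by apply: le_Rintegral => // y _; exact: Sl_bound.
  have i1 := iQ (ltW r0).
  rewrite RintegralZl//; last by apply: intgD => //; exact: intgZl.
  rewrite RintegralD//; last exact: intgZl.
  rewrite ler_wpM2l ?Cth1// RintegralZl// lerD2l.
  by apply: le_trans (hM _ (ltW r0) rt) _; exact: ler_norm.
rewrite -mulr_sumr -mulrA ler_wpM2l ?Cth1// big_split/= -mulr_sumr sumr_const card_ord.
rewrite [in leLHS](_ : \sum_(i < d) _ = fine (kinetic r)); last by rewrite kf.
rewrite -mulr_natl mulrDr mulr1 mulrDl.
by have := mulr_ge0 (mulr_ge0 (ler0n R d) (normr_ge0 M)) k0; lra.
Qed.

(** The slopes are integrated through measurable representatives [h_], which agree with them at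
    almost every time. *)
Lemma cvg_slope_integral (h_ : nat -> T -> R) s t : 0 <= s -> s < t ->
  (forall k, measurable_fun setT (h_ k)) -> (forall k r, good r -> h_ k r = slope_approx k r) ->
  (fun k => \int[lam]_(r in `]s, t]) h_ k r) @ \oo --> \int[lam]_(r in `]s, t]) (- fine (kinetic r)).
Proof.
move=> s0 st mh hE; have t0 : 0 < t by exact: le_lt_trans st.
have [B hB] := slope_approx_bound t.
have sub : (`]s, t]%classic : set T) `<=` (`]0, t]%classic : set T) by apply: subset_itvr; rewrite bnd_simp.
have ik : intg lam `]s, t] (fun r => fine (kinetic r)).
  by apply: integrableS (kinetic_fine_intg l0 e0 m1 CPsi wc Wrho diss t0).
have ga := good_ae l0 e0 m1 CPsi wc Wrho diss s0 st.
apply: (@dominated_Rintegral_ae _ _ _ lam (`]s, t]%classic : set T) _ _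
    (fun r => B * (1 + fine (kinetic r)))) => //.
- by move=> k; apply: measurable_funTS.
- by apply: intg_measurable (intgN _ ik).
- apply: filterS ga => r gr rs; have {}gr := gr rs.
  rewrite (_ : (fun k => _) = (fun k => slope_approx k r)); first exact: cvg_slope_approx.
  by apply/funext => k; rewrite hE.
- move=> k; apply: filterS ga => r gr rs; have {}gr := gr rs.
  by rewrite hE// hB//; move: rs; rewrite /= in_itv/= => /andP[].
- exact: (slope_bound_intg l0 e0 m1 CPsi wc Wrho diss).
Qed.

Lemma slope_integral_le0 s t : 0 <= s -> s < t ->
  \int[lam]_(r in `]s, t]) (- fine (kinetic r)) <= 0.
Proof.
move=> s0 st; have t0 : 0 < t by exact: le_lt_trans st.
rewrite RintegralN//; last first.
  apply: integrableS (kinetic_fine_intg l0 e0 m1 CPsi wc Wrho diss t0) => //.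
  by apply: subset_itvr; rewrite bnd_simp.
by rewrite oppr_le0; apply: Rintegral_ge0 => // r _; rewrite fine_ge0// kinetic_ge0.
Qed.

End slope_limits.

Section ereal_sums.
Context {R : realType}.
Local Open Scope ereal_scope.

Lemma sum_lty (a b d : \bar R) (c : R) : 0 <= a -> 0 <= b -> 0 <= d ->
  a + b - c%:E + d < +oo -> [/\ a < +oo, b < +oo & d < +oo].
Proof. by case: a => [a| |]//; case: b => [b| |]//; case: d => [d| |]//=; rewrite !ltry. Qed.

Lemma sum_le (a b d : \bar R) (c M : R) : 0 <= a -> 0 <= b -> 0 <= d ->
  a + b + d <= (M + c)%:E -> a + b - c%:E + d <= M%:E.
Proof.
case: a => [a| |]//; case: b => [b| |]//; case: d => [d| |]//= _ _ _.
by rewrite -!EFinB -!EFinD !lee_fin; lra.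
Qed.

End ereal_sums.

(** * The free energy as a limit of regularised energies *)

Section free_energy.
Context {R : realType} {d : nat} (Psi : 'rV[R]_d -> R) (lambda eta m : R).
Hypotheses (l0 : 0 < lambda) (e0 : 0 < eta) (m1 : 1 < m).
Hypotheses (Psi0 : forall y, 0 <= Psi y) (CPsi : Ck 1 Psi).
Local Notation V := 'rV[R]_d.
Local Notation mu := (@vol R d).
Local Notation G_ k := (entropy_approx lambda eta m (dl k)).
Local Notation psi_ k := (potential_approx Psi k).
Local Notation Hp u := (Num.max (entropyH lambda u) 0).
Local Notation Hn u := (Num.max (- entropyH lambda u) 0).
Local Notation kap := (eta / (m - 1)).

Let kap0 : 0 <= kap. Proof. by rewrite ltW// divr_gt0// subr_gt0. Qed.

Let mPsi : measurable_fun setT Psi.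
Proof. by apply: cont_measurable; exact: Ck_continuous CPsi. Qed.

Let HpE u : Hp u = entropyH lambda u + Hn u.
Proof. by rewrite addr_maxr subrr addr0 maxC. Qed.

Let Hn0 u : 0 <= Hn u. Proof. by rewrite le_max lexx orbT. Qed.
Let Hp0 u : 0 <= Hp u. Proof. by rewrite le_max lexx orbT. Qed.

Section density.
Variable u : density R d.
Hypothesis D2u : D2 u.

Let u0 y : 0 <= u y. Proof. exact: density_ge0. Qed.
Let mu_ : measurable_fun setT u. Proof. exact: measurable_density. Qed.

Let mP : measurable_fun setT (fun y => Psi y * u y). Proof. exact: measurable_funM. Qed.
Let mH : measurable_fun setT (fun y => entropyH lambda (u y)).
Proof. by apply: measurableT_comp mu_; exact: measurable_entropyH. Qed.
Let mHp : measurable_fun setT (fun y => Hp (u y)).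
Proof. exact: measurable_maxr. Qed.
Let mHn : measurable_fun setT (fun y => Hn (u y)).
Proof. by apply: measurable_maxr => //; exact: measurableT_comp. Qed.
Let mD : measurable_fun setT (fun y => kap * u y `^ m).
Proof. by apply: measurable_funM => //; exact: (measurableT_comp (@measurable_powR R m) mu_). Qed.
Let P0 y : 0 <= Psi y * u y. Proof. exact: mulr_ge0. Qed.
Let D0 y : 0 <= kap * u y `^ m. Proof. by rewrite mulr_ge0// powR_ge0. Qed.

Let iHn : intg mu setT (fun y => Hn (u y)). Proof. exact: neg_entropy_intg. Qed.

Definition approx_energy (k : nat) : R := \int[mu]_y (G_ k (u y) + psi_ k y * u y).
Definition free_energy : R :=
  \int[mu]_y (Psi y * u y + entropyH lambda (u y) + kap * u y `^ m).

Let intg_lty (f : V -> R) : measurable_fun setT f -> (forall y, 0 <= f y) ->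
  (\int[mu]_y (f y)%:E < +oo)%E -> intg mu setT f.
Proof.
move=> mf f0 fy; apply/integrableP; split; first exact/measurable_EFinP.
by rewrite (eq_integral (EFin \o f))// => y _ /=; rewrite ger0_norm.
Qed.

Let JE : J Psi lambda eta m u = (\int[mu]_y (Psi y * u y)%:E + \int[mu]_y (Hp (u y))%:E -
  (\int[mu]_y (Hn (u y)))%:E + \int[mu]_y (kap * u y `^ m)%:E)%E.
Proof. by rewrite /J lebE -(Rintegral_EFin measurableT iHn). Qed.

Let J_intg : (J Psi lambda eta m u < +oo)%E ->
  [/\ intg mu setT (fun y => Psi y * u y), intg mu setT (fun y => Hp (u y)) &
      intg mu setT (fun y => kap * u y `^ m)].
Proof.
have h f : (forall y, 0 <= f y) -> (0 <= \int[mu]_y (f y)%:E)%E.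
  by move=> f0; apply: integral_ge0 => y _; rewrite lee_fin.
rewrite JE => /(sum_lty (h _ P0) (h _ (fun y => Hp0 (u y))) (h _ D0))[h1 h2 h3].
by split; exact: intg_lty.
Qed.

Lemma J_free_energy : (J Psi lambda eta m u < +oo)%E -> J Psi lambda eta m u = free_energy%:E.
Proof.
move=> /J_intg[iP iHp iD]; rewrite JE !Rintegral_EFin// -!EFinD /free_energy; congr EFin.
rewrite -RintegralD// -RintegralB//; last exact: intgD.
rewrite -RintegralD//; last by apply: intgB => //; exact: intgD.
by apply: eq_Rintegral => y _; rewrite HpE; ring.
Qed.

Let mG k : measurable_fun setT (G_ k).
Proof. exact: measurable_entropy_approx. Qed.

Let mpsi k : measurable_fun setT (psi_ k).
Proof. by apply: cont_measurable; exact: potential_approx_continuous. Qed.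

Let mE k : measurable_fun setT (fun y => G_ k (u y) + psi_ k y * u y).
Proof. by apply: measurable_funD; [exact: (measurableT_comp (mG k))|exact: measurable_funM]. Qed.

Let cvgE y : (fun k => G_ k (u y) + psi_ k y * u y) @ \oo -->
  Psi y * u y + entropyH lambda (u y) + kap * u y `^ m.
Proof.
rewrite -addrA addrC; apply: cvgD; first exact: cvg_entropy_approx.
by apply: cvgM; [exact: cvg_potential_approx|exact: cvg_cst].
Qed.

(** Finiteness of [J] makes each of its terms integrable, and the bounds [entropy_approx_lower] and
    [entropy_approx_upper] then dominate uniformly in [k]. *)
Lemma cvg_approx_energy : (J Psi lambda eta m u < +oo)%E -> approx_energy @ \oo --> free_energy.
Proof.
move=> /J_intg[iP iHp iD].
apply: (@dominated_Rintegral_ae _ _ _ mu setT _ _ (fun y => Hn (u y) +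
  ((2 * kap + lambda) * u y + 2 * Hp (u y) + 2 * (kap * u y `^ m) + Psi y * u y))) => //.
- by apply: measurable_funD => //; exact: measurable_funD.
- by apply: aeW => y _; exact: cvgE.
- move=> k; apply: aeW => y _; have d0 := @dl_gt0 R k; have d1 := @dl_lt1 R k.
  have h1 := entropy_approx_lower l0 e0 m1 d0 d1 (u0 y).
  have h2 := entropy_approx_upper l0 e0 m1 d0 d1 (u0 y).
  have p0 : 0 <= psi_ k y * u y by rewrite mulr_ge0// potential_approx_ge0.
  have p1 : psi_ k y * u y <= Psi y * u y by rewrite ler_wpM2r// potential_approx_le.
  have q : 0 <= (2 * kap + lambda) * u y + 2 * Hp (u y) + 2 * (kap * u y `^ m).
    have c0 : 0 <= 2 * kap + lambda by apply: addr_ge0; [apply: mulr_ge0|exact: ltW].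
    by have := mulr_ge0 c0 (u0 y); have := Hp0 (u y); have := D0 y; lra.
  rewrite ler_norml; have := Hn0 (u y); have := P0 y; move: h1 h2 p0 p1 q.
  by move=> *; apply/andP; split; lra.
- apply: intgD => //; apply: intgD => //; apply: intgD => //; last exact: intgZl.
  by apply: intgD => //; apply: intgZl => //; exact: density_intg.
Qed.

Let iE k : intg mu setT (fun y => G_ k (u y) + psi_ k y * u y).
Proof.
have d0 := @dl_gt0 R k; have d1 := @dl_lt1 R k.
have [Cg hg] := dentropy_approx_bound l0 e0 m1 d0 d1.
apply: (@energy_intg R d (G_ k) _ Cg hg _ _ _ (psi_ k) k.+1%:R) => //.
- exact: entropy_approx0.
- by move=> x y x0 y0; exact: entropy_approx_convex.
- by move=> x; exact: potential_approx_bound.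
- exact: density_intg.
Qed.

(** Here [J] may be infinite a priori. Adding the integrable negative entropy makes the approximate
    integrands nonnegative, so Fatou bounds the positive terms of [J], and finiteness is part of the
    conclusion. *)
Lemma J_le_approx_energy (a_ : nat -> R) (M : R) : (forall k, approx_energy k <= a_ k) ->
  a_ @ \oo --> M -> (J Psi lambda eta m u <= M%:E)%E.
Proof.
move=> ha ca; apply/lee_addgt0Pr => e ep; rewrite -EFinD JE; apply: sum_le;
  try by apply: integral_ge0 => y _; rewrite lee_fin.
have [N _ hN] : \forall n \near \oo, a_ n <= M + e.
  by move/cvgrPdist_le : ca => /(_ _ ep); apply: filterS => n; rewrite ler_norml; lra.
have intD (f g : V -> R) : measurable_fun setT f -> measurable_fun setT g ->
    (forall y, 0 <= f y) -> (forall y, 0 <= g y) ->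
    (\int[mu]_y (f y)%:E + \int[mu]_y (g y)%:E = \int[mu]_y (f y + g y)%:E)%E.
  move=> mf mg f0 g0; under [RHS]eq_integral do rewrite EFinD.
  rewrite ge0_integralD//; try exact/measurable_EFinP.
    by move=> y _; rewrite lee_fin.
  by move=> y _; rewrite lee_fin.
rewrite intD//; rewrite intD//; [|exact: measurable_funD|by move=> y; rewrite addr_ge0].
(* The shift by [N] discards the indices before the bound [M + e] holds. *)
apply: (@fatou_bound _ _ _ mu (fun n y => G_ (n + N) (u y) + psi_ (n + N) y * u y + Hn (u y))
    (fun y => Psi y * u y + Hp (u y) + kap * u y `^ m)).
- by move=> n; exact: measurable_funD.
- by apply: measurable_funD => //; exact: measurable_funD.
- move=> n y; have h1 := entropy_approx_lower l0 e0 m1 (dl_gt0 (n + N)) (dl_lt1 _) (u0 y).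
  have p0 : 0 <= psi_ (n + N) y * u y by rewrite mulr_ge0// potential_approx_ge0.
  by move: h1 p0; lra.
- by move=> y; rewrite !addr_ge0.
- apply: aeW => y e' e'0.
  have := @cvgE y; rewrite -(cvg_shiftn N) => c.
  move/cvgrPdist_le : c => /(_ _ e'0); apply: filterS => n.
  by rewrite HpE ler_norml /= => /andP[_]; lra.
- move=> n; rewrite Rintegral_EFin//; last exact: intgD.
  rewrite lee_fin RintegralD// lerD2r; apply: le_trans (ha _) _; apply: hN => /=.
  exact: leq_addl.
Qed.

End density.

(** [J] is four integrals of nonnegative functions of the density, each unchanged on null sets. *)
Lemma J_ae_eq (u v : density R d) : {ae lebesgue_rV R d, forall y, u y = v y} ->
  J Psi lambda eta m u = J Psi lambda eta m v.
Proof.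
rewrite lebE => uv; rewrite /J lebE.
have u0 := density_ge0 u; have v0 := density_ge0 v.
have mH (w : density R d) : measurable_fun setT (fun y => entropyH lambda (w y)).
  by apply: measurableT_comp (measurable_density w); exact: measurable_entropyH.
have mp (w : density R d) : measurable_fun setT (fun y => w y `^ m).
  by exact: (measurableT_comp (@measurable_powR R m) (measurable_density w)).
have key (F : V -> R -> R) : (forall y x, 0 <= x -> 0 <= F y x) ->
    (forall w : density R d, measurable_fun setT (fun y => F y (w y))) ->
    (\int[mu]_y (F y (u y))%:E = \int[mu]_y (F y (v y))%:E)%E.
  move=> F0 mF; apply: ge0_ae_eq_integral => //.
  - exact/measurable_EFinP.
  - exact/measurable_EFinP.
  - by move=> y _; rewrite lee_fin F0.
  - by move=> y _; rewrite lee_fin F0.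
  - by apply: filterS uv => y -> _.
rewrite (key (fun y x => Psi y * x)); last 2 first.
- by move=> y x x0; exact: mulr_ge0.
- by move=> w; apply: measurable_funM => //; exact: measurable_density.
rewrite (key (fun y x => Hp x)); last 2 first.
- by move=> y x x0; exact: Hp0.
- by move=> w; exact: measurable_maxr.
rewrite (key (fun y x => Hn x)); last 2 first.
- by move=> y x x0; exact: Hn0.
- by move=> w; apply: measurable_maxr => //; exact: measurableT_comp.
rewrite (key (fun y x => kap * x `^ m))//.
- by move=> y x x0; apply: mulr_ge0; [exact: kap0|exact: powR_ge0].
- by move=> w; exact: measurable_funM.
Qed.

End free_energy.

(** * Monotonicity of the free energy along the solution *)

Section dissipation.
Context {R : realType} {d : nat} (Psi : 'rV[R]_d -> R) (lambda eta m : R)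
  (rho0 : density R d) (rho : R -> density R d).
Hypotheses (l0 : 0 < lambda) (e0 : 0 < eta) (m1 : 1 < m).
Hypotheses (Psi0 : forall y, 0 <= Psi y) (CPsi : Ck 1 Psi).
Local Notation V := 'rV[R]_d.
Local Notation mu := (@vol R d).
Local Notation lam := (@lebesgue_measure R).

Lemma dissipation_kinetic t :
  (\int[lam]_(r in `]0%R, t[) \int[lebesgue_rV R d]_y
     (enorm (velocity Psi lambda eta m (rho r) y) ^+ 2 * rho r y)%:E < +oo)%E ->
  (\int[lam]_(r in `]0%R, t[) kinetic Psi lambda eta m rho r < +oo)%E.
Proof.
apply: le_lt_trans; rewrite le_eqVlt; apply/orP; left; apply/eqP; apply: eq_integral => r.
rewrite inE/= in_itv/= => /andP[r0 _]; rewrite lebE /kinetic; apply: eq_integral => y _.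
by rewrite /vel rposE ?ltW// enorm_sqr mulr_suml; congr EFin; apply: eq_bigr => i _; rewrite mulrC.
Qed.

Lemma J_nonincreasing :
  (exists2 K, 0 < K & forall y, enorm (grad Psi y) <= K * (1 + enorm y)) ->
  MM_solution Psi lambda eta m rho0 rho ->
  forall s t, 0 <= s -> s <= t ->
    (J Psi lambda eta m (rho t) <= J Psi lambda eta m (rho s))%E.
Proof.
move=> [K K0 hK] [hD [[wc _] Wrho FP] _ AC diss0] s t s0.
rewrite le_eqVlt => /predU1P[->//|st].
have [->|Js] := eqVneq (J Psi lambda eta m (rho s)) +oo%E; first exact: leey.
have {}Js : (J Psi lambda eta m (rho s) < +oo)%E by rewrite lt_neqAle Js leey.
have t0 : 0 < t by exact: le_lt_trans st.
have diss r : 0 < r -> (\int[lam]_(r in `]0%R, r[) kinetic Psi lambda eta m rho r < +oo)%E.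
  by move=> r0; apply: dissipation_kinetic; exact: diss0.
rewrite lebE in FP.
pose Q := @grad_bound R d K.
have hQ i (x y : V) : cube 1 (y - x) -> 'D_(delta_mx ord0 i) Psi x ^+ 2 <= Q y.
  exact: grad_boundP.
have iQ r : 0 <= r -> intg mu setT (fun y => Q y * rpos rho r y).
  by move=> r0; rewrite rposE//; apply: grad_bound_intg; exact: hD.
have bQ r' : exists M, forall r, 0 <= r -> r <= r' -> \int[mu]_y (Q y * rpos rho r y) <= M.
  (* The moment bound needs a positive horizon, while [r'] is arbitrary: [|r'| + 1] is positive and
     beyond it. *)
  have [M hM] := AC2_moment2_bounded (ltr_pwDr ltr01 (normr_ge0 r')) hD AC.
  exists (K ^+ 2 * (2 + 4 * d%:R) + K ^+ 2 * 4 * M) => r r0 rr.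
  rewrite rposE// grad_bound_Rintegral//; last exact: hD.
  rewrite lerD2l; apply: ler_wpM2l; first by rewrite mulr_ge0 ?sqr_ge0.
  apply: hM => //.
  by have := ler_norm r'; lra.
(* One cutoff index drives the entropy and the potential together, so a single limit in [k]
   remains. *)
have step k : exists h : measurableTypeR R -> R, [/\ measurable_fun setT h,
    forall r, good Psi lambda eta m rho r -> h r = slope_approx Psi lambda eta m rho k r &
    approx_energy Psi lambda eta m (rho t) k <=
      approx_energy Psi lambda eta m (rho s) k + \int[lam]_(r in `]s, t]) h r].
  have d0 := @dl_gt0 R k; have d1 := @dl_lt1 R k.
  have [Cg hg] := dentropy_approx_bound l0 e0 m1 d0 d1.
  have [h [mh hE _ hle]] := energy_le l0 e0 m1 CPsi wc Wrho FP diss hQ iQ bQ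
    (measurable_ddentropy_approx lambda eta (dl k) m1)
    (fun s s0 => ddentropy_approx_continuous m1 d0 s0)
    (fun s s0 => ddentropy_approx_bound l0 e0 m1 d0 d1 s0)
    (fun s s0 => is_derive_dentropy_approx lambda eta m1 d0 s0)
    (measurable_dentropy_approx lambda eta m (dl k)) hg
    (entropy_approx0 _ _ _ _) (measurable_entropy_approx lambda eta m (dl k))
    (fun x y x0 y0 => entropy_approx_convex l0 e0 m1 d0 x0 y0)
    (fun i => @dpotential_approx_continuous R d Psi Psi0 CPsi k i) (dpotential_approx_le Psi0 k)
    (cont_measurable (@potential_approx_continuous R d Psi Psi0 CPsi k))
    (potential_approx_bound Psi0 k) (@potential_approx_continuous R d Psi Psi0 CPsi k)
    (is_derive_potential_approx Psi0 CPsi k) s0 st.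
  exists h; split => //; move: hle; rewrite lerBlDl.
  by rewrite /energy rposE ?rposE ?(ltW t0).
have [h_ hh] := choice step.
have ch := @cvg_slope_integral R d Psi lambda eta m rho l0 e0 m1 Psi0 CPsi wc Wrho diss Q hQ iQ bQ
  h_ s t s0 st (fun k => let: And3 a _ _ := hh k in a) (fun k => let: And3 _ a _ := hh k in a).
have ce := cvg_approx_energy l0 e0 m1 Psi0 CPsi (hD _ s0) Js.
rewrite (J_free_energy l0 e0 m1 Psi0 CPsi (hD _ s0) Js).
(* The limit of the approximate inequalities keeps the full dissipation; only its sign is used
   afterwards. *)
apply: (@le_trans _ _ (free_energy Psi lambda eta m (rho s) +
    \int[lam]_(r in `]s, t]) (- fine (kinetic Psi lambda eta m rho r)))%:E).
  apply: (J_le_approx_energy l0 e0 m1 Psi0 CPsi (hD _ (ltW t0)) _ (cvgD ce ch)) => k.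
  by have [_ _] := hh k.
by rewrite lee_fin gerDl; exact: (slope_integral_le0 l0 e0 m1 CPsi wc Wrho diss).
Qed.

End dissipation.

Theorem lemma7p1 (R : realType) (d : nat) (lambda eta m : R)
    (Psi : 'rV[R]_d -> R) (rho0 : density R d) (rho : R -> density R d) :
  (0 < d)%N ->
  0 < lambda -> lambda < expR 1 / 2 -> 0 < eta -> 1 < m ->
  (forall y, 0 <= Psi y) ->
  Ck 1 Psi ->
  (exists2 K, 0 < K & forall y, enorm (grad Psi y) <= K * (1 + enorm y)) ->
  D2 rho0 ->
  (J Psi lambda eta m rho0 < +oo)%E ->
  MM_solution Psi lambda eta m rho0 rho ->
  (forall t, 0 <= t ->
     (J Psi lambda eta m (rho t) <= J Psi lambda eta m rho0)%E) /\
  ((exists L, forall x y,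
      enorm (grad Psi x - grad Psi y) <= L * enorm (x - y)) ->
   forall s t, 0 <= s -> s <= t ->
     (J Psi lambda eta m (rho t) <= J Psi lambda eta m (rho s))%E).
Proof.
move=> _ l0 _ e0 m1 Psi0 CPsi hK _ _ hMM.
have noninc := J_nonincreasing l0 e0 m1 Psi0 CPsi hK hMM.
split => [t t0|_]; last exact: noninc.
have [_ [[_ r0] _ _] _ _ _] := hMM.
(* [rho 0] and [rho0] agree only almost everywhere, which [J] does not see. *)
rewrite -(_ : J Psi lambda eta m (rho 0) = J Psi lambda eta m rho0); first exact: noninc.
exact: J_ae_eq.
Qed.
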